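(* As $N\to\infty$, $T_N-\theta=\mathcal{L}_1+o_p(1/\sqrt N)$, where $$\mathcal{L}_1:=\frac1N\sum_{i=1}^N\Big[(I-\mathcal{A}^*\mathcal{A})^{-1}(\eta_{1,0}-\mathcal{A}^*\eta_{0,1})(X_i)+(I-\mathcal{A}\mathcal{A}^* )^{-1}(\eta_{0,1}-\mathcal{A}\eta_{1,0})(Y_i)\Big].$$
   Context: Let $P,Q$ be Borel probability measures on $\mathbb{R}^d$, and let $\mu$ be a probability measure on $\mathbb{R}^d\times\mathbb{R}^d$ with marginals $P$ and $Q$, absolutely continuous with respect to $P\otimes Q$, with density $\xi=\frac{d\mu}{d(P\otimes Q)}$. Define $\mathcal{A}:L^2(P)\to L^2(Q)$ and its adjoint $\mathcal{A}^*:L^2(Q)\to L^2(P)$ by $(\mathcal{A}f)(y)=\int f(x)\xi(x,y)\,dP(x)$ and $(\mathcal{A}^*g)(x)=\int g(y)\xi(x,y)\,dQ(y)$. Standing assumptions: (i) $\xi\in L^2(P\otimes Q)$; consequently $\mathcal{A}$ is compact and there are eigenvalue decompositions $\mathcal{A}^*\mathcal{A}\alpha_k=s_k^2\alpha_k$, $\mathcal{A}\mathcal{A}^*\beta_k=s_k^2\beta_k$, $k\ge 0$, with $s_0=1$, $\alpha_0=\beta_0=\mathbf{1}$, $0\le s_k\le 1$, $\mathcal{A}\alpha_k=s_k\beta_k$, $\mathcal{A}^*\beta_k=s_k\alpha_k$. (ii) $s_k\le s_1<1$ for all $k\ge 1$. (iii) $\eta:\mathbb{R}^d\times\mathbb{R}^d\to\mathbb{R}$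 is a $\mu$-integrable function with $\eta^2\xi\in L^1(P\otimes Q)$ and $\eta\xi\in L^2(P\otimes Q)$. Let $X_1,X_2,\dots$ be i.i.d. from $P$ and $Y_1,Y_2,\dots$ i.i.d. from $Q$, the two sequences being independent. Let $\mathcal{S}_N$ be the set of permutations of $\{1,\dots,N\}$, $\xi^{\otimes}(X,Y_\sigma):=\prod_{i=1}^N\xi(X_i,Y_{\sigma_i})$, $$T_N:=\frac{\frac1{N!}\sum_{\sigma\in\mathcal{S}_N}\frac1N\sum_{i=1}^N\eta(X_i,Y_{\sigma_i})\,\xi^{\otimes}(X,Y_\sigma)}{\frac1{N!}\sum_{\sigma\in\mathcal{S}_N}\xi^{\otimes}(X,Y_\sigma)},\qquad\theta:=\int\eta\,d\mu$$ (on the event that the denominator vanishes, $T_N$ is assigned an arbitrary value). Put $$\eta_{1,0}(x):=\int[\eta(x,y)-\theta]\xi(x,y)\,dQ(y),\qquad\eta_{0,1}(y):=\int[\eta(x,y)-\theta]\xi(x,y)\,dP(x),$$ which have mean zero under $P$ and $Q$ respectively. $I$ is the identity operator; $(I-\mathcal{A}^*\mathcal{A})^{-1}$ and $(I-\mathcal{A}\mathcal{A}^* )^{-1}$ are the inverses on the subspaces $L^2_0(P)\subset L^2(P)$ and $L^2_0(Q)\subset L^2(Q)$ of mean-zero functions, where these operators are bijective. $o_p(a_N)$ denotes a random quantity which divided by $a_N$ tends to $0$ in probability. *)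

(* Defs.v *)
From HB Require Import structures.
From mathcomp Require Import all_boot all_order all_algebra perm finmap.
From mathcomp Require Import all_classical all_reals all_analysis.

Set Implicit Arguments.
Unset Strict Implicit.
Unset Printing Implicit Defensive.

Import Order.TTheory GRing.Theory Num.Theory.
Import numFieldTopology.Exports numFieldNormedType.Exports.

Local Open Scope classical_set_scope.
Local Open Scope ring_scope.

(* R^dim with its Borel sigma-algebra. *)
Notation Rd R dim := (g_sigma_algebraType (@open 'rV[R]_dim)).

Section probability_notions.
Context {d d' : measure_display} {Omega : measurableType d}
  {T : measurableType d'} {R : realType}.
Variable Pr : probability Omega R.

Definition mutually_independent (X : nat -> {RV Pr >-> T}) :=
  forall (J : {fset nat}) (B : nat -> set T),
    (forall i, measurable (B i)) ->
    Pr (\bigcap_(i in [set` J]) (X i @^-1` B i)) =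
    (\prod_(i <- J) Pr (X i @^-1` B i))%E.

Definition iid (P : probability T R) (X : nat -> {RV Pr >-> T}) :=
  (forall i B, measurable B -> distribution Pr (X i) B = P B) /\
  mutually_independent X.

Definition sigma_of_seq (X : nat -> {RV Pr >-> T}) : set (set Omega) :=
  <<s [set E | exists i B, measurable B /\ E = X i @^-1` B] >>.

Definition independent_seqs (X Y : nat -> {RV Pr >-> T}) :=
  forall E F, sigma_of_seq X E -> sigma_of_seq Y F ->
    Pr (E `&` F) = (Pr E * Pr F)%E.

Definition cvg_in_probability (Z : nat -> Omega -> R) (l : R) :=
  forall eps : R, 0 < eps ->
    Pr [set w | eps <= `|Z N w - l|] @[N --> \oo] --> 0%E.

Definition little_op (Z : nat -> Omega -> R) (a : nat -> R) :=
  cvg_in_probability (fun N w => Z N w / a N) 0.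

End probability_notions.

Section L2.
Context {d : measure_display} {T : measurableType d} {R : realType}.
Variable P : probability T R.

(* Elements of L^2 are represented by functions; equality in L^2 is equality
   almost everywhere. *)
Definition L2 : set (T -> R) := [set f | f \in Lfun P 2%:E].

Definition L20 : set (T -> R) := [set f | L2 f /\ \int[P]_x f x = 0].

Definition inner (f g : T -> R) : R := \int[P]_x (f x * g x).

(* The inverse at [g] of the operator [Op] restricted to [D]: a function in
   [D], determined almost everywhere when [Op] is bijective on [D] modulo
   almost everywhere equality (junk value 0 if there is no preimage). *)
Definition inverse_on (D : set (T -> R)) (Op : (T -> R) -> (T -> R))
    (g : T -> R) : T -> R :=
  xget (cst 0) [set f | D f /\ Op f = g %[ae P]].

(* Complete orthonormal system. To allow for a finite-dimensional L^2 the
   sequence may be padded with zero functions. *)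
Definition complete_orthonormal (a : nat -> T -> R) :=
  [/\ forall k, L2 (a k),
      forall j k, j != k -> inner (a j) (a k) = 0,
      forall k, inner (a k) (a k) = 1 \/ a k = cst 0 %[ae P]
    & forall f, L2 f -> (forall k, inner f (a k) = 0) -> f = cst 0 %[ae P] ].

End L2.

Section operators.
Context {d d' : measure_display} {S : measurableType d}
  {T : measurableType d'} {R : realType}.
Variables (P : probability S R) (Q : probability T R).

Definition has_marginals (mu : probability (S * T)%type R) :=
  (forall B, measurable B -> pushforward mu fst B = P B) /\
  (forall B, measurable B -> pushforward mu snd B = Q B).

(* [xi] is a real-valued version of the density d mu / d(P \x Q); it is
   nonnegative almost everywhere as a consequence of the last clause. *)
Definition has_density (mu : probability (S * T)%type R) (xi : S * T -> R) :=
  [/\ mu `<< (P \x Q)%E, measurable_fun [set: S * T] xi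
    & forall A, measurable A ->
        mu A = (\int[(P \x Q)%E]_(z in A) (xi z)%:E)%E ].

Variable xi : S * T -> R.

Definition opA (f : S -> R) : T -> R := fun y => \int[P]_x (f x * xi (x, y)).

Definition opAs (g : T -> R) : S -> R := fun x => \int[Q]_y (g y * xi (x, y)).

Definition I_sub_AsA (f : S -> R) : S -> R := f \- opAs (opA f).

Definition I_sub_AAs (g : T -> R) : T -> R := g \- opA (opAs g).

(* The last clause forces [s k = 0] when exactly one of [alpha k], [beta k] is a
   padding zero, so the spaces L^2(P), L^2(Q) may have different dimensions. *)
Definition eigen_decomposition (s : nat -> R) (alpha : nat -> S -> R)
    (beta : nat -> T -> R) :=
  [/\ [/\ s 0%N = 1, alpha 0%N = cst 1 & beta 0%N = cst 1],
      forall k, 0 <= s k <= 1,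
      complete_orthonormal P alpha /\ complete_orthonormal Q beta,
      forall k, opAs (opA (alpha k)) = (fun x => s k ^+ 2 * alpha k x) %[ae P]
             /\ opA (opAs (beta k)) = (fun y => s k ^+ 2 * beta k y) %[ae Q]
    & forall k, opA (alpha k) = (fun y => s k * beta k y) %[ae Q]
             /\ opAs (beta k) = (fun x => s k * alpha k x) %[ae P] ].

Definition theta (mu : probability (S * T)%type R) (eta : S * T -> R) : R :=
  \int[mu]_z eta z.

Definition eta10 mu (eta : S * T -> R) : S -> R :=
  fun x => \int[Q]_y ((eta (x, y) - theta mu eta) * xi (x, y)).

Definition eta01 mu (eta : S * T -> R) : T -> R :=
  fun y => \int[P]_x ((eta (x, y) - theta mu eta) * xi (x, y)).

End operators.

(* The samples X_1, ..., X_N and Y_1, ..., Y_N are X 0, ..., X N.-1 and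
   Y 0, ..., Y N.-1. *)
Section statistic.
Context {S T Omega : Type} {R : realType}.
Variables (xi eta : S * T -> R) (X : nat -> Omega -> S) (Y : nat -> Omega -> T).

Definition xi_tensor N (sigma : 'S_N) (w : Omega) : R :=
  \prod_(i < N) xi (X i w, Y (sigma i) w).

Definition T_num N (w : Omega) : R :=
  N`!%:R^-1 * \sum_(sigma : 'S_N)
    (N%:R^-1 * \sum_(i < N) eta (X i w, Y (sigma i) w)) * xi_tensor sigma w.

Definition T_den N (w : Omega) : R :=
  N`!%:R^-1 * \sum_(sigma : 'S_N) xi_tensor sigma w.

(* [c N] is the value assigned to T_N where the denominator vanishes. *)
Definition T_stat (c : nat -> Omega -> R) N (w : Omega) : R :=
  if T_den N w == 0 then c N w else T_num N w / T_den N w.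

End statistic.

Section first_order_term.
Context {d d' : measure_display} {S : measurableType d}
  {T : measurableType d'} {R : realType} {Omega : Type}.
Variables (P : probability S R) (Q : probability T R)
  (mu : probability (S * T)%type R) (xi eta : S * T -> R)
  (X : nat -> Omega -> S) (Y : nat -> Omega -> T).

Let eta_P := eta10 Q xi mu eta.
Let eta_Q := eta01 P xi mu eta.

Definition L1_P : S -> R :=
  inverse_on P (L20 P) (I_sub_AsA P Q xi) (eta_P \- opAs Q xi eta_Q).

Definition L1_Q : T -> R :=
  inverse_on Q (L20 Q) (I_sub_AAs P Q xi) (eta_Q \- opA P xi eta_P).

Definition L1 N (w : Omega) : R :=
  N%:R^-1 * \sum_(i < N) (L1_P (X i w) + L1_Q (Y i w)).

End first_order_term.

(* Main.v *)
Require Import Defs.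
From mathcomp Require Import all_boot all_order all_algebra perm fingroup finmap.
From mathcomp Require Import complex.
From mathcomp Require Import all_classical all_reals all_analysis.
From mathcomp Require Import measurable_realfun.
From mathcomp Require Import zify ring lra.

(** Write [D] for the denominator of [T_N] and [V g] for the average over all permutations [sigma] and
indices [i] of [g (X_i, Y_(sigma i))] times the product of the other factors [xi (X_j, Y_(sigma j))].
The two functions [a], [b] in the first order term solve [a + A^* b = eta10] and [b + A a = eta01].
If [a'], [b'] are bounded centered approximations of them in L^2, then exactly
[T_N - theta - (mean of a'(X_i) + b'(Y_i)) = V g / D] with [g = (eta - theta - a'(x) - b'(y)) xi].
Expanding in products of the eigenfunctions, which are orthogonal, bounds [N * E (V g)^2] by a constant
times the squared norms of the two one-variable projections of [g], plus O(1/N); these projections are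
small because [a'], [b'] almost solve the system. Here the number of permutations producing a given product
only depends on its content, and [s_1 < 1] with the summability of [s_k^2] makes the sums over contents finite.

It remains to bound [D] away from 0 in probability. Replacing [xi] by [1 + t (xi - 1)] changes [D] by
O(1 - t) in L^2 and makes the kernel at least [1 - t]. The matrix of the new kernel becomes doubly
stochastic after multiplication by [1 + a_i + b_j], with corrections [a_i], [b_j] explicit in the
eigenfunctions, up to an error tending to 0. Van der Waerden's bound, in Gurvits' form
[per M >= (N! / N^N) * cap M], and Jensen's inequality bound [log D] below by a quantity that is tight in [N]. *)

Set Implicit Arguments.
Unset Strict Implicit.
Unset Printing Implicit Defensive.

Import Order.TTheory GRing.Theory Num.Theory.
Import numFieldTopology.Exports numFieldNormedType.Exports.
Import HBNNSimple.

Local Open Scope classical_set_scope.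
Local Open Scope ring_scope.

(** * Independent families and square integrable functions *)

(** Second moments cannot finish the argument by themselves: [D] has mean 1, but its variance stays
    away from 0 as N grows unless [xi] is almost everywhere constant. So a lower bound for [D]
    cannot come from Chebyshev's inequality, and a deterministic inequality for permanents is used
    instead. That inequality involves the logarithms of the entries, which is why [xi] is first
    moved away from 0. The order in which the constants are chosen is decisive. The threshold
    [delta] for [D] comes first, from bounds on the corrections that hold uniformly in [t]. Then [t]
    is taken so close to 1 that damping moves [D] by less than [delta]. Only for this fixed [t] are
    the truncation level [K] of the eigenfunction expansion and the size N taken large, so that the
    scaling error is negligible even after multiplication by a constant of order [1 / (1 - t)]. The
    approximations [a'], [b'] are bounded because [a(x) xi(x,y)] need not be square integrable, and
    centered so that the constant coefficient of [g] vanishes; without this [V g] would not be of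
    order [1 / sqrt N]. *)

Section measurable_big.
Context d (T : measurableType d) (R : realType).

Lemma measurable_Rprod (I : Type) (r : seq I) (p : pred I) (F : I -> T -> R) :
  (forall i, p i -> measurable_fun setT (F i)) ->
  measurable_fun setT (fun x => \prod_(i <- r | p i) F i x).
Proof.
move=> mF; elim: r => [|i r IH].
  by under eq_fun do rewrite big_nil; exact: measurable_cst.
have [pi|/negPf pi] := boolP (p i); under eq_fun do rewrite big_cons pi //.
  by apply: measurable_funM => //; exact: mF.
exact: IH.
Qed.

Lemma measurable_Rsum (I : Type) (r : seq I) (p : pred I) (F : I -> T -> R) :
  (forall i, p i -> measurable_fun setT (F i)) ->
  measurable_fun setT (fun x => \sum_(i <- r | p i) F i x).
Proof.
move=> mF; elim: r => [|i r IH].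
  by under eq_fun do rewrite big_nil; exact: measurable_cst.
have [pi|/negPf pi] := boolP (p i); under eq_fun do rewrite big_cons pi //.
  by apply: measurable_funD => //; exact: mF.
exact: IH.
Qed.

End measurable_big.

Section Rintegral_sum.
Context d (T : measurableType d) (R : realType) (mu : {measure set T -> \bar R}).

Lemma integrable_RZl (r : R) (f : T -> R) : mu.-integrable setT (EFin \o f) ->
  mu.-integrable setT (EFin \o fun x => r * f x).
Proof. by move=> intf; exact: (integrableZl measurableT r intf). Qed.

Lemma integrable_RD (f g : T -> R) : mu.-integrable setT (EFin \o f) ->
  mu.-integrable setT (EFin \o g) -> mu.-integrable setT (EFin \o fun x => f x + g x).
Proof. by move=> intf intg; exact: (integrableD measurableT intf intg). Qed.

Lemma integrable_RB (f g : T -> R) : mu.-integrable setT (EFin \o f) ->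
  mu.-integrable setT (EFin \o g) -> mu.-integrable setT (EFin \o fun x => f x - g x).
Proof. by move=> intf intg; exact: (integrableB measurableT intf intg). Qed.

Lemma integrable_Rsum (I : Type) (r : seq I) (p : pred I) (F : I -> T -> R) :
  (forall i, p i -> mu.-integrable setT (EFin \o F i)) ->
  mu.-integrable setT (EFin \o fun x => \sum_(i <- r | p i) F i x).
Proof.
move=> iF; rewrite (_ : _ \o _ = fun x => (\sum_(i <- r | p i) (F i x)%:E)%E); last first.
  by apply/funext => x; rewrite /= sumEFin.
exact: integrable_sum.
Qed.

Lemma Rintegral_sum (I : Type) (r : seq I) (p : pred I) (F : I -> T -> R) :
  (forall i, p i -> mu.-integrable setT (EFin \o F i)) ->
  \int[mu]_x (\sum_(i <- r | p i) F i x) = \sum_(i <- r | p i) \int[mu]_x F i x.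
Proof.
move=> iF; elim: r => [|i r IH].
  under eq_Rintegral do rewrite big_nil.
  by rewrite big_nil Rintegral_cst// mul0r.
under eq_Rintegral do rewrite big_cons.
rewrite big_cons; case: ifPn => pi //.
by rewrite RintegralD// ?IH//; [exact: iF|exact: integrable_Rsum].
Qed.

End Rintegral_sum.

Section indep.
Context d (Omega : measurableType d) (R : realType) (Pr : probability Omega R).

(** Simple functions first, then monotone convergence. The weight [G] carries the other factors of a
    product, so that a single factor can be generalised while the rest stays as it is. *)
Lemma ge0_integral_comp_ext d' (U : measurableType d') (Z : Omega -> U)
    (m : probability U R) (G : Omega -> R) (c : R) :
  measurable_fun setT Z -> measurable_fun setT G -> (forall w, 0 <= G w) ->
  0 <= c ->
  (forall B, measurable B ->
    \int[Pr]_w (\1_B (Z w) * G w)%:E = c%:E * m B)%E ->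
  forall f : U -> R, measurable_fun setT f -> (forall x, 0 <= f x) ->
  (\int[Pr]_w (f (Z w) * G w)%:E = c%:E * \int[m]_x (f x)%:E)%E.
Proof.
move=> mZ mG G0 c0 ind f mf f0.
have mf' : measurable_fun setT (EFin \o f) by exact/measurable_EFinP.
have mfZ (h : U -> R) : measurable_fun setT h ->
    measurable_fun setT (fun w => (h (Z w) * G w)%:E).
  move=> mh; apply/measurable_EFinP/measurable_funM => //.
  exact: (measurableT_comp mh mZ).
pose h := nnsfun_approx measurableT mf'.
have sf (k : {nnsfun U >-> R}) :
    (\int[Pr]_w (k (Z w) * G w)%:E = c%:E * \int[m]_x (k x)%:E)%E.
  under eq_integral => w _.
    rewrite EFinM fimfunE -fsumEFin// ge0_mule_fsuml; last first.
      by move=> r; exact: nnfun_muleindic_ge0.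
    over.
  rewrite /= ge0_integral_fsum//; last 2 first.
    - move=> r; under eq_fun do rewrite -EFinM; apply: (mfZ (fun x => r * \1_(k @^-1` [set r]) x)).
      exact: measurable_funM.
    - by move=> n w _; apply: mule_ge0; rewrite ?lee_fin //; exact: nnfun_muleindic_ge0.
  under [X in _ = (_ * X)%E]eq_integral => x _ do rewrite fimfunE -fsumEFin//.
  rewrite ge0_integral_fsum//; last 2 first.
    - by move=> r; apply/measurable_EFinP/measurable_funM => //.
    - by move=> n w _; exact: nnfun_muleindic_ge0.
  rewrite ge0_mule_fsumr; last first.
    by move=> r; apply: integral_ge0 => x _; exact: nnfun_muleindic_ge0.
  apply: eq_fsbigr => r /set_mem[x _ <-{r}].
  under eq_integral do rewrite -EFinM -mulrA EFinM.
  rewrite ge0_integralZl//; last 3 first.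
    - by apply: (mfZ (\1_(k @^-1` [set k x]))).
    - by move=> w _; rewrite lee_fin mulr_ge0.
    - by rewrite lee_fin.
  rewrite ind//.
  under [X in _ = (_ * X)%E]eq_integral do rewrite EFinM.
  rewrite ge0_integralZl//; last 2 first.
    - exact/measurable_EFinP.
    - by rewrite lee_fin.
  by rewrite integral_indic// setIT muleCA.
have lim1 x : ((h n x)%:E @[n --> \oo] --> (f x)%:E)%E.
  by apply: (cvg_nnsfun_approx measurableT mf') => //= y _; rewrite lee_fin.
have E1 : (\int[m]_x (h n x)%:E @[n --> \oo] --> \int[m]_x (f x)%:E)%E.
  rewrite (_ : (\int[m]_x (f x)%:E = \int[m]_x (limn (fun n => (h n x)%:E)))%E); last first.
    by apply: eq_integral => x _; apply/esym/cvg_lim => //; exact: lim1.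
  apply: cvg_monotone_convergence => //.
  - by move=> n; exact/measurable_EFinP.
  - by move=> n x _; rewrite lee_fin.
  - by move=> x _ a b ab; rewrite lee_fin; exact/lefP/nd_nnsfun_approx.
have lim2 w : ((h n (Z w) * G w)%:E @[n --> \oo] --> (f (Z w) * G w)%:E)%E.
  have E (k : U -> R) : (k (Z w) * G w)%:E = ((G w)%:E * (k (Z w))%:E)%E.
    by rewrite mulrC.
  rewrite E (_ : (fun n => _) = (fun n => (G w)%:E * (h n (Z w))%:E)%E); last first.
    by apply/funext => n; rewrite E.
  by apply: cvgeZl => //; exact: lim1.
have E2 : (\int[Pr]_w (h n (Z w) * G w)%:E @[n --> \oo] -->
    \int[Pr]_w (f (Z w) * G w)%:E)%E.
  rewrite (_ : (\int[Pr]_w (f (Z w) * G w)%:E =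
      \int[Pr]_w (limn (fun n => (h n (Z w) * G w)%:E)))%E); last first.
    by apply: eq_integral => x _; apply/esym/cvg_lim => //; exact: lim2.
  apply: cvg_monotone_convergence => //.
  - by move=> n; exact: mfZ.
  - by move=> n x _; rewrite lee_fin mulr_ge0.
  - by move=> x _ a b ab; rewrite lee_fin; apply: ler_wpM2r => //; exact/lefP/nd_nnsfun_approx.
have E3 : (c%:E * \int[m]_x (h n x)%:E)%E @[n --> \oo] --> (c%:E * \int[m]_x (f x)%:E)%E.
  exact: cvgeZl.
apply: cvg_unique E2 _ => //.
rewrite /=; rewrite (_ : (fun n => _) = (fun n => c%:E * \int[m]_x (h n x)%:E)%E)//.
by apply/funext => n; exact: sf.
Qed.

(** Independence and the laws are recorded in one formula. Subfamilies need no separate clause: take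
    [B i = setT] for the indices left out. *)
Definition indep_family (I : finType) d' (U : measurableType d')
    (Z : I -> Omega -> U) (m : I -> probability U R) :=
  (forall i, measurable_fun setT (Z i)) /\
  forall B : I -> set U, (forall i, measurable (B i)) ->
    Pr (\bigcap_(i in setT) (Z i @^-1` B i)) = (\prod_i m i (B i))%E.

Section family.
Context (I : finType) d' (U : measurableType d').
Variables (Z : I -> Omega -> U) (m : I -> probability U R).
Hypothesis ind : indep_family Z m.

Let mZ i : measurable_fun setT (Z i). Proof. exact: (proj1 ind). Qed.

Let measurable_comp i (h : U -> R) :
  measurable_fun setT h -> measurable_fun setT (fun w => h (Z i w)).
Proof. by move=> mh; exact: (measurableT_comp mh (mZ i)). Qed.

Lemma ge0_integral_prod (f : I -> U -> R) :
  (forall i, measurable_fun setT (f i)) -> (forall i x, 0 <= f i x) ->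
  (forall i, (m i).-integrable setT (EFin \o f i)) ->
  (\int[Pr]_w (\prod_i f i (Z i w))%:E = (\prod_i \int[m i]_x f i x)%:E)%E.
Proof.
move=> mf f0 intf.
pose g (r : seq I) B i := if i \in r then f i else \1_(B i).
have mg r B i : (forall i, measurable (B i)) -> measurable_fun setT (g r B i).
  by move=> mB; rewrite /g; case: ifP => // _; exact: measurable_indic.
have g0 r B i x : 0 <= g r B i x by rewrite /g; case: ifP.
have fin_prob i (B : set U) : measurable B -> m i B = (fine (m i B))%:E.
  by move=> mB; rewrite fineK//; exact: fin_num_measure.
(* Factors with index in [r] are already [f i], the others are still indicators. For empty [r] this
   is the definition of independence, and each step trades one indicator for a function. *)
have main r : forall B : I -> set U, (forall i, measurable (B i)) ->
    (\int[Pr]_w (\prod_i g r B i (Z i w))%:E =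
      (\prod_i if i \in r then \int[m i]_x f i x else fine (m i (B i)))%:E)%E.
  elim: r => [B mB|j r IH B mB].
    rewrite /g /=.
    transitivity (\int[Pr]_w (\1_(\bigcap_(i in setT) (Z i @^-1` B i)) w)%:E)%E.
      apply: eq_integral => w _; congr EFin; rewrite indicE.
      case: (boolP (w \in _)) => [/set_mem wB|wB].
        by apply: big1 => i _; rewrite indicE mem_set//; exact: wB.
      have [i Bi] : exists i, ~ (B i) (Z i w).
        apply/existsNP => h; move/negP: wB; apply; apply/mem_set => i _; exact: h.
      by rewrite (bigD1 i)//= indicE memNset// mul0r.
    rewrite integral_indic ?setIT//; last first.
      apply: fin_bigcap_measurable => // i _.
      by rewrite -[X in measurable X]setTI; exact: mZ.
    apply: (etrans (proj2 ind B mB)); rewrite -prodEFin.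
    by apply: eq_bigr => i _; exact: fin_prob.
  have [jr|jr] := boolP (j \in r).
    have E i : (i \in j :: r) = (i \in r).
      by rewrite inE; case: eqP => // ->; rewrite jr.
    have -> : g (j :: r) B = g r B by apply/funext => i; rewrite /g E.
    by rewrite IH//; congr EFin; apply: eq_bigr => i _; rewrite E.
  pose G w := \prod_(i | i != j) g r B i (Z i w).
  pose c := \prod_(i | i != j) if i \in r then \int[m i]_x f i x else fine (m i (B i)).
  have Ei i : i != j -> (i \in j :: r) = (i \in r) by rewrite inE => /negPf ->.
  transitivity (\int[Pr]_w (f j (Z j w) * G w)%:E)%E.
    apply: eq_integral => w _; congr EFin; rewrite (bigD1 j)//=; congr *%R.
      by rewrite /g mem_head.
    by apply: eq_bigr => i ij; rewrite /g Ei.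
  rewrite (@ge0_integral_comp_ext _ U (Z j) (m j) G c) //.
  - rewrite (bigD1 j)//= mem_head mulrC EFinM; congr (_ * _)%E.
      by congr EFin; apply: eq_bigr => i ij; rewrite Ei.
    by rewrite /Rintegral fineK//; apply: integrable_fin_num => //; exact: intf.
  - by apply: measurable_Rprod => i _; apply: measurable_comp; exact: mg.
  - by move=> w; apply: prodr_ge0.
  - apply: prodr_ge0 => i _; case: ifP => _; last exact: fine_ge0.
    by apply: Rintegral_ge0.
  move=> C mC.
  pose B' i := if i == j then C else B i.
  have B'j : B' j = C by rewrite /B' eqxx.
  have mB' i : measurable (B' i) by rewrite /B'; case: ifP.
  have := IH _ mB'; rewrite (bigD1 j)//= (negPf jr) B'j => E.
  rewrite muleC fin_prob// -EFinM.
  rewrite [in RHS](_ : c = \prod_(i | i != j) if i \in r then \int[m i]_x f i x else fine (m i (B' i))); last first.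
    by apply: eq_bigr => i /negPf ij; rewrite /B' ij.
  rewrite -E; apply: eq_integral => w _; congr EFin.
  rewrite (bigD1 j)//=; congr *%R; first by rewrite /g (negPf jr) /B' eqxx.
  by apply: eq_bigr => i /negPf ij; rewrite /g /B' ij.
have := main (enum I) (fun=> setT) (fun=> measurableT).
under eq_integral do under eq_bigr do rewrite /g mem_enum inE.
by under [in RHS]eq_bigr do rewrite mem_enum inE.
Qed.

Lemma integrable_prod (f : I -> U -> R) :
  (forall i, (m i).-integrable setT (EFin \o f i)) ->
  Pr.-integrable setT (EFin \o fun w => \prod_i f i (Z i w)).
Proof.
move=> intf.
have mf i : measurable_fun setT (f i).
  by apply/measurable_EFinP; exact: measurable_int (intf i).
apply/integrableP; split.
  by apply/measurable_EFinP/measurable_Rprod => i _; exact: measurable_comp.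
under eq_integral do rewrite /= normr_prod.
rewrite (@ge0_integral_prod (fun i x => `|f i x|)) ?ltry// => i.
- exact: measurableT_comp.
- by have := integrable_norm (intf i).
Qed.

Lemma Rintegral_prod (f : I -> U -> R) :
  (forall i, (m i).-integrable setT (EFin \o f i)) ->
  \int[Pr]_w (\prod_i f i (Z i w)) = \prod_i \int[m i]_x f i x.
Proof.
move=> intf.
have mf i : measurable_fun setT (f i).
  by apply/measurable_EFinP; exact: measurable_int (intf i).
(* The product of the differences of positive and negative parts is expanded over all choices of
   signs [t]; every term is then a product of nonnegative functions. *)
pose g i (b : bool) : U -> R := if b then (f i)^\+%R else (f i)^\-%R.
have fE i x : f i x = \sum_(b : bool) (-1) ^+ (~~ b) * g i b x.
  by rewrite big_bool /= mul1r mulN1r /g -[RHS]/(((f i)^\+ - (f i)^\-) x) funrposBneg.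
have intg i b : (m i).-integrable setT (EFin \o g i b).
  by rewrite /g; case: b; [exact: (integrable_funrpos measurableT (intf i))|
    exact: (integrable_funrneg measurableT (intf i))].
have mg i b : measurable_fun setT (g i b).
  by apply/measurable_EFinP; exact: measurable_int (intg i b).
have g0 i b x : 0 <= g i b x by rewrite /g; case: b; rewrite ?funrpos_ge0 ?funrneg_ge0.
have i1 (t : {ffun I -> bool}) : Pr.-integrable setT
    (EFin \o (fun w => \prod_i g i (t i) (Z i w))) by exact: (@integrable_prod (fun i => g i (t i))).
transitivity (\int[Pr]_w (\sum_(t : {ffun I -> bool})
    (\prod_i (-1) ^+ (~~ t i)) * \prod_i g i (t i) (Z i w))).
  congr fine; apply: eq_integral => w _; congr EFin.
  under eq_bigr do rewrite fE.
  rewrite bigA_distr_bigA /=.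
  by apply: eq_bigr => t _; rewrite big_split.
rewrite Rintegral_sum; last first.
  by move=> t _; exact: integrable_RZl.
transitivity (\sum_(t : {ffun I -> bool}) \prod_i ((-1) ^+ (~~ t i) * \int[m i]_x g i (t i) x)).
  apply: eq_bigr => t _; rewrite RintegralZl// big_split/=; congr *%R.
  rewrite -[RHS]/(fine (_)%:E); congr fine.
  exact: (@ge0_integral_prod (fun i => g i (t i))).
rewrite -(bigA_distr_bigA (fun i b => (-1) ^+ (~~ b) * \int[m i]_x g i b x)).
apply: eq_bigr => i _; rewrite big_bool /= mul1r mulN1r -RintegralB//.
  by apply: eq_Rintegral => x _; rewrite [RHS]fE big_bool /= mul1r mulN1r.
- exact: (intg i true).
- exact: (intg i false).
Qed.

End family.
End indep.

Section square_integrable.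
Context d (T : measurableType d) (R : realType) (P : probability T R).
Implicit Types f g : T -> R.

Definition sqi f := measurable_fun setT f /\
  P.-integrable setT (EFin \o fun x => f x ^+ 2).

Lemma Lfun2P f : f \in Lfun P 2%:E <-> sqi f.
Proof.
split=> [lf|[mf intf]].
  split; last exact: Lfun2_integrable_sqr.
  by move: lf; rewrite inE => /andP[]; rewrite inE.
rewrite inE; apply/andP; split; rewrite inE//= /finite_norm unlock.
apply: poweR_lty.
move/integrableP : intf => [_]; apply: le_lt_trans.
rewrite le_eqVlt; apply/orP; left; apply/eqP/eq_integral => x _.
by rewrite /= normrX powR_mulrn.
Qed.

Lemma sqiM f g : sqi f -> sqi g -> P.-integrable setT (EFin \o fun x => f x * g x).
Proof.
by move=> /Lfun2P lf /Lfun2P lg; exact/Lfun1_integrable/Lfun2_mul_Lfun1.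
Qed.

Lemma sqi_cst c : sqi (cst c).
Proof.
split=> //.
have := @finite_measure_integrable_cst _ _ _ P setT (c ^+ 2).
by apply.
Qed.

Lemma sqi_int f : sqi f -> P.-integrable setT (EFin \o f).
Proof.
move=> sf; have := sqiM sf (sqi_cst 1).
by rewrite (_ : (fun x => _) = f)//; apply/funext => x; rewrite /= mulr1.
Qed.

Lemma sqiZ c f : sqi f -> sqi (fun x => c * f x).
Proof.
move=> [mf intf]; split; first exact: measurable_funM.
by under eq_fun do rewrite exprMn; exact: integrable_RZl.
Qed.

Lemma sqiD f g : sqi f -> sqi g -> sqi (fun x => f x + g x).
Proof.
move=> sf sg; split; first by apply: measurable_funD; [case: sf|case: sg].
rewrite (_ : (fun x => _) = (fun x => f x ^+ 2 + (2 * (f x * g x)) + g x ^+ 2)); last first.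
  by apply/funext => x; rewrite sqrrD mulr_natl.
apply: integrable_RD; last by case: sg.
by apply: integrable_RD; [case: sf|apply: integrable_RZl; exact: sqiM].
Qed.

Lemma sqiN f : sqi f -> sqi (fun x => - f x).
Proof. by move=> sf; under eq_fun do rewrite -mulN1r; exact: sqiZ. Qed.

Lemma sqiB f g : sqi f -> sqi g -> sqi (fun x => f x - g x).
Proof. by move=> sf sg; apply: sqiD => //; exact: sqiN. Qed.

Lemma sqi_sum (I : Type) (r : seq I) (p : pred I) (F : I -> T -> R) :
  (forall i, p i -> sqi (F i)) -> sqi (fun x => \sum_(i <- r | p i) F i x).
Proof.
move=> sF; elim: r => [|i r IH].
  by under eq_fun do rewrite big_nil; exact: sqi_cst.
have [pi|/negPf pi] := boolP (p i); under eq_fun do rewrite big_cons pi //.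
  by apply: sqiD => //; exact: sF.
exact: IH.
Qed.

Lemma bounded_integrable f M : measurable_fun setT f -> (forall x, `|f x| <= M) ->
  P.-integrable setT (EFin \o f).
Proof.
move=> mf fM; apply: (@le_integrable _ _ _ _ _ measurableT _ (EFin \o cst M)).
- exact/measurable_EFinP.
- by move=> x _; rewrite lee_fin /= (le_trans (fM x))// ler_norm.
- exact: finite_measure_integrable_cst.
Qed.

Lemma bounded_sqi f M : measurable_fun setT f -> (forall x, `|f x| <= M) -> sqi f.
Proof.
move=> mf fM; split => //; apply: (@bounded_integrable _ (M ^+ 2)).
  exact: measurable_funX.
by move=> x; rewrite normrX lerXn2r ?nnegrE// (le_trans (normr_ge0 _) (fM x)).
Qed.

Lemma sqi_bM f g M : measurable_fun setT g -> (forall x, `|g x| <= M) ->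
  sqi f -> sqi (fun x => g x * f x).
Proof.
move=> mg gM [mf intf]; split; first exact: measurable_funM.
apply: (@le_integrable _ _ _ _ _ measurableT _ (EFin \o fun x => M ^+ 2 * f x ^+ 2)).
- by apply/measurable_EFinP/measurable_funX; exact: measurable_funM.
- move=> x _; rewrite lee_fin /= exprMn !normrM ler_wpM2r// -!normrM -!expr2 !normrX.
  by rewrite lerXn2r ?nnegrE// (le_trans (gM x))// ler_norm.
- exact: integrable_RZl.
Qed.

Definition nrm f : R := Num.sqrt (\int[P]_x (f x ^+ 2)).

Lemma nrm_ge0 f : 0 <= nrm f. Proof. exact: sqrtr_ge0. Qed.

Lemma nrm_sqr f : nrm f ^+ 2 = \int[P]_x (f x ^+ 2).
Proof. by rewrite sqr_sqrtr// Rintegral_ge0// => x _; exact: sqr_ge0. Qed.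

Lemma eq_nrm f g : f =1 g -> nrm f = nrm g.
Proof. by move=> fg; congr Num.sqrt; apply: eq_Rintegral => x _; rewrite fg. Qed.

Lemma le_Rint f g : P.-integrable setT (EFin \o f) -> P.-integrable setT (EFin \o g) ->
  (forall x, f x <= g x) -> \int[P]_x f x <= \int[P]_x g x.
Proof. by move=> i1 i2 fg; apply: le_Rintegral => // x _. Qed.

Lemma Rint_cst c : \int[P]_x c = c.
Proof.
rewrite Rintegral_cst// [X in fine X](_ : _ = 1%E) ?mulr1//.
exact: probability_setT.
Qed.

Lemma nrm_quad f g (t : R) : sqi f -> sqi g ->
  \int[P]_x ((f x + t * g x) ^+ 2) =
  \int[P]_x (f x ^+ 2) + t * 2 * (\int[P]_x (f x * g x)) + t ^+ 2 * \int[P]_x (g x ^+ 2).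
Proof.
move=> sf sg.
have ifg := sqiM sf sg.
transitivity (\int[P]_x (f x ^+ 2 + t * 2 * (f x * g x) + t ^+ 2 * g x ^+ 2)).
  by apply: eq_Rintegral => x _; ring.
case: (sf) => _ if2; case: (sg) => _ ig2.
have iZ := integrable_RZl (t * 2) ifg.
have iZ2 := integrable_RZl (t ^+ 2) ig2.
by rewrite RintegralD ?RintegralD ?RintegralZl//; exact: integrable_RD.
Qed.

Lemma cauchy_schwarz f g : sqi f -> sqi g ->
  `| \int[P]_x (f x * g x) | <= nrm f * nrm g.
Proof.
move=> sf sg.
set a := \int[P]_x (f x ^+ 2); set b := \int[P]_x (f x * g x).
set c := \int[P]_x (g x ^+ 2).
have q t : 0 <= a + t * 2 * b + t ^+ 2 * c.
  by rewrite -nrm_quad//; apply: Rintegral_ge0 => x _; exact: sqr_ge0.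
have c0 : 0 <= c by apply: Rintegral_ge0 => x _; exact: sqr_ge0.
have a0 : 0 <= a by apply: Rintegral_ge0 => x _; exact: sqr_ge0.
have bac : b ^+ 2 <= a * c.
  have [c1|c1] := eqVneq c 0.
    have [->|b1] := eqVneq b 0; first by rewrite expr0n/= mulr_ge0.
    (* For [c = 0] the quadratic is affine in t, and this t gives it the value -1. *)
    have := q (- (a + 1) / (2 * b)); rewrite c1 mulr0 addr0.
    rewrite (_ : _ + _ = -1); last by field.
    by lra.
  have := q (- b / c).
  rewrite (_ : _ + _ = (a * c - b ^+ 2) / c); last by field.
  have cp : 0 < c by rewrite lt0r c1.
  by rewrite pmulr_lge0 ?invr_gt0// subr_ge0.
rewrite -sqrtrM// -sqrtr_sqr; exact: ler_wsqrtr.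
Qed.

Lemma nrmD f g : sqi f -> sqi g -> nrm (fun x => f x + g x) <= nrm f + nrm g.
Proof.
move=> sf sg; rewrite -(@ler_pXn2r _ 2)// ?nnegrE ?addr_ge0 ?nrm_ge0//.
rewrite nrm_sqr sqrrD !nrm_sqr.
have -> : \int[P]_x ((f x + g x) ^+ 2) = \int[P]_x ((f x + 1 * g x) ^+ 2).
  by apply: eq_Rintegral => x _; rewrite mul1r.
rewrite nrm_quad// mul1r expr1n mul1r.
rewrite lerD2r lerD2l mulr2n mulrDl mul1r.
by have := le_trans (ler_norm _) (cauchy_schwarz sf sg); lra.
Qed.

Lemma nrmZ c f : sqi f -> nrm (fun x => c * f x) = `|c| * nrm f.
Proof.
move=> [mf sf]; rewrite /nrm; under eq_Rintegral do rewrite exprMn.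
by rewrite RintegralZl// sqrtrM ?sqr_ge0// sqrtr_sqr.
Qed.

Lemma nrmN f : nrm (fun x => - f x) = nrm f.
Proof. by rewrite /nrm; under eq_Rintegral do rewrite sqrrN. Qed.

Lemma nrmB f g : sqi f -> sqi g -> nrm (fun x => f x - g x) <= nrm f + nrm g.
Proof. by move=> sf sg; rewrite -(nrmN g); apply: nrmD => //; exact: sqiN. Qed.

Lemma nrm_cst c : nrm (cst c) = `|c|.
Proof. by rewrite /nrm (Rint_cst (c ^+ 2)) sqrtr_sqr. Qed.

Lemma nrm_sum (I : Type) (r : seq I) (p : pred I) (F : I -> T -> R) :
  (forall i, p i -> sqi (F i)) ->
  nrm (fun x => \sum_(i <- r | p i) F i x) <= \sum_(i <- r | p i) nrm (F i).
Proof.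
move=> sF; elim: r => [|i r IH].
  rewrite (@eq_nrm _ (cst 0)); first by rewrite nrm_cst normr0 big_nil.
  by move=> x; rewrite big_nil.
rewrite big_cons; case: ifPn => pi.
  rewrite (@eq_nrm _ (fun x => F i x + \sum_(i <- r | p i) F i x)).
    apply: le_trans (nrmD _ _) _; [exact: sF|exact: sqi_sum|exact: lerD].
  by move=> x; rewrite big_cons pi.
rewrite (@eq_nrm _ (fun x => \sum_(i <- r | p i) F i x))//.
by move=> x; rewrite big_cons (negPf pi).
Qed.

Lemma normr_int_le_nrm f : sqi f -> `|\int[P]_x f x| <= nrm f.
Proof.
move=> sf; have := cauchy_schwarz sf (sqi_cst 1).
by rewrite nrm_cst normr1 mulr1; under eq_Rintegral do rewrite /= mulr1.
Qed.

Lemma integral_sqr f : sqi f -> (\int[P]_x (f x ^+ 2)%:E = (nrm f ^+ 2)%:E)%E.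
Proof.
move=> [mf intf]; rewrite nrm_sqr /Rintegral fineK//.
exact: integrable_fin_num.
Qed.

Lemma ae_eq_Rint f g : measurable_fun setT f -> measurable_fun setT g ->
  f = g %[ae P] -> \int[P]_x f x = \int[P]_x g x.
Proof.
move=> mf mg fg; congr fine; apply: ae_eq_integral => //.
- exact/measurable_EFinP.
- exact/measurable_EFinP.
- by apply: filterS fg => x /= h _; rewrite h.
Qed.

Lemma chebyshev f (e : R) : sqi f -> 0 < e ->
  (P [set x | (e <= `|f x|)%R] <= ((nrm f / e) ^+ 2)%:E)%E.
Proof.
move=> sf e0; have [mf _] := sf.
have := @le_integral_comp_abse _ _ _ P _ measurableT (EFin \o f) e (fun x => x * x)%E.
rewrite setTI => /(_ _ _ _ _ e0) h.
have {}h : ((e * e)%:E * P [set x | (e <= `|f x|)%R] <= \int[P]_x (f x ^+ 2)%:E)%E.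
  rewrite [leRHS](_ : _ = (\int[P]_x (`|(EFin \o f) x| * `|(EFin \o f) x|))%E); last first.
    by apply: eq_integral => x _ /=; rewrite -EFinM -normrM -expr2 ger0_norm// sqr_ge0.
  apply: h.
  - exact: emeasurable_funM.
  - by move=> r r0; exact: mule_ge0.
  - by move=> x y; rewrite !inE /= !in_itv/= !andbT => x0 y0 xy; exact: lee_pmul.
  - exact/measurable_EFinP.
rewrite integral_sqr// in h.
rewrite expr_div_n EFinM muleC lee_pdivlMl ?exprn_gt0// -?expr2 //.
Qed.

Lemma eq_ae_nrm f g : measurable_fun setT f -> measurable_fun setT g ->
  f = g %[ae P] -> nrm f = nrm g.
Proof.
move=> mf mg fg; congr Num.sqrt; apply: ae_eq_Rint.
- exact: measurable_funX.
- exact: measurable_funX.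
- by apply: filterS fg => x /= h _; rewrite h.
Qed.

End square_integrable.

(** * Completeness of L^2 and orthogonal systems *)

Lemma limn_einf_le_near (R : realType) (v : (\bar R)^nat) (l : \bar R) N :
  (forall n, (N <= n)%N -> (v n <= l)%E) -> (limn_einf v <= l)%E.
Proof.
move=> vl; rewrite limn_einf_lim; apply: lime_le; first exact: is_cvg_einfs.
apply: nearW => n; apply: (@le_trans _ _ (v (maxn n N))); last by apply: vl; exact: leq_maxr.
by apply: ereal_inf_lbound; exists (maxn n N) => //=; exact: leq_maxl.
Qed.

Definition cvgL2 d (T : measurableType d) (R : realType) (P : probability T R)
    (f : nat -> T -> R) (g : T -> R) :=
  forall e : R, 0 < e -> exists N, forall n, (N <= n)%N ->
    nrm P (fun x => f n x - g x) <= e.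

(** Along a subsequence with increments of norm at most [2^-k], the sum of the absolute increments
    has finite integral, so the subsequence converges almost everywhere. Fatou's lemma then carries
    the Cauchy bound over to the limit. *)
Lemma riesz_fischer d (T : measurableType d) (R : realType) (P : probability T R)
    (f : nat -> T -> R) :
  (forall n, sqi P (f n)) ->
  (forall e : R, 0 < e -> exists N, forall m n, (N <= m)%N -> (N <= n)%N ->
    nrm P (fun x => f m x - f n x) <= e) ->
  exists2 g, sqi P g & cvgL2 P f g.
Proof.
move=> sf cf.
have /boolp.choice[N0 N0P] : forall k, exists N, forall m n, (N <= m)%N -> (N <= n)%N ->
    nrm P (fun x => f m x - f n x) <= 2^-1 ^+ k.
  by move=> k; apply: cf; rewrite exprn_gt0// invr_gt0.
pose u := fix u k := if k is k'.+1 then (u k' + N0 k).+1 else N0 0%N.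
have uN k : (N0 k <= u k)%N by case: k => //= k; rewrite leqW// leq_addl.
have uk k : (k <= u k)%N.
  by elim: k => [|k IH] //; rewrite (leq_ltn_trans IH)//= ltnS leq_addr.
have uS k : (u k <= u k.+1)%N by rewrite /= leqW// leq_addr.
have sfu k : sqi P (fun x => f (u k.+1) x - f (u k) x) by exact: sqiB.
pose G x : \bar R := (\sum_(k <oo) (`|f (u k.+1) x - f (u k) x|)%:E)%E.
have mGk k : measurable_fun setT (fun x => (`|f (u k.+1) x - f (u k) x|)%:E).
  by apply/measurable_EFinP; apply: measurableT_comp => //; case: (sfu k).
have G0 k x : (0 <= (`|f (u k.+1) x - f (u k) x|)%:E)%E by rewrite lee_fin.
have mG : measurable_fun setT G by apply: ge0_emeasurable_sum.
have iG : (\int[P]_x G x < +oo)%E.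
  rewrite integral_nneseries//.
  apply: (@le_lt_trans _ _ 2%:E); last exact: ltry.
  apply: lime_le; first by apply: is_cvg_nneseries => k _ _; exact: integral_ge0.
  apply: nearW => n.
  apply: (@le_trans _ _ (\sum_(0 <= k < n) (2^-1 ^+ k)%:E)%E).
    apply: lee_sum => k _.
    have si := sqi_int (sfu k).
    have := normr_int_le_nrm (f := fun x => `|f (u k.+1) x - f (u k) x|) (P := P).
    have sn : sqi P (fun x => `|f (u k.+1) x - f (u k) x|).
      split; first by apply: measurableT_comp => //; case: (sfu k).
      by under eq_fun do rewrite real_normK ?num_real//; case: (sfu k).
    move=> /(_ sn); rewrite ger0_norm; last by apply: Rintegral_ge0.
    have -> : nrm P (fun x => `|f (u k.+1) x - f (u k) x|) = nrm P (fun x => f (u k.+1) x - f (u k) x).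
      by congr Num.sqrt; apply: eq_Rintegral => x _; rewrite real_normK ?num_real.
    move=> h; rewrite -(@fineK _ (\int[P]_x _)%E); last first.
      by apply: integrable_fin_num => //; exact: sqi_int sn.
    rewrite lee_fin; apply: (le_trans h); apply: N0P => //.
    exact: leq_trans (uN k) (uS k).
  rewrite sumEFin lee_fin.
  have : 0 <= (2^-1 : R) ^+ n by rewrite exprn_ge0// invr_ge0.
  have : \sum_(0 <= k < n) (2^-1 : R) ^+ k = 2 - 2 * 2^-1 ^+ n.
    elim: n => [|n IH]; first by rewrite big_geq// expr0 mulr1 subrr.
    by rewrite big_nat_recr//= IH exprS; field.
  by move=> ->; lra.
have Gfin : {ae P, forall x, G x \is a fin_num}.
  have iG' : P.-integrable setT G.
    apply/integrableP; split => //.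
    by under eq_integral do rewrite gee0_abs ?nneseries_ge0//.
  by have := integrable_ae measurableT iG'; apply: filterS => x; exact.
(* The upper limit is measurable everywhere and agrees with the limit wherever the latter exists, so
   no exceptional set has to be removed. *)
pose g x := fine (limn_esup (fun k => (f (u k) x)%:E)).
have mg : measurable_fun setT g.
  apply: measurableT_comp => //; apply: measurable_fun_limn_esup => k.
  by apply/measurable_EFinP; case: (sf (u k)).
have fg : {ae P, forall x, f (u k) x @[k --> \oo] --> g x}.
  apply: filterS Gfin => x Gx.
  have c1 : cvgn (series (fun k => f (u k.+1) x - f (u k) x)).
    apply: normed_cvg; apply: nondecreasing_is_cvgn.
      by apply: nondecreasing_series => k _ _ /=.
    exists (fine (G x)) => _ [n _ <-].
    rewrite -lee_fin fineK// /= -sumEFin.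
    by apply: nneseries_lim_ge.
  have E n : series (fun k => f (u k.+1) x - f (u k) x) n = f (u n) x - f (u 0%N) x.
    by rewrite /series /= telescope_sumr.
  have c2 : cvgn (fun k => f (u k) x).
    rewrite (_ : (fun k => f (u k) x) = (fun n => series (fun k => f (u k.+1) x - f (u k) x) n + f (u 0%N) x)).
      by apply: is_cvgD => //; exact: is_cvg_cst.
    by apply/funext => n; rewrite E subrK.
  rewrite /g; have c3 : (f (u k) x)%:E @[k --> \oo] --> (limn (fun k => f (u k) x))%:E.
    by apply: cvg_EFin; [exact: nearW|exact: c2].
  by rewrite (cvg_limn_einf_sup c3).2.
have bnd (e : R) N : 0 < e -> (forall m n, (N <= m)%N -> (N <= n)%N ->
    nrm P (fun x => f m x - f n x) <= e) -> forall n, (N <= n)%N ->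
    (\int[P]_x ((f n x - g x) ^+ 2)%:E <= (e ^+ 2)%:E)%E.
  move=> e0 H n Nn.
  pose h k x := ((f n x - f (u k) x) ^+ 2)%:E.
  have mh k : measurable_fun setT (h k).
    by apply/measurable_EFinP/measurable_funX; case: (sqiB (sf n) (sf (u k))).
  have h0 k x : (0 <= h k x)%E by rewrite lee_fin sqr_ge0.
  have := fatou P measurableT mh (fun k x _ => h0 k x).
  rewrite (_ : (\int[P]_x limn_einf (h^~ x) = \int[P]_x ((f n x - g x) ^+ 2)%:E)%E); last first.
    apply: ae_eq_integral => //.
    - rewrite (_ : (fun x => _) = (fun x => - limn_esup (fun k => - h k x))%E).
        apply: measurableT_comp => //; apply: measurable_fun_limn_esup => k.
        exact: measurableT_comp.
      apply/funext => x; rewrite -limn_einfN; congr limn_einf.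
      by apply/funext => k; rewrite -[RHS]/(- - h k x)%E oppeK.
    - by apply/measurable_EFinP/measurable_funX/measurable_funB => //; case: (sf n).
    - apply: filterS fg => x hx _.
      have c3 : (h^~ x) k @[k --> \oo] --> ((f n x - g x) ^+ 2)%:E.
        apply: cvg_EFin; first exact: nearW.
        rewrite (_ : fine \o h^~ x = (fun k => (f n x - f (u k) x) * (f n x - f (u k) x))); last first.
          by apply/funext => k; rewrite -expr2.
        by rewrite expr2; apply: cvgM; apply: cvgB => //; exact: cvg_cst.
      by rewrite (cvg_limn_einf_sup c3).1.
  move=> /le_trans; apply; apply: (@limn_einf_le_near _ _ _ N) => k Nk.
  have sk := sqiB (sf n) (sf (u k)).
  rewrite integral_sqr// lee_fin lerXn2r ?nnegrE ?nrm_ge0 ?(ltW e0)//.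
  apply: H => //; apply: leq_trans Nk _.
  exact: uk.
have sg : sqi P g.
  have [N NP] := cf 1 ltr01.
  have h := bnd 1 N ltr01 NP N (leqnn N).
  have mfg : measurable_fun setT (fun x => f N x - g x).
    by apply: measurable_funB => //; case: (sf N).
  have sB : sqi P (fun x => f N x - g x).
    split => //; apply/integrableP; split; first by apply/measurable_EFinP/measurable_funX.
    apply: le_lt_trans (ltry (1 ^+ 2)); apply: le_trans h.
    rewrite le_eqVlt; apply/orP; left; apply/eqP/eq_integral => x _ /=.
    by rewrite ger0_norm// sqr_ge0.
  have := sqiB (sf N) sB.
  by rewrite (_ : (fun x => _) = g)//; apply/funext => x; ring.
exists g => // e e0; have [N NP] := cf e e0; exists N => n Nn.
have := bnd e N e0 NP n Nn; have sB := sqiB (sf n) sg.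
by rewrite integral_sqr// lee_fin ler_pXn2r ?nnegrE ?nrm_ge0 ?(ltW e0).
Qed.

Lemma summable_tail (R : realType) (c : nat -> R) (M : R) :
  (forall k, 0 <= c k) -> (forall n, \sum_(k < n) c k <= M) ->
  forall e : R, 0 < e -> exists N, forall m n, (N <= m)%N ->
    \sum_(k < n | (m <= k)%N) c k <= e.
Proof.
move=> c0 cM e e0; pose S n := \sum_(k < n) c k.
have Sle m n : (m <= n)%N -> S m + \sum_(k < n | (m <= k)%N) c k = S n.
  move=> mn; rewrite /S (big_ord_widen _ _ mn) [RHS](bigID (fun k : 'I_n => (k < m)%N))/=.
  by congr (_ + _); apply: eq_bigl => k; rewrite leqNgt.
have sS : has_sup (range S).
  by split; [exists (S 0%N), 0%N|exists M => _ [n _ <-]; exact: cM].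
have [_ [N _ <-] HN] := sup_adherent e0 sS.
exists N => m n Nm; have [mn|nm] := leqP m n; last first.
  rewrite big1 ?ltW// => k /(leq_trans nm) kk.
  by have := leq_ltn_trans (ltnW kk) (ltn_ord k); rewrite ltnn.
have h1 : S N <= S m.
  by rewrite -(Sle N m)// lerDl; apply: sumr_ge0 => k _.
have h2 : S n <= sup (range S) by apply: sup_upper_bound => //; exists n.
by have := Sle _ _ mn; rewrite /S in h1 h2 HN *; lra.
Qed.

Section orthogonal.
Context d (T : measurableType d) (R : realType) (P : probability T R).

Lemma inner_sumr (I : finType) (p : pred I) (F : I -> T -> R) (c : I -> R) g :
  (forall i, sqi P (F i)) -> sqi P g ->
  inner P g (fun x => \sum_(i | p i) c i * F i x) = \sum_(i | p i) c i * inner P g (F i).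
Proof.
move=> sF sg; rewrite /inner.
under eq_Rintegral do rewrite mulr_sumr.
rewrite Rintegral_sum; last by move=> i _; apply: sqiM => //; exact: sqiZ.
apply: eq_bigr => i _; rewrite -RintegralZl//; last exact: sqiM.
by apply: eq_Rintegral => x _; rewrite mulrCA.
Qed.

Lemma innerC f g : inner P f g = inner P g f.
Proof. by apply: eq_Rintegral => x _; rewrite mulrC. Qed.

Lemma innerE f : inner P f f = nrm P f ^+ 2.
Proof. by rewrite nrm_sqr; apply: eq_Rintegral => x _; rewrite expr2. Qed.

Lemma orthogonal_nrm (I : finType) (p : pred I) (F : I -> T -> R) (c : I -> R) :
  (forall i, sqi P (F i)) -> (forall i j, i != j -> inner P (F i) (F j) = 0) ->
  nrm P (fun x => \sum_(i | p i) c i * F i x) ^+ 2 =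
  \sum_(i | p i) c i ^+ 2 * inner P (F i) (F i).
Proof.
move=> sF oF; rewrite -innerE inner_sumr//; last by apply: sqi_sum => i _; exact: sqiZ.
apply: eq_bigr => i pi; rewrite innerC inner_sumr// (bigD1 i)//= big1 ?addr0; last first.
  by move=> j /andP[_ ji]; rewrite oF ?mulr0// eq_sym.
by rewrite expr2 mulrA.
Qed.

(** The norms are only assumed to be at most 1, because a complete system may be padded with null
    functions. *)
Lemma bessel_dist (I : finType) (p : pred I) (F : I -> T -> R) f :
  (forall i, sqi P (F i)) -> (forall i j, i != j -> inner P (F i) (F j) = 0) ->
  (forall i, inner P (F i) (F i) <= 1) -> sqi P f ->
  nrm P (fun x => f x - \sum_(i | p i) inner P f (F i) * F i x) ^+ 2 <=
  nrm P f ^+ 2 - \sum_(i | p i) inner P f (F i) ^+ 2.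
Proof.
move=> sF oF F1 sf.
have sS : sqi P (fun x => \sum_(i | p i) inner P f (F i) * F i x).
  by apply: sqi_sum => i _; exact: sqiZ.
rewrite nrm_sqr.
under eq_Rintegral do rewrite -mulN1r.
rewrite nrm_quad// -/(inner P f _) inner_sumr// -!nrm_sqr orthogonal_nrm//.
rewrite -addrA lerD2l.
rewrite (_ : \sum_(i | p i) _ * _ = \sum_(i | p i) inner P f (F i) ^+ 2); last first.
  by apply: eq_bigr => i _; rewrite expr2.
rewrite sqrrN expr1n mul1r mulN1r mulNr mulrDl mul1r.
have : \sum_(i | p i) inner P f (F i) ^+ 2 * inner P (F i) (F i) <= \sum_(i | p i) inner P f (F i) ^+ 2.
  by apply: ler_sum => i _; rewrite ler_piMr// sqr_ge0.
by lra.
Qed.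

Lemma bessel (I : finType) (p : pred I) (F : I -> T -> R) f :
  (forall i, sqi P (F i)) -> (forall i j, i != j -> inner P (F i) (F j) = 0) ->
  (forall i, inner P (F i) (F i) <= 1) -> sqi P f ->
  \sum_(i | p i) inner P f (F i) ^+ 2 <= nrm P f ^+ 2.
Proof.
move=> sF oF F1 sf; have := bessel_dist p sF oF F1 sf.
by move=> /(le_trans (sqr_ge0 _)); rewrite subr_ge0.
Qed.

Lemma orthogonal_series (a : nat -> T -> R) (c : nat -> R) (M : R) :
  (forall k, sqi P (a k)) -> (forall j k, j != k -> inner P (a j) (a k) = 0) ->
  (forall k, inner P (a k) (a k) <= 1) -> (forall n, \sum_(k < n) c k ^+ 2 <= M) ->
  exists2 g, sqi P g & cvgL2 P (fun n x => \sum_(k < n) c k * a k x) g.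
Proof.
move=> sa oa a1 cM; apply: riesz_fischer.
  by move=> n; apply: sqi_sum => i _; exact: sqiZ.
move=> e e0; have e20 : 0 < e ^+ 2 by rewrite exprn_gt0.
have [N HN] := summable_tail (fun k => sqr_ge0 (c k)) cM e20.
exists N.
have main m n : (N <= m)%N -> (m <= n)%N ->
    nrm P (fun x => \sum_(k < n) c k * a k x - \sum_(k < m) c k * a k x) <= e.
  move=> Nm mn.
  rewrite (@eq_nrm _ _ _ _ _ (fun x => \sum_(k < n | (m <= k)%N) c k * a k x)); last first.
    move=> x; rewrite (big_ord_widen _ (fun k => c k * a k x) mn).
    rewrite [X in X - _](bigID (fun k : 'I_n => (k < m)%N))/= addrAC subrr add0r.
    by apply: eq_bigl => k; rewrite -leqNgt.
  rewrite -(@ler_pXn2r _ 2)// ?nnegrE ?nrm_ge0 ?(ltW e0)//.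
  rewrite (@orthogonal_nrm _ _ (fun k : 'I_n => a k) (fun k : 'I_n => c k))//; last first.
    by move=> i j ij; exact: oa.
  apply: le_trans (HN m n Nm); apply: ler_sum => i _.
  by rewrite ler_piMr// sqr_ge0.
move=> m n Nm Nn; have [mn|/ltnW nm] := leqP m n; last exact: main.
rewrite -nrmN (@eq_nrm _ _ _ _ _ (fun x => \sum_(k < n) c k * a k x - \sum_(k < m) c k * a k x)).
  exact: main.
by move=> x; rewrite opprB.
Qed.

Lemma inner_cvg f g h (l : R) : (forall n, sqi P (f n)) -> sqi P g -> sqi P h ->
  cvgL2 P f g -> (exists N, forall n, (N <= n)%N -> inner P (f n) h = l) -> inner P g h = l.
Proof.
move=> sf sg sh fg [N HN]; apply/eqP; rewrite -subr_eq0 -normr_le0.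
apply/ler_addgt0Pl => e e0; rewrite addr0.
have n0 : 0 < nrm P h + 1 by rewrite ltr_wpDl ?nrm_ge0.
have [N' HN'] := fg (e / (nrm P h + 1)) (divr_gt0 e0 n0).
set n := maxn N N'.
rewrite -(HN n (leq_maxl _ _)) -normrN opprB.
rewrite /inner -RintegralB//; [|exact: sqiM..].
under eq_Rintegral do rewrite -mulrBl.
apply: (le_trans (cauchy_schwarz (sqiB (sf n) sg) sh)).
apply: le_trans (_ : e / (nrm P h + 1) * (nrm P h + 1) <= _); last by rewrite divfK ?gt_eqF.
apply: ler_pM; rewrite ?nrm_ge0 ?lerDl//; apply: HN'; exact: leq_maxr.
Qed.

Section complete.
Variable a : nat -> T -> R.
Hypothesis ca : complete_orthonormal P a.

Lemma co_sqi k : sqi P (a k). Proof. by case: ca => h _ _ _; apply/Lfun2P/h. Qed.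

Lemma co_orth j k : j != k -> inner P (a j) (a k) = 0.
Proof. by case: ca => _ h _ _; exact: h. Qed.

Lemma ae0_inner f g : sqi P f -> sqi P g -> g = cst 0 %[ae P] -> inner P f g = 0.
Proof.
move=> [mf _] [mg _] g0; rewrite -(Rint_cst P 0); apply: ae_eq_Rint.
- exact: measurable_funM.
- exact: measurable_cst.
- by apply: filterS g0 => x /= h _; rewrite h// mulr0.
Qed.

(** The way padding is dealt with: a padding function contributes zero to every coefficient, so
    formulas valid for unit vectors survive. *)
Lemma co_norm k : inner P (a k) (a k) = 1 \/ (forall f, sqi P f -> inner P f (a k) = 0).
Proof.
case: (ca) => _ _ /(_ k)[h|h] _; [by left|right] => f sf.
by apply: ae0_inner => //; exact: co_sqi.
Qed.

Lemma co_le1 k : inner P (a k) (a k) <= 1.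
Proof. by have [->|/(_ _ (co_sqi k)) ->] := co_norm k. Qed.

End complete.
End orthogonal.

(** * Van der Waerden's permanent bound *)

Section permanent.
Variable F : comNzRingType.

Definition permanent n (A : 'I_n -> 'I_n -> F) : F :=
  \sum_(s : 'S_n) \prod_i A i (s i).

Lemma eq_permanent n (A B : 'I_n -> 'I_n -> F) :
  (forall i j, A i j = B i j) -> permanent A = permanent B.
Proof. by move=> AB; apply: eq_bigr => s _; apply: eq_bigr => i _. Qed.

(** For [v i = \sum_(l < k) A i l * x l] this is k! times what remains of the polynomial
    [\prod_i \sum_j A i j * x j] after differentiating once in every variable of index at least k
    and setting these variables to 0. The values k = n, ..., 0 form Gurvits' chain from the product
    polynomial to the permanent. *)
Definition mixed_permanent n k (v : 'I_n -> F) (A : 'I_n -> 'I_n -> F) : F :=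
  permanent (fun i j => if (j < k)%N then v i else A i j).

Lemma mixed_permanent_full n (v : 'I_n -> F) A :
  mixed_permanent n v A = n`!%:R * \prod_i v i.
Proof.
rewrite /mixed_permanent /permanent.
transitivity (\sum_(s : 'S_n) \prod_i v i).
  by apply: eq_bigr => s _; apply: eq_bigr => i _; rewrite ltn_ord.
by rewrite sumr_const card_Sn mulr_natl.
Qed.

Lemma prod_linear_poly (I : finType) (a b : I -> F) :
  \prod_i ((a i)%:P + (b i)%:P * 'X) =
  \poly_(m < #|I|.+1) (\sum_(S : {set I} | #|S| == m)
      \prod_i (if i \in S then b i else a i)).
Proof.
under eq_bigr do rewrite addrC.
rewrite bigA_distr /=.
transitivity (\sum_(S : {set I}) (\prod_i (if i \in S then b i else a i))%:P * 'X^#|S|).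
  apply: eq_bigr => S _; rewrite rmorph_prod -prodr_const [X in _ * X]big_mkcond -big_split/=.
  by apply: eq_bigr => i _; case: ifP => _; rewrite ?mulr1 ?expr1.
apply/polyP => m; rewrite coef_poly coef_sum.
transitivity (\sum_(S : {set I}) (\prod_i (if i \in S then b i else a i)) * (m == #|S|)%:R).
  by apply: eq_bigr => S _; rewrite coefCM coefXn.
rewrite (bigID (fun S : {set I} => #|S| == m))/= [X in _ + X]big1 ?addr0; last first.
  by move=> S /negPf Sm; rewrite eq_sym Sm mulr0.
case: ltnP => mI.
  by apply: eq_bigr => S /eqP ->; rewrite eqxx mulr1.
rewrite big1// => S /eqP Sm; have := max_card S; rewrite Sm leqNgt.
by rewrite mI.
Qed.

End permanent.

Section line_poly.
Variable F : comNzRingType.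
Variables (n k : nat) (v m : 'I_n -> F) (A : 'I_n -> 'I_n -> F).

Definition line_poly : {poly F} :=
  @mixed_permanent {poly F} n k (fun i => (v i)%:P + (m i)%:P * 'X) (fun i j => (A i j)%:P).

Lemma horner_line_poly x :
  line_poly.[x] = mixed_permanent k (fun i => v i + m i * x) A.
Proof.
rewrite horner_sum; apply: eq_bigr => s _; rewrite horner_prod.
by apply: eq_bigr => i _; case: ifP => _; rewrite !hornerE.
Qed.

Let a (s : 'S_n) i := if (s i < k)%N then v i else A i (s i).
Let b (s : 'S_n) i := if (s i < k)%N then m i else 0.

Lemma coef_line_poly l : line_poly`_l =
  \sum_(s : 'S_n) \sum_(S : {set 'I_n} | #|S| == l)
      \prod_i (if i \in S then b s i else a s i).
Proof.
rewrite coef_sum; apply: eq_bigr => s _.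
rewrite (eq_bigr (fun i => (a s i)%:P + (b s i)%:P * 'X)); last first.
  by move=> i _; rewrite /a /b; case: ifP => _; rewrite ?polyC0 ?mul0r ?addr0.
rewrite prod_linear_poly coef_poly card_ord; case: ltnP => // ln.
rewrite big1// => S /eqP Sl; have := max_card S.
by rewrite Sl card_ord leqNgt ln.
Qed.

End line_poly.

Section permanent_line.
Variable F : comNzRingType.

Lemma coefk_line_poly n k (v m : 'I_n -> F) A : (k <= n)%N ->
  (line_poly k v m A)`_k = mixed_permanent k m A.
Proof.
move=> kn; rewrite coef_line_poly; apply: eq_bigr => s _.
pose K : {set 'I_n} := [set i : 'I_n | (s i < k)%N]%SET.
have cK : #|K| = k.
  rewrite -sum1_card (eq_bigl (fun i => (s i < k)%N)); last by move=> i; rewrite inE.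
  transitivity (\sum_(i < n | (i < k)%N) 1)%N.
    by rewrite [RHS](reindex_inj (@perm_inj _ s)).
  by rewrite -(big_ord_widen n (fun=> 1%N) kn) sum1_card card_ord.
rewrite (bigD1 K)/=; last by rewrite cK.
rewrite [X in _ + X]big1 ?addr0; first by apply: eq_bigr => i _; rewrite inE; case: (s i < k)%N.
move=> S /andP[/eqP cS SK].
have [i iS iK] : exists2 i, i \in S & i \notin K.
  apply/subsetPn; apply: contra SK => SK; apply/eqP/setP/subset_cardP => //.
  by rewrite cS cK.
by rewrite (bigD1 i)//= iS; move: iK; rewrite inE => /negPf ->; rewrite mul0r.
Qed.

Lemma size_line_poly n k (v m : 'I_n -> F) A : (k <= n)%N ->
  (size (line_poly k v m A) <= k.+1)%N.
Proof.
move=> kn; apply/leq_sizeP => l kl; rewrite coef_line_poly big1// => s _.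
pose K : {set 'I_n} := [set i : 'I_n | (s i < k)%N]%SET.
have cK : #|K| = k.
  rewrite -sum1_card (eq_bigl (fun i => (s i < k)%N)); last by move=> i; rewrite inE.
  transitivity (\sum_(i < n | (i < k)%N) 1)%N.
    by rewrite [RHS](reindex_inj (@perm_inj _ s)).
  by rewrite -(big_ord_widen n (fun=> 1%N) kn) sum1_card card_ord.
rewrite big1// => S /eqP cS.
have [i iS iK] : exists2 i, i \in S & i \notin K.
  apply/subsetPn; apply/negP => /subset_leq_card.
  by rewrite cS cK leqNgt kl.
by rewrite (bigD1 i)//= iS; move: iK; rewrite inE => /negPf ->; rewrite mul0r.
Qed.

Lemma map_line_poly (G : comNzRingType) (h : {rmorphism F -> G}) n k
    (v m : 'I_n -> F) A :
  map_poly h (line_poly k v m A) =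
  line_poly k (fun i => h (v i)) (fun i => h (m i)) (fun i j => h (A i j)).
Proof.
rewrite rmorph_sum; apply: eq_bigr => s _; rewrite rmorph_prod.
apply: eq_bigr => i _; case: ifP => _; last by rewrite /= map_polyC.
by rewrite rmorphD rmorphM /= !map_polyC map_polyX.
Qed.

(** The derivative replaces one of the [k + 1] equal columns by column [k] of [A]. A transposition
    brings that column to its own place, so all these terms are equal. *)
Lemma coef1_line_poly n (k : 'I_n) (v : 'I_n -> F) A :
  (line_poly k.+1 v (fun i => A i k) A)`_1 = k.+1%:R * mixed_permanent k v A.
Proof.
rewrite coef_line_poly.
pose G (l : 'I_n) := permanent (fun i (j : 'I_n) =>
  if j == l then A i k else if (j < k.+1)%N then v i else A i j).
transitivity (\sum_(l < n | (l < k.+1)%N) G l).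
  rewrite /G /permanent [RHS]exchange_big/=; apply: eq_bigr => s _.
  rewrite (eq_bigl (fun S : {set 'I_n} => S \in [set [set i] | i : 'I_n]%SET)); last first.
    move=> S; apply/cards1P/imsetP => [[i ->]|[i _ ->]]; by exists i.
  rewrite big_imset/=; last by move=> i j _ _ /set1_inj.
  rewrite [in RHS](reindex_inj (@perm_inj _ s))/= [in RHS]big_mkcond/=.
  apply: eq_bigr => l _.
  rewrite (bigD1 l)//= inE eqxx; case: ifP => lk; last by rewrite mul0r.
  rewrite [RHS](bigD1 l)//= eqxx; congr *%R; apply: eq_bigr => i il.
  by rewrite inE (negPf il) (inj_eq perm_inj) (negPf il).
rewrite (eq_bigr (fun=> mixed_permanent k v A)); last first.
  move=> l lk; rewrite /G /permanent (reindex_inj (mulIg (tperm l k)))/=.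
  apply: eq_bigr => s _; apply: eq_bigr => i _; rewrite permM.
  case: tpermP => [->|->|/eqP/negPf jl /eqP jk].
  - have [<-|lk'] := eqVneq k l; first by rewrite ltnn.
    rewrite ltnS leqnn; rewrite ltnS leq_eqVlt in lk.
    by move: lk; rewrite -[_ == _]/(l == k) eq_sym (negPf lk') /= => ->.
  - by rewrite eqxx ltnn.
  - by rewrite jl ltnS leq_eqVlt -[_ == _]/(s i == k) (negPf jk).
rewrite -(big_ord_widen n (fun=> mixed_permanent k v A) (ltn_ord k)).
by rewrite sumr_const card_ord mulr_natl.
Qed.

End permanent_line.

(** * Stability of mixed permanents *)

Section stability.
Variable R : realType.
Local Notation C := (complex R).
Local Notation Im := (@complex.Im R).
Local Notation Re := (@complex.Re R).
Local Notation "x %:C" := (x +i* 0)%C.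

Lemma ImD (x y : C) : Im (x + y) = Im x + Im y.
Proof. by case: x y => a b [c d]. Qed.

Lemma Im_realM (a : R) (x : C) : Im (a%:C * x) = a * Im x.
Proof. by case: x => c d /=; rewrite mul0r addr0. Qed.

Lemma Im_inv (x : C) : Im x < 0 -> 0 < Im x^-1.
Proof.
move=> x0; have xn0 : x != 0 by apply: contraTneq x0 => ->; rewrite ltxx.
have := mulVf xn0; case: (x^-1) => a b; case: x x0 {xn0} => c d /= d0.
move=> /eqP; rewrite eq_complex /= => /andP[/eqP h1 /eqP h2].
have : b * (c ^+ 2 + d ^+ 2) = - d.
  have e1 : b * c = - (a * d) by lra.
  have e2 : b * d = a * c - 1 by lra.
  rewrite (_ : b * _ = c * (b * c) + d * (b * d)); last by ring.
  by rewrite e1 e2; ring.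
have : 0 < c ^+ 2 + d ^+ 2 by nra.
by move=> p1 p2; rewrite -(pmulr_lgt0 b p1) p2 oppr_gt0.
Qed.

Lemma coef1_prod_XsubC (F : fieldType) (r : seq F) : all (fun z => z != 0) r ->
  (\prod_(z <- r) ('X - z%:P))`_1 =
  - (\prod_(z <- r) ('X - z%:P))`_0 * \sum_(z <- r) z^-1.
Proof.
elim: r => [|z r IH] /=; first by rewrite !big_nil mulr0 coef1.
move=> /andP[z0 /IH {}IH]; rewrite !big_cons mulrBl !coefB !coefXM !coefCM /= IH.
by rewrite sub0r; field.
Qed.

(** The Gauss-Lucas argument at the point 0: the logarithmic derivative there is minus the sum of
    the inverse roots, and inverting a number of the lower half plane leads into the upper one. *)
Lemma gauss_lucas0 (p : {poly C}) : (1 < size p)%N ->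
  (forall z, root p z -> Im z < 0) -> p`_1 != 0.
Proof.
move=> p1 pr; have p0 : p != 0 by rewrite -size_poly_gt0 ltnW.
have [r pE] := closed_field_poly_normal p.
have lc : lead_coef p != 0 by rewrite lead_coef_eq0.
have rr z : z \in r -> Im z < 0.
  by move=> zr; apply: pr; rewrite pE rootZ// root_prod_XsubC.
have rn0 : all (fun z => z != 0) r.
  by apply/allP => z /rr; apply: contraTneq => ->; rewrite ltxx.
have rs : (0 < size r)%N.
  by move: p1; rewrite pE size_scale// size_prod_XsubC.
rewrite pE coefZ mulf_neq0// coef1_prod_XsubC// mulf_neq0//.
  rewrite oppr_eq0 -horner_coef0 -/(root _ _) root_prod_XsubC.
  by apply/negP => /(allP rn0); rewrite eqxx.
have : 0 < Im (\sum_(z <- r) z^-1).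
  case: r rs rr {pE rn0} => // z r _ rr; rewrite big_cons ImD ltr_pwDl//.
    by apply: Im_inv; apply: rr; rewrite mem_head.
  have {}rr z' : z' \in r -> Im z' < 0 by move=> h; apply: rr; rewrite inE h orbT.
  elim: r rr => [|z' r IH] rr; first by rewrite big_nil.
  rewrite big_cons ImD addr_ge0 ?IH// => [|y yr]; last by apply: rr; rewrite inE yr orbT.
  by apply/ltW/Im_inv; apply: rr; rewrite mem_head.
by apply: contraTneq => ->; rewrite ltxx.
Qed.

Variables (n : nat) (A : 'I_n -> 'I_n -> R).
Hypothesis A0 : forall i j, 0 < A i j.

(** Descending induction from k = n, where the mixed permanent is a product of nonzero numbers.
    Moving [v] along a positive column keeps it in the upper half plane, so by induction [h] has its
    roots below the real axis; its linear coefficient, a multiple of the next mixed permanent, is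
    then nonzero. *)
Lemma stable_mixed_permanent k (v : 'I_n -> C) : (k <= n)%N ->
  (forall i, 0 < Im (v i)) -> mixed_permanent k v (fun i j => (A i j)%:C) != 0.
Proof.
move=> kn; rewrite -(subKn kn); move: (n - k)%N (leq_subr k n) => m {k kn}.
elim: m v => [|m IH] v mn v0.
  rewrite subn0 mixed_permanent_full mulf_neq0//.
  apply/prodf_neq0 => i _; have := v0 i.
  by apply: contraTneq => ->; rewrite ltxx.
have kn : (n - m.+1 < n)%N by rewrite subnSK// leq_subr.
pose k := Ordinal kn.
have kE : k.+1 = (n - m)%N by rewrite /= subnSK.
pose h := line_poly k.+1 v (fun i => (A i k)%:C) (fun i j => (A i j)%:C).
have hr z : root h z -> Im z < 0.
  rewrite ltNge; apply: contraTN => z0; rewrite /root horner_line_poly kE.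
  apply: IH; first exact: ltnW.
  by move=> i; rewrite ImD Im_realM ltr_pwDl// mulr_ge0// ltW.
(* The top coefficient is a sum of products of positive entries, so [h] is not constant. *)
have hs : (1 < size h)%N.
  have : h`_k.+1 != 0.
    rewrite coefk_line_poly//.
    rewrite (_ : mixed_permanent _ _ _ = (mixed_permanent k.+1 (fun i => A i k) A)%:C).
      rewrite eq_complex /= eqxx andbT gt_eqF// /mixed_permanent /permanent.
      have pp (s : 'S_n) : 0 < \prod_i (if (s i < k.+1)%N then A i k else A i (s i)).
        by apply: prodr_gt0 => i _; case: ifP.
      rewrite (bigD1 1%g)//= ltr_pwDl//; apply: sumr_ge0 => s _; exact/ltW/pp.
    rewrite /mixed_permanent /permanent -[RHS]/(real_complex_def (Phant R) _).
    rewrite rmorph_sum; apply: eq_bigr => s _; rewrite rmorph_prod; apply: eq_bigr => i _.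
    by case: ifP.
  by apply: contraR; rewrite -leqNgt => hs; rewrite nth_default// (leq_trans hs).
have := gauss_lucas0 hs hr; rewrite coef1_line_poly.
by apply: contraNN => /eqP ->; rewrite mulr0.
Qed.

End stability.

Section vanderWaerden.
Variable R : realType.
Local Notation C := (complex R).

(** The inequality of means, after padding [r] with zeros to length [d]. The degree of a polynomial
    may be smaller than [d], which is why the lengths differ. *)
Lemma prod_le_mean_exp (r : seq R) d : (size r <= d)%N -> (0 < d)%N ->
  (forall x, x \in r -> 0 <= x) ->
  \prod_(x <- r) (1 + x) <= (1 + (\sum_(x <- r) x) / d%:R) ^+ d.
Proof.
move=> rd d0 r0; pose E (i : 'I_d) := 1 + nth 0 r i.
have E0 (i : 'I_d) : 0 <= nth 0 r i.
  by have [ir|ir] := ltnP i (size r); [apply: r0; exact: mem_nth|rewrite nth_default].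
have [|+ _] := (@leif_AGM R 'I_d predT E) _; first by move=> i _; rewrite addr_ge0.
have -> : \sum_(i in predT) E i = d%:R + \sum_(x <- r) x.
  rewrite big_split/= sumr_const cardT size_enum_ord; congr (_ + _).
  rewrite (big_nth 0) big_mkord (big_ord_widen d (nth 0 r) rd) [LHS](bigID (fun i : 'I_d => (i < size r)%N))/=.
  rewrite [X in _ + X]big1 ?addr0 => [|i]; first exact: eq_bigl.
  by rewrite -leqNgt => ir; rewrite nth_default.
have -> : \prod_(i in predT) E i = \prod_(x <- r) (1 + x).
  rewrite (big_nth 0) big_mkord (big_ord_widen d (fun i => 1 + nth 0 r i) rd) [LHS](bigID (fun i : 'I_d => (i < size r)%N))/=.
  rewrite [X in _ * X]big1 ?mulr1 => [|i]; first exact: eq_bigl.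
  by rewrite -leqNgt /E => ir; rewrite nth_default// addr0.
rewrite cardT size_enum_ord => /le_trans; apply.
by rewrite mulrDl divff ?pnatr_eq0 -?lt0n.
Qed.

(* For a polynomial with nonnegative coefficients and only real roots,
   [p ^ (1/d)] is concave on the positive axis. *)
Lemma real_rooted_le (p : {poly R}) d t : (size p <= d.+1)%N -> (0 < d)%N ->
  (forall x, 0 <= x -> 0 < p.[x]) ->
  (forall z : C, root (map_poly (real_complex R) p) z -> complex.Im z = 0) -> 0 <= t ->
  p.[t] <= p`_0 * (1 + t * (p`_1 / p`_0) / d%:R) ^+ d.
Proof.
move=> sp d0 ppos preal t0.
have p0 : p != 0 by have := ppos 0 (lexx 0); apply: contraTneq => ->; rewrite horner0 ltxx.
pose q := map_poly (real_complex R) p.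
have q0 : q != 0 by rewrite map_poly_eq0.
have [r qE] := closed_field_poly_normal q.
have lq : lead_coef q != 0 by rewrite lead_coef_eq0.
have rr z : z \in r -> complex.Im z = 0.
  by move=> zr; apply: preal; rewrite -/q qE rootZ// root_prod_XsubC.
pose r' := map (@complex.Re R) r.
have rE : r = map (real_complex R) r'.
  rewrite /r' -map_comp -[LHS]map_id; apply/eq_in_map => z /rr.
  by case: z => a b /= ->.
have pE : p = lead_coef p *: \prod_(z <- r') ('X - z%:P).
  apply: (map_poly_inj (real_complex R)); rewrite -/q qE map_polyZ lead_coef_map; congr (_ *: _).
  by rewrite {1}rE big_map rmorph_prod; apply: eq_bigr => z _; rewrite rmorphB /= map_polyX map_polyC.
have lp : lead_coef p != 0 by rewrite lead_coef_eq0.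
have rneg z : z \in r' -> z < 0.
  move=> zr; rewrite ltNge; apply/negP => z0; have := ppos z z0.
  rewrite pE hornerZ (_ : (\prod_(z <- r') _).[z] = 0) ?mulr0 ?ltxx//.
  by apply/eqP; rewrite -/(root _ _) root_prod_XsubC.
have rn0 : all (fun z => z != 0) r' by apply/allP => z /rneg /lt_eqF ->.
have c1 : p`_1 / p`_0 = \sum_(z <- r') - z^-1.
  have p00 : p`_0 != 0 by rewrite -horner_coef0 gt_eqF// ppos.
  apply: (mulIf p00); rewrite divfK// {1 2}pE !coefZ coef1_prod_XsubC//.
  by rewrite sumrN; ring.
have -> : p.[t] = p`_0 * \prod_(z <- map (fun z => t * - z^-1) r') (1 + z).
  rewrite -horner_coef0 {1 2}pE !hornerZ -mulrA; congr *%R.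
  rewrite !horner_prod big_map -big_split/= big_seq [RHS]big_seq.
  apply: eq_bigr => z /rneg /lt_eqF /negbT z0; rewrite !hornerE; field.
  exact: z0.
rewrite ler_pM2l; last by rewrite -horner_coef0 ppos.
apply: le_trans (prod_le_mean_exp (d := d) _ d0 _) _.
- by rewrite size_map size_map; move: sp; rewrite -(size_map_poly (real_complex R)) -/q qE size_scale// size_prod_XsubC ltnS.
- by move=> _ /mapP[z /rneg z0 ->]; rewrite mulr_ge0// oppr_ge0 invr_le0 ltW.
by rewrite big_map -mulr_sumr c1.
Qed.

(** One step of Gurvits' chain costs the factor [(d / (d + 1)) ^ d]; the product of these factors
    for d = 1, ..., n - 1 is [n! / n ^ n]. *)
Lemma optimal_slope (K a b : R) d : (0 < d)%N -> 0 < a -> 0 < b ->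
  (forall t, 0 < t -> K * t <= a * (1 + t * (b / a) / d.+1%:R) ^+ d.+1) ->
  K * (d%:R / d.+1%:R) ^+ d <= b.
Proof.
move=> d0 a0 b0 H.
have dp : 0 < d%:R :> R by rewrite ltr0n.
have dp1 : 0 < d.+1%:R :> R by rewrite ltr0n.
(* The minimiser of the right hand side divided by t. *)
pose t := d.+1%:R * a / (b * d%:R).
have tp : 0 < t by rewrite /t divr_gt0 ?mulr_gt0.
have := H t tp.
have -> : 1 + t * (b / a) / d.+1%:R = d.+1%:R / d%:R.
  by rewrite /t -(natr1 d); field; rewrite natr1 !gt_eqF.
rewrite exprS /t => h.
have {}h : K <= b * (d.+1%:R / d%:R) ^+ d.
  rewrite -(ler_pM2r tp) /t (le_trans h)// le_eqVlt; apply/orP; left; apply/eqP.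
  by field; rewrite !gt_eqF.
have := ler_wpM2r (exprn_ge0 d (divr_ge0 (ltW dp) (ltW dp1))) h.
move=> /le_trans; apply; rewrite -mulrA -exprMn mulf_div (mulrC d.+1%:R).
by rewrite divff ?expr1n ?mulr1// mulf_neq0 ?gt_eqF.
Qed.

Variables (n : nat) (A : 'I_n -> 'I_n -> R).
Hypothesis A0 : forall i j, 0 < A i j.

(** Each step freezes all variables but one and compares the resulting univariate polynomial with
    its linear coefficient. Stability makes this polynomial real-rooted, which is what
    [real_rooted_le] asks for. *)
Lemma vanderWaerden_capacity (K : R) : 0 <= K ->
  (forall x : 'I_n -> R, (forall i, 0 < x i) ->
    K * \prod_j x j <= \prod_i \sum_j A i j * x j) ->
  K * (n`!%:R / n%:R ^+ n) <= permanent A.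
Proof.
move=> K0 cap.
pose v k (x : 'I_n -> R) (i : 'I_n) := \sum_(l < n | (l < k)%N) A i l * x l.
(* The factor [(n - m) ^ (n - m)] makes the constants of [optimal_slope] telescope: it is [n ^ n] at
   the start and 1 at the end. *)
have main m : (m <= n)%N -> forall x : 'I_n -> R, (forall i, 0 < x i) ->
    K * (n`!%:R / n%:R ^+ n) * (n - m)%:R ^+ (n - m) * \prod_(l < n | (l < n - m)%N) x l
    <= mixed_permanent (n - m) (v (n - m)%N x) A.
  elim: m => [_ x x0|m IH mn x x0].
    rewrite subn0 mixed_permanent_full.
    have -> : \prod_(l < n | (l < n)%N) x l = \prod_l x l.
      by apply: eq_bigl => l; rewrite ltn_ord.
    have nn0 : n%:R ^+ n != 0 :> R by rewrite expf_eq0 pnatr_eq0 lt0n andNb.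
    rewrite mulrA divfK// (mulrC K) -mulrA ler_pM2l ?ltr0n ?fact_gt0//.
    apply: le_trans (cap x x0) _; rewrite le_eqVlt; apply/orP; left; apply/eqP/eq_bigr => i _.
    by apply: eq_bigl => l; rewrite ltn_ord.
  have kn : (n - m.+1 < n)%N by rewrite subnSK// leq_subr.
  pose k := Ordinal kn.
  have kE : (n - m)%N = k.+1 by rewrite /= subnSK.
  rewrite -/(nat_of_ord k) in IH *; rewrite kE in IH.
  rewrite -[(n - m.+1)%N]/(nat_of_ord k).
  pose f := line_poly k.+1 (v k x) (fun i => A i k) A.
  pose xt t l := if l == k then t else x l.
  have vE t i : v k.+1 (xt t) i = v k x i + A i k * t.
    rewrite /v (bigD1 k)//= /xt eqxx addrC; congr (_ + _).
    rewrite (eq_bigl (fun l : 'I_n => (l < k)%N)); last first.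
      by move=> l; rewrite ltnS leq_eqVlt -[nat_of_ord l == _]/(l == k); case: eqVneq => [->|]; rewrite ?ltnn// andbT.
    by apply: eq_bigr => l lk; case: eqP => // lk'; rewrite lk' ltnn in lk.
  have fE t : f.[t] = mixed_permanent k.+1 (v k.+1 (xt t)) A.
    by rewrite horner_line_poly; apply: eq_permanent => i j; rewrite vE.
  have perm_pos l (w : 'I_n -> R) : (forall i, 0 < w i) -> 0 < mixed_permanent l w A.
    move=> w0; have pp (s : 'S_n) : 0 < \prod_i (if (s i < l)%N then w i else A i (s i)).
      by apply: prodr_gt0 => i _; case: ifP.
    rewrite /mixed_permanent /permanent (bigD1 1%g)//= ltr_pwDl//.
    by apply: sumr_ge0 => s _; exact/ltW/pp.
  have IHt t : 0 < t -> K * (n`!%:R / n%:R ^+ n) * k.+1%:R ^+ k.+1 *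
      (\prod_(l < n | (l < k)%N) x l) * t <= f.[t].
    move=> t0; rewrite fE; have := IH (ltnW mn) (xt t).
    have -> : \prod_(l < n | (l < k.+1)%N) xt t l = (\prod_(l < n | (l < k)%N) x l) * t.
      rewrite (bigD1 k)//= /xt eqxx mulrC; congr *%R.
      rewrite (eq_bigl (fun l : 'I_n => (l < k)%N)); last first.
        by move=> l; rewrite ltnS leq_eqVlt -[nat_of_ord l == _]/(l == k); case: eqVneq => [->|]; rewrite ?ltnn// andbT.
      by apply: eq_bigr => l lk; case: eqP => // lk'; rewrite lk' ltnn in lk.
    by rewrite !mulrA; apply => i; rewrite /xt; case: ifP.
  have b1 : f`_1 = k.+1%:R * mixed_permanent k (v k x) A by exact: coef1_line_poly.
  (* In the last step [optimal_slope] does not apply, but all columns are proportional to the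
     remaining variable or already columns of [A], so the value at 1 is the permanent itself. *)
  have [k0|k0] := posnP k.
    have := IHt 1 ltr01; rewrite mulr1 [X in _ * X](big_pred0); last by move=> l; rewrite k0.
    rewrite [X in _ -> _ * X <= _](big_pred0); last by move=> l; rewrite k0.
    rewrite (_ : k.+1%:R ^+ k.+1 = 1); last by rewrite k0 expr1n.
    rewrite (_ : k%:R ^+ k = 1); last by rewrite k0 expr0.
    move=> /le_trans; apply; rewrite le_eqVlt; apply/orP; left; apply/eqP.
    rewrite horner_line_poly; apply: eq_permanent => i j.
    rewrite mulr1 k0 ltn0 ltnS leqn0; case: eqP => // j0.
    rewrite /v big_pred0; last by move=> l; rewrite ltn0.
    by rewrite add0r; congr A; apply: val_inj; rewrite /= j0 -k0.
  have vpos i : 0 < v k x i.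
    rewrite /v (bigD1 (Ordinal (ltn_trans k0 kn)))//= ltr_pwDl ?mulr_gt0//.
    by apply: sumr_ge0 => l _; rewrite mulr_ge0// ltW.
  have fpos t : 0 <= t -> 0 < f.[t].
    move=> t0; rewrite horner_line_poly; apply: perm_pos => i.
    by rewrite ltr_pwDl// mulr_ge0// ltW.
  have sf : (size f <= k.+2)%N.
    exact: size_line_poly.
  have fE' (z : C) : (map_poly (real_complex R) f).[z] =
      mixed_permanent k.+1 (fun i => ((v k x i) +i* 0 + (A i k +i* 0) * z)%C) (fun i j => (A i j +i* 0)%C).
    by rewrite map_line_poly horner_line_poly.
  have froot (z : C) : 0 < complex.Im z -> ~~ root (map_poly (real_complex R) f) z.
    move=> z0; rewrite /root fE'; apply: stable_mixed_permanent => // i.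
    by rewrite ImD Im_realM add0r mulr_gt0.
  (* The coefficients are real, so roots come in conjugate pairs; excluding the upper half plane
     excludes the lower one too. *)
  have freal (z : C) : root (map_poly (real_complex R) f) z -> complex.Im z = 0.
    move=> rz; apply/eqP; rewrite eq_le; apply/andP; split.
      by rewrite leNgt; apply/negP => /froot; rewrite rz.
    rewrite leNgt; apply/negP => z0; have /froot : 0 < complex.Im (conjc z).
      by case: (z) z0 => a b /=; rewrite oppr_gt0.
    have -> : map_poly (real_complex R) f = map_poly (@conjc R) (map_poly (real_complex R) f).
      by rewrite -map_poly_comp; apply: eq_map_poly => y; rewrite /= oppr0.
    by rewrite /root horner_map (eqP rz) rmorph0 eqxx.
  have f0 : 0 < f`_0 by rewrite -horner_coef0 fpos.
  have f1 : 0 < f`_1 by rewrite b1 mulr_gt0 ?ltr0n// perm_pos.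
  have := @optimal_slope (K * (n`!%:R / n%:R ^+ n) * k.+1%:R ^+ k.+1 *
      (\prod_(l < n | (l < k)%N) x l)) f`_0 f`_1 k k0 f0 f1.
  have k1 : 0 < k.+1%:R :> R by rewrite ltr0n.
  rewrite b1 => H; rewrite -(ler_pM2l k1); apply: le_trans (H _) => [|t t0].
    rewrite le_eqVlt; apply/orP; left; apply/eqP.
    move: (K * (n`!%:R / n%:R ^+ n)) (\prod_(l < n | _) _) => c Q.
    rewrite expr_div_n exprS; have := expf_neq0 k (lt0r_neq0 k1).
    have aux (z u w : R) : u != 0 -> z * (c * w * Q) = c * (z * u) * Q * (w / u).
      by move=> u0; field.
    exact: aux.
  apply: le_trans (IHt t t0) _; rewrite -b1.
  by apply: real_rooted_le => //; exact: ltW.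
have := main n (leqnn n) (fun=> 1) (fun=> ltr01).
rewrite subnn expr0 big_pred0// ?mulr1 => /le_trans; apply.
by rewrite le_eqVlt; apply/orP; left; apply/eqP/eq_permanent => i j.
Qed.

End vanderWaerden.

(** * Second moments of permutation averages *)

Section types.
Variables (J : finType) (N : nat).
Local Notation T := {ffun 'I_N -> option J}.
Implicit Types (kap lam mu : T) (i : 'I_N) (a b c : option J).

Definition mult kap c : nat := \sum_(i < N) (kap i == c).

(** [None] stands for the constant eigenfunction. Its multiplicity is N minus the others, so it is
    not recorded. *)
Definition content kap : {ffun J -> 'I_N.+1} := [ffun x => inord (mult kap (Some x))].

Definition permf kap (s : 'S_N) : T := [ffun i => kap (s i)].

Definition upd kap i b : T := [ffun j => if j == i then b else kap j].

Definition class_size kap : nat := #|[pred lam : T | content lam == content kap]|.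

Lemma mult_leN kap c : (mult kap c <= N)%N.
Proof.
apply: leq_trans (_ : \sum_(i < N) 1 <= N)%N; last by rewrite sum1_card card_ord.
by apply: leq_sum => i _; case: (_ == _).
Qed.

Lemma contentE kap x : content kap x = mult kap (Some x) :> nat.
Proof. by rewrite ffunE inordK// ltnS mult_leN. Qed.

Lemma mult_total kap : (\sum_c mult kap c = N)%N.
Proof.
rewrite exchange_big/= -[RHS]card_ord -sum1_card; apply: eq_bigr => i _.
rewrite (bigD1 (kap i))//= eqxx big1// => c /negPf.
by rewrite eq_sym => ->.
Qed.

Lemma content_eqP kap lam :
  reflect (forall c, mult kap c = mult lam c) (content kap == content lam).
Proof.
apply: (iffP eqP) => [E|E]; last by apply/ffunP => x; rewrite !ffunE E.
have ES x : mult kap (Some x) = mult lam (Some x) by rewrite -!contentE E.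
case=> // ; have := mult_total kap; rewrite -{1}(mult_total lam).
rewrite (bigD1 None)//= [in X in _ = X -> _](bigD1 None)//=.
have -> : (\sum_(c | c != None) mult kap c = \sum_(c | c != None) mult lam c)%N.
  by apply: eq_bigr => -[x|].
by move=> /addIn.
Qed.

Lemma mult_perm kap (s : 'S_N) c : mult (permf kap s) c = mult kap c.
Proof.
rewrite /mult [RHS](reindex_inj (@perm_inj _ s)).
by apply: eq_bigr => i _; rewrite ffunE.
Qed.

Lemma content_perm kap (s : 'S_N) : content (permf kap s) = content kap.
Proof. by apply/eqP/content_eqP => c; rewrite mult_perm. Qed.

Lemma content_permP kap lam : content kap = content lam ->
  exists s : 'S_N, lam = permf kap s.
Proof.
move=> /eqP/content_eqP E.
pose tup (f : T) := [tuple f i | i < N].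
have multE (f : T) c : mult f c = count_mem c (tup f).
  rewrite /= count_map -sum1_count big_enum_cond/= /mult [RHS]big_mkcond/=.
  by apply: eq_bigr => i _; case: (_ == _).
have /tuple_permP[s sE] : perm_eq (tup lam) (tup kap).
  by apply/allP => c _ /=; apply/eqP; rewrite -!multE E.
exists s; apply/ffunP => i; rewrite ffunE.
have : tnth (tup lam) i = tnth [tuple tnth (tup kap) (s i) | i < N] i.
  by congr tnth; exact: val_inj.
by rewrite !tnth_mktuple.
Qed.

Lemma permf_inj (s : 'S_N) : injective (permf^~ s).
Proof.
move=> kap lam /ffunP E; apply/ffunP => i.
by have := E (s^-1%g i); rewrite !ffunE permKV.
Qed.

Lemma class_size_gt0 kap : (0 < class_size kap)%N.
Proof. by apply/card_gt0P; exists kap; rewrite inE. Qed.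

Lemma class_size_content kap lam : content kap = content lam ->
  class_size kap = class_size lam.
Proof. by rewrite /class_size => ->. Qed.

Lemma permfM kap (s t : 'S_N) : permf (permf kap s) t = permf kap (t * s)%g.
Proof. by apply/ffunP => i; rewrite !ffunE permM. Qed.

(** Orbit counting: every element of the class is reached by the same number of permutations, so a
    uniform permutation of [kap] is uniform on its class. *)
Lemma sum_permf (R : numFieldType) kap (f : T -> R) :
  N`!%:R^-1 * (\sum_(s : 'S_N) f (permf kap s)) =
  (class_size kap)%:R^-1 * \sum_(lam | content lam == content kap) f lam.
Proof.
pose st lam := #|[pred s : 'S_N | permf kap s == lam]|.
have stE lam : content lam == content kap -> st lam = st kap.
  move=> /eqP/esym /content_permP[t ->].
  rewrite /st -!sum1_card (reindex_inj (mulgI t))/=; apply: eq_bigl => s.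
  by rewrite !inE -permfM (inj_eq (@permf_inj t)).
have H (g : T -> R) : \sum_(s : 'S_N) g (permf kap s) =
    (st kap)%:R * \sum_(lam | content lam == content kap) g lam.
  rewrite (partition_big (permf kap) (fun lam => content lam == content kap))/=; last first.
    by move=> s _; rewrite content_perm.
  rewrite mulr_sumr; apply: eq_bigr => lam clam.
  rewrite (eq_bigr (fun=> g lam)); last by move=> s /eqP ->.
  by rewrite sumr_const -(stE lam clam) mulr_natl.
have := H (fun=> 1); rewrite sumr_const card_Sn sumr_const => E.
rewrite H E -/(class_size kap) mulr_natl.
have o0 : (class_size kap)%:R != 0 :> R by rewrite pnatr_eq0 -lt0n class_size_gt0.
have s0 : (st kap)%:R != 0 :> R.
  apply/negP => /eqP s0; move/eqP: E; rewrite s0 mul0r; apply/negP.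
  by rewrite pnatr_eq0 -lt0n fact_gt0.
by rewrite -mulr_natr; field; rewrite o0 s0.
Qed.

Lemma mult_upd kap i b c :
  (mult (upd kap i b) c + (kap i == c) = mult kap c + (b == c))%N.
Proof.
rewrite /mult (bigD1 i)//= [in RHS](bigD1 i)//= ffunE eqxx.
rewrite (eq_bigr (fun j => nat_of_bool (kap j == c))); last first.
  by move=> j /negPf ji; rewrite ffunE ji.
by rewrite -addnA (addnC _ (kap i == c : nat)) [RHS]addnC.
Qed.

(* Count the pairs [(kap, i)] with [kap i = a] in two ways. *)
Lemma class_size_upd kap i b :
  (class_size kap * mult kap (kap i) =
   class_size (upd kap i b) * mult (upd kap i b) b)%N.
Proof.
have H (mu : T) c : (class_size mu * mult mu c =
    \sum_(p : T * 'I_N | (content p.1 == content mu) && (p.1 p.2 == c)) 1)%N.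
  rewrite -(pair_big_dep (fun lam => content lam == content mu) (fun lam i => lam i == c) (fun _ _ => 1%N))/=.
  rewrite (eq_bigr (fun=> mult mu c)); last first.
    move=> lam /content_eqP <-; rewrite /mult big_mkcond/=.
    by apply: eq_bigr => j _; case: (_ == _).
  by rewrite sum_nat_const.
rewrite !H.
pose h b (p : T * 'I_N) := (upd p.1 p.2 b, p.2).
rewrite (reindex_onto (h (kap i)) (h b))/=; last first.
  move=> [lam j] /andP[/= /eqP cl /eqP lj]; congr pair.
  by apply/ffunP => l; rewrite !ffunE; case: eqP => // ->.
apply: eq_bigl => -[lam j]; rewrite /h /= ffunE eqxx eqxx andbT xpair_eqE eqxx andbT.
have -> : (upd (upd lam j (kap i)) j b == lam) = (lam j == b).
  apply/eqP/eqP => [<-|lj]; first by rewrite ffunE eqxx.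
  by apply/ffunP => l; rewrite !ffunE; case: eqP => // ->.
rewrite andbC [RHS]andbC; case: (eqVneq (lam j) b) => //= lj; apply/content_eqP/content_eqP => E c.
  apply: (@addIn (kap i == c)).
  by rewrite (mult_upd kap i b c) -(E c) -lj mult_upd.
apply: (@addIn (b == c)).
by rewrite -(mult_upd kap i b c) -(E c) -lj mult_upd.
Qed.

Definition nontrivial kap : nat := #|[pred i | kap i != None]|.

Lemma mult_nontrivial kap x : (mult kap (Some x) <= nontrivial kap)%N.
Proof.
rewrite /mult /nontrivial -sum1_card [leqRHS]big_mkcond/=; apply: leq_sum => i _.
by rewrite inE; case: eqP => // ->.
Qed.

Lemma sum_mult_nontrivial kap : (\sum_x mult kap (Some x) = nontrivial kap)%N.
Proof.
rewrite exchange_big/= /nontrivial -sum1_card [RHS]big_mkcond/=; apply: eq_bigr => i _.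
rewrite inE; case: (kap i) => [x|] /=; last by rewrite big1.
rewrite (bigD1 x)//= eqxx big1// => y /negPf yx.
by rewrite (inj_eq Some_inj) eq_sym yx.
Qed.

(* The weights of the [kap] with a given content add up to at most 1. *)
Lemma sum_class_size (R : numFieldType) (phi : J -> nat -> R) :
  (forall x j, 0 <= phi x j) ->
  \sum_kap (class_size kap)%:R^-1 * \prod_x phi x (mult kap (Some x)) <=
  \prod_x \sum_(j < N.+1) phi x j.
Proof.
move=> phi0; rewrite bigA_distr_bigA/=.
rewrite (partition_big content predT)//=; apply: ler_sum => n _.
have [kap0 /eqP k0|none] := pickP (fun kap => content kap == n); last first.
  rewrite big_pred0; last by move=> kap; rewrite none.
  by apply: prodr_ge0 => x _.
rewrite (eq_bigr (fun=> (class_size kap0)%:R^-1 * \prod_x phi x (n x))); last first.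
  move=> kap /eqP kn; rewrite (class_size_content (lam := kap0)) ?kn// -kn.
  by congr *%R; apply: eq_bigr => x _; rewrite contentE.
rewrite sumr_const (_ : #|_| = class_size kap0); last by rewrite /class_size k0.
rewrite -mulrnAl -mulr_natr mulVf ?mul1r// pnatr_eq0 -lt0n; exact: class_size_gt0.
Qed.

End types.

(** * Sums over contents *)

Section series_bounds.
Variable R : realType.
Implicit Types r q u H : R.

Lemma bernoulli_exp (x : R) m : 0 <= x -> 1 + m%:R * x <= (1 + x) ^+ m.
Proof.
move=> x0; elim: m => [|m IH]; first by rewrite mul0r addr0 expr0.
rewrite exprS; apply: (@le_trans _ _ ((1 + x) * (1 + m%:R * x))).
  rewrite -natr1; have : 0 <= m%:R * x * x by rewrite !mulr_ge0.
  by lra.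
by apply: ler_wpM2l => //; lra.
Qed.

(** Bernoulli's inequality for the square root of r, squared. It lets the polynomial factors of the
    combinatorial estimates be absorbed by a geometric one. *)
Lemma sqr_exp_bounded r : 0 < r < 1 -> exists2 C : R, 0 < C &
  forall m, m.+1%:R ^+ 2 <= C * r ^- m.
Proof.
move=> /andP[r0 r1]; pose q := Num.sqrt r.
have q0 : 0 < q by rewrite sqrtr_gt0.
have q1 : q < 1 by rewrite -sqrtr1 ltr_sqrt.
pose x := q^-1 - 1.
have x0 : 0 < x by rewrite subr_gt0 invf_gt1.
exists ((1 + x^-1) ^+ 2) => [|m]; first by rewrite exprn_gt0// addr_gt0// invr_gt0.
rewrite -(sqr_sqrtr (ltW r0)) -/q -exprM mulnC exprM -exprVn -exprMn.
rewrite lerXn2r ?nnegrE// ?mulr_ge0 ?invr_ge0 ?exprn_ge0 ?addr_ge0 ?(ltW x0) ?(ltW q0)//.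
  by rewrite invr_ge0 ltW.
rewrite -exprVn (_ : q^-1 = 1 + x); last by rewrite /x; ring.
have B := bernoulli_exp m (ltW x0).
have p0 : 0 < 1 + x^-1 by rewrite addr_gt0// invr_gt0.
apply: le_trans (ler_wpM2l (ltW p0) B).
rewrite (_ : _ * _ = m%:R + 1 + (m%:R * x + x^-1)); last by field; rewrite gt_eqF.
rewrite -natr1; have : 0 <= m%:R * x by rewrite mulr_ge0// ltW.
have : 0 < x^-1 by rewrite invr_gt0.
by lra.
Qed.

Lemma geometric_le (u : R) n : 0 <= u < 1 -> \sum_(j < n) u ^+ j <= (1 - u)^-1.
Proof.
move=> /andP[u0 u1]; have p : 0 < 1 - u by rewrite subr_gt0.
have -> : \sum_(j < n) u ^+ j = (1 - u ^+ n) / (1 - u).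
  elim: n => [|n IH]; first by rewrite big_ord0 expr0 subrr mul0r.
  by rewrite big_ord_recr/= IH exprS; field; rewrite gt_eqF.
by rewrite ler_piMl ?invr_ge0 ?(ltW p)// lerBlDr lerDl exprn_ge0.
Qed.

(** The bound sees [J] only through the sum of [u], hence it does not depend on the truncation of
    the spectrum. *)
Lemma prod_geometric_le (J : finType) (u : J -> R) ub H :
  ub < 1 -> (forall x, 0 <= u x <= ub) -> \sum_x u x <= H ->
  \prod_x (1 - u x)^-1 <= expR (H / (1 - ub)).
Proof.
move=> ub1 u0 uH; have p : 0 < 1 - ub by rewrite subr_gt0.
apply: (@le_trans _ _ (\prod_x expR (u x / (1 - ub)))); last first.
  by rewrite -expR_sum ler_expR -mulr_suml ler_wpM2r// invr_ge0 ltW.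
apply: ler_prod => x _; have /andP[ux0 uxb] := u0 x.
have p1 : 0 < 1 - u x by rewrite subr_gt0; exact: le_lt_trans ub1.
rewrite invr_ge0 ltW//=; apply: le_trans (expR_ge1Dx _).
rewrite (_ : (1 - u x)^-1 = 1 + u x / (1 - u x)); last by field; rewrite gt_eqF.
rewrite lerD2l ler_wpM2l// lef_pV2 ?posrE//; lra.
Qed.

Section constant.
Variables (q H : R).
Hypotheses (q01 : 0 <= q < 1) (H0 : 0 <= H).

(** Strictly between q and 1: [r ^- m] still absorbs a square of m, and the ratio [q / r] remains
    below 1. *)
Let r := (1 + q) / 2.
Let r01 : 0 < r < 1.
Proof. by move: q01; rewrite /r => /andP[? ?]; lra. Qed.
Let qr1 : q / r < 1.
Proof. by move: (r01) q01 => /andP[r0 _] /andP[? ?]; rewrite ltr_pdivrMr// mul1r /r; lra. Qed.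

Variables (C : R).
Hypothesis C0 : 0 < C.
Hypothesis HC : forall m, m.+1%:R ^+ 2 <= C * r ^- m.

(** [C] pays for the quadratic factor, [1 + r^-1] for the one omitted singular value, and the
    exponential for the product of the geometric series. *)
Definition cnst := C * (1 + r^-1) * expR (H / r / (1 - q / r)).

Variables (J : finType) (N : nat) (s : J -> R).
Hypothesis sq : forall x, s x ^+ 2 <= q.
Hypothesis sH : \sum_x s x ^+ 2 <= H.
Local Notation T := {ffun 'I_N -> option J}.

(** One factor of type [a] is left out, because the corresponding position carries [g] in place of
    [xi]. For [a = None] nothing is lost, the missing factor being 1. *)
Definition weight_but (a : option J) (kap : T) : R :=
  \prod_x (s x ^+ 2) ^+ (mult kap (Some x) - (Some x == a))%N.

Lemma sum_weight_but (a : option J) :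
  \sum_(kap : T) (class_size kap)%:R^-1 *
    ((nontrivial kap).+1%:R ^+ 2 * ((0 < mult kap a)%N || (a == None))%:R * weight_but a kap) <= cnst.
Proof.
have /andP[r0 r1] := r01.
(* The last factor discards j = 0 for the type [a]; the lowered exponent then runs from 0 again and
   the truncated subtraction counts nothing twice. *)
pose phi x j : R := (s x ^+ 2) ^+ (j - (Some x == a)) * r ^- j *
  ((0 < j)%N || (Some x != a))%:R.
have phi0 x j : 0 <= phi x j.
  apply: mulr_ge0 => //; apply: mulr_ge0; first by apply: exprn_ge0; exact: sqr_ge0.
  by rewrite invr_ge0; apply: exprn_ge0; exact: ltW.
apply: (@le_trans _ _ (C * \sum_(kap : T) (class_size kap)%:R^-1 * \prod_x phi x (mult kap (Some x)))).
  rewrite mulr_sumr; apply: ler_sum => kap _; rewrite [leRHS]mulrCA.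
  rewrite ler_wpM2l ?invr_ge0// /phi !big_split/= /weight_but.
  have -> : \prod_x r ^- mult kap (Some x) = r ^- nontrivial kap.
    rewrite -sum_mult_nontrivial -exprVn expr_sum.
    by apply: eq_bigr => x _; rewrite exprVn.
  have -> : \prod_x ((0 < mult kap (Some x))%N || (Some x != a))%:R =
      ((0 < mult kap a)%N || (a == None))%:R :> R.
    case: (a) => [y|]; last by rewrite big1 ?orbT// => x _; rewrite orbT.
    rewrite (bigD1 y)//= eqxx !orbF.
    by rewrite big1 ?mulr1// => x; rewrite (inj_eq Some_inj) => ->; rewrite orbT.
  set W := \prod_x _; set e := (_ || _)%:R.
  rewrite (_ : C * _ = (C * r ^- nontrivial kap) * e * W); last by ring.
  have W0 : 0 <= W by apply: prodr_ge0 => x _; rewrite exprn_ge0// sqr_ge0.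
  by rewrite ler_wpM2r// ler_wpM2r// ?ler0n.
apply: (@le_trans _ _ (C * \prod_x \sum_(j < N.+1) phi x j)).
  by rewrite ler_wpM2l ?(ltW C0)//; exact: sum_class_size.
rewrite /cnst -mulrA ler_pM2l//.
have ub x : 0 <= s x ^+ 2 / r <= q / r.
  by rewrite divr_ge0 ?sqr_ge0 ?(ltW r0)//= ler_wpM2r// invr_ge0 ltW.
have u1 x : 0 <= s x ^+ 2 / r < 1 by have /andP[-> /le_lt_trans ->] := ub x.
apply: (@le_trans _ _ (\prod_x ((1 + r^-1) ^+ (Some x == a) * (1 - s x ^+ 2 / r)^-1))).
  apply: ler_prod => x _; rewrite sumr_ge0//=.
  have sE j : (s x ^+ 2) ^+ j * r ^- j = (s x ^+ 2 / r) ^+ j.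
    by rewrite [RHS]expr_div_n.
  rewrite /phi; have [xa|xa] := eqVneq (Some x) a; last first.
    rewrite expr0 mul1r; apply: le_trans (geometric_le N.+1 (u1 x)).
    by apply: ler_sum => j _; rewrite subn0 orbT mulr1 sE.
  rewrite big_ord_recl/= mulr0 add0r expr1.
  apply: (@le_trans _ _ (r^-1 * \sum_(j < N) (s x ^+ 2 / r) ^+ j)).
    rewrite mulr_sumr; apply: ler_sum => j _.
    rewrite /bump /= add1n subn1 /= mulr1 -(sE j).
    have -> : r ^- j.+1 = r^-1 * r ^- j by rewrite exprS invfM.
    by rewrite mulrCA.
  rewrite ler_pM ?invr_ge0 ?(ltW r0)//.
  - by apply: sumr_ge0 => j _; rewrite exprn_ge0//; have /andP[] := u1 x.
  - by rewrite lerDr.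
  - exact: geometric_le.
rewrite big_split/= ler_pM//.
- by apply: prodr_ge0 => x _; rewrite exprn_ge0// addr_ge0// invr_ge0 ltW.
- by apply: prodr_ge0 => x _; rewrite invr_ge0 subr_ge0 ltW//; have /andP[] := u1 x.
- have r1p : 1 <= 1 + r^-1 by rewrite lerDl invr_ge0 ltW.
  case: a {phi phi0} => [y|]; last by rewrite big1.
  by rewrite (bigD1 y)//= eqxx big1 ?mulr1// => x; rewrite (inj_eq Some_inj) => /negPf ->.
- by apply: prod_geometric_le => //; rewrite -mulr_suml ler_wpM2r ?invr_ge0 ?(ltW r0).
Qed.

End constant.
End series_bounds.

Lemma sqr_sum_le (R : realFieldType) (I : finType) (p : pred I) (x : I -> R) :
  (\sum_(i | p i) x i) ^+ 2 <= #|p|%:R * \sum_(i | p i) x i ^+ 2.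
Proof.
have -> : #|p|%:R * \sum_(i | p i) x i ^+ 2 =
    \sum_(i | p i) \sum_(j | p j) (x i ^+ 2 + x j ^+ 2) / 2.
  have -> : \sum_(i | p i) \sum_(j | p j) (x i ^+ 2 + x j ^+ 2) / 2 =
      \sum_(i | p i) (#|p|%:R * x i ^+ 2 + \sum_(j | p j) x j ^+ 2) / 2.
    apply: eq_bigr => i _; rewrite -mulr_suml big_split/= sumr_const mulr_natl.
    by [].
  rewrite -mulr_suml big_split/= -mulr_sumr sumr_const -[X in _ + X]mulr_natl.
  by field.
rewrite expr2 mulr_suml; apply: ler_sum => i _; rewrite mulr_sumr; apply: ler_sum => j _.
by have := sqr_ge0 (x i - x j); rewrite sqrrB; lra.
Qed.

(** * Permutation averages in an orthogonal expansion *)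

Section chaos.
Context d (Omega : measurableType d) (R : realType) (Pr : probability Omega R).
Variables (J : finType) (N : nat) (u v : option J -> 'I_N -> Omega -> R).
Local Notation T := {ffun 'I_N -> option J}.

Definition chaos (kap lam : T) (w : Omega) : R :=
  (\prod_i u (kap i) i w) * \prod_j v (lam j) j w.

Hypothesis chaos_sqi : forall kap lam, sqi Pr (chaos kap lam).
Hypothesis chaos_orth : forall p p' : T * T, p != p' ->
  inner Pr (chaos p.1 p.2) (chaos p'.1 p'.2) = 0.
Hypothesis chaos_le1 : forall kap lam, inner Pr (chaos kap lam) (chaos kap lam) <= 1.

Lemma nrm_chaos (f : Omega -> R) (c : T -> T -> R) :
  (forall w, f w = \sum_kap \sum_lam c kap lam * chaos kap lam w) ->
  nrm Pr f ^+ 2 <= \sum_kap \sum_lam c kap lam ^+ 2.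
Proof.
move=> fE; rewrite (@eq_nrm _ _ _ _ _ (fun w =>
    \sum_(p : T * T) c p.1 p.2 * chaos p.1 p.2 w)); last first.
  by move=> w; rewrite fE pair_big.
rewrite (@orthogonal_nrm _ _ _ _ _ predT (fun p => chaos p.1 p.2) (fun p => c p.1 p.2))//.
rewrite pair_big/=; apply: ler_sum => p _.
by rewrite ler_piMr// sqr_ge0.
Qed.

Lemma sym_sum (mu : T) w :
  N`!%:R^-1 * (\sum_(sigma : 'S_N) \prod_i v (mu i) (sigma i) w) =
  (class_size mu)%:R^-1 * \sum_(lam : T | content lam == content mu) \prod_j v (lam j) j w.
Proof.
rewrite -(sum_permf mu (fun lam => \prod_j v (lam j) j w)).
congr *%R; rewrite [RHS](reindex_inj invg_inj); apply: eq_bigr => sigma _.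
rewrite [RHS](reindex_inj (@perm_inj _ sigma)); apply: eq_bigr => i _.
by rewrite ffunE permK.
Qed.

Variable s : J -> R.

Definition ext (c : option J) : R := if c is Some x then s x else 1.

Lemma prod_ext_weight (kap : T) :
  \prod_i ext (kap i) ^+ 2 = \prod_x (s x ^+ 2) ^+ mult kap (Some x).
Proof.
rewrite /mult; under [RHS]eq_bigr do rewrite expr_sum.
rewrite [RHS]exchange_big/=; apply: eq_bigr => i _.
case: (kap i) => [x|] /=; last by rewrite expr1n big1.
rewrite (bigD1 x)//= eqxx expr1 big1 ?mulr1// => y /negPf yx.
by rewrite (inj_eq Some_inj) eq_sym yx.
Qed.

Lemma prod_ext_but (kap : T) i :
  \prod_(j | j != i) ext (kap j) ^+ 2 =
  \prod_x (s x ^+ 2) ^+ (mult kap (Some x) - (Some x == kap i))%N.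
Proof.
rewrite /mult; transitivity (\prod_x (s x ^+ 2) ^+ (\sum_(j < N | j != i) (kap j == Some x))%N).
  under [RHS]eq_bigr do rewrite expr_sum.
  rewrite [RHS]exchange_big/=; apply: eq_bigr => j _.
  case: (kap j) => [x|] /=; last by rewrite expr1n big1.
  rewrite (bigD1 x)//= eqxx expr1 big1 ?mulr1// => y /negPf yx.
  by rewrite (inj_eq Some_inj) eq_sym yx.
apply: eq_bigr => x _; congr (_ ^+ _).
by rewrite [X in (X - _)%N](bigD1 i)//= (eq_sym (Some x)) addKn.
Qed.

Variables (q H C : R).
Hypotheses (q01 : 0 <= q < 1) (H0 : 0 <= H) (C0 : 0 < C).
Hypothesis HC : forall m, m.+1%:R ^+ 2 <= C * ((1 + q) / 2) ^- m.
Hypothesis sq : forall x, s x ^+ 2 <= q.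
Hypothesis sH : \sum_x s x ^+ 2 <= H.

Local Notation cst0 := (cnst q H C).

Definition perm_mean (c : option J -> R) (w : Omega) : R :=
  N`!%:R^-1 * \sum_(sigma : 'S_N) \prod_i \sum_a c a * (u a i w * v a (sigma i) w).

Lemma perm_mean_chaos c w : perm_mean c w =
  \sum_(kap : T) \sum_(lam : T) ((\prod_i c (kap i)) * (content lam == content kap)%:R / (class_size kap)%:R) *
    chaos kap lam w.
Proof.
rewrite /perm_mean; under eq_bigr do rewrite bigA_distr_bigA/=.
rewrite exchange_big/= mulr_sumr; apply: eq_bigr => kap _.
rewrite (eq_bigr (fun sigma : 'S_N => (\prod_i c (kap i)) * (\prod_i u (kap i) i w) *
    \prod_i v (kap i) (sigma i) w)); last first.
  by move=> sigma _; rewrite -!big_split/=; apply: eq_bigr => i _; rewrite mulrA.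
rewrite -mulr_sumr mulrCA sym_sum mulr_sumr mulr_sumr big_mkcond/=.
apply: eq_bigr => lam _; rewrite /chaos; case: ifP => _; last by rewrite mulr0 !mul0r.
by rewrite mulr1; ring.
Qed.

(** Damping multiplies the coefficient of [kap] by [t ^ m], with m the number of its nontrivial
    positions, and [1 - t ^ m <= (m + 1) (1 - t)]. The class of [kap] has as many terms as the
    inverse of their common weight, so one power of [class_size] is left for [sum_weight_but]. *)
Lemma perm_mean_damped (t : R) : 0 <= t <= 1 ->
  nrm Pr (fun w => perm_mean ext w - perm_mean (fun c => if c is Some x then t * s x else 1) w) ^+ 2 <=
  (1 - t) ^+ 2 * cst0.
Proof.
move=> /andP[t0 t1].
have dampE (kap : T) : \prod_i (if kap i is Some x then t * s x else 1) =
    t ^+ nontrivial kap * \prod_i ext (kap i).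
  rewrite /nontrivial -prodr_const [X in X * _]big_mkcond -big_split/=.
  by apply: eq_bigr => i _; rewrite inE; case: (kap i) => [x|] //=; rewrite mulr1.
apply: le_trans (nrm_chaos (c := fun kap lam => (1 - t ^+ nontrivial kap) * (\prod_i ext (kap i)) *
    (content lam == content kap)%:R / (class_size kap)%:R) _) _.
  move=> w; rewrite !perm_mean_chaos -sumrB; apply: eq_bigr => kap _.
  by rewrite -sumrB; apply: eq_bigr => lam _; rewrite dampE; ring.
rewrite -(ler_pM2l (_ : 0 < 1))// mul1r mul1r.
have := sum_weight_but q01 C0 HC N sq sH None.
move=> /(ler_wpM2l (sqr_ge0 (1 - t))); apply: le_trans.
rewrite mulr_sumr; apply: ler_sum => kap _.
have o0 : 0 < (class_size kap)%:R :> R by rewrite ltr0n class_size_gt0.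
rewrite (eq_bigr (fun lam => ((1 - t ^+ nontrivial kap) * (\prod_i ext (kap i)) / (class_size kap)%:R) ^+ 2 *
   (content lam == content kap)%:R)); last first.
  by move=> lam _; case: (_ == _); rewrite ?mulr1 ?mulr0 ?mul0r ?expr0n.
rewrite -mulr_sumr -natr_sum.
rewrite (_ : (\sum_lam _)%N = class_size kap); last first.
  by rewrite /class_size -sum1_card [RHS]big_mkcond; apply: eq_bigr => lam _; rewrite inE; case: (_ == _).
rewrite orbT mulr1.
rewrite [leLHS](_ : _ = (class_size kap)%:R^-1 * ((1 - t ^+ nontrivial kap) ^+ 2 * (\prod_i ext (kap i)) ^+ 2)); last first.
  by field; rewrite gt_eqF.
rewrite [leRHS]mulrCA ler_pM2l ?invr_gt0// [leRHS]mulrA ler_pM//.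
- exact: sqr_ge0.
- exact: sqr_ge0.
- rewrite -exprMn lerXn2r ?nnegrE// ?mulr_ge0 ?subr_ge0//.
    by rewrite exprn_ile1.
  rewrite mulrC; elim: (nontrivial kap) => [|m IH]; first by rewrite expr0 subrr mul1r subr_ge0.
  rewrite exprS (_ : 1 - t * t ^+ m = (1 - t) + t * (1 - t ^+ m)); last by ring.
  rewrite -natr1 mulrDl mul1r addrC lerD2r.
  apply: le_trans IH; rewrite ler_piMl// subr_ge0 exprn_ile1//.
by rewrite -prodrXl prod_ext_weight /weight_but; apply: ler_prod => x _; rewrite subn0 exprn_ge0 ?sqr_ge0//=.
Qed.

Lemma weight_but_ge0 a (kap : T) : 0 <= weight_but s a kap.
Proof. by apply: prodr_ge0 => x _; rewrite exprn_ge0// sqr_ge0. Qed.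

Variable g : option J -> option J -> R.
Hypothesis g00 : g None None = 0.

Definition perm_deriv (w : Omega) : R :=
  N`!%:R^-1 * \sum_(sigma : 'S_N) N%:R^-1 * \sum_i
    (\sum_a \sum_b g a b * (u a i w * v b (sigma i) w)) *
    \prod_(j | j != i) \sum_a ext a * (u a j w * v a (sigma j) w).

Let but (kap : T) i := \prod_(j | j != i) ext (kap j).

(** Different positions of [g] can lead to the same orthogonal product; the coefficient collects all
    pairs of a position and a new type that turn the content of [kap] into that of [lam]. *)
Let coef (kap lam : T) : R := N%:R^-1 *
  \sum_(p : 'I_N * option J | (content lam == content (upd kap p.1 p.2)) && (g (kap p.1) p.2 != 0))
    g (kap p.1) p.2 * but kap p.1 / (class_size lam)%:R.

Lemma perm_deriv_chaos w : perm_deriv w = \sum_kap \sum_lam coef kap lam * chaos kap lam w.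
Proof.
have E (sigma : 'S_N) i :
    (\sum_a \sum_b g a b * (u a i w * v b (sigma i) w)) *
    (\prod_(j | j != i) \sum_a ext a * (u a j w * v a (sigma j) w)) =
    \sum_(kap : T) \sum_b g (kap i) b * but kap i * (\prod_j u (kap j) j w) *
       \prod_j v (upd kap i b j) (sigma j) w.
  pose G j a := if j == i then \sum_b g a b * (u a i w * v b (sigma i) w)
     else ext a * (u a j w * v a (sigma j) w).
  transitivity (\prod_j \sum_a G j a).
    rewrite [RHS](bigD1 i)//= /G eqxx; congr *%R.
    by apply: eq_bigr => j /negPf ->.
  rewrite bigA_distr_bigA/=; apply: eq_bigr => kap _.
  rewrite (bigD1 i)//= {1}/G eqxx mulr_suml; apply: eq_bigr => b _.
  rewrite [\prod_j u _ _ _](bigD1 i)//= [\prod_j v _ _ _](bigD1 i)//= ffunE eqxx.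
  rewrite (eq_bigr (fun j => ext (kap j) * (u (kap j) j w * v (kap j) (sigma j) w))); last first.
    by move=> j /negPf ji; rewrite /G ji.
  rewrite !big_split/= [\prod_(j | _) v (upd _ _ _ _) _ _](eq_bigr (fun j => v (kap j) (sigma j) w)); last first.
    by move=> j /negPf ji; rewrite ffunE ji.
  by rewrite /but; ring.
rewrite /perm_deriv.
under eq_bigr do under eq_bigr do rewrite E.
transitivity (N%:R^-1 * \sum_i \sum_(kap : T) \sum_b g (kap i) b * but kap i * (\prod_j u (kap j) j w) *
    (N`!%:R^-1 * \sum_(sigma : 'S_N) \prod_j v (upd kap i b j) (sigma j) w)).
  rewrite -mulr_sumr mulrCA; congr *%R.
  rewrite exchange_big/= mulr_sumr; apply: eq_bigr => i _.
  rewrite exchange_big/= mulr_sumr; apply: eq_bigr => kap _.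
  rewrite exchange_big/= mulr_sumr; apply: eq_bigr => b _.
  by rewrite -mulr_sumr mulrCA.
rewrite exchange_big/= mulr_sumr; apply: eq_bigr => kap _.
rewrite pair_big/= mulr_sumr.
transitivity (\sum_(p : 'I_N * option J) \sum_(lam : T)
  N%:R^-1 * (if (content lam == content (upd kap p.1 p.2)) then
     g (kap p.1) p.2 * but kap p.1 / (class_size lam)%:R else 0) * chaos kap lam w).
  apply: eq_bigr => -[i b] _ /=; rewrite sym_sum mulr_sumr mulr_sumr mulr_sumr big_mkcond/=.
  apply: eq_bigr => lam _; case: ifPn => [/eqP cl|_]; last by rewrite mulr0 mul0r.
  by rewrite (class_size_content cl) /chaos; ring.
rewrite exchange_big/=; apply: eq_bigr => lam _; rewrite /coef -mulr_suml mulr_sumr.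
congr *%R; rewrite [RHS]big_mkcond/=; apply: eq_bigr => p _.
case: (_ == _); rewrite ?mulr0//=; case: (eqVneq (g (kap p.1) p.2) 0) => [->|_ //=].
by rewrite /= !mul0r mulr0.
Qed.

Let L (kap : T) (p : 'I_N * option J) : nat :=
  if p.2 == kap p.1 then nontrivial kap else mult kap (kap p.1).

(** The number of coinciding terms decides the order in N. If a type is really exchanged, the
    contents determine both the old and the new type. If it is kept, every position is possible, but
    the trivial ones drop out because [g None None = 0]; this is where centering saves a factor
    N. *)
Let card_W (kap lam : T) (p : 'I_N * option J) :
  (content lam == content (upd kap p.1 p.2)) && (g (kap p.1) p.2 != 0) ->
  (#|[pred p' : 'I_N * option J |
     (content lam == content (upd kap p'.1 p'.2)) && (g (kap p'.1) p'.2 != 0%R)]| <= L kap p)%N.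
Proof.
case: p => i b /= /andP[/eqP clam gib].
have key i' b' : content lam == content (upd kap i' b') -> forall c,
    ((kap i == c) + (b' == c) = (kap i' == c) + (b == c))%N.
  rewrite clam => /content_eqP E c.
  have := mult_upd kap i b c; have := mult_upd kap i' b' c; rewrite E.
  move: (mult _ _) (mult _ _) (kap i == c : nat) (b' == c : nat) (kap i' == c : nat) (b == c : nat).
  move=> m1 m2 n1 n2 n3 n4 e1 e2; apply: (@addnI (m1 + m2)); lia.
rewrite /L /=; case: ifPn => [/eqP bi|bi].
  rewrite /nontrivial; apply: leq_trans (leq_imset_card (fun i' => (i', kap i')) _).
  apply: subset_leq_card; apply/fintype.subsetP => -[i' b']; rewrite inE /= => /andP[/key E g'].
  have bi' : b' = kap i'.
    have := E b'; rewrite eqxx bi addnC => /addIn; case: eqP => // ->.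
  rewrite bi' in g' *; apply: imset_f; rewrite inE.
  by apply: contraNneq g' => ->; rewrite g00.
have -> : mult kap (kap i) = #|[pred i' | kap i' == kap i]|.
  by rewrite /mult -sum1_card [RHS]big_mkcond; apply: eq_bigr => i' _; rewrite inE; case: (_ == _).
apply: leq_trans (leq_imset_card (fun i' => (i', b)) _).
apply: subset_leq_card; apply/fintype.subsetP => -[i' b']; rewrite inE /= => /andP[/key E _].
have bb : b' = b.
  have := E b; rewrite eqxx [kap i == b]eq_sym (negPf bi) add0n.
  by case: (eqVneq b' b) => // _; rewrite addn1.
have ki : kap i' = kap i.
  have := E (kap i); rewrite eqxx bb (negPf bi) addn0.
  by case: (eqVneq (kap i') (kap i)).
by rewrite bb; apply: imset_f; rewrite inE ki.
Qed.

(** A coefficient with a trivial index belongs to a one-variable projection and has weight N; the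
    interaction part is smaller by that factor. *)
Definition scale_of (a b : option J) : R := if a && b then 1 else N%:R.

(** The Cauchy-Schwarz inequality within each coefficient costs the count of [card_W];
    [class_size_upd] converts the class of [lam] back to that of [kap], and the remaining sum over
    [kap] is bounded by [sum_weight_but]. *)
Lemma nrm_perm_deriv : nrm Pr perm_deriv ^+ 2 <=
  cst0 * (N%:R ^- 2 * \sum_a \sum_b scale_of a b * g a b ^+ 2).
Proof.
apply: le_trans (nrm_chaos perm_deriv_chaos) _.
pose y (kap : T) p := g (kap p.1) p.2 * but kap p.1.
(* What the count [L] becomes after the change of class: by [class_size_upd] the multiplicity of the
   removed type is traded for that of the inserted one. *)
pose rho (kap : T) a b : nat := if b == a then nontrivial kap else (mult kap b).+1.
have o0 (kap : T) : 0 < (class_size kap)%:R :> R by rewrite ltr0n class_size_gt0.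
apply: (@le_trans _ _ (\sum_(kap : T) N%:R ^- 2 * \sum_(p : 'I_N * option J)
    (class_size kap)%:R^-1 * ((rho kap (kap p.1) p.2)%:R * y kap p ^+ 2))).
  apply: ler_sum => kap _.
  apply: (@le_trans _ _ (\sum_lam N%:R ^- 2 * \sum_(p : 'I_N * option J |
      (content lam == content (upd kap p.1 p.2)) && (g (kap p.1) p.2 != 0))
      (L kap p)%:R * (y kap p / (class_size lam)%:R) ^+ 2)).
    apply: ler_sum => lam _; rewrite /coef exprMn exprVn ler_wpM2l ?invr_ge0 ?exprn_ge0//.
    apply: le_trans (sqr_sum_le _ _) _; rewrite mulr_sumr.
    apply: ler_sum => p Wp; apply: ler_wpM2r; first exact: sqr_ge0.
    by rewrite ler_nat; exact: card_W.
  rewrite -mulr_sumr ler_wpM2l ?invr_ge0 ?exprn_ge0//.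
  rewrite (exchange_big_dep (fun p => g (kap p.1) p.2 != 0))/=; last by move=> lam p _ /andP[].
  rewrite [leRHS](bigID (fun p => g (kap p.1) p.2 != 0))/= [X in _ <= _ + X]big1 ?addr0; last first.
    by move=> p /negbNE/eqP g0; rewrite /y g0 mul0r expr0n/= !mulr0.
  apply: ler_sum => -[i b] /= gib.
  set mu := upd kap i b.
  rewrite (eq_bigl (fun lam => content lam == content mu)); last first.
    by move=> lam; rewrite gib andbT.
  rewrite (eq_bigr (fun=> (L kap (i, b))%:R * (y kap (i, b) / (class_size mu)%:R) ^+ 2)); last first.
    by move=> lam /eqP /class_size_content ->.
  rewrite sumr_const -[#|_|]/(class_size mu) -mulr_natr.
  rewrite [leLHS](_ : _ = ((L kap (i, b))%:R / (class_size mu)%:R) * y kap (i, b) ^+ 2); last first.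
    by field; rewrite gt_eqF.
  rewrite [leRHS]mulrA ler_wpM2r ?sqr_ge0// ler_pdivrMr// mulrAC mulrC.
  rewrite [leRHS]mulrCA [leRHS]mulrC ler_pdivlMr// -!natrM ler_nat /L /rho /=.
  case: eqP => [bi|/eqP bi].
    rewrite (_ : class_size mu = class_size kap)//; apply: class_size_content.
    by congr content; apply/ffunP => j; rewrite ffunE; case: eqP => // ->.
  rewrite mulnC (class_size_upd kap i b) -/mu mulnC leq_mul2r; apply/orP; right.
  have := mult_upd kap i b b; rewrite eqxx eq_sym (negPf bi) addn0 => ->.
  by rewrite addn1.
rewrite -mulr_sumr mulrCA ler_wpM2l ?invr_ge0 ?exprn_ge0//.
apply: (@le_trans _ _ (\sum_a \sum_b g a b ^+ 2 * \sum_(kap : T) (class_size kap)%:R^-1 *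
    ((mult kap a * rho kap a b)%:R * weight_but s a kap))).
  rewrite le_eqVlt; apply/orP; left; apply/eqP.
  transitivity (\sum_(kap : T) \sum_a \sum_b (class_size kap)%:R^-1 * g a b ^+ 2 *
      ((mult kap a * rho kap a b)%:R * weight_but s a kap)).
    apply: eq_bigr => kap _; rewrite -(pair_bigA _ (fun i b => (class_size kap)%:R^-1 * ((rho kap (kap i) b)%:R * y kap (i, b) ^+ 2)))/=.
    rewrite (partition_big (fun i => kap i) predT)//=; apply: eq_bigr => a _.
    rewrite exchange_big/=; apply: eq_bigr => b _.
    rewrite (eq_bigr (fun=> (class_size kap)%:R^-1 * g a b ^+ 2 * ((rho kap a b)%:R * weight_but s a kap))); last first.
      move=> i /eqP <-; rewrite /y /= exprMn /but -prodrXl prod_ext_but -/(weight_but s (kap i) kap).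
      by ring.
    rewrite sumr_const (_ : #|_| = mult kap a); last first.
      by rewrite /mult -sum1_card [LHS]big_mkcond; apply: eq_bigr => i _; rewrite -[i \in _]/(kap i == a); case: (_ == _).
    by rewrite -mulr_natr natrM; ring.
  rewrite exchange_big/=; apply: eq_bigr => a _; rewrite exchange_big/=; apply: eq_bigr => b _.
  by rewrite mulr_sumr; apply: eq_bigr => kap _; ring.
rewrite mulr_sumr; apply: ler_sum => a _; rewrite mulr_sumr; apply: ler_sum => b _.
have [/andP[/eqP -> /eqP ->]|ab] := boolP ((a == None) && (b == None)).
  by rewrite g00 expr0n/= mul0r !mulr0.
rewrite [leLHS]mulrC [leRHS]mulrA; apply: ler_wpM2r; first exact: sqr_ge0.
have sc0 : 0 <= scale_of a b by rewrite /scale_of; case: ifP.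
have := sum_weight_but q01 C0 HC N sq sH a.
move=> /(ler_wpM2r sc0); apply: le_trans; rewrite mulrC mulr_sumr.
apply: ler_sum => kap _; rewrite [leRHS]mulrCA ler_pM2l ?invr_gt0//.
rewrite [leRHS]mulrA ler_wpM2r ?weight_but_ge0//.
rewrite /scale_of (_ : (if _ then _ else _) = (if a && b then 1 else N)%:R); last by case: ifP.
rewrite -natrX -!natrM ler_nat /rho.
(* A nontrivial type occurs at most [nontrivial kap] times, while the trivial one can occur up to N
   times; [scale_of] pays for the latter. *)
case: a b ab {sc0} => [x|] [z|] //= _; rewrite ?orbF ?orbT ?muln1 ?mul1n.
- have := mult_nontrivial kap x; have := mult_nontrivial kap z.
  by case: (posnP (mult kap (Some x))) => [->//|mx]; case: eqP => _; nia.
- have := mult_nontrivial kap x.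
  have := mult_total kap; rewrite (bigD1 None)//= (bigD1 (Some x))//=.
  by case: (posnP (mult kap (Some x))) => [->//|mx]; nia.
- by have := mult_nontrivial kap z; have := mult_leN kap None; nia.
Qed.

End chaos.

(** * Samples *)

Section pairs.
Context d (Omega : measurableType d) (R : realType) (Pr : probability Omega R).

(** Restricting [Pr] to an event that concerns the other coordinates gives a measure of mass c,
    possibly 0, to which uniqueness of the product measure has to be applied. *)
Lemma product_measure_unique_scaled d1 d2 (S : measurableType d1) (T : measurableType d2)
    (P : probability S R) (Q : probability T R) (m : {measure set (S * T) -> \bar R}) (c : R) :
  0 <= c ->
  (forall A B, measurable A -> measurable B -> m (A `*` B) = c%:E * (P A * Q B))%E ->
  forall X, measurable X -> (m X = c%:E * (P \x Q) X)%E.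
Proof.
move=> c0 mAB X mX; have [c1|c1] := eqVneq c 0.
  rewrite c1 mul0e; apply/eqP; rewrite eq_le measure_ge0 andbT.
  have : m setT = 0%E by rewrite -setXTT mAB// c1 mul0e.
  by move=> <-; apply: le_measure; rewrite ?inE.
have ci : 0 <= c^-1 by rewrite invr_ge0.
have := @product_measure_unique _ _ _ _ _ P Q (mscale (NngNum ci) m) _ _ mX.
rewrite /mscale/= => ->; last first.
  by move=> A B mA mB; rewrite /mscale /= mAB// muleA -EFinM mulVf// mul1e.
by rewrite muleA -EFinM mulfV// mul1e.
Qed.

Context (I : finType) d' (U : measurableType d').
Variables (Z : I + I -> Omega -> U) (m : I + I -> probability U R).
Hypothesis ind : indep_family Pr Z m.

Let measZ k : measurable_fun setT (Z k). Proof. exact: (proj1 ind). Qed.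

(** For rectangles this is independence of the underlying family. General sets in the product are
    reached one pair at a time by uniqueness of the product measure. *)
Lemma indep_family_pair (s : {perm I}) :
  indep_family Pr (fun i w => (Z (inl i) w, Z (inr (s i)) w))
    (fun i => (m (inl i) \x m (inr (s i)))%E : probability _ R).
Proof.
pose Z2 i w := (Z (inl i) w, Z (inr (s i)) w).
have mZ2 i : measurable_fun setT (Z2 i) by apply: measurable_fun_pair.
split; first exact: mZ2.
have mpre i (C : set (U * U)) : measurable C -> measurable (Z2 i @^-1` C).
  by move=> mC; rewrite -[X in measurable X]setTI; exact: mZ2.
have mcap (C : I -> set (U * U)) : (forall i, measurable (C i)) ->
    measurable (\bigcap_(i in setT) (Z2 i @^-1` C i)).
  by move=> mC; apply: fin_bigcap_measurable => // i _; exact: mpre.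
(* Pairs with index outside [r] are still tested on rectangles [A i * A' i]. *)
have main (r : seq I) : uniq r -> forall (B : I -> set (U * U)) (A A' : I -> set U),
    (forall i, measurable (B i)) -> (forall i, measurable (A i)) -> (forall i, measurable (A' i)) ->
    (forall i, i \notin r -> B i = A i `*` A' i) ->
    Pr (\bigcap_(i in setT) (Z2 i @^-1` B i)) = (\prod_i (m (inl i) \x m (inr (s i))) (B i))%E.
  elim: r => [_ B A A' mB mA mA' BA|j r IH /= /andP[jr ur] B A A' mB mA mA' BA].
    pose C (k : I + I) := match k with inl i => A i | inr i => A' (s^-1 i)%g end.
    have mC k : measurable (C k) by case: k => i /=.
    have -> : \bigcap_(i in setT) (Z2 i @^-1` B i) = \bigcap_(k in setT) (Z k @^-1` C k).
      apply/seteqP; split => w h.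
        case=> i _ /=; first by have := h i Logic.I; rewrite BA// => -[].
        by have := h (s^-1 i)%g Logic.I; rewrite /Z2 BA// /= permKV => -[].
      move=> i _; rewrite /= BA//; split; first exact: (h (inl i)).
      by have := h (inr (s i)) Logic.I; rewrite /= permK.
    rewrite (proj2 ind)// big_sumType/=.
    rewrite [X in (_ * X)%E](reindex_inj (@perm_inj _ s))/= -big_split/=.
    apply: eq_bigr => i _; rewrite permK BA// product_measure1E//.
  pose rest := \bigcap_(i in setT) (Z2 i @^-1` (if i == j then setT else B i)).
  have mrest : measurable rest by apply: mcap => i; case: ifP.
  pose c := \prod_(i | i != j) fine ((m (inl i) \x m (inr (s i))) (B i))%E.
  have c0 : 0 <= c by apply: prodr_ge0 => i _; exact: fine_ge0.
  have cE : c%:E = (\prod_(i | i != j) (m (inl i) \x m (inr (s i))) (B i))%E.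
    rewrite -prodEFin; apply: eq_bigr => i _; rewrite fineK//.
    exact: (@fin_num_measure _ _ _ ((m (inl i) \x m (inr (s i)))%E : probability _ R)).
  have E (C : set (U * U)) : \bigcap_(i in setT) (Z2 i @^-1` (if i == j then C else B i)) =
      Z2 j @^-1` C `&` rest.
    apply/seteqP; split => w h.
      split; first by have := h j Logic.I; rewrite eqxx.
      by move=> i _; have := h i Logic.I; case: ifP.
    move=> i _; case: ifPn => [/eqP ->|ij]; first by case: h.
    by case: h => _ /(_ i Logic.I); rewrite (negPf ij).
  have := @product_measure_unique_scaled _ _ _ _ (m (inl j)) (m (inr (s j)))
    (measure_function_pushforward__canonical__measure_function_Measure (mrestr Pr mrest) (mZ2 j)) c c0 _ (B j) (mB j).
  rewrite (bigD1 j)//= -cE muleC => <-.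
    rewrite /pushforward /mrestr /= -E; congr (Pr _).
    by apply: eq_bigcapr => i _; case: ifP => // /eqP ->.
  move=> A1 A2 mA1 mA2; rewrite /pushforward /mrestr /= -E.
  rewrite (IH ur _ (fun i => if i == j then A1 else A i) (fun i => if i == j then A2 else A' i)).
  - rewrite (bigD1 j)//= eqxx muleC product_measure1E// cE; congr (_ * _)%E.
    by apply: eq_bigr => i /negPf ->.
  - by move=> i; case: ifP => // _; exact: measurableX.
  - by move=> i; case: ifP.
  - by move=> i; case: ifP.
  - move=> i ir; case: ifPn => // ij; apply: BA.
    by rewrite inE negb_or ij.
move=> B mB; apply: (main (enum I) (enum_uniq _) B (fun=> setT) (fun=> setT)) => //.
by move=> i; rewrite mem_enum.
Qed.

End pairs.

Section samples.
Context d d' (Omega : measurableType d) (U : measurableType d') (R : realType).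
Context (Pr : probability Omega R) (P Q : probability U R).
Variables (X Y : nat -> {RV Pr >-> U}).
Hypotheses (iX : iid P X) (iY : iid Q Y) (iXY : independent_seqs X Y).

Lemma iid_bigcap (m : probability U R) (Z : nat -> {RV Pr >-> U}) N (B : 'I_N -> set U) :
  iid m Z -> (forall i, measurable (B i)) ->
  Pr (\bigcap_(i in [set: 'I_N]) (Z i @^-1` B i)) = (\prod_i m (B i))%E.
Proof.
move=> [law ind] mB.
pose B' k := if insub k is Some i then B i else setT.
have mB' k : measurable (B' k) by rewrite /B'; case: insubP.
have B'E (i : 'I_N) : B' i = B i by rewrite /B' valK.
pose J : {fset nat} := [fset k in iota 0 N]%fset.
have -> : \bigcap_(i in [set: 'I_N]) (Z i @^-1` B i) = \bigcap_(k in [set` J]) (Z k @^-1` B' k).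
  apply/seteqP; split => w h.
    move=> k /=; rewrite inE mem_iota add0n /= => kN.
    by have := h (Ordinal kN) I; rewrite -B'E.
  by move=> i _; have := h i; rewrite B'E; apply; rewrite /= inE mem_iota add0n/=.
rewrite ind// (@perm_big _ _ _ _ _ (index_iota 0 N)); last first.
  apply: uniq_perm; [exact: fset_uniq|exact: iota_uniq|].
  by move=> k; rewrite inE /index_iota subn0.
rewrite big_mkord; apply: eq_bigr => i _; rewrite B'E.
exact: law.
Qed.

Definition sample N (k : 'I_N + 'I_N) : Omega -> U :=
  match k with inl i => X i | inr j => Y j end.

Definition sample_law N (k : 'I_N + 'I_N) : probability U R :=
  match k with inl _ => P | inr _ => Q end.

Lemma sigma_of_bigcap (Z : nat -> {RV Pr >-> U}) N (B : 'I_N -> set U) :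
  (forall i, measurable (B i)) -> sigma_of_seq Z (\bigcap_(i in [set: 'I_N]) (Z i @^-1` B i)).
Proof.
move=> mB; rewrite /sigma_of_seq; set G := [set E | _].
apply: (@fin_bigcap_measurable _ (g_sigma_algebraType G)) => // i _.
by apply: sub_sigma_algebra; exists i, (B i).
Qed.

Lemma sample_indep N : indep_family Pr (@sample N) (@sample_law N).
Proof.
split; first by case.
move=> B mB.
rewrite (_ : \bigcap_(k in setT) _ = \bigcap_(i in [set: 'I_N]) (X i @^-1` B (inl i)) `&`
    \bigcap_(j in [set: 'I_N]) (Y j @^-1` B (inr j))); last first.
  apply/seteqP; split => w h; first by split=> i _; [exact: (h (inl i))|exact: (h (inr i))].
  by case=> i _; [exact: (h.1 i)|exact: (h.2 i)].
rewrite iXY; [|exact: sigma_of_bigcap..].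
by rewrite (iid_bigcap iX)// (iid_bigcap iY)// big_sumType.
Qed.

Lemma pair_indep N (s : 'S_N) :
  indep_family Pr (fun (i : 'I_N) w => (X i w, Y (s i) w)) (fun=> (P \x Q)%E : probability _ R).
Proof. exact: indep_family_pair (sample_indep N) s. Qed.

End samples.

(** * Convergence in L^2 and moments of independent families *)

Lemma cvg_fin_sum (R : realType) (I : Type) (r : seq I) (p : pred I) (f : I -> nat -> R) (l : I -> R) :
  (forall i, p i -> f i n @[n --> \oo] --> l i) ->
  \sum_(i <- r | p i) f i n @[n --> \oo] --> \sum_(i <- r | p i) l i.
Proof.
move=> fl; elim: r => [|i r IH].
  by under eq_fun do rewrite big_nil; rewrite big_nil; exact: cvg_cst.
rewrite big_cons; under eq_fun do rewrite big_cons; case: ifP => // pi.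
by apply: cvgD => //; exact: fl.
Qed.

Lemma cvg_fin_prod (R : realType) (I : Type) (r : seq I) (p : pred I) (f : I -> nat -> R) (l : I -> R) :
  (forall i, p i -> f i n @[n --> \oo] --> l i) ->
  \prod_(i <- r | p i) f i n @[n --> \oo] --> \prod_(i <- r | p i) l i.
Proof.
move=> fl; elim: r => [|i r IH].
  by under eq_fun do rewrite big_nil; rewrite big_nil; exact: cvg_cst.
rewrite big_cons; under eq_fun do rewrite big_cons; case: ifP => // pi.
by apply: cvgM => //; exact: fl.
Qed.

Section cvgL2.
Context d (T : measurableType d) (R : realType) (P : probability T R).
Implicit Types (f : nat -> T -> R) (g h : T -> R).

Lemma cvgL2P f g : cvgL2 P f g <-> (nrm P (fun x => f n x - g x) @[n --> \oo] --> (0 : R)).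
Proof.
split=> [fg|fg].
  apply/cvgr0Pnorm_le => e e0; have [N HN] := fg e e0.
  by exists N => // n /= Nn; rewrite ger0_norm ?nrm_ge0// HN.
move=> e e0; have /cvgr0Pnorm_le/(_ e e0)[N _ HN] := fg.
by exists N => n Nn; have := HN n Nn; rewrite ger0_norm ?nrm_ge0.
Qed.

Lemma cvgL2_inner f g f' g' : (forall n, sqi P (f n)) -> sqi P g ->
  (forall n, sqi P (f' n)) -> sqi P g' -> cvgL2 P f g -> cvgL2 P f' g' ->
  inner P (f n) (f' n) @[n --> \oo] --> inner P g g'.
Proof.
move=> sf sg sf' sg' /cvgL2P fg /cvgL2P fg'.
pose u n := nrm P (fun x => f n x - g x); pose u' n := nrm P (fun x => f' n x - g' x).
have bnd n : `|inner P (f n) (f' n) - inner P g g'| <=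
    u n * u' n + u n * nrm P g' + nrm P g * u' n.
  have -> : inner P (f n) (f' n) - inner P g g' =
      inner P (fun x => f n x - g x) (fun x => f' n x - g' x) +
      inner P (fun x => f n x - g x) g' + inner P g (fun x => f' n x - g' x).
    have s1 := sqiB (sf n) sg; have s2 := sqiB (sf' n) sg'.
    rewrite /inner -RintegralB//; [|exact: sqiM..].
    rewrite -RintegralD//; [|exact: sqiM..].
    rewrite -RintegralD//; [|by apply: integrable_RD; exact: sqiM|exact: sqiM].
    by apply: eq_Rintegral => x _; ring.
  apply: le_trans (ler_normD _ _) _; apply: lerD; last first.
    by apply: cauchy_schwarz => //; exact: sqiB.
  apply: le_trans (ler_normD _ _) _.
  by apply: lerD; apply: cauchy_schwarz => //; exact: sqiB.
apply/subr_cvg0/norm_cvg0P.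
apply: (@squeeze_cvgr _ _ _ _ (fun=> 0) (fun n => u n * u' n + u n * nrm P g' + nrm P g * u' n)).
- by apply: nearW => n; rewrite normr_ge0 bnd.
- exact: cvg_cst.
- rewrite (_ : (0 : R) = 0 * 0 + 0 * nrm P g' + nrm P g * 0); last by ring.
  apply: cvgD; first apply: cvgD.
  + exact: cvgM.
  + by apply: cvgM => //; exact: cvg_cst.
  + by apply: cvgM => //; exact: cvg_cst.
Qed.

Lemma cvgL2_sum (I : finType) (p : pred I) (f : I -> nat -> T -> R) (g : I -> T -> R) :
  (forall i n, sqi P (f i n)) -> (forall i, sqi P (g i)) ->
  (forall i, cvgL2 P (f i) (g i)) ->
  cvgL2 P (fun n x => \sum_(i | p i) f i n x) (fun x => \sum_(i | p i) g i x).
Proof.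
move=> sf sg fg; apply/cvgL2P.
apply: (@squeeze_cvgr _ _ _ _ (fun=> 0) (fun n => \sum_(i | p i) nrm P (fun x => f i n x - g i x))).
- apply: nearW => n; rewrite nrm_ge0/=.
  under eq_nrm do rewrite -sumrB.
  by apply: nrm_sum => i _; exact: sqiB.
- exact: cvg_cst.
- rewrite [X in _ --> X](_ : 0 = \sum_(i | p i) (0 : R)); last by rewrite big1.
  apply: cvg_fin_sum => i _; exact/cvgL2P.
Qed.

Lemma cvgL2Z c f g : (forall n, sqi P (f n)) -> sqi P g -> cvgL2 P f g ->
  cvgL2 P (fun n x => c * f n x) (fun x => c * g x).
Proof.
move=> sf sg /cvgL2P fg; apply/cvgL2P.
have E n : nrm P (fun x => c * f n x - c * g x) = `|c| * nrm P (fun x => f n x - g x).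
  by rewrite -nrmZ; [apply: eq_nrm => x; rewrite mulrBr|exact: sqiB].
under eq_fun do rewrite E.
by rewrite -(mulr0 `|c|); apply: cvgM => //; exact: cvg_cst.
Qed.

Lemma cvgL2B f g f' g' : (forall n, sqi P (f n)) -> sqi P g ->
  (forall n, sqi P (f' n)) -> sqi P g' -> cvgL2 P f g -> cvgL2 P f' g' ->
  cvgL2 P (fun n x => f n x - f' n x) (fun x => g x - g' x).
Proof.
move=> sf sg sf' sg' fg fg'.
move: fg fg' => /cvgL2P fg /cvgL2P fg'; apply/cvgL2P.
apply: (@squeeze_cvgr _ _ _ _ (fun=> 0)
   (fun n => nrm P (fun x => f n x - g x) + nrm P (fun x => f' n x - g' x))).
- apply: nearW => n; rewrite nrm_ge0/=.
  apply: le_trans (nrmB (sqiB (sf n) sg) (sqiB (sf' n) sg')).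
  by rewrite le_eqVlt; apply/orP; left; apply/eqP/eq_nrm => x; ring.
- exact: cvg_cst.
- by rewrite -(addr0 0); exact: cvgD.
Qed.

Lemma cvgL2_nrm_le f g c : (forall n, sqi P (f n)) -> sqi P g -> cvgL2 P f g ->
  (forall n, nrm P (f n) ^+ 2 <= c) -> nrm P g ^+ 2 <= c.
Proof.
move=> sf sg fg fc; rewrite -innerE.
have h := cvgL2_inner sf sg sf sg fg fg.
rewrite -(cvg_lim _ h)//; apply: limr_le; first by apply/cvg_ex; eexists; exact: h.
by apply: nearW => n; rewrite innerE.
Qed.

End cvgL2.
Section family_moments.
Context d (Omega : measurableType d) (R : realType) (Pr : probability Omega R).
Context (I : finType) d' (U : measurableType d').
Variables (Z : I -> Omega -> U) (m : I -> probability U R).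
Hypothesis ind : indep_family Pr Z m.

Lemma indep_measurable i (h : U -> R) :
  measurable_fun setT h -> measurable_fun setT (fun w => h (Z i w)).
Proof. by move=> mh; exact: (measurableT_comp mh (proj1 ind i)). Qed.

Lemma indep_prob i (B : set U) : measurable B -> Pr (Z i @^-1` B) = m i B.
Proof.
move=> mB; have := proj2 ind (fun j => if j == i then B else setT).
rewrite (bigD1 i)//= eqxx big1 ?mule1; last first.
  by move=> j /negPf ->; exact: probability_setT.
move=> <-; last by move=> j; case: ifP.
congr (Pr _); apply/seteqP; split => w h.
  by move=> j _; case: ifPn => // /eqP ->.
by have := h i Logic.I; rewrite eqxx.
Qed.

Lemma indep_Rint i (f : U -> R) : (m i).-integrable setT (EFin \o f) ->
  Pr.-integrable setT (EFin \o fun w => f (Z i w)) /\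
  \int[Pr]_w f (Z i w) = \int[m i]_x f x.
Proof.
move=> intf; pose F j := if j == i then f else cst 1.
have iF j : (m j).-integrable setT (EFin \o F j).
  rewrite /F; case: eqP => [->//|_].
  by have := @finite_measure_integrable_cst _ _ _ (m j) setT 1; apply.
have E w : \prod_j F j (Z j w) = f (Z i w).
  rewrite (bigD1 i)//= {1}/F eqxx big1 ?mulr1// => j /negPf ji.
  by rewrite /F ji.
split; first by have := integrable_prod ind iF; under eq_fun do rewrite E.
have := Rintegral_prod ind iF; under eq_Rintegral do rewrite E.
move=> ->; rewrite (bigD1 i)//= big1 ?mulr1.
  by apply: eq_Rintegral => x _; rewrite /F eqxx.
move=> j /negPf ji; rewrite -[RHS](Rint_cst (m j) 1).
by apply: eq_Rintegral => x _; rewrite /F ji.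
Qed.

Lemma indep_Rint2 i j (f g : U -> R) : i != j ->
  (m i).-integrable setT (EFin \o f) -> (m j).-integrable setT (EFin \o g) ->
  \int[Pr]_w (f (Z i w) * g (Z j w)) = (\int[m i]_x f x) * \int[m j]_x g x.
Proof.
move=> ij intf intg; pose F k := if k == i then f else if k == j then g else cst 1.
have ji : (j == i) = false by rewrite eq_sym (negPf ij).
have iF k : (m k).-integrable setT (EFin \o F k).
  rewrite /F; case: eqP => [->//|_]; case: eqP => [->//|_].
  by have := @finite_measure_integrable_cst _ _ _ (m k) setT 1; apply.
have E w : \prod_k F k (Z k w) = f (Z i w) * g (Z j w).
  rewrite (bigD1 i)//= (bigD1 j)/=; last by rewrite ji.
  rewrite big1 ?mulr1 => [|k /andP[/negPf ki /negPf kj]]; last by rewrite /F ki kj.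
  by rewrite /F !eqxx ji.
have := Rintegral_prod ind iF; under eq_Rintegral do rewrite E.
move=> ->; rewrite (bigD1 i)//= (bigD1 j)/=; last by rewrite ji.
rewrite big1 ?mulr1 => [|k /andP[/negPf ki /negPf kj]].
  by congr *%R; apply: eq_Rintegral => x _; rewrite /F ?ji eqxx.
rewrite -[RHS](Rint_cst (m k) 1).
by apply: eq_Rintegral => x _; rewrite /F ki kj.
Qed.

Lemma indep_sqi i (f : U -> R) : sqi (m i) f -> sqi Pr (fun w => f (Z i w)).
Proof.
move=> [mf intf]; split; first exact: indep_measurable.
by have [] := indep_Rint intf.
Qed.

Lemma indep_nrm i (f : U -> R) : sqi (m i) f -> nrm Pr (fun w => f (Z i w)) = nrm (m i) f.
Proof. by move=> [mf intf]; rewrite /nrm; congr Num.sqrt; have [] := indep_Rint intf. Qed.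

Lemma indep_sum_nrm (f : I -> U -> R) : (forall i, sqi (m i) (f i)) ->
  (forall i, \int[m i]_x f i x = 0) ->
  nrm Pr (fun w => \sum_i f i (Z i w)) ^+ 2 = \sum_i nrm (m i) (f i) ^+ 2.
Proof.
move=> sf f0.
rewrite (@eq_nrm _ _ _ _ _ (fun w => \sum_i 1 * f i (Z i w))); last first.
  by move=> w; apply: eq_bigr => i _; rewrite mul1r.
rewrite (@orthogonal_nrm _ _ _ _ _ predT (fun i w => f i (Z i w)) (fun=> 1)).
- by apply: eq_bigr => i _; rewrite expr1n mul1r innerE (indep_nrm (sf i)).
- by move=> i; exact: indep_sqi (sf i).
- move=> i j ij; rewrite /inner indep_Rint2 ?f0 ?mul0r//; exact: sqi_int.
Qed.

Lemma indep_prod_sqi (f : I -> U -> R) : (forall i, sqi (m i) (f i)) ->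
  sqi Pr (fun w => \prod_i f i (Z i w)).
Proof.
move=> sf; split.
  by apply: measurable_Rprod => i _; apply: indep_measurable; case: (sf i).
under eq_fun do rewrite -prodrXl.
by apply: (integrable_prod ind (f := fun i x => f i x ^+ 2)) => i; case: (sf i).
Qed.

Lemma indep_prod_inner (f g : I -> U -> R) : (forall i, sqi (m i) (f i)) ->
  (forall i, sqi (m i) (g i)) ->
  inner Pr (fun w => \prod_i f i (Z i w)) (fun w => \prod_i g i (Z i w)) =
  \prod_i inner (m i) (f i) (g i).
Proof.
move=> sf sg; rewrite /inner; under eq_Rintegral do rewrite -big_split/=.
by apply: (Rintegral_prod ind (f := fun i x => f i x * g i x)) => i; exact: sqiM.
Qed.

(** Without independence the products need not even be square integrable. With it, the squared
    distance is a combination of inner products that factorise, and each factor converges. *)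
Lemma indep_prod_cvg (f : nat -> I -> U -> R) (g : I -> U -> R) :
  (forall n i, sqi (m i) (f n i)) -> (forall i, sqi (m i) (g i)) ->
  (forall i, cvgL2 (m i) (fun n => f n i) (g i)) ->
  cvgL2 Pr (fun n w => \prod_i f n i (Z i w)) (fun w => \prod_i g i (Z i w)).
Proof.
move=> sf sg fg; apply/cvgL2P.
pose F n w := \prod_i f n i (Z i w); pose G w := \prod_i g i (Z i w).
have sF n : sqi Pr (F n) by exact: indep_prod_sqi.
have sG : sqi Pr G by exact: indep_prod_sqi.
have E n : nrm Pr (fun w => F n w - G w) ^+ 2 =
    inner Pr (F n) (F n) - 2 * inner Pr (F n) G + inner Pr G G.
  rewrite nrm_sqr /inner -RintegralZl//; last exact: sqiM.
  have i1 := sqiM (sF n) (sF n); have i2 := integrable_RZl 2 (sqiM (sF n) sG).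
  rewrite -RintegralB// -RintegralD//; [|exact: integrable_RB|exact: sqiM].
  by apply: eq_Rintegral => w _; ring.
have H : nrm Pr (fun w => F n w - G w) ^+ 2 @[n --> \oo] --> (0 : R).
  under eq_fun do rewrite E /F /G !indep_prod_inner//.
  rewrite (_ : 0 = \prod_i inner (m i) (g i) (g i) - 2 * \prod_i inner (m i) (g i) (g i) +
    \prod_i inner (m i) (g i) (g i)); last by ring.
  apply: cvgD; last exact: cvg_cst.
  apply: cvgB.
    by apply: cvg_fin_prod => i _; apply: cvgL2_inner.
  apply: cvgM; first exact: cvg_cst.
  apply: cvg_fin_prod => i _; apply: cvgL2_inner => // e e0.
  by exists 0%N => n _; rewrite (@eq_nrm _ _ _ _ _ (cst 0)) ?nrm_cst ?normr0 ?ltW// => x; rewrite subrr.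
rewrite (_ : (0 : R) = Num.sqrt 0); last by rewrite sqrtr0.
rewrite (_ : (fun n => _) = (fun n => Num.sqrt (nrm Pr (fun w => F n w - G w) ^+ 2))); last first.
  by apply/funext => n; rewrite sqrtr_sqr ger0_norm// nrm_ge0.
by apply: (continuous_cvg _ _ H); exact: sqrt_continuous.
Qed.

End family_moments.

(** * Square integrable kernels and their operators *)

Section kernel.
Context d1 d2 (S : measurableType d1) (T : measurableType d2) (R : realType).
Variables (P : probability S R) (Q : probability T R).
Implicit Types (h : S * T -> R) (f : S -> R) (g : T -> R).

Lemma measurable_swap_fun h : measurable_fun setT h ->
  measurable_fun setT (fun z : T * S => h (z.2, z.1)).
Proof.
move=> mh; have ms : measurable_fun setT (fun z : T * S => (z.2, z.1)).
  by apply: measurable_fun_pair; [exact: measurable_snd|exact: measurable_fst].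
exact: (measurableT_comp mh ms).
Qed.

Lemma measurable_section h x : measurable_fun setT h -> measurable_fun setT (fun y => h (x, y)).
Proof. by move=> mh; exact: (measurableT_comp mh (pair1_measurable x)). Qed.

(** Real valued integrals have a default value where a section is not integrable; this happens only
    on a null set, which is all that has to be checked. *)
Lemma Rfubini h : (P \x Q)%E.-integrable setT (EFin \o h) ->
  P.-integrable setT (EFin \o fun x => \int[Q]_y h (x, y)) /\
  \int[(P \x Q)%E]_z h z = \int[P]_x \int[Q]_y h (x, y).
Proof.
move=> ih.
have mF : measurable_fun setT (fubini_F Q (EFin \o h)) := measurable_fubini_F ih.
have iF : P.-integrable setT (fubini_F Q (EFin \o h)) := integrable_fubini_F ih.
have mI : measurable_fun setT (fun x => \int[Q]_y h (x, y)).
  by apply: measurableT_comp mF.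
have fF : {ae P, forall x, (\int[Q]_y h (x, y))%:E = fubini_F Q (EFin \o h) x}.
  by apply: filterS (integrable_ae measurableT iF) => x /(_ Logic.I) fx; rewrite fineK.
split.
  apply: (le_integrable _ _ _ iF) => //; first exact/measurable_EFinP.
  by move=> x _; rewrite /= /Rintegral /fubini_F; case: (integral _ _ _) => //=; rewrite ?normr0 leey.
rewrite {1 2}/Rintegral -(integral12_prod_meas1 ih); congr fine.
apply: ae_eq_integral => //; first exact/measurable_EFinP.
by apply: filterS fF => x E _; rewrite E.
Qed.

Lemma integrable_tensor f g : P.-integrable setT (EFin \o f) -> Q.-integrable setT (EFin \o g) ->
  (P \x Q)%E.-integrable setT (EFin \o fun z => f z.1 * g z.2).
Proof.
move=> intf intg.
have mf : measurable_fun setT f by apply/measurable_EFinP; exact: measurable_int intf.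
have mg : measurable_fun setT g by apply/measurable_EFinP; exact: measurable_int intg.
have mfg : measurable_fun setT (fun z : S * T => f z.1 * g z.2).
  by apply: measurable_funM; [exact: (measurableT_comp mf)|exact: (measurableT_comp mg)].
apply/integrableP; split; first exact/measurable_EFinP.
rewrite fubini_tonelli1//=; last first.
  by apply/measurable_EFinP; exact: (measurableT_comp _ mfg).
rewrite (_ : fubini_F _ _ = fun x => (`|f x|%:E * \int[Q]_y `|g y|%:E)%E); last first.
  apply/funext => x; rewrite /fubini_F /=.
  under eq_integral do rewrite normrM EFinM.
  by rewrite ge0_integralZl//; apply/measurable_EFinP/measurableT_comp.
have /integrableP[_ /= fg] := intg; have /integrableP[_ /= ff] := intf.
rewrite ge0_integralZr//; last 2 first.
- by apply/measurable_EFinP/measurableT_comp.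
- exact: integral_ge0.
rewrite -(@fineK _ (\int[Q]_y `|g y|%:E)%E) ?ge0_fin_numE ?integral_ge0//.
by rewrite -(@fineK _ (\int[P]_y `|f y|%:E)%E) ?ge0_fin_numE ?integral_ge0// -EFinM ltry.
Qed.

Lemma Rint_tensor f g : P.-integrable setT (EFin \o f) -> Q.-integrable setT (EFin \o g) ->
  \int[(P \x Q)%E]_z (f z.1 * g z.2) = (\int[P]_x f x) * \int[Q]_y g y.
Proof.
move=> intf intg; rewrite (Rfubini (integrable_tensor intf intg)).2/=.
rewrite -RintegralZr//; apply: eq_Rintegral => x _.
by rewrite RintegralZl.
Qed.

Lemma sqi_tensor f g : sqi P f -> sqi Q g -> sqi (P \x Q)%E (fun z => f z.1 * g z.2).
Proof.
move=> [mf intf] [mg intg]; split.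
  by apply: measurable_funM; [exact: (measurableT_comp mf)|exact: (measurableT_comp mg)].
by under eq_fun do rewrite exprMn; exact: (integrable_tensor intf intg).
Qed.

Lemma inner_tensor f f' g g' : sqi P f -> sqi P f' -> sqi Q g -> sqi Q g' ->
  inner (P \x Q)%E (fun z => f z.1 * g z.2) (fun z => f' z.1 * g' z.2) =
  inner P f f' * inner Q g g'.
Proof.
move=> sf sf' sg sg'; rewrite /inner -Rint_tensor; [|exact: sqiM..].
by apply: eq_Rintegral => z _; ring.
Qed.

Lemma sqi_fst f : sqi P f -> sqi (P \x Q)%E (fun z => f z.1).
Proof.
by move=> sf; have := sqi_tensor sf (sqi_cst Q 1); under eq_fun do rewrite mulr1.
Qed.

Lemma sqi_snd g : sqi Q g -> sqi (P \x Q)%E (fun z => g z.2).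
Proof.
by move=> sg; have := sqi_tensor (sqi_cst P 1) sg; under eq_fun do rewrite mul1r.
Qed.

Lemma sqi_section h : sqi (P \x Q)%E h -> {ae P, forall x, sqi Q (fun y => h (x, y))}.
Proof.
move=> [mh ih]; apply: filterS (ae_integrable1 ih) => x ihx; split; first exact: measurable_section.
exact: ihx.
Qed.

Lemma int_sqr_section h : sqi (P \x Q)%E h ->
  P.-integrable setT (EFin \o fun x => nrm Q (fun y => h (x, y)) ^+ 2) /\
  \int[P]_x (nrm Q (fun y => h (x, y)) ^+ 2) = nrm (P \x Q)%E h ^+ 2.
Proof.
move=> [mh ih]; under eq_fun do rewrite nrm_sqr; rewrite nrm_sqr.
by have [? ->] := Rfubini ih.
Qed.

Lemma measurable_opAs h g : sqi (P \x Q)%E h -> sqi Q g -> measurable_fun setT (opAs Q h g).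
Proof.
move=> sh sg; apply/measurable_EFinP.
have ih := sqiM (sqi_snd sg) sh.
exact: measurable_int (Rfubini ih).1.
Qed.

Lemma opAs_le h g : sqi (P \x Q)%E h -> sqi Q g ->
  {ae P, forall x, opAs Q h g x ^+ 2 <= nrm Q g ^+ 2 * nrm Q (fun y => h (x, y)) ^+ 2}.
Proof.
move=> sh sg; apply: filterS (sqi_section sh) => x sx.
rewrite -exprMn -[leLHS]real_normK ?num_real// lerXn2r ?nnegrE ?mulr_ge0 ?nrm_ge0//.
exact: cauchy_schwarz.
Qed.

Lemma sqi_opAs h g : sqi (P \x Q)%E h -> sqi Q g -> sqi P (opAs Q h g).
Proof.
move=> sh sg; have mo := measurable_opAs sh sg; split => //.
apply/integrableP; split; first exact/measurable_EFinP/measurable_funX.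
have [i1 _] := int_sqr_section sh.
have /integrableP[_ i2] := integrable_RZl (nrm Q g ^+ 2) i1.
apply: le_lt_trans i2.
apply: ae_ge0_le_integral => //.
- by apply: measurableT_comp => //; exact/measurable_EFinP/measurable_funX.
- by apply: measurableT_comp => //; exact: measurable_int (integrable_RZl _ i1).
apply: filterS (opAs_le sh sg) => x hx _ /=.
by rewrite lee_fin ger0_norm ?sqr_ge0// ger0_norm// mulr_ge0 ?sqr_ge0.
Qed.

(** The Hilbert-Schmidt bound, from the Cauchy-Schwarz inequality on almost every section. *)
Lemma nrm_opAs h g : sqi (P \x Q)%E h -> sqi Q g ->
  nrm P (opAs Q h g) <= nrm (P \x Q)%E h * nrm Q g.
Proof.
move=> sh sg; rewrite -(@ler_pXn2r _ 2)// ?nnegrE ?mulr_ge0 ?nrm_ge0// exprMn mulrC.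
have [i1 <-] := int_sqr_section sh; rewrite nrm_sqr -RintegralZl//.
have [mo io] := sqi_opAs sh sg.
apply: fine_le; [exact: integrable_fin_num|apply: integrable_fin_num => //; exact: integrable_RZl|].
apply: ae_ge0_le_integral => //.
- by move=> x _; rewrite lee_fin sqr_ge0.
- exact: measurable_int io.
- by move=> x _; rewrite lee_fin mulr_ge0 ?sqr_ge0.
- exact: measurable_int (integrable_RZl _ i1).
by apply: filterS (opAs_le sh sg) => x hx _ /=; rewrite lee_fin.
Qed.

Lemma inner_opAs h f g : sqi (P \x Q)%E h -> sqi P f -> sqi Q g ->
  inner P (opAs Q h g) f = inner (P \x Q)%E h (fun z => f z.1 * g z.2).
Proof.
move=> sh sf sg; rewrite /inner (Rfubini (sqiM sh (sqi_tensor sf sg))).2/=.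
apply: ae_eq_Rint.
- by apply: measurable_funM; [exact: measurable_opAs|case: sf].
- by apply/measurable_EFinP; exact: measurable_int (Rfubini (sqiM sh (sqi_tensor sf sg))).1.
apply: filterS (sqi_section sh) => x sx _.
rewrite /opAs -RintegralZr//; last exact: sqiM.
by apply: eq_Rintegral => y _; ring.
Qed.

(** [opA P h] is [opAs] for the kernel with exchanged arguments. Results are therefore proved for
    [opAs] only and transferred through this identity. *)
Lemma integral_swap (h : S * T -> \bar R) : measurable_fun setT h ->
  (\int[(Q \x P)%E]_z h (z.2, z.1) = \int[(P \x Q)%E]_z h z)%E.
Proof.
have ge0 (k : S * T -> \bar R) : measurable_fun setT k -> (forall z, 0 <= k z)%E ->
    (\int[(Q \x P)%E]_z k (z.2, z.1) = \int[(P \x Q)%E]_z k z)%E.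
  move=> mk k0; rewrite fubini_tonelli1//=; last first.
    have ms : measurable_fun setT (fun z : T * S => (z.2, z.1)).
      by apply: measurable_fun_pair; [exact: measurable_snd|exact: measurable_fst].
    exact: (measurableT_comp mk ms).
  by rewrite fubini_tonelli2.
move=> mh.
transitivity ((\int[(Q \x P)%E]_z (h^\+ (z.2, z.1))) - \int[(Q \x P)%E]_z (h^\- (z.2, z.1)))%E.
  rewrite integralE; congr (_ - _)%E; apply: eq_integral => z _.
    by rewrite !funeposE.
  by rewrite !funenegE.
rewrite (ge0 _ (measurable_funepos mh)); last by move=> z; exact: funepos_ge0.
rewrite (ge0 _ (measurable_funeneg mh)); last by move=> z; exact: funeneg_ge0.
by rewrite -integralE.
Qed.

Lemma Rintegral_swap h : measurable_fun setT h ->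
  \int[(Q \x P)%E]_z h (z.2, z.1) = \int[(P \x Q)%E]_z h z.
Proof. by move=> mh; congr fine; apply: (@integral_swap (EFin \o h)); exact/measurable_EFinP. Qed.

Lemma sqi_swap h : sqi (P \x Q)%E h -> sqi (Q \x P)%E (fun z => h (z.2, z.1)).
Proof.
move=> [mh ih]; split; first exact: measurable_swap_fun.
have mh2 := measurable_funX 2%N mh.
apply/integrableP; split; first by apply/measurable_EFinP; exact: (measurable_swap_fun mh2).
have /integrableP[mh3 i2] := ih; apply: le_lt_trans i2.
rewrite le_eqVlt; apply/orP; left; apply/eqP.
by apply: (@integral_swap (fun z => `|(h z ^+ 2)%:E|)%E); exact: measurableT_comp.
Qed.

Lemma nrm_swap h : measurable_fun setT h ->
  nrm (Q \x P)%E (fun z => h (z.2, z.1)) = nrm (P \x Q)%E h.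
Proof. by move=> mh; congr Num.sqrt; apply: Rintegral_swap; exact: measurable_funX. Qed.

End kernel.

Lemma big_option_ord (V : nmodType) K (F : nat -> V) :
  \sum_(c : option 'I_K) F (if c is Some k then k.+1 else 0%N) = \sum_(k < K.+1) F k.
Proof.
rewrite (reindex (fun k : 'I_K.+1 => unlift ord0 k))/=.
  by apply: eq_bigr => k _; case: unliftP => [j ->|->].
exists (fun c : option 'I_K => oapp (lift ord0) ord0 c) => [k|[j|]] _ /=.
- by case: unliftP => [j ->|->].
- by rewrite liftK.
- by rewrite unlift_none.
Qed.

Lemma big_ord_square (V : nmodType) K L (F : nat -> nat -> V) : (K <= L)%N ->
  \sum_(a < K) \sum_(b < K) F a b =
  \sum_(p : 'I_L * 'I_L | (p.1 < K)%N && (p.2 < K)%N) F p.1 p.2.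
Proof.
move=> KL; rewrite (big_ord_widen _ (fun a => \sum_(b < K) F a b) KL).
under eq_bigr do rewrite (big_ord_widen _ (F _) KL).
by rewrite pair_big.
Qed.

Lemma nondecreasing_bounded_cauchy (R : realType) (u : nat -> R) M :
  (forall m n, (m <= n)%N -> u m <= u n) -> (forall n, u n <= M) ->
  forall e, 0 < e -> exists N, forall m n, (N <= m)%N -> u n - u m <= e.
Proof.
move=> nd uM e e0.
have su : has_sup (range u) by split; [exists (u 0%N), 0%N|exists M => _ [n _ <-]].
have [_ [N _ <-] HN] := sup_adherent e0 su; exists N => m n Nm.
have : u n <= sup (range u) by apply: sup_upper_bound => //; exists n.
by have := nd _ _ Nm; lra.
Qed.

(** * Expansion of a kernel in products of eigenfunctions *)

Section tensor_basis.
Context d1 d2 (S : measurableType d1) (T : measurableType d2) (R : realType).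
Variables (P : probability S R) (Q : probability T R).
Variables (alpha : nat -> S -> R) (beta : nat -> T -> R).
Hypotheses (ca : complete_orthonormal P alpha) (cb : complete_orthonormal Q beta).

Definition tensor a b (z : S * T) : R := alpha a z.1 * beta b z.2.

Definition coef (h : S * T -> R) a b : R := inner (P \x Q)%E h (tensor a b).

Lemma tensor_sqi a b : sqi (P \x Q)%E (tensor a b).
Proof. by apply: sqi_tensor; apply: co_sqi. Qed.

Lemma tensor_orth a b a' b' : (a, b) != (a', b') ->
  inner (P \x Q)%E (tensor a b) (tensor a' b') = 0.
Proof.
move=> ab; rewrite inner_tensor; [|by apply: co_sqi..].
have [aa|aa] := eqVneq a a'; last by rewrite (co_orth ca aa) mul0r.
rewrite (co_orth cb) ?mulr0//; apply: contra ab => /eqP ->; by rewrite aa.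
Qed.

Lemma inner_ge0 d (V : measurableType d) (M : probability V R) f : 0 <= inner M f f.
Proof. by rewrite innerE sqr_ge0. Qed.

Lemma tensor_le1 a b : inner (P \x Q)%E (tensor a b) (tensor a b) <= 1.
Proof.
rewrite inner_tensor; [|by apply: co_sqi..].
by rewrite mulr_ile1 ?inner_ge0//; apply: co_le1.
Qed.

Lemma tensor_norm a b :
  inner (P \x Q)%E (tensor a b) (tensor a b) = 1 \/ forall h, sqi (P \x Q)%E h -> coef h a b = 0.
Proof.
have [a1|a0] := co_norm ca a; last first.
  right=> h sh; rewrite /coef.
  rewrite -inner_opAs//; [|exact: co_sqi..]; apply: a0; apply: sqi_opAs => //; exact: co_sqi.
have [b1|b0] := co_norm cb b.
  by left; rewrite inner_tensor; [rewrite a1 b1 mulr1|by apply: co_sqi..].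
have bz : nrm Q (beta b) = 0.
  by apply/eqP; rewrite -sqrf_eq0 -innerE b0//; exact: co_sqi.
right=> h sh; rewrite /coef -inner_opAs//; [|exact: co_sqi..].
have := cauchy_schwarz (sqi_opAs sh (co_sqi cb b)) (co_sqi ca a).
have := nrm_opAs sh (co_sqi cb b); rewrite bz mulr0 => n0.
have -> : nrm P (opAs Q h (beta b)) = 0 by apply/eqP; rewrite eq_le n0 nrm_ge0.
by rewrite mul0r normr_le0 => /eqP.
Qed.

(** For each b the function [opAs Q h (beta b)] is orthogonal to every [alpha a], hence null.
    Outside a countable union of null sets, the section of h at x is then orthogonal to every
    [beta b]. *)
Lemma tensor_complete h : sqi (P \x Q)%E h -> (forall a b, coef h a b = 0) ->
  nrm (P \x Q)%E h = 0.
Proof.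
move=> sh h0.
have hb b : opAs Q h (beta b) = cst 0 %[ae P].
  case: (ca) => _ _ _; apply.
    by apply/Lfun2P/sqi_opAs => //; exact: co_sqi.
  by move=> a; rewrite inner_opAs; [exact: h0|by []|exact: co_sqi|exact: co_sqi].
have [_ E] := int_sqr_section sh.
apply/eqP; rewrite -sqrf_eq0 -E -(Rint_cst P 0); apply/eqP.
have [i1 _] := int_sqr_section sh.
apply: ae_eq_Rint; [by apply/measurable_EFinP; exact: measurable_int i1|by []|].
have := ae_foralln hb; apply: filterS2 (sqi_section sh) => x sx hx _.
have : (fun y => h (x, y)) = cst 0 %[ae Q].
  case: (cb) => _ _ _; apply; first exact/Lfun2P.
  move=> b; apply: etrans (hx b Logic.I).
  by apply: eq_Rintegral => y _; rewrite mulrC.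
move=> h00; rewrite (@eq_ae_nrm _ _ _ _ _ (cst 0)) ?nrm_cst ?normr0 ?expr0n//.
by case: sx.
Qed.

Definition tensor_sum (h : S * T -> R) K (z : S * T) : R :=
  \sum_(a < K) \sum_(b < K) coef h a b * tensor a b z.

Lemma tensor_sum_sqi h K : sqi (P \x Q)%E (tensor_sum h K).
Proof. by do 2![apply: sqi_sum => ? _]; apply: sqiZ; exact: tensor_sqi. Qed.

Lemma coef_tensor_sum h K a b : sqi (P \x Q)%E h -> (a < K)%N -> (b < K)%N ->
  coef (tensor_sum h K) a b = coef h a b.
Proof.
move=> sh aK bK; rewrite {1}/coef innerC.
pose F (p : 'I_K * 'I_K) := tensor p.1 p.2.
have -> : tensor_sum h K = fun z => \sum_(p : 'I_K * 'I_K) coef h p.1 p.2 * F p z.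
  by apply/funext => z; rewrite /tensor_sum pair_bigA.
rewrite inner_sumr; [|by move=> p; exact: tensor_sqi|exact: tensor_sqi].
rewrite (bigD1 (Ordinal aK, Ordinal bK))//= big1 ?addr0; last first.
  move=> [i j] ij; rewrite tensor_orth ?mulr0//; apply: contra ij => /eqP[ai bj].
  by apply/eqP; congr pair; apply: val_inj.
by rewrite /F/=; have [->|/(_ h sh) ->] := tensor_norm a b; rewrite ?mulr1 ?mul0r.
Qed.

Lemma coef_bessel h (I : finType) (f : I -> nat * nat) : injective f -> sqi (P \x Q)%E h ->
  \sum_i coef h (f i).1 (f i).2 ^+ 2 <= nrm (P \x Q)%E h ^+ 2.
Proof.
move=> fi sh; apply: (bessel predT (F := fun i => tensor (f i).1 (f i).2)) => // [i|i j ij|i].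
- exact: tensor_sqi.
- by apply: tensor_orth; rewrite -!surjective_pairing (inj_eq fi).
- exact: tensor_le1.
Qed.

(** Bessel's inequality makes the square partial sums a Cauchy sequence. Their limit has the
    coefficients of h, so it is at distance 0 from h by completeness. *)
Lemma tensor_parseval h : sqi (P \x Q)%E h -> cvgL2 (P \x Q)%E (tensor_sum h) h.
Proof.
move=> sh; pose u K := \sum_(a < K) \sum_(b < K) coef h a b ^+ 2.
have split_u K L : (K <= L)%N ->
    u L = u K + \sum_(p : 'I_L * 'I_L | ~~ ((p.1 < K)%N && (p.2 < K)%N)) coef h p.1 p.2 ^+ 2.
  move=> KL; rewrite {2}/u (@big_ord_square _ _ _ (fun a b => coef h a b ^+ 2) KL).
  by rewrite /u pair_bigA/= (bigID (fun p : 'I_L * 'I_L => (p.1 < K)%N && (p.2 < K)%N)).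
have und K L : (K <= L)%N -> u K <= u L.
  by move=> /split_u ->; rewrite lerDl; apply: sumr_ge0 => p _; exact: sqr_ge0.
have uM K : u K <= nrm (P \x Q)%E h ^+ 2.
  rewrite /u pair_bigA/=; apply: (@coef_bessel h _ (fun p : 'I_K * 'I_K => (p.1 : nat, p.2 : nat))) => //.
  by move=> [i j] [i' j'] [/val_inj -> /val_inj ->].
have ss K := tensor_sum_sqi h K.
have [|g sg hg] := @riesz_fischer _ _ _ (P \x Q)%E (tensor_sum h) ss.
  move=> e e0; have [N HN] := nondecreasing_bounded_cauchy und uM (exprn_gt0 2 e0).
  have main m n : (N <= m)%N -> (m <= n)%N ->
      nrm (P \x Q)%E (fun z => tensor_sum h n z - tensor_sum h m z) <= e.
    move=> Nm mn; rewrite -(@ler_pXn2r _ 2)// ?nnegrE ?nrm_ge0 ?(ltW e0)//.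
    apply: le_trans (HN m n Nm); rewrite (split_u m n mn) addrAC subrr add0r.
    pose F (p : 'I_n * 'I_n) := tensor p.1 p.2.
    rewrite (@eq_nrm _ _ _ _ _ (fun z =>
      \sum_(p : 'I_n * 'I_n | ~~ ((p.1 < m)%N && (p.2 < m)%N)) coef h p.1 p.2 * F p z)); last first.
      move=> z; rewrite /tensor_sum (@big_ord_square _ _ _ (fun a b => coef h a b * tensor a b z) mn).
      by rewrite pair_bigA/= (bigID (fun p : 'I_n * 'I_n => (p.1 < m)%N && (p.2 < m)%N))/= addrAC subrr add0r.
    rewrite orthogonal_nrm; last 2 first.
    - by move=> p; exact: tensor_sqi.
    - move=> [i j] [i' j'] ij; apply: tensor_orth; apply: contra ij => /eqP[/val_inj -> /val_inj ->].
      by [].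
    by apply: ler_sum => p _; rewrite ler_piMr ?sqr_ge0// tensor_le1.
  exists N => m n Nm Nn; have [mn|/ltnW nm] := leqP m n; last exact: main.
  rewrite -nrmN (@eq_nrm _ _ _ _ _ (fun z => tensor_sum h n z - tensor_sum h m z)); first exact: main.
  by move=> z; rewrite opprB.
have gE a b : coef g a b = coef h a b.
  apply: (inner_cvg ss sg (tensor_sqi a b) hg).
  exists (maxn a b).+1 => n abn; apply: coef_tensor_sum => //.
    exact: leq_ltn_trans (leq_maxl _ _) abn.
  exact: leq_ltn_trans (leq_maxr _ _) abn.
have gh0 : nrm (P \x Q)%E (fun z => g z - h z) = 0.
  apply: tensor_complete; first exact: sqiB.
  move=> a b; rewrite /coef /inner; under eq_Rintegral do rewrite mulrBl.
  rewrite RintegralB//; [|by apply: sqiM => //; exact: tensor_sqi..].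
  by rewrite -/(inner (P \x Q)%E g (tensor a b)) -/(inner (P \x Q)%E h (tensor a b)) -/(coef g a b) -/(coef h a b) gE subrr.
move=> e e0; have [N HN] := hg e e0; exists N => n Nn.
apply: le_trans (HN n Nn); rewrite (@eq_nrm _ _ _ _ _ (fun z => (tensor_sum h n z - g z) + (g z - h z))).
  by apply: le_trans (nrmD (sqiB (ss n) sg) (sqiB sg sh)) _; rewrite gh0 addr0.
by move=> z; ring.
Qed.

End tensor_basis.

(** * Expansions evaluated at the samples *)

Section sample_chaos.
Context d d' (Omega : measurableType d) (U : measurableType d') (R : realType).
Context (Pr : probability Omega R) (P Q : probability U R).
Variables (X Y : nat -> {RV Pr >-> U}).
Hypotheses (iX : iid P X) (iY : iid Q Y) (iXY : independent_seqs X Y).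
Variables (alpha beta : nat -> U -> R).
Hypotheses (ca : complete_orthonormal P alpha) (cb : complete_orthonormal Q beta).

Definition idx K (c : option 'I_K) : nat := if c is Some k then k.+1 else 0%N.

Lemma idx_inj K : injective (@idx K).
Proof. by move=> [i|] [j|] //= [] /val_inj ->. Qed.

Definition basisX K N (c : option 'I_K) (i : 'I_N) (w : Omega) := alpha (idx c) (X i w).
Definition basisY K N (c : option 'I_K) (i : 'I_N) (w : Omega) := beta (idx c) (Y i w).

Section fixed.
Variables K N : nat.
Local Notation M := {ffun 'I_N -> option 'I_K}.
Local Notation ch := (chaos (@basisX K N) (@basisY K N)).

Let F (kap lam : M) (k : 'I_N + 'I_N) : U -> R :=
  match k with inl i => alpha (idx (kap i)) | inr j => beta (idx (lam j)) end.

Let chE kap lam : ch kap lam = fun w => \prod_k F kap lam k (sample X Y k w).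
Proof. by apply/funext => w; rewrite big_sumType. Qed.

Let sF kap lam k : sqi (sample_law P Q k) (F kap lam k).
Proof. by case: k => i /=; apply: co_sqi. Qed.

Lemma sample_chaos_sqi kap lam : sqi Pr (ch kap lam).
Proof. by rewrite chE; apply: (indep_prod_sqi (sample_indep iX iY iXY N)) => k; exact: sF. Qed.

Lemma sample_chaos_orth p p' : p != p' -> inner Pr (ch p.1 p.2) (ch p'.1 p'.2) = 0.
Proof.
move=> pp; rewrite !chE (indep_prod_inner (sample_indep iX iY iXY N))//.
have [[i ki]|[j lj]] : (exists i, p.1 i != p'.1 i) \/ (exists j, p.2 j != p'.2 j).
  move: pp; case: p p' => [kap lam] [kap' lam'] /=.
  have [->|kk] := eqVneq kap kap'; last first.
    move=> _; left; apply/existsP; apply: contraNT kk; rewrite negb_exists => /forallP h.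
    by apply/eqP/ffunP => i; apply/eqP; rewrite -[_ == _]negbK h.
  have [->|ll] := eqVneq lam lam'; first by rewrite eqxx.
  move=> _; right; apply/existsP; apply: contraNT ll; rewrite negb_exists => /forallP h.
  by apply/eqP/ffunP => i; apply/eqP; rewrite -[_ == _]negbK h.
- by rewrite (bigD1 (inl i))//= (co_orth ca) ?mul0r// (inj_eq (@idx_inj K)).
- by rewrite (bigD1 (inr j))//= (co_orth cb) ?mul0r// (inj_eq (@idx_inj K)).
Qed.

Lemma sample_chaos_le1 kap lam : inner Pr (ch kap lam) (ch kap lam) <= 1.
Proof.
rewrite !chE (indep_prod_inner (sample_indep iX iY iXY N))//.
apply: le_trans (_ : \prod_(k : 'I_N + 'I_N) (1 : R) <= 1); last by rewrite big1_eq.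
apply: ler_prod => k _.
rewrite inner_ge0/=.
by case: k => i /=; [exact: (co_le1 ca)|exact: (co_le1 cb)].
Qed.

End fixed.

(** At fixed N the denominator depends continuously on the kernel. Bounds for finite expansions,
    with constants free of the truncation, thus pass to [xi]. *)
Lemma den_cvg N (F : nat -> U * U -> R) (G : U * U -> R) :
  (forall K, sqi (P \x Q)%E (F K)) -> sqi (P \x Q)%E G -> cvgL2 (P \x Q)%E F G ->
  [/\ forall K, sqi Pr (T_den (F K) X Y N), sqi Pr (T_den G X Y N) &
     cvgL2 Pr (fun K => T_den (F K) X Y N) (T_den G X Y N)].
Proof.
move=> sF sG FG.
have s1 H (sigma : 'S_N) : sqi (P \x Q)%E H -> sqi Pr (xi_tensor H X Y sigma).
  by move=> sH; apply: (indep_prod_sqi (pair_indep iX iY iXY sigma) (f := fun=> H)).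
have s2 H : sqi (P \x Q)%E H -> sqi Pr (T_den H X Y N).
  by move=> sH; apply: sqiZ; apply: sqi_sum => sigma _; exact: s1.
split; [by move=> K; exact: s2|exact: s2|].
apply: cvgL2Z; [by move=> K; apply: sqi_sum => sigma _; exact: s1|
  by apply: sqi_sum => sigma _; exact: s1|].
apply: (@cvgL2_sum _ _ _ _ _ predT (fun (sigma : 'S_N) K => xi_tensor (F K) X Y sigma)
   (fun sigma => xi_tensor G X Y sigma)) => [sigma K|sigma|sigma]; [exact: s1|exact: s1|].
by apply: (indep_prod_cvg (pair_indep iX iY iXY sigma) (f := fun K i => F K) (g := fun=> G)).
Qed.

(* The factor of index [i] is replaced by [g]; with [g = (eta - theta) * xi] this is [(T_N - theta) * T_den]. *)
Definition score (g xi : U * U -> R) N (w : Omega) : R :=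
  N`!%:R^-1 * \sum_(sigma : 'S_N) N%:R^-1 * \sum_(i < N)
    g (X i w, Y (sigma i) w) * \prod_(j < N | j != i) xi (X j w, Y (sigma j) w).

Lemma score_cvg N (g : nat -> U * U -> R) (h : U * U -> R) (F : nat -> U * U -> R) (G : U * U -> R) :
  (forall K, sqi (P \x Q)%E (g K)) -> sqi (P \x Q)%E h -> cvgL2 (P \x Q)%E g h ->
  (forall K, sqi (P \x Q)%E (F K)) -> sqi (P \x Q)%E G -> cvgL2 (P \x Q)%E F G ->
  [/\ forall K, sqi Pr (score (g K) (F K) N), sqi Pr (score h G N) &
     cvgL2 Pr (fun K => score (g K) (F K) N) (score h G N)].
Proof.
move=> sg sh gh sF sG FG.
pose one (h' H : U * U -> R) (i j : 'I_N) := if j == i then h' else H.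
have oneE (h' H : U * U -> R) (sigma : 'S_N) (i : 'I_N) w : h' (X i w, Y (sigma i) w) * \prod_(j < N | j != i) H (X j w, Y (sigma j) w) =
    \prod_j one h' H i j (X j w, Y (sigma j) w).
  rewrite [RHS](bigD1 i)//= {1}/one eqxx; congr *%R.
  by apply: eq_bigr => j /negPf ji; rewrite /one ji.
have scE h' H : score h' H N = fun w => N`!%:R^-1 * \sum_(sigma : 'S_N) N%:R^-1 * \sum_(i < N)
    \prod_j one h' H i j (X j w, Y (sigma j) w).
  apply/funext => w; congr *%R; apply: eq_bigr => sigma _; congr *%R.
  by apply: eq_bigr => i _; exact: oneE.
have s1 h' H (sigma : 'S_N) i : sqi (P \x Q)%E h' -> sqi (P \x Q)%E H ->
    sqi Pr (fun w => \prod_j one h' H i j (X j w, Y (sigma j) w)).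
  move=> sh' sH; apply: (indep_prod_sqi (pair_indep iX iY iXY sigma)) => j.
  by rewrite /one; case: ifP.
have s3 h' H (sigma : 'S_N) : sqi (P \x Q)%E h' -> sqi (P \x Q)%E H ->
    sqi Pr (fun w => N%:R^-1 * \sum_(i < N) \prod_j one h' H i j (X j w, Y (sigma j) w)).
  by move=> sh' sH; apply: sqiZ; apply: sqi_sum => i _; exact: s1.
have s2 h' H : sqi (P \x Q)%E h' -> sqi (P \x Q)%E H -> sqi Pr (score h' H N).
  by move=> sh' sH; rewrite scE; apply: sqiZ; apply: sqi_sum => sigma _; exact: s3.
split; [by move=> K; exact: s2|exact: s2|].
rewrite scE; under eq_fun do rewrite scE.
apply: cvgL2Z; [by move=> K; apply: sqi_sum => sigma _; exact: s3|
  by apply: sqi_sum => sigma _; exact: s3|].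
apply: (@cvgL2_sum _ _ _ _ _ predT (fun (sigma : 'S_N) K w => N%:R^-1 * \sum_(i < N) \prod_j one (g K) (F K) i j (X j w, Y (sigma j) w))
   (fun sigma w => N%:R^-1 * \sum_(i < N) \prod_j one h G i j (X j w, Y (sigma j) w))) => [sigma K|sigma|sigma]; [exact: s3|exact: s3|].
apply: cvgL2Z; [by move=> K; apply: sqi_sum => i _; exact: s1|
  by apply: sqi_sum => i _; exact: s1|].
apply: (@cvgL2_sum _ _ _ _ _ predT (fun (i : 'I_N) K w => \prod_j one (g K) (F K) i j (X j w, Y (sigma j) w))
   (fun i w => \prod_j one h G i j (X j w, Y (sigma j) w))) => [i K|i|i]; [exact: s1|exact: s1|].
apply: (indep_prod_cvg (pair_indep iX iY iXY sigma) (f := fun K j => one (g K) (F K) i j)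
  (g := fun j => one h G i j)) => [K j|j|j]; rewrite /one; by case: ifP.
Qed.

End sample_chaos.

Section moment_bounds.
Context d d' (Omega : measurableType d) (U : measurableType d') (R : realType).
Context (Pr : probability Omega R) (P Q : probability U R).
Variables (X Y : nat -> {RV Pr >-> U}).
Hypotheses (iX : iid P X) (iY : iid Q Y) (iXY : independent_seqs X Y).
Variables (xi : U * U -> R) (s : nat -> R) (alpha beta : nat -> U -> R).
Hypothesis sxi : sqi (P \x Q)%E xi.
Hypothesis ed : eigen_decomposition P Q xi s alpha beta.
Hypotheses (s_le : forall k, (1 <= k)%N -> s k <= s 1%N) (s1 : s 1%N < 1).

Lemma ed_co : complete_orthonormal P alpha /\ complete_orthonormal Q beta.
Proof. by case: ed. Qed.

Let ca : complete_orthonormal P alpha. Proof. exact: ed_co.1. Qed.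
Let cb : complete_orthonormal Q beta. Proof. exact: ed_co.2. Qed.

(** Equal to [s k] if [alpha k] has norm 1, and 0 if it is padding. When both eigenfunctions are
    padding, [s k] is arbitrary in [0, 1]; this version is always square summable by Bessel's
    inequality. *)
Definition sing k := coef P Q alpha beta xi k k.

Lemma ed_alpha0 : alpha 0%N = cst 1. Proof. by case: ed => -[]. Qed.
Lemma ed_beta0 : beta 0%N = cst 1. Proof. by case: ed => -[]. Qed.

Lemma coef_xiE a b : coef P Q alpha beta xi a b = s b * inner P (alpha b) (alpha a).
Proof.
rewrite /coef -inner_opAs//; [|exact: co_sqi|exact: co_sqi].
rewrite -RintegralZl//; last by apply: sqiM; exact: co_sqi.
apply: ae_eq_Rint.
- by apply: measurable_funM; [exact: measurable_opAs sxi (co_sqi cb b)|case: (co_sqi ca a)].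
- by apply: measurable_funM => //; apply: measurable_funM; [case: (co_sqi ca b)|case: (co_sqi ca a)].
- by case: ed => _ _ _ _ /(_ b)[_]; apply: filterS => x /(_ Logic.I) -> _; rewrite mulrA.
Qed.

Lemma coef_xi_neq a b : a != b -> coef P Q alpha beta xi a b = 0.
Proof. by move=> ab; rewrite coef_xiE (co_orth ca) ?mulr0// eq_sym. Qed.

Lemma s_ge0 k : 0 <= s k.
Proof. by case: ed => _ /(_ k)/andP[]. Qed.

Lemma sing0 : sing 0 = 1.
Proof.
rewrite /sing coef_xiE ed_alpha0; have [[-> _ _] _ _ _ _] := ed.
by rewrite mul1r /inner -[RHS](Rint_cst P 1); apply: eq_Rintegral => x _; rewrite /= mulr1.
Qed.

Lemma sing_ge0 k : 0 <= sing k.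
Proof. by rewrite /sing coef_xiE mulr_ge0 ?inner_ge0// s_ge0. Qed.

Lemma sing_sqr k : sing k.+1 ^+ 2 <= s 1%N ^+ 2.
Proof.
rewrite lerXn2r ?nnegrE ?sing_ge0 ?s_ge0// /sing coef_xiE.
apply: le_trans (_ : s k.+1 <= _); last exact: s_le.
by rewrite ler_piMr ?s_ge0//; exact: (co_le1 ca).
Qed.

Lemma sing_sum K : \sum_(k < K) sing k.+1 ^+ 2 <= nrm (P \x Q)%E xi ^+ 2.
Proof.
apply: (@coef_bessel _ _ _ _ _ _ _ _ _ ca cb xi _ (fun k : 'I_K => (k.+1, k.+1))) => //.
by move=> i j [/val_inj].
Qed.

Lemma tensor_sum_xi K z : tensor_sum P Q alpha beta xi K.+1 z =
  \sum_(c : option 'I_K) ext (fun k : 'I_K => sing k.+1) c * (alpha (idx c) z.1 * beta (idx c) z.2).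
Proof.
rewrite (eq_bigr (fun c : option 'I_K => sing (idx c) * (alpha (idx c) z.1 * beta (idx c) z.2))); last first.
  by case=> [k|] _ //=; rewrite sing0.
rewrite (big_option_ord _ (fun k => sing k * (alpha k z.1 * beta k z.2))).
apply: eq_bigr => a _; rewrite (bigD1 a)//= big1 ?addr0// => b ba.
by rewrite coef_xi_neq ?mul0r// eq_sym.
Qed.

(* [xi >= 0] gives [damp t >= 1 - t], so that the permanent bound applies. *)
Definition damp (t : R) (z : U * U) : R := 1 + t * (xi z - 1).

Lemma damp_sqi t : sqi (P \x Q)%E (damp t).
Proof. by apply: sqiD; [exact: sqi_cst|apply: sqiZ; apply: sqiB => //; exact: sqi_cst]. Qed.

Lemma den_perm_mean K N (c : option 'I_K -> R) w :
  T_den (fun z => \sum_a c a * (alpha (idx a) z.1 * beta (idx a) z.2)) X Y N w =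
  perm_mean (basisX X alpha (N := N)) (basisY Y beta (N := N)) c w.
Proof. by []. Qed.

Lemma damp_tensor_sum K t z : 1 + t * (tensor_sum P Q alpha beta xi K.+1 z - 1) =
  \sum_(a : option 'I_K) (if a is Some k then t * sing k.+1 else 1) * (alpha (idx a) z.1 * beta (idx a) z.2).
Proof.
rewrite tensor_sum_xi (bigD1 None)//= [RHS](bigD1 None)//= ed_alpha0 ed_beta0 /=.
rewrite !mul1r addrAC subrr add0r mulr_sumr; congr (_ + _).
by apply: eq_bigr => -[k|]//= _; rewrite mulrA.
Qed.

Lemma damp_cvg t : cvgL2 (P \x Q)%E
  (fun K z => 1 + t * (tensor_sum P Q alpha beta xi K.+1 z - 1)) (damp t).
Proof.
have h : cvgL2 (P \x Q)%E (fun K => tensor_sum P Q alpha beta xi K.+1) xi.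
  move=> e e0; have [N HN] := tensor_parseval ca cb sxi e0; exists N => n Nn.
  by apply: HN; rewrite ltnW.
move=> e e0; have [N HN] := cvgL2Z t (fun K => tensor_sum_sqi ca cb xi K.+1) sxi h e0.
exists N => n Nn; rewrite (@eq_nrm _ _ _ _ _ (fun z => t * tensor_sum P Q alpha beta xi n.+1 z - t * xi z)).
  exact: HN.
by move=> z; rewrite /damp; ring.
Qed.

Lemma eq_T_den (F G : U * U -> R) N w : F =1 G -> T_den F X Y N w = T_den G X Y N w.
Proof. by move=> /funext ->. Qed.

(** One constant serves all N, t and g. Both bounds are the finite-dimensional ones of the chaos
    expansion, applied to the truncated kernels and carried to the limit. *)
Lemma moment_bounds : exists2 C : R, 0 <= C &
  (forall N t, 0 <= t <= 1 ->
    nrm Pr (fun w => T_den xi X Y N w - T_den (damp t) X Y N w) ^+ 2 <= (1 - t) ^+ 2 * C) /\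
  (forall N g, (0 < N)%N -> sqi (P \x Q)%E g -> coef P Q alpha beta g 0 0 = 0 ->
    N%:R * nrm Pr (score X Y g xi N) ^+ 2 <=
    C * (nrm P (opAs Q g (cst 1)) ^+ 2 + nrm Q (opA P g (cst 1)) ^+ 2 + N%:R^-1 * nrm (P \x Q)%E g ^+ 2)).
Proof.
have s0 : 0 <= s 1%N by exact: s_ge0.
pose q := s 1%N ^+ 2; pose H := nrm (P \x Q)%E xi ^+ 2.
have q01 : 0 <= q < 1 by rewrite /q sqr_ge0/= exprn_ilt1.
have r01 : 0 < (1 + q) / 2 < 1 by case/andP: q01 => ? ?; lra.
have [C C0 HC] := sqr_exp_bounded r01.
have H0 : 0 <= H by exact: sqr_ge0.
have cs K N := sample_chaos_sqi iX iY iXY ca cb (K := K) (N := N).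
have co K N := sample_chaos_orth iX iY iXY ca cb (K := K) (N := N).
have c1 K N := sample_chaos_le1 iX iY iXY ca cb (K := K) (N := N).
have sK K (x : 'I_K) : sing x.+1 ^+ 2 <= q by exact: sing_sqr.
have sq_ts t K : sqi (P \x Q)%E (fun z => 1 + t * (tensor_sum P Q alpha beta xi K.+1 z - 1)).
  apply: sqiD; first exact: sqi_cst.
  by apply: sqiZ; apply: sqiB; [exact: tensor_sum_sqi|exact: sqi_cst].
(* Treating [xi] as the case t = 1 gives both kernels the same form of truncation. *)
have xiE : damp 1 = xi by apply/funext => z; rewrite /damp; ring.
have cC : 0 <= cnst q H C.
  rewrite /cnst mulr_ge0 ?expR_ge0// mulr_ge0 ?(ltW C0)// addr_ge0// invr_ge0.
  by case/andP: r01 => /ltW.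
exists (cnst q H C) => //; split => [N t t01|N g N0 sg g00].
  have [d1 d2 d3] := den_cvg iX iY iXY N (sq_ts 1) (damp_sqi 1) (damp_cvg 1).
  have [e1 e2 e3] := den_cvg iX iY iXY N (sq_ts t) (damp_sqi t) (damp_cvg t).
  rewrite -{1}xiE.
  apply: (cvgL2_nrm_le _ _ (cvgL2B d1 d2 e1 e2 d3 e3)).
  - by move=> K; exact: sqiB.
  - exact: sqiB.
  move=> K.
  have := perm_mean_damped (@cs K N) (@co K N) (@c1 K N) q01 C0 HC (sK K) (sing_sum K) t01.
  rewrite (@eq_nrm _ _ _ _ _ (fun w =>
     T_den (fun z => 1 + 1 * (tensor_sum P Q alpha beta xi K.+1 z - 1)) X Y N w -
     T_den (fun z => 1 + t * (tensor_sum P Q alpha beta xi K.+1 z - 1)) X Y N w))//.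
  move=> w; rewrite -!den_perm_mean; congr (_ - _); apply: eq_T_den => z.
    by rewrite mul1r addrC subrK tensor_sum_xi.
  by rewrite damp_tensor_sum.
have gc : cvgL2 (P \x Q)%E (fun K => tensor_sum P Q alpha beta g K.+1) g.
  move=> e e0; have [M HM] := tensor_parseval ca cb sg e0; exists M => n Mn.
  by apply: HM; rewrite ltnW.
have [d1 d2 d3] := score_cvg iX iY iXY N (fun K => tensor_sum_sqi ca cb g K.+1) sg gc
   (sq_ts 1) (damp_sqi 1) (damp_cvg 1).
rewrite -{1}xiE mulrC -ler_pdivlMr ?ltr0n//.
apply: (cvgL2_nrm_le d1 d2 d3) => K.
pose gK (a b : option 'I_K) := coef P Q alpha beta g (idx a) (idx b).
have := nrm_perm_deriv (@cs K N) (@co K N) (@c1 K N) q01 H0 C0 HC (sK K) (sing_sum K) (g := gK) g00.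
rewrite (@eq_nrm _ _ _ _ _ (score X Y (tensor_sum P Q alpha beta g K.+1)
   (fun z => 1 + 1 * (tensor_sum P Q alpha beta xi K.+1 z - 1)) N)); last first.
  move=> w; rewrite /perm_deriv /score; congr *%R; apply: eq_bigr => sigma _; congr *%R.
  apply: eq_bigr => i _; congr *%R.
    rewrite /tensor_sum -(big_option_ord _ (fun a => \sum_(b < K.+1) coef P Q alpha beta g a b * tensor alpha beta a b (X i w, Y (sigma i) w))).
    apply: eq_bigr => a _.
    by rewrite -(big_option_ord _ (fun b => coef P Q alpha beta g (idx a) b * tensor alpha beta (idx a) b (X i w, Y (sigma i) w))).
  apply: eq_bigr => j _.
  by rewrite mul1r addrC subrK tensor_sum_xi.
move=> /le_trans; apply; rewrite -[leRHS]mulrA; apply: ler_wpM2l; first exact: cC.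
have Nn0 : N%:R != 0 :> R by rewrite pnatr_eq0 -lt0n.
(* Coefficients with one trivial index are the coefficients of a one-variable projection, because
   the eigenfunction of index 0 is 1. *)
have b1 : \sum_a gK a None ^+ 2 <= nrm P (opAs Q g (cst 1)) ^+ 2.
  have E a : gK a None = inner P (opAs Q g (cst 1)) (alpha (idx a)).
    by rewrite /gK /coef /= -ed_beta0 inner_opAs//; exact: co_sqi.
  under eq_bigr do rewrite E.
  apply: (bessel predT (F := fun a : option 'I_K => alpha (idx a))) => // [a|a b ab|a|].
  - exact: (co_sqi ca).
  - by apply: (co_orth ca); rewrite (inj_eq (@idx_inj K)).
  - exact: (co_le1 ca).
  - by apply: sqi_opAs => //; exact: sqi_cst.
have b2 : \sum_b gK None b ^+ 2 <= nrm Q (opA P g (cst 1)) ^+ 2.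
  have sw := sqi_swap sg.
  have E b : gK None b = inner Q (opA P g (cst 1)) (beta (idx b)).
    rewrite -[opA P g (cst 1)]/(opAs P (fun z => g (z.2, z.1)) (cst 1)) -ed_alpha0.
    rewrite inner_opAs//; [|exact: co_sqi..].
    have mF : measurable_fun setT (fun z => g z * tensor alpha beta 0 (idx b) z).
      by apply: measurable_funM; [case: sg|case: (tensor_sqi ca cb 0 (idx b))].
    rewrite /gK /coef /inner -(Rintegral_swap P Q mF).
    by apply: eq_Rintegral => z _; rewrite /tensor /= [_ * beta _ _]mulrC.
  under eq_bigr do rewrite E.
  apply: (bessel predT (F := fun b : option 'I_K => beta (idx b))) => // [b|a b ab|b|].
  - exact: (co_sqi cb).
  - by apply: (co_orth cb); rewrite (inj_eq (@idx_inj K)).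
  - exact: (co_le1 cb).
  - by apply: (sqi_opAs sw); exact: sqi_cst.
have b3 : \sum_a \sum_b gK a b ^+ 2 <= nrm (P \x Q)%E g ^+ 2.
  rewrite pair_bigA/=.
  apply: (coef_bessel ca cb (f := fun p : option 'I_K * option 'I_K => (idx p.1, idx p.2))) => //.
  by move=> [a b] [a' b'] [/idx_inj -> /idx_inj ->].
apply: (@le_trans _ _ (N%:R ^- 2 * (N%:R * \sum_a gK a None ^+ 2 + N%:R * \sum_b gK None b ^+ 2 +
    \sum_a \sum_b gK a b ^+ 2))); last first.
  rewrite (_ : N%:R ^- 2 * _ = ((\sum_a gK a None ^+ 2 + \sum_b gK None b ^+ 2) +
     N%:R^-1 * \sum_a \sum_b gK a b ^+ 2) / N%:R); last by field.
  rewrite ler_wpM2r ?invr_ge0// lerD//; first exact: lerD.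
  by rewrite ler_wpM2l ?invr_ge0.
rewrite ler_wpM2l ?invr_ge0 ?exprn_ge0//.
have -> : \sum_a gK a None ^+ 2 = \sum_a \sum_b (b == None)%:R * gK a b ^+ 2.
  apply: eq_bigr => a _; rewrite (bigD1 None)//= mul1r big1 ?addr0// => b /negPf ->.
  by rewrite mul0r.
have -> : \sum_b gK None b ^+ 2 = \sum_a \sum_b (a == None)%:R * gK a b ^+ 2.
  rewrite [RHS](bigD1 None)//= [X in _ + X]big1 ?addr0; first by apply: eq_bigr => b _; rewrite mul1r.
  by move=> a /negPf ->; apply: big1 => b _; rewrite mul0r.
rewrite !mulr_sumr -!big_split/=; apply: ler_sum => a _.
rewrite !mulr_sumr -!big_split/=; apply: ler_sum => b _.
have := sqr_ge0 (gK a b); have : 0 <= N%:R :> R by []. 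
rewrite /scale_of; case: a b => [a|] [b|] /= n0 g0; nra.
Qed.

End moment_bounds.

(** * Permanents of almost doubly stochastic matrices *)

Section lower_bound.
Context (R : realType) (N : nat).
Hypothesis N0 : (0 < N)%N.
Implicit Types M p : 'I_N -> 'I_N -> R.

Let Nr0 : 0 < N%:R :> R. Proof. by rewrite ltr0n. Qed.

Lemma ln_le_sub1 (x : R) : 0 < x -> ln x <= x - 1.
Proof. by move=> x0; have := expR_ge1Dx (ln x); rewrite lnK ?posrE//; lra. Qed.

(* The weights [p i j / N] form a doubly stochastic matrix; Jensen's inequality for [ln] along the rows bounds the capacity of [M] from below. *)
Lemma permanent_entropy M p : (forall i j, 0 < M i j) -> (forall i j, 0 < p i j) ->
  (forall i, \sum_j p i j = N%:R) -> (forall j, \sum_i p i j = N%:R) ->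
  expR (- (N%:R^-1 * \sum_i \sum_j p i j * ln (p i j / M i j))) <= N`!%:R^-1 * permanent M.
Proof.
move=> M0 p0 prow pcol.
set lam := N%:R^-1 * _.
have f0 : 0 < N`!%:R :> R by rewrite ltr0n fact_gt0.
have NN0 : 0 < N%:R ^+ N :> R by rewrite exprn_gt0.
(* The row inequalities are summed over i; the column sums of [p] collect the logarithms of the
   [x j] with weight exactly 1, so the capacity bound is homogeneous in x. *)
have cap x : (forall j, 0 < x j) -> N%:R ^+ N * expR (- lam) * \prod_j x j <= \prod_i \sum_j M i j * x j.
  move=> x0; pose S i := \sum_j M i j * x j.
  have S0 i : 0 < S i.
    rewrite /S (bigD1 i)//= ltr_pwDl ?mulr_gt0//.
    by apply: sumr_ge0 => j _; rewrite mulr_ge0 ?ltW.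
  have row i : ln N%:R + N%:R^-1 * \sum_j p i j * ln (x j) -
      N%:R^-1 * \sum_j p i j * ln (p i j / M i j) <= ln (S i).
    (* Jensen's inequality in the form [ln y <= y - 1]: the upper bounds add up to [N - N = 0],
       since row i of [p] has sum N. *)
    have : N%:R^-1 * \sum_j p i j * ln (N%:R * (M i j * x j) / (p i j * S i)) <= 0.
      have : \sum_j p i j * ln (N%:R * (M i j * x j) / (p i j * S i)) <=
          \sum_j (N%:R * (M i j * x j) / S i - p i j).
        apply: ler_sum => j _.
        apply: le_trans (ler_wpM2l (ltW (p0 i j)) (ln_le_sub1 _)) _.
          by rewrite divr_gt0 ?mulr_gt0.
        by rewrite le_eqVlt; apply/orP; left; apply/eqP; field; rewrite !gt_eqF.
      rewrite sumrB prow -mulr_suml -mulr_sumr -/(S i) -mulrA divff ?gt_eqF// mulr1 subrr.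
      by move=> h; rewrite pmulr_rle0 ?invr_gt0.
    have -> : \sum_j p i j * ln (N%:R * (M i j * x j) / (p i j * S i)) =
        N%:R * ln N%:R + \sum_j p i j * ln (x j) - \sum_j p i j * ln (p i j / M i j) - N%:R * ln (S i).
      have cE c : N%:R * c = \sum_j p i j * c by rewrite -mulr_suml prow.
      rewrite (cE (ln N%:R)) (cE (ln (S i))) -big_split/= -!sumrB; apply: eq_bigr => j _.
      rewrite !lnM ?lnV ?posrE ?mulr_gt0 ?divr_gt0 ?invr_gt0 ?mulr_gt0//.
      rewrite !lnM ?lnV ?posrE ?mulr_gt0 ?divr_gt0 ?invr_gt0 ?mulr_gt0//.
      by ring.
    rewrite !(mulrBr, mulrDr) !mulKf ?gt_eqF//.
    by lra.
  rewrite -ler_ln ?posrE ?mulr_gt0 ?expR_gt0 ?prodr_gt0//; last by move=> i _; exact: S0.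
  rewrite !lnM ?posrE ?mulr_gt0 ?expR_gt0 ?prodr_gt0// expRK.
  have lnp (F : 'I_N -> R) : (forall j, 0 < F j) -> ln (\prod_j F j) = \sum_j ln (F j).
    move=> F0; suff: 0 < \prod_j F j /\ ln (\prod_j F j) = \sum_j ln (F j) by case.
    elim/big_rec2 : _ => [|j u v _ [v0 <-]]; first by rewrite ln1.
    by rewrite mulr_gt0// lnM ?posrE.
  rewrite lnXn// !lnp//.
  apply: le_trans (ler_sum _ (fun i _ => row i)); rewrite sumrB big_split/=.
  rewrite sumr_const card_ord -!mulr_sumr -/lam exchange_big/=.
  rewrite [X in _ <= _ + X - _](_ : _ = \sum_j ln (x j)); first by lra.
  rewrite -[RHS](mulKf (lt0r_neq0 Nr0)); congr *%R; rewrite mulr_sumr; apply: eq_bigr => j _.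
  by rewrite -mulr_suml pcol.
have h := vanderWaerden_capacity M0 (mulr_ge0 (ltW NN0) (expR_ge0 _)) cap.
rewrite ler_pdivlMl//; apply: le_trans h; rewrite le_eqVlt; apply/orP; left; apply/eqP.
by field; rewrite gt_eqF.
Qed.

(* [1 + a i + b j] is the first order correction making [1 + z] doubly stochastic; [e] and [f] remove the remaining error. *)
Lemma permanent_lower (z : 'I_N -> 'I_N -> R) (a b : 'I_N -> R) (c : R) :
  let r i := N%:R^-1 * \sum_j (1 + z i j) * (1 + a i + b j) in
  let q j := N%:R^-1 * \sum_i (1 + z i j) * (1 + a i + b j) in
  let e i := 1 - r i in
  let f j := 1 - q j - N%:R^-1 * \sum_i e i in
  let E := \sum_i e i ^+ 2 + \sum_j f j ^+ 2 in
  let A := \sum_i a i ^+ 2 + \sum_j b j ^+ 2 in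
  let Z := \sum_i (N%:R^-1 * \sum_j z i j) ^+ 2 + \sum_j (N%:R^-1 * \sum_i z i j) ^+ 2 in
  0 < c -> (forall i j, c <= 1 + z i j) ->
  (forall i, `|a i| <= 4^-1) -> (forall j, `|b j| <= 4^-1) -> E <= (c / 8) ^+ 2 ->
  expR (- (`|N%:R^-1 * \sum_i \sum_j z i j| + Z + 2 * A + (1 + 2 / c) * E)) <=
  N`!%:R^-1 * permanent (fun i j => 1 + z i j).
Proof.
move=> r q e f E A Z c0 zc a1 b1 Ec.
pose p i j := (1 + z i j) * (1 + a i + b j) + e i + f j.
have Nn0 : N%:R != 0 :> R by rewrite gt_eqF.
have M0 i j : 0 < 1 + z i j by exact: lt_le_trans (zc i j).
have eb i : `|e i| <= c / 8.
  rewrite -(@ler_pXn2r _ 2)// ?nnegrE ?divr_ge0 ?(ltW c0)// real_normK ?num_real//.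
  apply: le_trans Ec; rewrite /E (bigD1 i)//= -addrA lerDl addr_ge0 ?sumr_ge0// => *; exact: sqr_ge0.
have fb j : `|f j| <= c / 8.
  rewrite -(@ler_pXn2r _ 2)// ?nnegrE ?divr_ge0 ?(ltW c0)// real_normK ?num_real//.
  apply: le_trans Ec; rewrite /E [X in _ <= _ + X](bigD1 j)//= addrCA lerDl addr_ge0 ?sumr_ge0// => *; exact: sqr_ge0.
(* [1 + a i + b j] is at least 1/2, so the main term is at least [c / 2], whereas each error is at
   most [c / 8]. *)
have p0 i j : 0 < p i j.
  have := a1 i; have := b1 j; have := eb i; have := fb j; have := zc i j.
  rewrite !ler_norml /p => h /andP[h1 _] /andP[h2 _] /andP[h3 _] /andP[h4 _].
  have : (1 + z i j) * 2^-1 <= (1 + z i j) * (1 + a i + b j) by apply: ler_wpM2l; [exact: ltW|lra].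
  by lra.
have cst (x : R) : \sum_(i < N) x = N%:R * x by rewrite sumr_const card_ord mulr_natl.
have rE i : \sum_j (1 + z i j) * (1 + a i + b j) = N%:R * (1 - e i).
  by rewrite /e subKr /r mulrA divff// mul1r.
(* The totals over rows and over columns agree. Subtracting the mean of [e] in [f] is what makes
   adding [f] leave the row sums unchanged. *)
have sume : \sum_i f i = 0.
  have eE : \sum_i e i = N%:R - \sum_i r i by rewrite /e sumrB cst mulr1.
  have qE : \sum_i q i = \sum_i r i by rewrite /q /r -!mulr_sumr exchange_big.
  by rewrite /f sumrB sumrB !cst mulr1 mulrA divff// mul1r eE qE subrr.
have prow i : \sum_j p i j = N%:R.
  by rewrite /p big_split/= big_split/= sume addr0 cst rE; ring.
have pcol j : \sum_i p i j = N%:R.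
  rewrite /p big_split/= big_split/= cst /f.
  have -> : \sum_i (1 + z i j) * (1 + a i + b j) = N%:R * q j by rewrite /q mulVKf.
  by field.
apply: le_trans (permanent_entropy M0 p0 prow pcol); rewrite ler_expR lerN2.
(* Again [ln y <= y - 1], with [p / (1 + z) - 1 = (a + b) + (e + f) / (1 + z)]; multiplying by [p]
   separates linear from quadratic terms. *)
have lnle i j : p i j * ln (p i j / (1 + z i j)) <=
    (a i + b j) * p i j + (e i + f j) * (1 + a i + b j) + (e i + f j) ^+ 2 / c.
  apply: le_trans (ler_wpM2l (ltW (p0 i j)) (ln_le_sub1 _)) _; first by rewrite divr_gt0.
  apply: (@le_trans _ _ ((a i + b j) * p i j + (e i + f j) * (1 + a i + b j) + (e i + f j) ^+ 2 / (1 + z i j))).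
    by rewrite le_eqVlt; apply/orP; left; apply/eqP; rewrite /p; field; rewrite gt_eqF.
  by rewrite lerD2l ler_wpM2l ?sqr_ge0// lef_pV2 ?posrE.
pose rt i := N%:R^-1 * \sum_j z i j; pose qt j := N%:R^-1 * \sum_i z i j.
have S1 : N%:R^-1 * \sum_i \sum_j (a i + b j) * p i j = \sum_i a i + \sum_j b j.
  have -> : \sum_i \sum_j (a i + b j) * p i j = N%:R * (\sum_i a i + \sum_j b j).
    under eq_bigr do under eq_bigr do rewrite mulrDl.
    under eq_bigr do rewrite big_split/=.
    rewrite big_split/= mulrDr; congr (_ + _).
      by rewrite mulr_sumr; apply: eq_bigr => i _; rewrite -mulr_sumr prow mulrC.
    by rewrite exchange_big/= mulr_sumr; apply: eq_bigr => j _; rewrite -mulr_sumr pcol mulrC.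
  by rewrite mulKf.
(* The three linear sums are not controlled one by one. Computing the total of all entries in two
   ways turns their sum into the normalised total of [z] and products of second order. *)
have S2 : \sum_i a i + \sum_j b j + \sum_i e i =
    - (N%:R^-1 * \sum_i \sum_j z i j) - \sum_i a i * rt i - \sum_j b j * qt j.
  have : \sum_i \sum_j (1 + z i j) * (1 + a i + b j) = N%:R * N%:R - N%:R * \sum_i e i.
    under eq_bigr do rewrite rE.
    by rewrite -mulr_sumr sumrB cst mulrBr mulr1.
  have -> : \sum_i \sum_j (1 + z i j) * (1 + a i + b j) = N%:R * N%:R + \sum_i \sum_j z i j +
      N%:R * \sum_i a i + N%:R * \sum_j b j + N%:R * \sum_i a i * rt i + N%:R * \sum_j b j * qt j.
    have -> : N%:R * \sum_i a i * rt i = \sum_i \sum_j a i * z i j.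
      by rewrite mulr_sumr; apply: eq_bigr => i _; rewrite /rt -mulr_sumr; field.
    have -> : N%:R * \sum_j b j * qt j = \sum_i \sum_j b j * z i j.
      by rewrite exchange_big/= mulr_sumr; apply: eq_bigr => j _; rewrite /qt -mulr_sumr; field.
    have -> : N%:R * \sum_i a i = \sum_(i < N) \sum_(j < N) a i.
      by rewrite mulr_sumr; apply: eq_bigr => i _; rewrite cst.
    rewrite -(cst (\sum_j b j)) -[N%:R * N%:R](cst N%:R).
    rewrite -!big_split/=; apply: eq_bigr => i _.
    rewrite -[N%:R in RHS]mulr1 -[N%:R * 1](cst 1) -!big_split/=; apply: eq_bigr => j _.
    by ring.
  move=> h; apply: (mulfI Nn0); rewrite !(mulrBr, mulrDr, mulrN) mulVKf//.
  by lra.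
have S3 : N%:R^-1 * \sum_i \sum_j ((e i + f j) * (1 + a i + b j)) <= \sum_i e i + E + A.
  have -> : \sum_i \sum_j ((e i + f j) * (1 + a i + b j)) =
      N%:R * \sum_i e i + N%:R * \sum_j f j + \sum_i \sum_j ((e i + f j) * (a i + b j)).
    rewrite mulr_sumr -(cst (\sum_j f j)) -!big_split/=; apply: eq_bigr => i _.
    by rewrite -cst -!big_split/=; apply: eq_bigr => j _; ring.
  rewrite sume mulr0 addr0 mulrDr mulKf// -addrA lerD2l.
  rewrite ler_pdivrMl//.
  have -> : N%:R * (E + A) = \sum_i \sum_j (e i ^+ 2 + f j ^+ 2 + (a i ^+ 2 + b j ^+ 2)).
    rewrite /E /A !mulrDr.
    have cr (F : 'I_N -> R) : N%:R * \sum_j F j = \sum_(i < N) \sum_j F j by rewrite cst.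
    have cl (F : 'I_N -> R) : N%:R * \sum_i F i = \sum_i \sum_(j < N) F i.
      by rewrite mulr_sumr; apply: eq_bigr => i _; rewrite cst.
    rewrite (cl (fun i => e i ^+ 2)) (cr (fun j => f j ^+ 2)) (cl (fun i => a i ^+ 2)) (cr (fun j => b j ^+ 2)).
    by rewrite -!big_split/=; apply: eq_bigr => i _; rewrite -!big_split/=.
  apply: ler_sum => i _; apply: ler_sum => j _.
  have := sqr_ge0 (e i - f j); have := sqr_ge0 (a i - b j).
  have := sqr_ge0 (e i + f j - (a i + b j)).
  have := sqr_ge0 (e i + f j); have := sqr_ge0 (a i + b j).
  nra.
have S4 : N%:R^-1 * \sum_i \sum_j ((e i + f j) ^+ 2 / c) <= 2 / c * E.
  rewrite ler_pdivrMl//.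
  have -> : N%:R * (2 / c * E) = \sum_i \sum_j (2 * (e i ^+ 2 + f j ^+ 2) / c).
    have cr (F : 'I_N -> R) : N%:R * \sum_j F j = \sum_(i < N) \sum_j F j by rewrite cst.
    have cl (F : 'I_N -> R) : N%:R * \sum_i F i = \sum_i \sum_(j < N) F i.
      by rewrite mulr_sumr; apply: eq_bigr => i _; rewrite cst.
    rewrite mulrCA /E mulrDr (cl (fun i => e i ^+ 2)) (cr (fun j => f j ^+ 2)) -big_split/= mulr_sumr.
    apply: eq_bigr => i _; rewrite -big_split/= mulr_sumr; apply: eq_bigr => j _.
    by ring.
  apply: ler_sum => i _; apply: ler_sum => j _.
  rewrite ler_wpM2r ?invr_ge0 ?(ltW c0)//.
  by have := sqr_ge0 (e i - f j); nra.
have S5 : - (\sum_i a i * rt i) - \sum_j b j * qt j <= A + Z.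
  have le (u v : 'I_N -> R) : - (\sum_i u i * v i) <= \sum_i u i ^+ 2 + \sum_i v i ^+ 2.
    rewrite -sumrN -big_split/=; apply: ler_sum => i _.
    by have := sqr_ge0 (u i + v i); have := sqr_ge0 (u i); have := sqr_ge0 (v i); nra.
  by have := le a rt; have := le b qt; rewrite /A /Z /rt /qt; lra.
apply: (@le_trans _ _ (N%:R^-1 * \sum_i \sum_j ((a i + b j) * p i j + (e i + f j) * (1 + a i + b j) + (e i + f j) ^+ 2 / c))).
  by rewrite ler_pM2l ?invr_gt0//; apply: ler_sum => i _; apply: ler_sum => j _; exact: lnle.
have -> : \sum_i \sum_j ((a i + b j) * p i j + (e i + f j) * (1 + a i + b j) + (e i + f j) ^+ 2 / c) =
   \sum_i \sum_j (a i + b j) * p i j + \sum_i \sum_j (e i + f j) * (1 + a i + b j) + \sum_i \sum_j (e i + f j) ^+ 2 / c.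
  by rewrite -!big_split/=; apply: eq_bigr => i _; rewrite -!big_split.
rewrite (mulrDr N%:R^-1) (mulrDr N%:R^-1) S1; have := ler_norm (- (N%:R^-1 * \sum_i \sum_j z i j)); rewrite normrN.
move: S2 S3 S4 S5; clearbody E A Z; rewrite [(1 + 2 / c) * E]mulrDl mul1r.
by move: (2 / c * E) => E'; lra.
Qed.

End lower_bound.

(** * Bounds in probability *)

Section tails.
Context d (Omega : measurableType d) (R : realType) (Pr : probability Omega R).

(* [A] need not be measurable. *)
Definition pbound (A : set Omega) (p : R) :=
  exists B, [/\ measurable B, A `<=` B & (Pr B <= p%:E)%E].

Lemma pboundW A A' p p' : A' `<=` A -> p <= p' -> pbound A p -> pbound A' p'.
Proof.
move=> AA pp [B [mB AB Bp]]; exists B; split => //; first exact: subset_trans AB.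
by apply: le_trans Bp _; rewrite lee_fin.
Qed.

Lemma pboundU A A' p p' : pbound A p -> pbound A' p' -> pbound (A `|` A') (p + p').
Proof.
move=> [B [mB AB Bp]] [B' [mB' AB' Bp']]; exists (B `|` B'); split.
- exact: measurableU.
- exact: setUSS.
- by rewrite EFinD; apply: le_trans (measureU2 _ mB mB') _; exact: leeD.
Qed.

Lemma pbound_sum (I : finType) (A : I -> set Omega) (p : I -> R) :
  (forall i, pbound (A i) (p i)) -> pbound [set w | exists i, A i w] (\sum_i p i).
Proof.
move=> Ap; suff H (r : seq I) : pbound [set w | exists2 i, i \in r & A i w] (\sum_(i <- r) p i).
  by apply: pboundW (H (index_enum I)) => // w [i Ai]; exists i => //; rewrite mem_index_enum.
elim: r => [|i r IH].
  by exists set0; split => //; [by move=> w []|by rewrite measure0 big_nil].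
rewrite big_cons; apply: pboundW (pboundU (Ap i) IH) => // w [j].
by rewrite inE => /orP[/eqP ->|jr] Aj; [left|right; exists j].
Qed.

Lemma pbound_markov f m e : 0 < e -> (forall w, 0 <= f w) -> Pr.-integrable setT (EFin \o f) ->
  \int[Pr]_w f w <= m -> pbound [set w | e <= f w] (m / e).
Proof.
move=> e0 f0 intf fm.
have mf : measurable_fun setT f by apply/measurable_EFinP; exact: measurable_int intf.
exists [set w | e <= f w]; split => //.
  by rewrite -[X in measurable X]setTI; exact: measurable_fun_le.
have := @le_integral_comp_abse _ _ _ Pr _ measurableT (EFin \o f) e (fun x => x).
rewrite setTI => /(_ _ _ _ _ e0) h.
have {}h : (e%:E * Pr [set w | (e <= f w)%R] <= \int[Pr]_w (f w)%:E)%E.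
  have E w : `|f w| = f w by rewrite ger0_norm.
  have -> : [set w | (e <= f w)%R] = [set w | (e%:E <= `|(EFin \o f) w|)%E].
    by apply/seteqP; split => w /=; rewrite E lee_fin.
  have -> : (\int[Pr]_w (f w)%:E = \int[Pr]_w `|(EFin \o f) w|)%E.
    by apply: eq_integral => w _ /=; rewrite E.
  apply: h => //.
  exact/measurable_EFinP.
rewrite muleC -lee_pdivlMr// in h; apply: le_trans h _.
have -> : (\int[Pr]_w (f w)%:E = (\int[Pr]_w f w)%:E)%E.
  by rewrite fineK//; exact: integrable_fin_num.
by rewrite -EFinM lee_fin ler_pM2r ?invr_gt0.
Qed.

Lemma integrable_sum_sqr (I : finType) (F : I -> Omega -> R) : (forall i, sqi Pr (F i)) ->
  Pr.-integrable setT (EFin \o fun w => \sum_i F i w ^+ 2) /\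
  \int[Pr]_w (\sum_i F i w ^+ 2) = \sum_i nrm Pr (F i) ^+ 2.
Proof.
move=> sF; have iF i : Pr.-integrable setT (EFin \o fun w => F i w ^+ 2) by case: (sF i).
split; first by apply: integrable_Rsum => i _; exact: iF.
by rewrite Rintegral_sum//; apply: eq_bigr => i _; rewrite nrm_sqr.
Qed.

Lemma pbound_sum_sqr (I : finType) (F : I -> Omega -> R) m e : (forall i, sqi Pr (F i)) ->
  0 < e -> \sum_i nrm Pr (F i) ^+ 2 <= m -> pbound [set w | e < \sum_i F i w ^+ 2] (m / e).
Proof.
move=> sF e0 Fm; have [iF IF] := integrable_sum_sqr sF.
apply: (@pboundW [set w | e <= \sum_i F i w ^+ 2]) (lexx _) _; first by move=> w /ltW.
apply: pbound_markov => //; last by rewrite IF.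
by move=> w; apply: sumr_ge0 => i _; exact: sqr_ge0.
Qed.

Implicit Types Z : nat -> Omega -> R.

Definition tail_le Z (b e : R) := exists N0, forall N, (N0 <= N)%N -> pbound [set w | b < Z N w] e.

Lemma tail_leW Z Z' b b' e e' : (forall N w, (0 < N)%N -> Z' N w <= Z N w) -> b <= b' -> e <= e' ->
  tail_le Z b e -> tail_le Z' b' e'.
Proof.
move=> ZZ bb ee [N0 H]; exists N0.+1 => N N0N.
apply: pboundW (H N (ltnW N0N)) => // w /= bZ.
by apply: le_lt_trans bb _; apply: lt_le_trans bZ _; apply: ZZ; case: N N0N.
Qed.

Lemma tail_leD Z Z' b b' e e' : tail_le Z b e -> tail_le Z' b' e' ->
  tail_le (fun N w => Z N w + Z' N w) (b + b') (e + e').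
Proof.
move=> [N0 H] [N1 H']; exists (maxn N0 N1) => N; rewrite geq_max => /andP[n0 n1].
apply: pboundW (pboundU (H N n0) (H' N n1)) => // w /= h.
by case: (ltP b (Z N w)) => [|zb]; [left|right; lra].
Qed.

Lemma tail_leM Z Z' b b' e e' : (forall N w, 0 <= Z N w) -> (forall N w, 0 <= Z' N w) ->
  tail_le Z b e -> tail_le Z' b' e' ->
  tail_le (fun N w => Z N w * Z' N w) (b * b') (e + e').
Proof.
move=> Z0 Z'0 [N0 H] [N1 H']; exists (maxn N0 N1) => N; rewrite geq_max => /andP[n0 n1].
apply: pboundW (pboundU (H N n0) (H' N n1)) => // w /= h.
case: (ltP b (Z N w)) => [|zb]; [by left|right].
by rewrite /= ltNge; apply/negP => zb'; move: h; rewrite ltNge ler_pM.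
Qed.

(** For nonnegative [Z], [small] is convergence to 0 in probability and [tight] below is boundedness
    in probability, with outer probabilities. *)
Definition small Z := forall b e : R, 0 < b -> 0 < e -> tail_le Z b e.
Definition tight Z := forall e : R, 0 < e -> exists2 b : R, 0 < b & tail_le Z b e.

Lemma small_le Z Z' : (forall N w, (0 < N)%N -> Z' N w <= Z N w) -> small Z -> small Z'.
Proof. by move=> ZZ sZ b e b0 e0; apply: tail_leW (sZ b e b0 e0). Qed.

Lemma tight_le Z Z' : (forall N w, (0 < N)%N -> Z' N w <= Z N w) -> tight Z -> tight Z'.
Proof. by move=> ZZ tZ e e0; have [b b0 Zb] := tZ e e0; exists b => //; apply: tail_leW Zb. Qed.

Lemma smallD Z Z' : small Z -> small Z' -> small (fun N w => Z N w + Z' N w).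
Proof.
move=> sZ sZ' b e b0 e0; rewrite (splitr b) (splitr e).
by apply: tail_leD; [apply: sZ|apply: sZ']; rewrite divr_gt0.
Qed.

Lemma tightD Z Z' : tight Z -> tight Z' -> tight (fun N w => Z N w + Z' N w).
Proof.
move=> tZ tZ' e e0; have e20 : 0 < e / 2 by rewrite divr_gt0.
have [b b0 h] := tZ _ e20; have [b' b'0 h'] := tZ' _ e20.
by exists (b + b'); [rewrite addr_gt0|rewrite (splitr e); exact: tail_leD].
Qed.

Lemma tight_smallM Z Z' : (forall N w, 0 <= Z N w) -> (forall N w, 0 <= Z' N w) ->
  tight Z -> small Z' -> small (fun N w => Z N w * Z' N w).
Proof.
move=> Z0 Z'0 tZ sZ b e b0 e0; have e20 : 0 < e / 2 by rewrite divr_gt0.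
have [c c0 h] := tZ _ e20; have h' := sZ (b / c) _ (divr_gt0 b0 c0) e20.
by rewrite (splitr e) (_ : b = c * (b / c)); [exact: tail_leM|field; rewrite gt_eqF].
Qed.

Lemma small0 : small (fun _ _ => 0).
Proof.
move=> b e b0 e0; exists 0%N => N _; exists set0; split => //.
  by move=> w /=; rewrite ltNge (ltW b0).
by rewrite measure0 lee_fin ltW.
Qed.

Lemma small_sum (I : finType) (Z : I -> nat -> Omega -> R) : (forall i, small (Z i)) ->
  small (fun N w => \sum_i Z i N w).
Proof.
move=> sZ; suff H (r : seq I) : small (fun N w => \sum_(i <- r) Z i N w) by exact: H.
elim: r => [|i r IH]; first by apply: small_le small0 => N w _; rewrite big_nil.
by apply: small_le (smallD (sZ i) IH) => N w _; rewrite big_cons.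
Qed.

Lemma tight_cst (c : R) : tight (fun _ _ => c).
Proof.
move=> e e0; exists (`|c| + 1); first by rewrite ltr_wpDl.
exists 0%N => N _; exists set0; split => //.
  by move=> w /= h; have := ler_norm c; lra.
by rewrite measure0 lee_fin ltW.
Qed.

Lemma tail_le_sum_sqr (I : nat -> finType) (F : forall N, I N -> Omega -> R) m b :
  0 < b -> (forall N i, (0 < N)%N -> sqi Pr (F N i)) ->
  (forall N, (0 < N)%N -> \sum_i nrm Pr (F N i) ^+ 2 <= m) ->
  tail_le (fun N w => \sum_i F N i w ^+ 2) b (m / b).
Proof.
move=> b0 sF Fm; exists 1%N => N N0.
by apply: pbound_sum_sqr => // [i|]; [exact: sF|exact: Fm].
Qed.

Lemma tight_sum_sqr (I : nat -> finType) (F : forall N, I N -> Omega -> R) m :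
  (forall N i, (0 < N)%N -> sqi Pr (F N i)) ->
  (forall N, (0 < N)%N -> \sum_i nrm Pr (F N i) ^+ 2 <= m) ->
  tight (fun N w => \sum_i F N i w ^+ 2).
Proof.
move=> sF Fm e e0; exists ((`|m| + 1) / e); first by rewrite divr_gt0 ?ltr_wpDl.
have m0 : 0 < `|m| + 1 by rewrite ltr_wpDl.
have := tail_le_sum_sqr (divr_gt0 m0 e0) sF (m := `|m| + 1).
rewrite [X in tail_le _ _ X](_ : _ = e); last by field; rewrite !gt_eqF.
by apply=> N N0; apply: le_trans (Fm N N0) _; have := ler_norm m; lra.
Qed.

Lemma small_sum_sqr (I : nat -> finType) (F : forall N, I N -> Omega -> R) m :
  (forall N i, (0 < N)%N -> sqi Pr (F N i)) -> 
  (forall N, (0 < N)%N -> \sum_i nrm Pr (F N i) ^+ 2 <= m / N%:R) ->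
  small (fun N w => \sum_i F N i w ^+ 2).
Proof.
move=> sF Fm b e b0 e0.
have [N0 HN0] : exists N0 : nat, `|m| / (b * e) < N0%:R.
  by exists (Num.bound (`|m| / (b * e))); apply: archi_boundP; rewrite divr_ge0// mulr_ge0 ?ltW.
exists N0.+1 => N N0N; have N0' : (0 < N)%N by apply: leq_trans N0N.
have NR : 0 < N%:R :> R by rewrite ltr0n.
rewrite (_ : e = e * b / b); last by field; rewrite gt_eqF.
apply: pbound_sum_sqr => // [i|]; first exact: sF.
apply: le_trans (Fm N N0') _; rewrite ler_pdivrMr//.
apply: le_trans (ler_norm _) _; rewrite mulrC -ler_pdivrMr ?mulr_gt0// [e * b]mulrC.
by apply: le_trans (ltW HN0) _; rewrite ler_nat ltnW.
Qed.

End tails.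

(** * Truncation, laws of pairs and row averages *)

Section truncation.
Context d (T : measurableType d) (R : realType) (P : probability T R).

Definition overflow (f : T -> R) (M : R) (x : T) : R := if `|f x| <= M then 0 else f x.

Lemma overflow_sqi f M : sqi P f -> sqi P (overflow f M).
Proof.
move=> [mf intf]; have mo : measurable_fun setT (overflow f M).
  apply: measurable_fun_ifT => //.
  by apply: measurable_fun_ler => //; exact: measurableT_comp.
split => //; apply: (le_integrable _ _ _ intf) => //; first exact/measurable_EFinP/measurable_funX.
move=> x _; rewrite lee_fin !ger0_norm ?sqr_ge0// /overflow.
by case: ifP => // _; rewrite expr0n sqr_ge0.
Qed.

Lemma overflow_small f : sqi P f -> forall e, 0 < e ->
  exists2 M : R, 0 < M & forall M', M <= M' -> nrm P (overflow f M') <= e.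
Proof.
move=> sf e e0; have [mf intf] := sf.
have mo M := proj1 (overflow_sqi M sf).
have h : (\int[P]_x ((overflow f n%:R x ^+ 2)%:E) @[n --> \oo] --> \int[P]_x (0 : \bar R))%E.
  apply: (@dominated_cvg _ _ _ P setT measurableT _ (cst 0%E) (fun x => (f x ^+ 2)%:E)) => //.
  - by move=> n; apply/measurable_EFinP/measurable_funX; exact: mo.
  - move=> x _; apply: cvg_near_cst; exists (Num.bound `|f x|) => // n /= bn.
    rewrite /overflow ifT ?expr0n//; apply: le_trans (ltW (archi_boundP _)) _ => //.
    by rewrite ler_nat.
  - move=> n x _; rewrite /= lee_fin ger0_norm ?sqr_ge0// /overflow.
    by case: ifP => // _; rewrite expr0n sqr_ge0.
rewrite integral0 in h; have e20 : 0 < e ^+ 2 by rewrite exprn_gt0.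
have /fine_cvgP[_ /cvgr0Pnorm_lt/(_ _ e20)[N _ HN]] := h.
exists N.+1%:R => // M' NM.
have {}HN := HN N.+1 (leqnSn _).
have i0 : \int[P]_x (overflow f N.+1%:R x ^+ 2) < e ^+ 2.
  by apply: le_lt_trans HN; rewrite /=; exact: ler_norm.
rewrite -(@ler_pXn2r _ 2)// ?nnegrE ?nrm_ge0 ?(ltW e0)// nrm_sqr.
apply: le_trans (ltW i0); apply: le_Rint; [by case: (overflow_sqi M' sf)|by case: (overflow_sqi N.+1%:R sf)|].
move=> x; rewrite /overflow; case: ifP => fM; first by rewrite expr0n sqr_ge0.
by rewrite ifF//; apply/negbTE; move/negbT: fM; rewrite -!ltNge; exact: le_lt_trans.
Qed.

End truncation.

Section law_transfer.
Context d (Omega : measurableType d) (R : realType) (Pr : probability Omega R).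

(** A family with one member, so that the moment lemmas for families also transfer the law of a
    single random vector. *)
Lemma single_indep d' (V : measurableType d') (W : Omega -> V) (m : probability V R) :
  measurable_fun setT W -> (forall B, measurable B -> Pr (W @^-1` B) = m B) ->
  indep_family Pr (fun _ : unit => W) (fun=> m).
Proof.
move=> mW lW; split => // B mB.
rewrite (_ : \bigcap_(i in setT) _ = W @^-1` B tt) ?lW//; last first.
  by apply/seteqP; split => w h; [exact: (h tt)|case].
by rewrite (bigD1 tt)//= big1 ?mule1// => -[].
Qed.

Lemma ae_fst d1 d2 (S : measurableType d1) (T : measurableType d2)
    (P : probability S R) (Q : probability T R) (p : S -> Prop) :
  {ae P, forall x, p x} -> {ae ((P \x Q)%E : probability _ R), forall z, p z.1}.
Proof.
move=> [A [mA A0 pA]]; exists (A `*` setT); split.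
- exact: measurableX.
- apply: etrans (product_measure1E P Q mA measurableT) _.
  by apply: etrans (congr1 (fun x => x * Q setT)%E A0) _; rewrite mul0e.
- by move=> z pz; split => //; exact: pA.
Qed.

End law_transfer.

Section rows.
Context d d' (Omega : measurableType d) (U : measurableType d') (R : realType).
Context (Pr : probability Omega R) (P Q : probability U R).
Variables (X Y : nat -> {RV Pr >-> U}).
Hypotheses (iX : iid P X) (iY : iid Q Y) (iXY : independent_seqs X Y).

Lemma XY_indep i j : indep_family Pr (fun _ : unit => fun w => (X i w, Y j w))
  (fun=> (P \x Q)%E : probability _ R).
Proof.
pose N := (maxn i j).+1.
have iN : (i < N)%N by rewrite ltnS leq_maxl.
have jN : (j < N)%N by rewrite ltnS leq_maxr.
have mW : measurable_fun setT (fun w => (X i w, Y j w)) by exact: measurable_fun_pair.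
apply: single_indep => // B mB.
(* The transposition of i and j sends i to j, so [(X i, Y j)] is one of the pairs matched by it. *)
have := indep_prob (pair_indep iX iY iXY (tperm (Ordinal iN) (Ordinal jN))) (Ordinal iN) mB.
by rewrite tpermL.
Qed.

Lemma X_indep i : indep_family Pr (fun _ : unit => X i : Omega -> U) (fun=> P).
Proof. by apply: single_indep => // B mB; exact: (iX.1 i B mB). Qed.

Lemma XY_sqi i j (g : U * U -> R) : sqi (P \x Q)%E g -> sqi Pr (fun w => g (X i w, Y j w)).
Proof. exact: (indep_sqi (XY_indep i j) (i := tt)). Qed.

Lemma XY_nrm i j (g : U * U -> R) : sqi (P \x Q)%E g ->
  nrm Pr (fun w => g (X i w, Y j w)) = nrm (P \x Q)%E g.
Proof. exact: (indep_nrm (XY_indep i j) (i := tt)). Qed.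

Lemma X_sqi i (f : U -> R) : sqi P f -> sqi Pr (fun w => f (X i w)).
Proof. exact: (indep_sqi (X_indep i) (i := tt)). Qed.

Lemma X_nrm i (f : U -> R) : sqi P f -> nrm Pr (fun w => f (X i w)) = nrm P f.
Proof. exact: (indep_nrm (X_indep i) (i := tt)). Qed.

Lemma XYY_indep i j j' : j != j' ->
  indep_family Pr (fun _ : unit => fun w => ((X i w, Y j w), Y j' w))
    (fun=> ((P \x Q) \x Q)%E : probability _ R).
Proof.
move=> jj; have mW : measurable_fun setT (fun w => (X i w, Y j w)) by exact: measurable_fun_pair.
have mW3 : measurable_fun setT (fun w => ((X i w, Y j w), Y j' w)) by exact: measurable_fun_pair.
apply: single_indep => // C mC.
pose N := (maxn i (maxn j j')).+1.
have iN : (i < N)%N by rewrite ltnS leq_maxl.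
have jN : (j < N)%N by rewrite ltnS (leq_trans (leq_maxl _ _) (leq_maxr _ _)).
have j'N : (j' < N)%N by rewrite ltnS (leq_trans (leq_maxr _ _) (leq_maxr _ _)).
have box A B D : measurable A -> measurable B -> measurable D ->
    (Pr (X i @^-1` A `&` Y j @^-1` B `&` Y j' @^-1` D) = P A * Q B * Q D)%E.
  move=> mA mB mD.
  pose E (k : 'I_N + 'I_N) := match k with
    | inl a => if a == Ordinal iN then A else setT
    | inr b => if b == Ordinal jN then B else if b == Ordinal j'N then D else setT end.
  have mE k : measurable (E k) by case: k => k /=; do 2?case: ifP.
  have j'j : (Ordinal j'N == Ordinal jN) = false.
    by apply/negbTE; apply: contra jj => /eqP[->].
  have := (sample_indep iX iY iXY N).2 E mE.
  rewrite (_ : \bigcap_(k in setT) _ = X i @^-1` A `&` Y j @^-1` B `&` Y j' @^-1` D); last first.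
    apply/seteqP; split => w.
      move=> h; have := h (inl (Ordinal iN)) Logic.I; have := h (inr (Ordinal jN)) Logic.I.
      have := h (inr (Ordinal j'N)) Logic.I; rewrite /sample /= !eqxx j'j.
      by [].
    move=> -[[h1 h2] h3] [a|b] _ /=; first by case: eqP => // ->.
    by case: eqP => [->//|_]; case: eqP => // ->.
  move=> ->; rewrite big_sumType/= (bigD1 (Ordinal iN))//= eqxx big1 ?mule1; last first.
    by move=> a /negPf ->; exact: probability_setT.
  rewrite (bigD1 (Ordinal jN))//= (bigD1 (Ordinal j'N))/=; last by rewrite j'j.
  rewrite !eqxx j'j big1 ?mule1 ?muleA//.
  by move=> b /andP[/negPf -> /negPf ->]; exact: probability_setT.
have law2 A D : measurable A -> measurable D ->
    (Pr ((fun w => (X i w, Y j w)) @^-1` A `&` Y j' @^-1` D) = (P \x Q) A * Q D)%E.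
  move=> mA mD.
  have mYD : measurable (Y j' @^-1` D) by rewrite -[X in measurable X]setTI; exact: measurable_funP.
  have QD : Q D = (fine (Q D))%:E by rewrite fineK//; exact: fin_num_measure.
  rewrite muleC QD.
  apply: (product_measure_unique_scaled
    (m := measure_function_pushforward__canonical__measure_function_Measure (mrestr Pr mYD) mW)) => //.
    exact: fine_ge0.
  move=> A1 A2 mA1 mA2; rewrite -QD muleC -box//.
have := @product_measure_unique _ _ _ _ _ ((P \x Q)%E : probability _ R) Q
  (measure_function_pushforward__canonical__measure_function_Measure Pr mW3) _ C mC.
move=> h; apply/esym; apply: h => A D mA mD.
exact: law2.
Qed.

(** Given [X i] and [Y j], integrating over the independent [Y j'] leaves the projection of g at
    [X i], which is null. *)
Lemma XYY_orth (g : U * U -> R) i j j' : sqi (P \x Q)%E g ->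
  opAs Q g (cst 1) = cst 0 %[ae P] -> j != j' ->
  inner Pr (fun w => g (X i w, Y j w)) (fun w => g (X i w, Y j' w)) = 0.
Proof.
move=> sg g0 jj; have ind := XYY_indep i jj.
pose F (z : U * U * U) := g z.1 * g (z.1.1, z.2).
have mg : measurable_fun setT g by case: sg.
have mF : measurable_fun setT F.
  apply: measurable_funM; first exact: (measurableT_comp mg).
  have m2 : measurable_fun setT (fun z : U * U * U => (z.1.1, z.2)).
    apply: measurable_fun_pair => //; exact: (measurableT_comp measurable_fst measurable_fst).
  exact: (measurableT_comp mg m2).
have iFP : Pr.-integrable setT (EFin \o fun w => F ((X i w, Y j w), Y j' w)).
  exact: (sqiM (XY_sqi i j sg) (XY_sqi i j' sg)).
have iF : ((P \x Q) \x Q)%E.-integrable setT (EFin \o F).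
  apply/integrableP; split; first exact/measurable_EFinP.
  have /integrableP[_] := iFP; apply: le_lt_trans.
  have mW := proj1 ind tt.
  have := @ge0_integral_comp_ext _ _ _ Pr _ _ (fun w => ((X i w, Y j w), Y j' w)) ((P \x Q) \x Q)%E (cst 1) 1 mW.
  have nF : measurable_fun setT (fun z => `|F z|) by exact: measurableT_comp.
  move=> /(_ _ _ _ _ (fun z => `|F z|) nF (fun z => normr_ge0 _)).
  rewrite mul1e; under eq_integral do rewrite mulr1.
  move=> h; rewrite le_eqVlt; apply/orP; left; apply/eqP/esym; apply: h => //.
  move=> B mB; rewrite mul1e -(indep_prob ind tt mB).
  under eq_integral do rewrite mulr1.
  rewrite integral_indic ?setIT//.
  by rewrite -[X in measurable X]setTI; exact: mW.
rewrite /inner; transitivity (\int[((P \x Q) \x Q)%E]_z F z).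
  exact: (proj2 (indep_Rint ind (i := tt) iF)).
have [iI ->] := Rfubini iF.
rewrite -(Rint_cst (P \x Q)%E 0); apply: ae_eq_Rint => //.
  by apply/measurable_EFinP; exact: measurable_int iI.
have h1 := ae_fst Q (sqi_section sg); have h2 := ae_fst Q g0.
apply: filterS2 h1 h2 => z sz gz _; rewrite /F /=.
rewrite RintegralZl//; last exact: sqi_int.
have := gz Logic.I; rewrite /opAs /=; under eq_Rintegral do rewrite mul1r.
by move=> ->; rewrite mulr0.
Qed.

(* The summands are uncorrelated given [X i]. *)
Lemma row_mean (g : U * U -> R) N i : (0 < N)%N -> sqi (P \x Q)%E g ->
  opAs Q g (cst 1) = cst 0 %[ae P] ->
  sqi Pr (fun w => N%:R^-1 * \sum_(j < N) g (X i w, Y j w)) /\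
  nrm Pr (fun w => N%:R^-1 * \sum_(j < N) g (X i w, Y j w)) ^+ 2 = nrm (P \x Q)%E g ^+ 2 / N%:R.
Proof.
move=> N0 sg g0; have s1 (j : 'I_N) := XY_sqi i j sg.
split; first by apply: sqiZ; apply: sqi_sum => j _; exact: s1.
rewrite (@eq_nrm _ _ _ _ _ (fun w => \sum_(j < N) N%:R^-1 * g (X i w, Y j w))); last first.
  by move=> w; rewrite mulr_sumr.
rewrite (@orthogonal_nrm _ _ _ _ _ predT (fun (j : 'I_N) w => g (X i w, Y j w)) (fun=> N%:R^-1))//; last first.
  by move=> j j' jj; exact: XYY_orth.
under eq_bigr do rewrite innerE XY_nrm//.
rewrite sumr_const card_ord -mulr_natl; field.
by rewrite pnatr_eq0 -lt0n.
Qed.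

End rows.

Lemma sum_cauchy_schwarz (R : realFieldType) (I : finType) (x y : I -> R) :
  (\sum_i x i * y i) ^+ 2 <= (\sum_i x i ^+ 2) * \sum_i y i ^+ 2.
Proof.
have : 0 <= \sum_i \sum_j (x i * y j - x j * y i) ^+ 2.
  by apply: sumr_ge0 => i _; apply: sumr_ge0 => j _; exact: sqr_ge0.
have -> : \sum_i \sum_j (x i * y j - x j * y i) ^+ 2 =
    2 * ((\sum_i x i ^+ 2) * \sum_i y i ^+ 2) - 2 * (\sum_i x i * y i) ^+ 2.
  have E : (\sum_i x i ^+ 2) * (\sum_i y i ^+ 2) = \sum_i \sum_j x i ^+ 2 * y j ^+ 2.
    by rewrite mulr_suml; apply: eq_bigr => i _; rewrite mulr_sumr.
  have E' : (\sum_i x i ^+ 2) * (\sum_i y i ^+ 2) = \sum_i \sum_j x j ^+ 2 * y i ^+ 2.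
    by rewrite E exchange_big.
  rewrite [2 * (_ * _)]mulr_natl mulr2n {1}E E' -big_split/=.
  rewrite [(\sum_i x i * y i) ^+ 2]expr2 mulr_suml mulr_sumr -sumrB; apply: eq_bigr => i _.
  rewrite !mulr_sumr -big_split/= -sumrB; apply: eq_bigr => j _.
  by ring.
by lra.
Qed.

(** * Averages and maxima over one sample *)

Section one_sample.
Context d d' (Omega : measurableType d) (U : measurableType d') (R : realType).
Context (Pr : probability Omega R) (P : probability U R).
Variables (X : nat -> {RV Pr >-> U}).
Hypotheses (iX : iid P X).

Lemma iid_indep N : indep_family Pr (fun i : 'I_N => X i : Omega -> U) (fun=> P).
Proof. by split => // B mB; exact: iid_bigcap. Qed.

Definition avg (f : U -> R) N (w : Omega) : R := N%:R^-1 * \sum_(i < N) f (X i w).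

Lemma avg_sqi f N : sqi P f -> sqi Pr (avg f N).
Proof.
move=> sf; apply: sqiZ; apply: sqi_sum => i _.
exact: (indep_sqi (iid_indep N) (i := i)).
Qed.

Lemma avg_nrm f N : (0 < N)%N -> sqi P f -> \int[P]_x f x = 0 ->
  nrm Pr (avg f N) ^+ 2 = nrm P f ^+ 2 / N%:R.
Proof.
move=> N0 sf f0; rewrite nrmZ; last first.
  by apply: sqi_sum => i _; exact: (indep_sqi (iid_indep N) (i := i)).
rewrite exprMn (indep_sum_nrm (iid_indep N) (f := fun=> f))//.
rewrite sumr_const card_ord -mulr_natl real_normK ?num_real//; field.
by rewrite pnatr_eq0 -lt0n.
Qed.

Lemma avg_int f N : (0 < N)%N -> P.-integrable setT (EFin \o f) ->
  Pr.-integrable setT (EFin \o avg f N) /\ \int[Pr]_w avg f N w = \int[P]_x f x.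
Proof.
move=> N0 intf; have h i := indep_Rint (iid_indep N) (i := i) intf.
have iS : Pr.-integrable setT (EFin \o fun w => \sum_(i < N) f (X i w)).
  by apply: integrable_Rsum => i _; exact: (h i).1.
split; first exact: integrable_RZl.
rewrite /avg RintegralZl// Rintegral_sum; last by move=> i _; exact: (h i).1.
rewrite (eq_bigr (fun=> \int[P]_x f x)); last by move=> i _; exact: (h i).2.
rewrite sumr_const card_ord -[X in _ * X]mulr_natl mulKf//.
by rewrite pnatr_eq0 -lt0n.
Qed.

Lemma avg_sqr_small f : sqi P f -> \int[P]_x f x = 0 -> small Pr (fun N w => avg f N w ^+ 2).
Proof.
move=> sf f0.
have := small_sum_sqr (I := fun=> unit) (F := fun N _ => avg f N) (Pr := Pr) (m := nrm P f ^+ 2).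
have E (N : nat) w : \sum_(i : unit) avg f N w ^+ 2 = avg f N w ^+ 2.
  by rewrite (bigD1 tt)//= big1 ?addr0// => -[].
move=> h; have {}h : small Pr (fun N w => \sum_(i : unit) avg f N w ^+ 2).
  apply: h => [N _ _|N N0]; first exact: avg_sqi.
  by rewrite (bigD1 tt)//= big1 ?addr0 ?avg_nrm// => -[].
by apply: small_le h => N w _; rewrite E.
Qed.

Lemma sqi_sqrt_norm (u : U -> R) : P.-integrable setT (EFin \o u) -> sqi P (fun x => Num.sqrt `|u x|).
Proof.
move=> intu; have mu : measurable_fun setT u by apply/measurable_EFinP; exact: measurable_int intu.
split.
  have ms : measurable_fun setT (@Num.sqrt R) by apply: continuous_measurable_fun; exact: sqrt_continuous.
  by apply: (measurableT_comp ms); exact: measurableT_comp.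
under eq_fun do rewrite sqr_sqrtr//.
exact: (integrable_norm intu).
Qed.

(** Only integrability is available, as u will be a product of two square integrable functions.
    Truncating the square root of [|u|] in L^2 truncates u in L^1. *)
Lemma wlln (u : U -> R) : P.-integrable setT (EFin \o u) ->
  small Pr (fun N w => `|avg u N w - \int[P]_x u x|).
Proof.
move=> intu b e b0 e0; have mu : measurable_fun setT u by apply/measurable_EFinP; exact: measurable_int intu.
have sq := sqi_sqrt_norm intu; set q := fun x => _ in sq.
(* The first bound controls the change of the mean by truncation, the second makes Markov's
   inequality for the truncated part cost at most [e / 4]. *)
pose eps : R := Num.min (b / 4) (e * b / 16).
have eps0 : 0 < eps by rewrite lt_min !divr_gt0 ?mulr_gt0.
have se0 : 0 < Num.sqrt eps by rewrite sqrtr_gt0.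
have [M M0 /(_ M (lexx _)) HM] := overflow_small sq se0.
have {HM} HM : nrm P (overflow q M) ^+ 2 <= eps.
  by rewrite -[leRHS]sqr_sqrtr ?(ltW eps0)// lerXn2r ?nnegrE ?nrm_ge0 ?sqrtr_ge0 ?HM ?sqrtr_gt0.
pose v x := if q x <= M then u x else 0.
have mq : measurable_fun setT q by case: sq.
have mv : measurable_fun setT v.
  by apply: measurable_fun_ifT => //; exact: measurable_fun_ler.
have vM x : `|v x| <= M ^+ 2.
  rewrite /v; case: ifP => [qM|_]; last by rewrite normr0 sqr_ge0.
  by rewrite -[leLHS]sqr_sqrtr// lerXn2r ?nnegrE ?sqrtr_ge0 ?(ltW M0).
have sv := bounded_sqi P mv vM; have iv := sqi_int sv.
have uvE x : `|u x - v x| = overflow q M x ^+ 2.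
  rewrite /v /overflow (@ger0_norm _ (q x)) ?sqrtr_ge0//; case: ifP => _.
    by rewrite subrr normr0 expr0n.
  by rewrite subr0 sqr_sqrtr.
have iuv : P.-integrable setT (EFin \o fun x => `|u x - v x|) by exact: (integrable_norm (integrable_RB intu iv)).
have Iuv : \int[P]_x `|u x - v x| <= eps.
  by apply: le_trans HM; rewrite nrm_sqr; under eq_Rintegral do rewrite uvE.
pose c := \int[P]_x v x.
have cE : `|c - \int[P]_x u x| <= eps.
  rewrite distrC /c -RintegralB//; apply: le_trans Iuv.
  apply: le_normr_Rintegral => //; exact: integrable_RB.
pose vc x := v x - c.
have svc : sqi P vc by apply: sqiB => //; exact: sqi_cst.
have vc0 : \int[P]_x vc x = 0.
  rewrite /vc RintegralB//; last by apply: sqi_int; exact: sqi_cst.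
  by rewrite Rint_cst subrr.
have b40 : 0 < b / 4 by rewrite divr_gt0.
have [N1 H1] := avg_sqr_small svc vc0 (exprn_gt0 2 b40) (divr_gt0 e0 (ltr0Sn R 1)).
exists (maxn 1 N1) => N; rewrite geq_max => /andP[N0 NN1].
have [ia Ia] := avg_int N0 iuv.
have H2 : pbound Pr [set w | b / 4 <= avg (fun x => `|u x - v x|) N w] (eps / (b / 4)).
  apply: pbound_markov => //; last by rewrite Ia.
  by move=> w; rewrite mulr_ge0 ?invr_ge0// sumr_ge0.
apply: pboundW (pboundU (H1 N NN1) H2).
  move=> w /= bw.
  case: (ltP (b / 4) (avg (fun x => `|u x - v x|) N w)) => [/ltW|a1]; first by right.
  left => /=; rewrite -[ltRHS]real_normK ?num_real// ltrXn2r ?nnegrE ?(ltW b40)//.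
  have avgD : avg u N w - \int[P]_x u x = avg vc N w + (c - \int[P]_x u x) + avg (fun x => u x - v x) N w.
    rewrite /avg /vc !sumrB sumr_const card_ord -[c *+ N]mulr_natl; field.
    by rewrite pnatr_eq0 -lt0n.
  have n1 := ler_normD (avg vc N w + (c - \int[P]_x u x)) (avg (fun x => u x - v x) N w).
  have n2 := ler_normD (avg vc N w) (c - \int[P]_x u x).
  have n3 : `|avg (fun x => u x - v x) N w| <= avg (fun x => `|u x - v x|) N w.
    rewrite /avg normrM ger0_norm ?invr_ge0// ler_wpM2l ?invr_ge0//.
    exact: ler_norm_sum.
  have e1 : eps <= b / 4 by rewrite ge_min lexx.
  rewrite -avgD in n1; lra.
have e1 : eps <= e * b / 16 by rewrite ge_min lexx orbT.
have : eps / (b / 4) <= e / 4 by rewrite ler_pdivrMr//; lra.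
lra.
Qed.

(** A union bound over N values, each exceeding a multiple of [sqrt N]. Chebyshev's inequality is
    applied to the part of f above M, whose norm is small; the rest cannot reach this level for
    large N. *)
Lemma sup_small (f : U -> R) : sqi P f ->
  small Pr (fun N w => (\big[Num.max/0]_(i < N) (`|f (X i w)| / Num.sqrt N%:R)) ^+ 2).
Proof.
move=> sf b e b0 e0.
have b20 : 0 < Num.sqrt b by rewrite sqrtr_gt0.
have m0 : 0 < Num.sqrt (e * b) by rewrite sqrtr_gt0 mulr_gt0.
have [M M0 HM] := overflow_small sf m0.
have {}HM := HM M (lexx _).
exists (maxn 1 (Num.bound ((M / Num.sqrt b) ^+ 2))) => N; rewrite geq_max => /andP[N0 NM].
have NR : 0 < N%:R :> R by rewrite ltr0n.
have so := overflow_sqi M sf.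
have sN0 : 0 < Num.sqrt N%:R :> R by rewrite sqrtr_gt0.
pose eta := Num.sqrt b * Num.sqrt N%:R.
have eta0 : 0 < eta by rewrite mulr_gt0.
have Meta : M <= eta.
  rewrite /eta mulrC -ler_pdivrMr// -(@ler_pXn2r _ 2)// ?nnegrE ?divr_ge0 ?sqrtr_ge0 ?(ltW M0)//.
  rewrite sqr_sqrtr//; apply: le_trans (ltW (archi_boundP _)) _; first exact: sqr_ge0.
  by rewrite ler_nat.
have one (i : 'I_N) : pbound Pr [set w | eta <= `|overflow f M (X i w)|] (e / N%:R).
  exists [set w | eta <= `|overflow f M (X i w)|]; split => //.
    rewrite -[X in measurable X]setTI; apply: measurable_fun_le => //.
    by apply: measurableT_comp => //; case: (X_sqi iX i so).
  apply: le_trans (chebyshev (X_sqi iX i so) eta0) _; rewrite lee_fin (X_nrm iX)//.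
  rewrite /eta expr_div_n exprMn (sqr_sqrtr (ltW b0)) (sqr_sqrtr (ler0n R N)).
  rewrite ler_pdivrMr ?mulr_gt0//.
  rewrite (_ : e / _ * _ = e * b); last by field; rewrite gt_eqF.
  have eb : 0 <= e * b by rewrite mulr_ge0 ?ltW.
  by rewrite -(sqr_sqrtr eb) lerXn2r ?nnegrE ?nrm_ge0 ?sqrtr_ge0.
have := pbound_sum one; rewrite sumr_const card_ord -[_ *+ N]mulr_natl.
rewrite (_ : N%:R * (e / N%:R) = e); last by field; rewrite gt_eqF.
apply: pboundW => // w /= bw; apply: contrapT => h.
have : (\big[Num.max/0]_(i < N) (`|f (X i w)| / Num.sqrt N%:R)) <= Num.sqrt b.
  apply: bigmax_le; first exact: ltW.
  move=> i _; rewrite ler_pdivrMr// leNgt; apply/negP => fi; apply: h; exists i.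
  rewrite /overflow ifF; first exact: ltW fi.
  by apply/negbTE; rewrite -ltNge; exact: le_lt_trans Meta fi.
move=> le; move: bw; rewrite ltNge => /negP; apply.
rewrite -[leRHS]sqr_sqrtr ?(ltW b0)// lerXn2r ?nnegrE ?sqrtr_ge0//.
by elim/big_ind : _ => // x y x0 y0; rewrite le_max x0.
Qed.

End one_sample.

Lemma sqr_sum3_le (R : realDomainType) (x y z : R) :
  (x + y + z) ^+ 2 <= 3 * (x ^+ 2 + y ^+ 2 + z ^+ 2).
Proof.
rewrite -subr_ge0 (_ : _ - _ = (x - y) ^+ 2 + (y - z) ^+ 2 + (x - z) ^+ 2); last by ring.
by rewrite !addr_ge0 ?sqr_ge0.
Qed.

Lemma tail_leZ d (Omega : measurableType d) (R : realType) (Pr : probability Omega R)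
    (Z : nat -> Omega -> R) (b e c : R) : 0 < c -> tail_le Pr Z b e ->
  tail_le Pr (fun N w => c * Z N w) (c * b) e.
Proof.
move=> c0 [N0 H]; exists N0 => N N0N; apply: pboundW (H N N0N) => // w /=.
by rewrite ltr_pM2l.
Qed.

Section small_averages.
Context d (Omega : measurableType d) (R : realType) (Pr : probability Omega R).

Lemma small_inv : small Pr (fun N _ => N%:R^-1).
Proof.
move=> b e b0 e0; exists (Num.bound b^-1) => N bN; exists set0; split => //.
  move=> w /=; rewrite ltNge => /negP; apply.
  rewrite -[leRHS]invrK lef_pV2 ?posrE ?invr_gt0//.
    by apply: le_trans (ltW (archi_boundP _)) _; rewrite ?ler_nat// invr_ge0 ltW.
  have : b^-1 < N%:R.
    by apply: lt_le_trans (archi_boundP _) _; rewrite ?ler_nat// invr_ge0 ltW.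
  by apply: lt_trans; rewrite invr_gt0.
by rewrite measure0 lee_fin ltW.
Qed.

Context d' (U : measurableType d') (P : probability U R) (X : nat -> {RV Pr >-> U}).
Hypothesis iX : iid P X.

Lemma avg_tail (u : U -> R) b m : 0 < b -> (forall x, 0 <= u x) -> P.-integrable setT (EFin \o u) ->
  \int[P]_x u x <= m -> tail_le Pr (avg X u) b (m / b).
Proof.
move=> b0 u0 iu um; exists 1%N => N N0; have [ia Ia] := avg_int iX N0 iu.
apply: (@pboundW _ _ _ _ [set w | b <= avg X u N w]) (lexx _) _; first by move=> w /= /ltW.
apply: pbound_markov => //; last by rewrite Ia.
by move=> w; rewrite mulr_ge0 ?invr_ge0// sumr_ge0.
Qed.

End small_averages.

(** * Empirical versions of the operators *)

Section remainder.
Context d d' (Omega : measurableType d) (U : measurableType d') (R : realType).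
Context (Pr : probability Omega R) (P Q : probability U R).
Variables (X Y : nat -> {RV Pr >-> U}).
Hypotheses (iX : iid P X) (iY : iid Q Y) (iXY : independent_seqs X Y).
Variable h : U * U -> R.
Hypothesis sh : sqi (P \x Q)%E h.

Definition row (g : U * U -> R) N i w : R := N%:R^-1 * \sum_(j < N) g (X i w, Y j w).

Lemma row_sum_nrm g : sqi (P \x Q)%E g -> opAs Q g (cst 1) = cst 0 %[ae P] ->
  (forall N (i : 'I_N), (0 < N)%N -> sqi Pr (row g N i)) /\
  (forall N, (0 < N)%N -> \sum_(i < N) nrm Pr (row g N i) ^+ 2 = nrm (P \x Q)%E g ^+ 2).
Proof.
move=> sg g0; split=> [N i N0|N N0]; first by have [] := row_mean iX iY iXY i N0 sg g0.
rewrite (eq_bigr (fun=> nrm (P \x Q)%E g ^+ 2 / N%:R)); last first.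
  by move=> i _; have [] := row_mean iX iY iXY i N0 sg g0.
rewrite sumr_const card_ord -[_ *+ N]mulr_natl; field.
by rewrite pnatr_eq0 -lt0n.
Qed.

Lemma rows_tail g b m : 0 < b -> sqi (P \x Q)%E g -> opAs Q g (cst 1) = cst 0 %[ae P] ->
  nrm (P \x Q)%E g ^+ 2 <= m ->
  tail_le Pr (fun N w => \sum_(i < N) row g N i w ^+ 2) b (m / b).
Proof.
move=> b0 sg g0 gm; have [s1 s2] := row_sum_nrm sg g0.
apply: (@tail_le_sum_sqr _ _ _ _ (fun N => 'I_N : finType) (fun N i => row g N i)) => // N N0.
by rewrite s2.
Qed.

Lemma rows_tight g : sqi (P \x Q)%E g -> opAs Q g (cst 1) = cst 0 %[ae P] ->
  tight Pr (fun N w => \sum_(i < N) row g N i w ^+ 2).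
Proof.
move=> sg g0; have [s1 s2] := row_sum_nrm sg g0.
apply: (@tight_sum_sqr _ _ _ _ (fun N => 'I_N : finType) (fun N i => row g N i)
  (nrm (P \x Q)%E g ^+ 2)) => [N i N0|N N0].
  exact: s1.
by rewrite s2.
Qed.

Lemma squares_tail b m : 0 < b -> nrm (P \x Q)%E h ^+ 2 <= m ->
  tail_le Pr (fun N w => N%:R ^- 2 * \sum_(p : 'I_N * 'I_N) h (X p.1 w, Y p.2 w) ^+ 2) b (m / b).
Proof.
move=> b0 hm.
have := @tail_le_sum_sqr _ _ _ Pr (fun N => ('I_N * 'I_N)%type : finType)
  (fun N p w => N%:R^-1 * h (X p.1 w, Y p.2 w)) m b b0.
have s1 N (p : 'I_N * 'I_N) := XY_sqi iX iY iXY p.1 p.2 sh.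
move=> H; have {}H := H (fun N p _ => sqiZ _ (s1 N p)).
apply: tail_leW (H _) => //.
  by move=> N w _; rewrite mulr_sumr; apply: ler_sum => p _; rewrite exprMn exprVn.
move=> N N0; rewrite (eq_bigr (fun=> N%:R ^- 2 * nrm (P \x Q)%E h ^+ 2)); last first.
  move=> p _; rewrite (nrmZ _ (s1 N p)).
  by rewrite (XY_nrm iX iY iXY)// exprMn real_normK ?num_real// exprVn.
rewrite sumr_const card_prod card_ord -[_ *+ _]mulr_natl natrM.
rewrite (_ : _ * _ = nrm (P \x Q)%E h ^+ 2)//; field.
by rewrite pnatr_eq0 -lt0n.
Qed.

(** [h(x,y) b(y)] need not be square integrable, so b is truncated. The bounded part, centered in y,
    is covered by [row_mean]; the overflow is handled by the Cauchy-Schwarz inequality along each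
    row, and the change of the image by the Hilbert-Schmidt bound. *)
Lemma remainder_small (b kap : U -> R) : sqi Q b -> sqi P kap -> opAs Q h b = kap %[ae P] ->
  small Pr (fun N w => N%:R^-1 * \sum_(i < N) (row (fun z => h z * b z.2) N i w - kap (X i w)) ^+ 2).
Proof.
move=> sb sk hk e p e0 p0.
pose H := nrm (P \x Q)%E h ^+ 2 + 1.
have H0 : 0 < H by rewrite ltr_wpDl ?sqr_ge0.
(* [c] bounds the average of [h ^ 2] over all pairs outside probability [p / 4]. The size [eps] of
   the overflow is then fitted to [c] and [H]; each of the three terms gets [e / 9], a factor 3
   coming from the square of their sum. *)
pose c := 4 * H / p; have c0 : 0 < c by rewrite !divr_gt0 ?mulr_gt0.
pose eps := Num.min (p / 4 * (e / 9 / c)) (p / 4 * (e / 9) / H).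
have eps0 : 0 < eps by rewrite lt_min !(divr_gt0, mulr_gt0).
have se0 : 0 < Num.sqrt eps by rewrite sqrtr_gt0.
have [M M0 /(_ M (lexx _)) HM] := overflow_small sb se0.
set o := overflow b M in HM; have so : sqi Q o := overflow_sqi M sb.
have {}HM : nrm Q o ^+ 2 <= eps.
  by rewrite -(sqr_sqrtr (ltW eps0)) lerXn2r ?nnegrE ?nrm_ge0 ?sqrtr_ge0.
pose bM y := b y - o y.
have mb : measurable_fun setT b by case: sb.
have mbM : measurable_fun setT bM by apply: measurable_funB => //; case: so.
have bMM y : `|bM y| <= M.
  by rewrite /bM /o /overflow; case: ifP => ?; rewrite ?subr0// subrr normr0 ltW.
have sbM : sqi Q bM := bounded_sqi Q mbM bMM.
pose kM := opAs Q h bM; have skM : sqi P kM := sqi_opAs sh sbM.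
pose g z := h z * bM z.2 - kM z.1.
have shb : sqi (P \x Q)%E (fun z => h z * bM z.2).
  have mb2 : measurable_fun setT (fun z : U * U => bM z.2) by exact: (measurableT_comp mbM measurable_snd).
  have := sqi_bM mb2 (fun z => bMM z.2) sh.
  by under eq_fun do rewrite mulrC.
have sg : sqi (P \x Q)%E g by apply: sqiB => //; exact: sqi_fst.
have g0 : opAs Q g (cst 1) = cst 0 %[ae P].
  apply: filterS (sqi_section sh) => x sx _; rewrite /opAs /g /=.
  under eq_Rintegral do rewrite mul1r.
  rewrite RintegralB//; [|exact: sqiM|exact: sqi_int (sqi_cst Q _)].
  rewrite Rint_cst /kM /opAs; apply/eqP; rewrite subr_eq0; apply/eqP.
  by apply: eq_Rintegral => y _; rewrite mulrC.
have sd : sqi P (fun x => kM x - kap x) by exact: sqiB.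
have dE : nrm P (fun x => kM x - kap x) ^+ 2 <= H * eps.
  rewrite (@eq_ae_nrm _ _ _ _ _ (fun x => - opAs Q h o x)).
  - rewrite nrmN; apply: (@le_trans _ _ ((nrm (P \x Q)%E h * nrm Q o) ^+ 2)).
      by rewrite lerXn2r ?nnegrE ?mulr_ge0 ?nrm_ge0//; exact: nrm_opAs.
    by rewrite exprMn ler_pM ?sqr_ge0// lerDl.
  - by case: sd.
  - by case: (sqiN (sqi_opAs sh so)).
  apply: filterS2 hk (sqi_section sh) => x kx sx _; rewrite -kx// /kM /opAs /bM.
  under eq_Rintegral do rewrite mulrBl.
  by rewrite RintegralB//; [ring|exact: sqiM|exact: sqiM].
have b1 := @avg_tail _ _ _ Pr _ _ P X iX (fun x => (kM x - kap x) ^+ 2) (e / 9) (H * eps).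
have {}b1 : tail_le Pr (avg X (fun x => (kM x - kap x) ^+ 2)) (e / 9) (p / 4).
  apply: tail_leW (b1 _ _ _ _) => //; rewrite ?divr_gt0//.
  - rewrite ler_pdivrMr ?divr_gt0// mulrC -ler_pdivlMr//.
    by rewrite ge_min lexx orbT.
  - by move=> x; exact: sqr_ge0.
  - by case: sd.
  - by rewrite -nrm_sqr.
have b2 := @avg_tail _ _ _ Pr _ _ Q Y iY (fun y => o y ^+ 2) (e / 9 / c) eps.
have {}b2 : tail_le Pr (avg Y (fun y => o y ^+ 2)) (e / 9 / c) (p / 4).
  have ec0 : 0 < e / 9 / c by apply: divr_gt0 c0; rewrite divr_gt0.
  apply: tail_leW (b2 ec0 _ _ _) => //.
  - by rewrite (ler_pdivrMr _ _ ec0) ge_min lexx.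
  - by move=> x; exact: sqr_ge0.
  - by case: so.
  - by rewrite -nrm_sqr.
have b3 : tail_le Pr (fun N w => N%:R ^- 2 * \sum_(q : 'I_N * 'I_N) h (X q.1 w, Y q.2 w) ^+ 2) c (p / 4).
  apply: tail_leW (@squares_tail c H c0 _) => //; last by rewrite /H lerDl.
  by rewrite /c invf_div le_eqVlt; apply/orP; left; apply/eqP; field; rewrite !gt_eqF.
have b4 : tail_le Pr (fun N w => N%:R^-1 * \sum_(i < N) row g N i w ^+ 2) (e / 9) (p / 4).
  have t1 := tight_smallM _ _ (rows_tight sg g0) (@small_inv _ _ _ Pr).
  apply: tail_leW (t1 _ _ (e / 9) (p / 4) _ _); rewrite ?divr_gt0//.
  - by move=> N w _; rewrite mulrC.
  - by move=> N w; apply: sumr_ge0 => i _; exact: sqr_ge0.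
have b23 : tail_le Pr (fun N w => N%:R ^- 2 * (\sum_(q : 'I_N * 'I_N) h (X q.1 w, Y q.2 w) ^+ 2) *
    avg Y (fun y => o y ^+ 2) N w) (e / 9) (p / 4 + p / 4).
  have -> : e / 9 = c * (e / 9 / c) by rewrite [RHS]mulrC divfK// gt_eqF.
  apply: tail_leM b3 b2 => N w; rewrite mulr_ge0 ?invr_ge0 ?exprn_ge0// sumr_ge0// => ? _; exact: sqr_ge0.
have := tail_leZ (ltr0Sn R 2) (tail_leD (tail_leD b4 b23) b1).
apply: tail_leW; [|by rewrite le_eqVlt; apply/orP; left; apply/eqP; field|by rewrite le_eqVlt; apply/orP; left; apply/eqP; field].
move=> N w N0; have NR : N%:R != 0 :> R by rewrite pnatr_eq0 -lt0n.
pose T2 i := N%:R^-1 * \sum_(j < N) h (X i w, Y j w) * o (Y j w).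
have remE i : row (fun z => h z * b z.2) N i w - kap (X i w) = row g N i w + T2 i + (kM (X i w) - kap (X i w)).
  have -> : row g N i w = row (fun z => h z * bM z.2) N i w - kM (X i w).
    have cs : \sum_(j < N) kM (X i w) = N%:R * kM (X i w) by rewrite sumr_const card_ord mulr_natl.
    by rewrite /row /g /= sumrB cs [LHS]mulrBr mulKf.
  have -> : row (fun z => h z * b z.2) N i w = row (fun z => h z * bM z.2) N i w + T2 i.
    rewrite /row /T2 -mulrDr -big_split/=; congr *%R; apply: eq_bigr => j _.
    by rewrite -mulrDr subrK.
  by ring.
have T2le : \sum_(i < N) T2 i ^+ 2 <= N%:R * (N%:R ^- 2 * (\sum_(q : 'I_N * 'I_N) h (X q.1 w, Y q.2 w) ^+ 2) *
    avg Y (fun y => o y ^+ 2) N w).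
  rewrite -(pair_bigA _ (fun i j => h (X (nat_of_ord i) w, Y (nat_of_ord j) w) ^+ 2))/=.
  rewrite /avg [leRHS](_ : _ = \sum_(i < N) N%:R ^- 2 * ((\sum_(j < N) h (X i w, Y j w) ^+ 2) * \sum_(j < N) o (Y j w) ^+ 2)); last first.
    by rewrite -mulr_sumr -mulr_suml; field.
  apply: ler_sum => i _; rewrite /T2 exprMn exprVn ler_wpM2l ?invr_ge0 ?exprn_ge0//.
  exact: (sum_cauchy_schwarz (fun j : 'I_N => h (X i w, Y j w)) (fun j : 'I_N => o (Y j w))).
have sumle : \sum_(i < N) (row (fun z => h z * b z.2) N i w - kap (X i w)) ^+ 2 <=
    3 * (\sum_(i < N) row g N i w ^+ 2 + \sum_(i < N) T2 i ^+ 2 + \sum_(i < N) (kM (X i w) - kap (X i w)) ^+ 2).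
  rewrite -!big_split/= mulr_sumr; apply: ler_sum => i _; rewrite remE.
  move: (row g N i w) (T2 i) (kM (X i w) - kap (X i w)) => x y z.
  exact: sqr_sum3_le.
apply: le_trans (ler_wpM2l _ sumle) _; first by rewrite invr_ge0.
rewrite mulrCA ler_wpM2l// !mulrDr; apply: lerD => //; apply: lerD => //.
by rewrite ler_pdivrMl// ltr0n.
Qed.

End remainder.

(** * Approximate scaling to a doubly stochastic matrix *)

Definition orthosystem d (T : measurableType d) (R : realType) (P : probability T R)
    (a : nat -> T -> R) :=
  [/\ forall k, sqi P (a k), forall j k, j != k -> inner P (a j) (a k) = 0,
      forall k, inner P (a k) (a k) <= 1 & forall k, \int[P]_x a k x = 0].

(** What the scaling uses of [h = xi - 1], with the constant functions split off. The two marginals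
    enter symmetrically, so every estimate for rows also gives the one for columns. *)
Record singular_system d (U : measurableType d) (R : realType) (P Q : probability U R)
    (h : U * U -> R) (sg : nat -> R) (a b : nat -> U -> R) (q H : R) : Prop := SingularSystem {
  ss_sqi : sqi (P \x Q)%E h;
  ss_a : orthosystem P a;
  ss_b : orthosystem Q b;
  ss_sg : forall k, 0 <= sg k <= q;
  ss_q : q < 1;
  ss_H : forall K, \sum_(k < K) sg k ^+ 2 <= H;
  ss_1P : opAs Q h (cst 1) = cst 0 %[ae P];
  ss_1Q : opA P h (cst 1) = cst 0 %[ae Q];
  ss_bP : forall k, opAs Q h (b k) = (fun x => sg k * a k x) %[ae P];
  ss_aQ : forall k, opA P h (a k) = (fun y => sg k * b k y) %[ae Q];
  ss_cvg : cvgL2 (P \x Q)%E (fun K z => \sum_(k < K) sg k * (a k z.1 * b k z.2)) h }.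

Lemma singular_system_swap d (U : measurableType d) (R : realType) (P Q : probability U R)
    h sg a b q H : singular_system P Q h sg a b q H ->
  singular_system Q P (fun z => h (z.2, z.1)) sg b a q H.
Proof.
move=> [sh oa ob sg01 q1 sgH p1 q1' bP aQ hc]; split => //; first exact: sqi_swap.
move=> e e0; have [N HN] := hc e e0; exists N => n Nn.
apply: le_trans (HN n Nn); rewrite -(nrm_swap P Q).
  rewrite le_eqVlt; apply/orP; left; apply/eqP; apply: eq_nrm => z /=; congr (_ - _).
    by apply: eq_bigr => k _; rewrite [b k _ * _]mulrC.
apply: measurable_funB; last by case: sh.
apply: measurable_Rsum => k _; apply: measurable_funM => //.
by case: oa => /(_ k) sa _ _ _; case: ob => /(_ k) sb _ _ _; case: (sqi_tensor sa sb).
Qed.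

Section correction.
Context d d' (Omega : measurableType d) (U : measurableType d') (R : realType).
Context (Pr : probability Omega R) (P Q : probability U R).
Variables (X Y : nat -> {RV Pr >-> U}).
Hypotheses (iX : iid P X) (iY : iid Q Y) (iXY : independent_seqs X Y).
Variables (h : U * U -> R) (sg : nat -> R) (a b : nat -> U -> R) (q H : R).
Hypothesis ss : singular_system P Q h sg a b q H.

Let sh : sqi (P \x Q)%E h. Proof. exact: ss_sqi ss. Qed.
Let sa k : sqi P (a k). Proof. by case: (ss_a ss). Qed.
Let sb k : sqi Q (b k). Proof. by case: (ss_b ss). Qed.
Let a0 k : \int[P]_x a k x = 0. Proof. by case: (ss_a ss). Qed.
Let b0 k : \int[Q]_x b k x = 0. Proof. by case: (ss_b ss). Qed.

Let na k : nrm P (a k) ^+ 2 <= 1. Proof. by rewrite -innerE; case: (ss_a ss). Qed.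
Let nb k : nrm Q (b k) ^+ 2 <= 1. Proof. by rewrite -innerE; case: (ss_b ss). Qed.

Let q0 : 0 <= q. Proof. by have /andP[] := ss_sg ss 0; exact: le_trans. Qed.
Let H0 : 0 <= H. Proof. by apply: le_trans (ss_H ss 0); rewrite big_ord0. Qed.

(* The coefficients solve [A k + S * V + S * B k = 0] and [B k + S * U + S * A k = 0], where [S = t * sg k] and [U], [V] are the empirical means of [a k], [b k]. *)
Definition coefA t k N w : R := let S := t * sg k in
  (- S * avg Y (b k) N w + S ^+ 2 * avg X (a k) N w) / (1 - S ^+ 2).
Definition coefB t k N w : R := let S := t * sg k in
  (- S * avg X (a k) N w + S ^+ 2 * avg Y (b k) N w) / (1 - S ^+ 2).

Section damped.
Variable t : R.
Hypothesis t01 : 0 <= t <= 1.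

Let S01 k : 0 <= t * sg k <= q.
Proof.
case/andP: t01 => t0 t1; have /andP[s0 s1] := ss_sg ss k.
by rewrite mulr_ge0//= -[q]mul1r ler_pM.
Qed.

Let S2 k : (t * sg k) ^+ 2 <= q ^+ 2.
Proof. by have /andP[s0 s1] := S01 k; rewrite lerXn2r ?nnegrE. Qed.

Let q2 : q ^+ 2 < 1. Proof. by rewrite exprn_ilt1// (ss_q ss). Qed.
Let dS k : 1 - (t * sg k) ^+ 2 != 0. Proof. by rewrite gt_eqF//; have := S2 k; move: q2; lra. Qed.

Lemma coefAE k N w : coefA t k N w + t * sg k * avg Y (b k) N w + t * sg k * coefB t k N w = 0.
Proof. by rewrite /coefA /coefB; field; exact: dS. Qed.

(** Free of [t]: since [t * sg k <= q] for every admissible t, the determinant of the 2 by 2 system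
    is at least [1 - q ^ 2]. *)
Definition bound : R := 2 / (1 - q ^+ 2) ^+ 2.

Lemma coefA_le k N w : coefA t k N w ^+ 2 <=
  bound * sg k ^+ 2 * (avg X (a k) N w ^+ 2 + avg Y (b k) N w ^+ 2).
Proof.
rewrite /coefA; move: (avg Y (b k) N w) (avg X (a k) N w) => v u.
set S := t * sg k; have D0 : 0 < 1 - q ^+ 2 by move: q2; lra.
have DS : 1 - q ^+ 2 <= 1 - S ^+ 2 by have := S2 k; rewrite -/S; lra.
have S2' : S ^+ 2 <= sg k ^+ 2.
  case/andP: t01 => t0 t1; have /andP[s0 _] := ss_sg ss k.
  by rewrite lerXn2r ?nnegrE ?mulr_ge0// ler_piMl.
have S1 : S ^+ 2 <= 1 by have := S2 k; rewrite -/S; move: q2; lra.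
have num : (- S * v + S ^+ 2 * u) ^+ 2 <= 2 * sg k ^+ 2 * (u ^+ 2 + v ^+ 2).
  apply: (@le_trans _ _ (2 * S ^+ 2 * (u ^+ 2 + v ^+ 2))); last first.
    by rewrite ler_wpM2r ?addr_ge0 ?sqr_ge0// ler_wpM2l.
  apply: (@le_trans _ _ (2 * (S ^+ 2 * v ^+ 2 + S ^+ 2 * (S ^+ 2 * u ^+ 2)))).
    rewrite -subr_ge0 (_ : _ - _ = (S * v + S ^+ 2 * u) ^+ 2) ?sqr_ge0//; ring.
  rewrite -mulrA ler_wpM2l// mulrDr addrC lerD2r ler_wpM2l ?sqr_ge0//.
  by rewrite ler_piMl ?sqr_ge0.
rewrite expr_div_n ler_pdivrMr; last by rewrite exprn_gt0//; exact: lt_le_trans DS.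
apply: le_trans num _; rewrite /bound.
rewrite (_ : _ / _ * _ * _ * _ = 2 * sg k ^+ 2 * (u ^+ 2 + v ^+ 2) * ((1 - S ^+ 2) ^+ 2 / (1 - q ^+ 2) ^+ 2)); last first.
  by field; rewrite gt_eqF.
apply: ler_peMr.
  exact: (mulr_ge0 (mulr_ge0 (ler0n R 2) (sqr_ge0 _)) (addr_ge0 (sqr_ge0 _) (sqr_ge0 _))).
rewrite ler_pdivlMr ?exprn_gt0// mul1r lerXn2r ?nnegrE ?(ltW D0)//.
exact: le_trans (ltW D0) DS.
Qed.

Lemma coefA_tail K c : 0 < c ->
  tail_le Pr (fun N w => \sum_(k < K) N%:R * coefA t k N w ^+ 2) c (bound * (H + H) / c).
Proof.
move=> c0; have B0 : 0 <= bound by rewrite divr_ge0 ?exprn_ge0 ?subr_ge0 ?(ltW q2).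
pose F N (p : 'I_K + 'I_K) w : R := Num.sqrt (bound * N%:R) * match p with
  | inl k => sg k * avg X (a k) N w | inr k => sg k * avg Y (b k) N w end.
have sF N p : sqi Pr (F N p).
  by apply: sqiZ; case: p => k; apply: sqiZ; [exact: (avg_sqi iX)|exact: (avg_sqi iY)].
have := @tail_le_sum_sqr _ _ _ Pr (fun _ => ('I_K + 'I_K)%type : finType) F (bound * (H + H)) c c0 (fun N p _ => sF N p).
move=> h'; have {}h' : tail_le Pr (fun N w => \sum_p F N p w ^+ 2) c (bound * (H + H) / c).
  apply: h' => N N0; have NR : 0 < N%:R :> R by rewrite ltr0n.
  rewrite big_sumType/= mulrDr; apply: lerD.
    apply: (@le_trans _ _ (bound * \sum_(k < K) sg k ^+ 2)); last by rewrite ler_wpM2l// (ss_H ss).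
    rewrite mulr_sumr; apply: ler_sum => k _.
    rewrite nrmZ; last by apply: sqiZ; exact: (avg_sqi iX).
    rewrite nrmZ; last exact: (avg_sqi iX).
    rewrite !exprMn (avg_nrm iX N0 (sa k) (a0 k)) !real_normK ?num_real// (sqr_sqrtr (mulr_ge0 B0 (ler0n R N))).
    rewrite -[leRHS]mulr1 [leLHS](_ : _ = bound * sg k ^+ 2 * nrm P (a k) ^+ 2); last by field; rewrite gt_eqF.
    by apply: ler_wpM2l => //; exact: (mulr_ge0 B0 (sqr_ge0 _)).
  apply: (@le_trans _ _ (bound * \sum_(k < K) sg k ^+ 2)); last by rewrite ler_wpM2l// (ss_H ss).
  rewrite mulr_sumr; apply: ler_sum => k _.
  rewrite nrmZ; last by apply: sqiZ; exact: (avg_sqi iY).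
  rewrite nrmZ; last exact: (avg_sqi iY).
  rewrite !exprMn (avg_nrm iY N0 (sb k) (b0 k)) !real_normK ?num_real// (sqr_sqrtr (mulr_ge0 B0 (ler0n R N))).
  rewrite -[leRHS]mulr1 [leLHS](_ : _ = bound * sg k ^+ 2 * nrm Q (b k) ^+ 2); last by field; rewrite gt_eqF.
  by apply: ler_wpM2l => //; exact: (mulr_ge0 B0 (sqr_ge0 _)).
apply: tail_leW h' => // N w N0; rewrite big_sumType/= -big_split/=; apply: ler_sum => k _.
apply: le_trans (ler_wpM2l (ler0n R N) (coefA_le k N w)) _.
have E x y : (Num.sqrt (bound * N%:R) * (x * y)) ^+ 2 = bound * N%:R * (x ^+ 2 * y ^+ 2).
  by rewrite exprMn (sqr_sqrtr (mulr_ge0 B0 (ler0n R N))) exprMn.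
by rewrite !E le_eqVlt; apply/orP; left; apply/eqP; ring.
Qed.

Definition corrA K N i w : R := \sum_(k < K) coefA t k N w * a k (X i w).

Lemma coefA_tight K : tight Pr (fun N w => \sum_(k < K) N%:R * coefA t k N w ^+ 2).
Proof.
move=> e e0; have B0 : 0 <= bound * (H + H).
  by rewrite mulr_ge0 ?addr_ge0// divr_ge0 ?exprn_ge0 ?subr_ge0 ?(ltW q2).
exists ((bound * (H + H) + 1) / e); first by rewrite divr_gt0// ltr_wpDl.
apply: tail_leW (@coefA_tail K _ _) => //; last by rewrite divr_gt0// ltr_wpDl.
by rewrite invf_div mulrCA ler_piMr ?(ltW e0)// ler_pdivrMr ?ltr_wpDl// mul1r lerDl.
Qed.

(** The sum is a quadratic form in the coefficients whose matrix is the empirical Gram matrix of the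
    [a k], and for fixed K that matrix converges. The level and the probability depend on neither K
    nor t, which is essential for the choice of [delta] later on. *)
Lemma corrA_sum_tail K c e : 0 < c -> 0 < e ->
  tail_le Pr (fun N w => \sum_(i < N) corrA K N i w ^+ 2) (c + 1) (bound * (H + H) / c + e).
Proof.
move=> c0 e0.
pose G j k N w : R := `|avg X (fun x => a j x * a k x) N w - inner P (a j) (a k)|.
have sG j k : small Pr (G j k) by apply: (wlln iX); exact: sqiM.
have sT : small Pr (fun N w => (\sum_(k < K) N%:R * coefA t k N w ^+ 2) * \sum_(p : 'I_K * 'I_K) G p.1 p.2 N w).
  apply: tight_smallM; [| |exact: coefA_tight|by apply: small_sum => p; exact: sG].
  - by move=> N w; apply: sumr_ge0 => k _; exact: (mulr_ge0 (ler0n R N) (sqr_ge0 _)).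
  - by move=> N w; apply: sumr_ge0 => p _; exact: normr_ge0.
apply: tail_leW (tail_leD (@coefA_tail K c c0) (sT 1 e ltr01 e0)) => // N w N0.
set A := \sum_(k < K) N%:R * coefA t k N w ^+ 2.
have NR : N%:R != 0 :> R by rewrite pnatr_eq0 -lt0n.
have -> : \sum_(i < N) corrA K N i w ^+ 2 =
   \sum_(j < K) \sum_(k < K) N%:R * (coefA t j N w * coefA t k N w) * avg X (fun x => a j x * a k x) N w.
  transitivity (\sum_(i < N) \sum_(j < K) \sum_(k < K) coefA t j N w * coefA t k N w * (a j (X i w) * a k (X i w))).
    apply: eq_bigr => i _; rewrite expr2 /corrA mulr_suml; apply: eq_bigr => j _.
    by rewrite mulr_sumr; apply: eq_bigr => k _; ring.
  rewrite exchange_big/=; apply: eq_bigr => j _; rewrite exchange_big/=; apply: eq_bigr => k _.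
  by rewrite -mulr_sumr /avg; field.
rewrite [leRHS](_ : _ = A + \sum_(j < K) \sum_(k < K) A * G j k N w); last first.
  congr (_ + _); rewrite mulr_sumr -(pair_bigA _ (fun j k => A * G (nat_of_ord j) (nat_of_ord k) N w)).
  by [].
have diag : \sum_(j < K) \sum_(k < K) N%:R * (coefA t j N w * coefA t k N w) * inner P (a j) (a k) <= A.
  apply: ler_sum => j _; rewrite (bigD1 j)//= big1 ?addr0; last first.
    by move=> k kj; case: (ss_a ss) => _ o _ _; rewrite o ?mulr0// eq_sym.
  have a1 : inner P (a j) (a j) <= 1 by case: (ss_a ss).
  by rewrite -expr2; apply: ler_piMr => //; exact: (mulr_ge0 (ler0n R N) (sqr_ge0 _)).
apply: le_trans (_ : _ <= \sum_(j < K) \sum_(k < K) N%:R * (coefA t j N w * coefA t k N w) * inner P (a j) (a k)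
   + \sum_(j < K) \sum_(k < K) A * G j k N w) _; last by rewrite lerD2r.
rewrite -big_split/=; apply: ler_sum => j _; rewrite -big_split/=; apply: ler_sum => k _.
rewrite -lerBlDl -mulrBr; apply: le_trans (ler_norm _) _; rewrite normrM ler_wpM2r//.
have Ale l : N%:R * coefA t (l : 'I_K) N w ^+ 2 <= A.
  by rewrite /A (bigD1 l)//= lerDl sumr_ge0// => *; exact: (mulr_ge0 (ler0n R N) (sqr_ge0 _)).
rewrite normrM ger0_norm// normrM.
have := Ale j; have := Ale k.
have := sqr_ge0 (`|coefA t j N w| - `|coefA t k N w|).
rewrite sqrrB !real_normK ?num_real//.
move: (`|coefA t j N w| * `|coefA t k N w|) (coefA t j N w ^+ 2) (coefA t k N w ^+ 2) => z x y h1 h2 h3.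
have h4 : z <= (x + y) / 2 by lra.
apply: le_trans (ler_wpM2l (ler0n R N) h4) _; lra.
Qed.

Lemma corrA_sup K : small Pr (fun N w => (\sum_(k < K) N%:R * coefA t k N w ^+ 2) *
   \sum_(k < K) (\big[Num.max/0]_(i < N) (`|a k (X i w)| / Num.sqrt N%:R)) ^+ 2).
Proof.
apply: tight_smallM; [| |exact: coefA_tight|by apply: small_sum => k; exact: (sup_small iX)].
- by move=> N w; apply: sumr_ge0 => k _; exact: (mulr_ge0 (ler0n R N) (sqr_ge0 _)).
- by move=> N w; apply: sumr_ge0 => k _; rewrite sqr_ge0.
Qed.

(** The Cauchy-Schwarz inequality, with a factor [sqrt N] moved from the functions to the
    coefficients: the first sum is tight, the second tends to 0. The corrections thus become
    uniformly small in i. *)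
Lemma corrA_le K N (i : 'I_N) w : corrA K N i w ^+ 2 <= (\sum_(k < K) N%:R * coefA t k N w ^+ 2) *
   \sum_(k < K) (\big[Num.max/0]_(i < N) (`|a k (X i w)| / Num.sqrt N%:R)) ^+ 2.
Proof.
have N0 : (0 < N)%N by case: (N) i => // -[].
have NR : 0 < N%:R :> R by rewrite ltr0n.
have sN : 0 < Num.sqrt N%:R :> R by rewrite sqrtr_gt0.
rewrite /corrA (eq_bigr (fun k : 'I_K => (Num.sqrt N%:R * coefA t k N w) * (a k (X i w) / Num.sqrt N%:R))); last first.
  by move=> k _; field; rewrite gt_eqF.
apply: le_trans (sum_cauchy_schwarz _ _) _.
rewrite (eq_bigr (fun k : 'I_K => N%:R * coefA t k N w ^+ 2)); last first.
  by move=> k _; rewrite exprMn sqr_sqrtr.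
rewrite ler_wpM2l//; first by apply: sumr_ge0 => k _; exact: (mulr_ge0 (ler0n R N) (sqr_ge0 _)).
apply: ler_sum => k _; rewrite -[leLHS]real_normK ?num_real// lerXn2r ?nnegrE//.
  by elim/big_ind : _ => // x y x0 y0; rewrite le_max x0.
rewrite normrM (@ger0_norm _ (Num.sqrt N%:R)^-1) ?invr_ge0 ?sqrtr_ge0//.
exact: (le_bigmax _ (fun i : 'I_N => `|a k (X i w)| / Num.sqrt N%:R) i).
Qed.

End damped.
End correction.

Lemma sqr_sum4_le (R : realDomainType) (x y z u : R) :
  (x + y + z + u) ^+ 2 <= 4 * (x ^+ 2 + y ^+ 2 + z ^+ 2 + u ^+ 2).
Proof.
rewrite -subr_ge0 (_ : _ - _ = (x - y) ^+ 2 + (y - z) ^+ 2 + (x - z) ^+ 2 +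
  (x - u) ^+ 2 + (y - u) ^+ 2 + (z - u) ^+ 2); last by ring.
by rewrite !addr_ge0 ?sqr_ge0.
Qed.

Lemma independent_seqs_sym d d' (Omega : measurableType d) (U : measurableType d') (R : realType)
    (Pr : probability Omega R) (X Y : nat -> {RV Pr >-> U}) :
  independent_seqs X Y -> independent_seqs Y X.
Proof. by move=> iXY E F sE sF; rewrite setIC iXY// muleC. Qed.

Section row_errors.
Context d d' (Omega : measurableType d) (U : measurableType d') (R : realType).
Context (Pr : probability Omega R) (P Q : probability U R).
Variables (X Y : nat -> {RV Pr >-> U}).
Hypotheses (iX : iid P X) (iY : iid Q Y) (iXY : independent_seqs X Y).
Variables (h : U * U -> R) (sg : nat -> R) (a b : nat -> U -> R) (q H : R).
Hypothesis ss : singular_system P Q h sg a b q H.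
Variable t : R.
Hypothesis t01 : 0 <= t <= 1.

Let sh : sqi (P \x Q)%E h. Proof. exact: ss_sqi ss. Qed.
Let sa k : sqi P (a k). Proof. by case: (ss_a ss). Qed.
Let sb k : sqi Q (b k). Proof. by case: (ss_b ss). Qed.
Let b0 k : \int[Q]_x b k x = 0. Proof. by case: (ss_b ss). Qed.
Let ss' := singular_system_swap ss.

Local Notation A := (coefA X Y sg a b t).
Local Notation B := (coefA Y X sg b a t).
Local Notation corrX := (corrA X Y sg a b t).
Local Notation corrY := (corrA Y X sg b a t).

Definition row_error K N i w : R :=
  1 - N%:R^-1 * \sum_(j < N) (1 + t * h (X i w, Y j w)) * (1 + corrX K N i w + corrY K N j w).

Let hK K z : R := \sum_(k < K) sg k * (a k z.1 * b k z.2).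
Let rem l N i w : R := row X Y (fun z => h z * b l z.2) N i w - sg l * a l (X i w).

Let hK_sqi K : sqi (P \x Q)%E (hK K).
Proof. by apply: sqi_sum => k _; apply: sqiZ; exact: sqi_tensor. Qed.

(** The four terms are the mean of the column corrections, the part of h beyond K, the product of a
    correction with a row mean, and the deviation of empirical images from [sg l * a l]. All terms
    of first order in the retained eigenfunctions have cancelled. *)
Let row_errorE K N i w : (0 < N)%N -> - row_error K N i w =
  (\sum_(l < K) B l N w * avg Y (b l) N w) + t * row X Y (fun z => h z - hK K z) N i w +
  t * (corrX K N i w * row X Y h N i w) + t * \sum_(l < K) B l N w * rem l N i w.
Proof.
move=> N0; have NR : N%:R != 0 :> R by rewrite pnatr_eq0 -lt0n.
pose mY := N%:R^-1 * \sum_(j < N) corrY K N j w.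
have e1 : mY = \sum_(l < K) B l N w * avg Y (b l) N w.
  rewrite /mY exchange_big/= mulr_sumr; apply: eq_bigr => l _.
  by rewrite -mulr_sumr /avg mulrCA.
have e2 : row X Y (fun z => h z - hK K z) N i w = row X Y h N i w -
    \sum_(l < K) sg l * a l (X i w) * avg Y (b l) N w.
  rewrite /row sumrB mulrBr; congr (_ - _); rewrite exchange_big/= mulr_sumr.
  apply: eq_bigr => l _; rewrite /avg mulrCA; congr *%R; rewrite mulr_sumr.
  by apply: eq_bigr => j _; rewrite mulrA.
have e3 : N%:R^-1 * \sum_(j < N) h (X i w, Y j w) * corrY K N j w =
    \sum_(l < K) B l N w * (rem l N i w + sg l * a l (X i w)).
  rewrite /rem; under [RHS]eq_bigr do rewrite subrK.
  rewrite (eq_bigr (fun j : 'I_N => \sum_(l < K) B l N w * (h (X i w, Y j w) * b l (Y j w)))); last first.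
    by move=> j _; rewrite /corrA mulr_sumr; apply: eq_bigr => l _; ring.
  rewrite exchange_big/= mulr_sumr; apply: eq_bigr => l _.
  by rewrite /row -mulr_sumr mulrCA.
(* The defining equation of the coefficients, multiplied by [a l (X i)] and summed over l. *)
have key : corrX K N i w + t * (\sum_(l < K) sg l * a l (X i w) * avg Y (b l) N w) +
    t * \sum_(l < K) B l N w * (sg l * a l (X i w)) = 0.
  rewrite /corrA !mulr_sumr -!big_split/= big1// => l _.
  have := coefAE X Y ss t01 l N w; rewrite -[coefB _ _ _ _ _ _ _ _ _]/(B l N w) => E.
  transitivity (a l (X i w) * (A l N w + t * sg l * avg Y (b l) N w + t * sg l * B l N w)).
    by move: (A l N w) (B l N w) => x y; ring.
  by rewrite E mulr0.
rewrite /row_error opprB.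
have -> : N%:R^-1 * (\sum_(j < N) (1 + t * h (X i w, Y j w)) * (1 + corrX K N i w + corrY K N j w)) =
    1 + corrX K N i w + mY + t * row X Y h N i w + t * (corrX K N i w * row X Y h N i w) +
    t * (N%:R^-1 * \sum_(j < N) h (X i w, Y j w) * corrY K N j w).
  have cs (c : R) : N%:R^-1 * \sum_(j < N) c = c by rewrite sumr_const card_ord -[c *+ N]mulr_natl mulKf.
  rewrite (eq_bigr (fun j : 'I_N => 1 + corrX K N i w + corrY K N j w + t * h (X i w, Y j w) +
      t * (corrX K N i w * h (X i w, Y j w)) + t * (h (X i w, Y j w) * corrY K N j w))); last first.
    by move=> j _; ring.
  rewrite 4!big_split/= 4!mulrDr cs -/mY -!mulr_sumr /row.
  by ring.
rewrite e3 -e1 e2; under [X in _ + t * X - _]eq_bigr do rewrite mulrDr.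
by rewrite big_split/= ; lra.
Qed.

Let hK_row K : opAs Q (fun z => h z - hK K z) (cst 1) = cst 0 %[ae P].
Proof.
apply: filterS2 (ss_1P ss) (sqi_section sh) => x /(_ Logic.I) hx sx _; rewrite -[RHS](subr0 (cst 0 x)) -hx.
rewrite /opAs /=; under eq_Rintegral do rewrite mulrBr.
have sk : sqi Q (fun y => hK K (x, y)).
  by rewrite /hK /=; apply: sqi_sum => k _; apply: sqiZ; apply: sqiZ.
rewrite RintegralB//; [|by under eq_fun do rewrite mul1r; exact: sqi_int|
   by under eq_fun do rewrite mul1r; exact: sqi_int].
congr (_ - _); under eq_Rintegral do rewrite mul1r.
rewrite /hK /= Rintegral_sum => [|k _]; last by apply: sqi_int; apply: sqiZ; exact: sqiZ.
rewrite big1// => k _.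
rewrite (_ : (fun y => _) = (fun y => sg k * a k x * b k y)); last by apply/funext => y; rewrite mulrA.
by rewrite RintegralZl ?b0 ?mulr0//; exact: sqi_int.
Qed.

(** Only the part of h beyond K does not vanish with N; it is made small by K. The other three terms
    are each a tight factor times a small one for fixed K. *)
Lemma row_error_tail c e : 0 < c -> 0 < e -> exists K0, forall K, (K0 <= K)%N ->
  tail_le Pr (fun N w => \sum_(i < N) row_error K N i w ^+ 2) c e.
Proof.
move=> c0 e0; pose m := e / 2 * (c / 8).
have m0 : 0 < m by rewrite !(mulr_gt0, divr_gt0).
have sm0 : 0 < Num.sqrt m by rewrite sqrtr_gt0.
have [K0 HK] := ss_cvg ss sm0; exists K0 => K KK.
pose SB N w := \sum_(l < K) N%:R * B l N w ^+ 2.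
have SB0 N w : 0 <= SB N w by apply: sumr_ge0 => l _; exact: (mulr_ge0 (ler0n R N) (sqr_ge0 _)).
have tB : tight Pr SB := coefA_tight iY iX ss' t01 K.
have t1 : small Pr (fun N w => SB N w * \sum_(l < K) avg Y (b l) N w ^+ 2).
  apply: (tight_smallM SB0 _ tB) => [N w|]; first by apply: sumr_ge0 => l _; exact: sqr_ge0.
  by apply: small_sum => l; exact: (avg_sqr_small iY).
have t4 : small Pr (fun N w => SB N w * \sum_(l < K) (N%:R^-1 * \sum_(i < N) rem l N i w ^+ 2)).
  apply: (tight_smallM SB0 _ tB) => [N w|].
    by apply: sumr_ge0 => l _; rewrite mulr_ge0 ?invr_ge0// sumr_ge0// => i _; exact: sqr_ge0.
  apply: small_sum => l; exact: (remainder_small iX iY iXY sh (sb l) (sqiZ (sg l) (sa l)) (ss_bP ss l)).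
pose SA N w := (\sum_(k < K) N%:R * A k N w ^+ 2) *
   \sum_(k < K) (\big[Num.max/0]_(i < N) (`|a k (X i w)| / Num.sqrt N%:R)) ^+ 2.
have SA0 N w : 0 <= SA N w.
  rewrite mulr_ge0// sumr_ge0// => k _; last exact: sqr_ge0.
  exact: (mulr_ge0 (ler0n R N) (sqr_ge0 _)).
have t3 : small Pr (fun N w => (\sum_(i < N) row X Y h N i w ^+ 2) * SA N w).
  apply: tight_smallM => //.
  - by move=> N w; apply: sumr_ge0 => i _; exact: sqr_ge0.
  - exact: (rows_tight iX iY iXY sh (ss_1P ss)).
  - exact: (corrA_sup iX iY ss t01).
have sd : sqi (P \x Q)%E (fun z => h z - hK K z) by exact: sqiB.
have dm : nrm (P \x Q)%E (fun z => h z - hK K z) ^+ 2 <= m.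
  rewrite -(sqr_sqrtr (ltW m0)) lerXn2r ?nnegrE ?nrm_ge0 ?sqrtr_ge0//.
  apply: le_trans (HK K KK); rewrite -nrmN le_eqVlt; apply/orP; left; apply/eqP.
  by apply: eq_nrm => z; rewrite opprB.
have c80 : 0 < c / 8 by rewrite divr_gt0.
have t2 := rows_tail iX iY iXY c80 sd (hK_row K) dm.
have small3 := smallD (smallD t1 t3) t4.
have e20 : 0 < e / 2 by rewrite divr_gt0.
have := tail_leZ (ltr0Sn R 3) (tail_leD t2 (small3 (c / 8) (e / 2) c80 e20)).
apply: tail_leW; last 2 first.
- by rewrite (_ : 4 * _ = c); last by field.
- by rewrite /m mulfK ?gt_eqF// -splitr.
move=> N w N0; have NR : N%:R != 0 :> R by rewrite pnatr_eq0 -lt0n.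
have tle x : (t * x) ^+ 2 <= x ^+ 2.
  by case/andP: t01 => ? ?; rewrite exprMn ler_piMl ?sqr_ge0// exprn_ile1.
have one (i : 'I_N) : row_error K N i w ^+ 2 <= 4 * (
   (\sum_(l < K) B l N w * avg Y (b l) N w) ^+ 2 + row X Y (fun z => h z - hK K z) N i w ^+ 2 +
   (corrX K N i w * row X Y h N i w) ^+ 2 + (\sum_(l < K) B l N w * rem l N i w) ^+ 2).
  rewrite -sqrrN row_errorE//; apply: le_trans (sqr_sum4_le _ _ _ _) _.
  by rewrite ler_wpM2l// !lerD.
apply: le_trans (ler_sum _ (fun i _ => one i)) _.
rewrite -mulr_sumr ler_wpM2l// !big_split/=.
have u1 : \sum_(i < N) (\sum_(l < K) B l N w * avg Y (b l) N w) ^+ 2 <=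
    SB N w * \sum_(l < K) avg Y (b l) N w ^+ 2.
  rewrite sumr_const card_ord -[_ *+ N]mulr_natl /SB -mulr_sumr -mulrA ler_wpM2l//.
  exact: (sum_cauchy_schwarz (fun l : 'I_K => B l N w) (fun l : 'I_K => avg Y (b l) N w)).
have u3 : \sum_(i < N) (corrX K N i w * row X Y h N i w) ^+ 2 <= (\sum_(i < N) row X Y h N i w ^+ 2) * SA N w.
  rewrite mulr_suml; apply: ler_sum => i _; rewrite exprMn mulrC ler_wpM2l ?sqr_ge0//.
  exact: corrA_le.
have u4 : \sum_(i < N) (\sum_(l < K) B l N w * rem l N i w) ^+ 2 <=
    SB N w * \sum_(l < K) (N%:R^-1 * \sum_(i < N) rem l N i w ^+ 2).
  rewrite /SB -!mulr_sumr -mulrA mulrCA mulVKf// exchange_big/= mulr_sumr; apply: ler_sum => i _.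
  exact: (sum_cauchy_schwarz (fun l : 'I_K => B l N w) (fun l : 'I_K => rem l N i w)).
by lra.
Qed.

End row_errors.

Section singular_of_eigen.
Context d (U : measurableType d) (R : realType) (P Q : probability U R).
Variables (xi : U * U -> R) (s : nat -> R) (alpha beta : nat -> U -> R).
Hypothesis sxi : sqi (P \x Q)%E xi.
Hypothesis ed : eigen_decomposition P Q xi s alpha beta.
Hypotheses (s_le : forall k, (1 <= k)%N -> s k <= s 1%N) (s1 : s 1%N < 1).

Let ca : complete_orthonormal P alpha. Proof. exact: (ed_co ed).1. Qed.
Let cb : complete_orthonormal Q beta. Proof. exact: (ed_co ed).2. Qed.

Local Notation sg k := (sing P Q xi alpha beta k.+1).

Lemma eigen_swap : eigen_decomposition Q P (fun z => xi (z.2, z.1)) s beta alpha.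
Proof.
case: ed => [[s0 a0 b0] s01 [oa ob] h1 h2]; split => //.
- by move=> k; have [e1 e2] := h1 k.
- by move=> k; have [e1 e2] := h2 k.
Qed.

Lemma sing_swap k : sing Q P (fun z => xi (z.2, z.1)) beta alpha k = sing P Q xi alpha beta k.
Proof.
have mF : measurable_fun setT (fun z => xi z * tensor alpha beta k k z).
  by apply: measurable_funM; [case: sxi|case: (tensor_sqi ca cb k k)].
rewrite /sing /coef /inner -(Rintegral_swap P Q mF).
by apply: eq_Rintegral => z _; rewrite /tensor /= [_ * alpha _ _]mulrC.
Qed.

Lemma orthosystem_tail (M : probability U R) (c : nat -> U -> R) :
  complete_orthonormal M c -> c 0%N = cst 1 -> orthosystem M (fun k => c k.+1).
Proof.
move=> cc c0; split => [k|j k jk|k|k].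
- exact: (co_sqi cc).
- by apply: (co_orth cc).
- exact: (co_le1 cc).
- rewrite -[RHS](@co_orth _ _ _ _ _ cc k.+1 0%N)// c0 /inner.
  by apply: eq_Rintegral => x _; rewrite mulr1.
Qed.

Lemma opAs_shift g c : sqi Q g -> {ae P, forall x,
  opAs Q (fun z => xi z - c) g x = opAs Q xi g x - c * \int[Q]_y g y}.
Proof.
move=> sgg; apply: filterS (sqi_section sxi) => x sx; rewrite /opAs.
rewrite -RintegralZl//; last exact: sqi_int.
rewrite -RintegralB//; [|exact: sqiM|by apply: sqi_int; exact: sqiZ].
by apply: eq_Rintegral => y _; rewrite mulrBr [c * _]mulrC.
Qed.

Lemma singular_left : opAs Q (fun z => xi z - 1) (cst 1) = cst 0 %[ae P] /\
  forall k, opAs Q (fun z => xi z - 1) (beta k.+1) = (fun x => sg k * alpha k.+1 x) %[ae P].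
Proof.
case: (ed) => [[s0 a0 b0] s01 _ _ h2]; split=> [|k].
  have [_ e] := h2 0%N; apply: filterS2 (opAs_shift 1 (sqi_cst Q 1)) e => x -> /(_ Logic.I) e _.
  by rewrite Rint_cst mulr1 -b0 e s0 a0 mulr1 subrr.
have [_ e] := h2 k.+1.
(* [s] and [sing] can differ only where the eigenfunction is null, and there both sides vanish. *)
have E : (fun x => s k.+1 * alpha k.+1 x) = (fun x => sg k * alpha k.+1 x) %[ae P].
  rewrite /sing (coef_xiE sxi ed); case: (ca) => _ _ /(_ k.+1)[->|h0] _.
    by apply: aeW => x _; rewrite mulr1.
  by apply: filterS h0 => x /= h0 _; rewrite h0// !mulr0.
have [_ _ _ m0] := orthosystem_tail cb (ed_beta0 ed).
apply: filterS3 (opAs_shift 1 (co_sqi cb k.+1)) e E => x -> /(_ Logic.I) -> /(_ Logic.I) <- _.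
by rewrite m0 mulr0 subr0.
Qed.

End singular_of_eigen.

Section singular.
Context d (U : measurableType d) (R : realType) (P Q : probability U R).
Variables (xi : U * U -> R) (s : nat -> R) (alpha beta : nat -> U -> R).
Hypothesis sxi : sqi (P \x Q)%E xi.
Hypothesis ed : eigen_decomposition P Q xi s alpha beta.
Hypotheses (s_le : forall k, (1 <= k)%N -> s k <= s 1%N) (s1 : s 1%N < 1).

Let ca : complete_orthonormal P alpha. Proof. exact: (ed_co ed).1. Qed.
Let cb : complete_orthonormal Q beta. Proof. exact: (ed_co ed).2. Qed.

Lemma singular_of_eigen : singular_system P Q (fun z => xi z - 1)
  (fun k => sing P Q xi alpha beta k.+1) (fun k => alpha k.+1) (fun k => beta k.+1)
  (s 1%N) (nrm (P \x Q)%E xi ^+ 2).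
Proof.
have [l1 l2] := singular_left sxi ed.
have [r1 r2] := singular_left (sqi_swap sxi) (eigen_swap ed).
split => //.
- by apply: sqiB => //; exact: sqi_cst.
- exact: orthosystem_tail ca (ed_alpha0 ed).
- exact: orthosystem_tail cb (ed_beta0 ed).
- move=> k; rewrite (sing_ge0 sxi ed)/=.
  rewrite -(@ler_pXn2r _ 2)// ?nnegrE ?(s_ge0 ed) ?(sing_ge0 sxi ed)//.
  exact: (sing_sqr sxi ed s_le).
- by move=> K; exact: (sing_sum sxi ed).
- by move=> k; apply: filterS (r2 k) => y h _; rewrite -(sing_swap sxi ed) -h.
move=> e e0; have [N HN] := damp_cvg sxi ed 1 e0; exists N => K NK.
apply: le_trans (HN K NK); rewrite le_eqVlt; apply/orP; left; apply/eqP; apply: eq_nrm => z.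
rewrite (tensor_sum_xi sxi ed) /damp !mul1r.
rewrite (bigD1 None)//= (ed_alpha0 ed) (ed_beta0 ed) !mulr1.
rewrite (_ : \sum_(k < K) _ = \sum_(c : option 'I_K | c != None) (ext (fun k : 'I_K => sing P Q xi alpha beta k.+1) c * (alpha (idx c) z.1 * beta (idx c) z.2))); last first.
  rewrite [RHS](reindex_omap Some id)/=; first by apply: eq_bigl => k; rewrite eqxx.
  by case.
by rewrite /ext; ring.
Qed.

End singular.

(** * Lower tail of the denominator *)

Section mean_total.
Context d d' (Omega : measurableType d) (U : measurableType d') (R : realType).
Context (Pr : probability Omega R) (P Q : probability U R).
Variables (X Y : nat -> {RV Pr >-> U}).
Hypotheses (iX : iid P X) (iY : iid Q Y) (iXY : independent_seqs X Y).
Variables (alpha beta : nat -> U -> R).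
Hypotheses (ca : complete_orthonormal P alpha) (cb : complete_orthonormal Q beta).
Hypotheses (alpha0 : alpha 0%N = cst 1) (beta0 : beta 0%N = cst 1).
Variables (sg : nat -> R) (h : U * U -> R) (H : R).
Hypothesis sh : sqi (P \x Q)%E h.
Hypothesis sgH : forall K, \sum_(k < K) sg k ^+ 2 <= H.
Hypothesis hc : cvgL2 (P \x Q)%E (fun K z => \sum_(k < K) sg k * (alpha k.+1 z.1 * beta k.+1 z.2)) h.

(** Expanded, the total is a sum of orthogonal products of one function of an [X i] and one of a
    [Y j]. There are [N ^ 2] of them for each k, with coefficient [sg k / N], so N cancels. *)
Lemma total_nrm N : (0 < N)%N ->
  sqi Pr (fun w => N%:R^-1 * \sum_(p : 'I_N * 'I_N) h (X p.1 w, Y p.2 w)) /\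
  nrm Pr (fun w => N%:R^-1 * \sum_(p : 'I_N * 'I_N) h (X p.1 w, Y p.2 w)) ^+ 2 <= H.
Proof.
move=> N0; have NR : N%:R != 0 :> R by rewrite pnatr_eq0 -lt0n.
pose hK K z := \sum_(k < K) sg k * (alpha k.+1 z.1 * beta k.+1 z.2).
have shK K : sqi (P \x Q)%E (hK K).
  by apply: sqi_sum => k _; apply: sqiZ; apply: sqi_tensor; [exact: (co_sqi ca)|exact: (co_sqi cb)].
have s1 g i j : sqi (P \x Q)%E g -> sqi Pr (fun w => g (X i w, Y j w)) := XY_sqi iX iY iXY i j (g := g).
have s2 g : sqi (P \x Q)%E g -> sqi Pr (fun w => N%:R^-1 * \sum_(p : 'I_N * 'I_N) g (X p.1 w, Y p.2 w)).
  by move=> gg; apply: sqiZ; apply: sqi_sum => p _; exact: s1.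
split; first exact: s2.
have c1 : cvgL2 Pr (fun K w => N%:R^-1 * \sum_(p : 'I_N * 'I_N) hK K (X p.1 w, Y p.2 w))
    (fun w => N%:R^-1 * \sum_(p : 'I_N * 'I_N) h (X p.1 w, Y p.2 w)).
  apply: cvgL2Z; [by move=> K; apply: sqi_sum => p _; exact: s1|by apply: sqi_sum => p _; exact: s1|].
  apply: (@cvgL2_sum _ _ _ _ _ predT (fun (p : 'I_N * 'I_N) K w => hK K (X p.1 w, Y p.2 w))
    (fun p w => h (X p.1 w, Y p.2 w))) => [p K|p|p]; [exact: s1|exact: s1|].
  move=> e e0; have [n Hn] := hc e0; exists n => K nK.
  have -> := @XY_nrm _ _ _ _ _ _ _ _ _ _ iX iY iXY p.1 p.2 (fun z => hK K z - h z) (sqiB (shK K) sh).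
  exact: Hn.
apply: (cvgL2_nrm_le (fun K => s2 _ (shK K)) (s2 _ sh) c1) => K.
pose single (i : 'I_N) (k : 'I_K) : {ffun 'I_N -> option 'I_K} := [ffun j => if j == i then Some k else None].
have single_inj i k i' k' : single i k = single i' k' -> i = i' /\ k = k'.
  move=> /ffunP /(_ i); rewrite !ffunE eqxx; case: eqP => // -> [->].
  by [].
(* Products with a single nontrivial position on each side, so the orthogonality of the chaos
   applies. *)
pose F (p : 'I_K * ('I_N * 'I_N)) := chaos (basisX X alpha (N := N)) (basisY Y beta (N := N)) (single p.2.1 p.1) (single p.2.2 p.1).
have FE p w : F p w = alpha p.1.+1 (X p.2.1 w) * beta p.1.+1 (Y p.2.2 w).
  case: p => k [i j]; rewrite /F /chaos /= (bigD1 i)//= [X in _ * X](bigD1 j)//= !ffunE !eqxx /basisX /basisY /=.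
  rewrite !big1 ?mulr1// => l /negPf lj; rewrite ffunE lj /= ?beta0 ?alpha0//.
have E w : N%:R^-1 * \sum_(p : 'I_N * 'I_N) hK K (X p.1 w, Y p.2 w) =
    \sum_(p : 'I_K * ('I_N * 'I_N)) (N%:R^-1 * sg p.1) * F p w.
  rewrite /hK exchange_big/= mulr_sumr -(pair_bigA _ (fun k p => N%:R^-1 * sg (nat_of_ord k) * F (k, p) w))/=.
  apply: eq_bigr => k _; rewrite mulr_sumr; apply: eq_bigr => p _.
  by rewrite FE /= -mulrA.
rewrite (eq_nrm _ E) (@orthogonal_nrm _ _ _ _ _ predT F (fun p => N%:R^-1 * sg p.1)).
- apply: (@le_trans _ _ (\sum_(p : 'I_K * ('I_N * 'I_N)) N%:R ^- 2 * sg p.1 ^+ 2)).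
    apply: ler_sum => p _; rewrite exprMn exprVn; apply: ler_piMr.
      by apply: (mulr_ge0 _ (sqr_ge0 _)); rewrite invr_ge0 exprn_ge0.
    exact: (sample_chaos_le1 iX iY iXY ca cb).
  rewrite -(pair_bigA _ (fun (k : 'I_K) (_ : 'I_N * 'I_N) => N%:R ^- 2 * sg k ^+ 2))/=.
  rewrite (eq_bigr (fun k : 'I_K => sg k ^+ 2)); first exact: sgH.
  move=> k _; rewrite sumr_const card_prod card_ord -[_ *+ _]mulr_natl natrM.
  by field.
- by move=> p; exact: (sample_chaos_sqi iX iY iXY ca cb).
- move=> p p' pp; apply: (sample_chaos_orth iX iY iXY ca cb (p := (_, _)) (p' := (_, _))).
  apply: contra pp => /eqP[/single_inj[e1 e2] /single_inj[e3 _]].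
  by apply/eqP; move: e1 e2 e3; case: p p' => [k [i j]] [k' [i' j']] /= -> -> ->.
Qed.

End mean_total.

Section lower_tail.
Context d d' (Omega : measurableType d) (U : measurableType d') (R : realType).
Context (Pr : probability Omega R) (P Q : probability U R).
Variables (X Y : nat -> {RV Pr >-> U}).
Hypotheses (iX : iid P X) (iY : iid Q Y) (iXY : independent_seqs X Y).
Variables (xi : U * U -> R) (s : nat -> R) (alpha beta : nat -> U -> R).
Hypothesis sxi : sqi (P \x Q)%E xi.
Hypothesis ed : eigen_decomposition P Q xi s alpha beta.
Hypotheses (s_le : forall k, (1 <= k)%N -> s k <= s 1%N) (s1 : s 1%N < 1).
Hypothesis xi0 : {ae (P \x Q)%E, forall z, 0 <= xi z}.

Let h z := xi z - 1.
Let sh : sqi (P \x Q)%E h. Proof. by apply: sqiB => //; exact: sqi_cst. Qed.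
Let ss := singular_of_eigen sxi ed s_le s1.
Let ss' := singular_system_swap ss.
Let iYX := independent_seqs_sym iXY.
Local Notation sg := (fun k => sing P Q xi alpha beta k.+1).
Local Notation a := (fun k => alpha k.+1).
Local Notation b := (fun k => beta k.+1).
Local Notation q := (s 1%N).
Local Notation H := (nrm (P \x Q)%E xi ^+ 2).

Lemma negative_null N : pbound Pr [set w | exists p : 'I_N * 'I_N, xi (X p.1 w, Y p.2 w) < 0] 0.
Proof.
have one (p : 'I_N * 'I_N) : pbound Pr [set w | xi (X p.1 w, Y p.2 w) < 0] 0.
  have [B [mB B0 nB]] := xi0.
  have mW := (XY_indep iX iY iXY p.1 p.2).1 tt.
  exists ((fun w => (X p.1 w, Y p.2 w)) @^-1` B); split.
  - by rewrite -[X in measurable X]setTI; exact: mW.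
  - by move=> w /= xw; apply: nB => /=; apply/negP; rewrite -ltNge.
  - rewrite (indep_prob (XY_indep iX iY iXY p.1 p.2) tt mB).
    by rewrite [leLHS]B0.
have := pbound_sum one; rewrite big1//.
Qed.

Lemma total_tight : tight Pr (fun N w => `|N%:R^-1 * \sum_(p : 'I_N * 'I_N) h (X p.1 w, Y p.2 w)|).
Proof.
have hc := ss_cvg ss.
have T N (N0 : (0 < N)%N) := total_nrm iX iY iXY (ed_co ed).1 (ed_co ed).2 (ed_alpha0 ed) (ed_beta0 ed) sh (ss_H ss) hc N0.
have t2 := @tight_sum_sqr _ _ _ Pr (fun=> unit : finType) (fun N _ w => N%:R^-1 * \sum_(p : 'I_N * 'I_N) h (X p.1 w, Y p.2 w)) H.
have {}t2 : tight Pr (fun N w => \sum_(i : unit) (N%:R^-1 * \sum_(p : 'I_N * 'I_N) h (X p.1 w, Y p.2 w)) ^+ 2).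
  apply: t2 => [N _ N0|N N0]; first exact: (T N N0).1.
  by rewrite sumr_const card_unit; exact: (T N N0).2.
apply: tight_le (tightD t2 (@tight_cst _ _ _ Pr 1)) => N w _.
rewrite sumr_const card_unit mulr1n.
move: (N%:R^-1 * _) => x; rewrite -[x ^+ 2]real_normK ?num_real//.
by have := sqr_ge0 (`|x| - 1); have := normr_ge0 x; rewrite sqrrB; lra.
Qed.

Lemma den_sqi N f : sqi (P \x Q)%E f -> sqi Pr (T_den f X Y N).
Proof.
move=> sf; have ff : cvgL2 (P \x Q)%E (fun _ : nat => f) f; last first.
  by have [_ sd _] := den_cvg iX iY iXY N (fun _ : nat => sf) sf ff.
by move=> e e0; exists 0%N => n _; rewrite (@eq_nrm _ _ _ _ _ (cst 0)) ?nrm_cst ?normr0 ?ltW// => x; rewrite subrr.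
Qed.

Lemma damp_den_lower N K t eta w : (0 < N)%N -> 0 <= t <= 1 -> 0 < 1 - t ->
  eta <= ((1 - t) / 8) ^+ 2 -> (1 + 2 / (1 - t)) * eta <= 1 ->
  (forall i j : 'I_N, 0 <= xi (X i w, Y j w)) ->
  (forall i : 'I_N, `|corrA X Y sg a b t K N i w| <= 4^-1) ->
  (forall j : 'I_N, `|corrA Y X sg b a t K N j w| <= 4^-1) ->
  \sum_(i < N) row_error X Y h sg a b t K N i w ^+ 2 +
    \sum_(j < N) row_error Y X (fun z => h (z.2, z.1)) sg b a t K N j w ^+ 2 <= eta / 6 + eta / 6 ->
  expR (- (`|N%:R^-1 * \sum_(p : 'I_N * 'I_N) h (X p.1 w, Y p.2 w)| +
     (\sum_(i < N) row X Y h N i w ^+ 2 + \sum_(j < N) row Y X (fun z => h (z.2, z.1)) N j w ^+ 2) +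
     2 * (\sum_(i < N) corrA X Y sg a b t K N i w ^+ 2 + \sum_(j < N) corrA Y X sg b a t K N j w ^+ 2) + 1))
  <= T_den (damp xi t) X Y N w.
Proof.
move=> N0 /andP[t0 t1] k0 eta1 eta2 xiw cX4 cY4 n2.
have NR : 0 < N%:R :> R by rewrite ltr0n.
pose z (i j : 'I_N) := t * h (X i w, Y j w).
pose cX (i : 'I_N) := corrA X Y sg a b t K N i w.
pose cY (j : 'I_N) := corrA Y X sg b a t K N j w.
pose eX (i : 'I_N) := row_error X Y h sg a b t K N i w.
pose eY (j : 'I_N) := row_error Y X (fun z => h (z.2, z.1)) sg b a t K N j w.
have zc i j : 1 - t <= 1 + z i j by have := mulr_ge0 t0 (xiw i j); rewrite /z /h; lra.
have fE j : 1 - N%:R^-1 * \sum_i (1 + z i j) * (1 + cX i + cY j) - N%:R^-1 * \sum_i eX i = eY j - N%:R^-1 * \sum_i eX i.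
  congr (1 - _ * _ - _); apply: eq_bigr => i _; congr (_ * _).
  by rewrite addrAC.
have mE : N%:R * (N%:R^-1 * \sum_i eX i) ^+ 2 <= \sum_i eX i ^+ 2.
  have := sum_cauchy_schwarz (fun=> 1) eX; rewrite (eq_bigr eX); last by move=> i _; rewrite mul1r.
  rewrite (eq_bigr (fun=> 1 : R) (P := predT) (F1 := fun i : 'I_N => _ ^+ 2)); last by move=> i _; exact: expr1n.
  rewrite sumr_const card_ord => cs.
  rewrite exprMn exprVn mulrA (_ : N%:R * N%:R ^- 2 = N%:R^-1); last by field; rewrite gt_eqF.
  by rewrite ler_pdivrMl.
have pl := permanent_lower N0 (z := z) (a := cX) (b := cY) (c := 1 - t) k0 zc cX4 cY4.
move: pl => /=; set E := (X in X <= _ -> _).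
(* Subtracting the mean row error from the column errors gives
   [E <= 3 * (row part) + 2 * (column part)], and the two parts together are at most [eta / 3]. *)
have E3 : E <= eta.
  apply: (@le_trans _ _ (\sum_i eX i ^+ 2 + (2 * \sum_j eY j ^+ 2 + 2 * \sum_i eX i ^+ 2))).
    rewrite lerD2l; apply: (@le_trans _ _ (\sum_(j < N) (2 * eY j ^+ 2 + 2 * (N%:R^-1 * \sum_i eX i) ^+ 2))).
      apply: ler_sum => j _; rewrite fE; move: (_ * _) (eY j) => x y.
      by have := sqr_ge0 (x + y); rewrite sqrrB sqrrD; lra.
    rewrite big_split/= -mulr_sumr lerD2l sumr_const card_ord -[_ *+ _]mulr_natl mulrCA.
    by apply: ler_wpM2l.
  have eX0 : 0 <= \sum_i eX i ^+ 2 by apply: sumr_ge0 => i _; exact: sqr_ge0.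
  have eY0 : 0 <= \sum_i eY i ^+ 2 by apply: sumr_ge0 => i _; exact: sqr_ge0.
  by move: n2 eX0 eY0; rewrite -/(eX) /=; move: (\sum_i eX i ^+ 2) (\sum_i eY i ^+ 2) => x y; lra.
move=> /(_ (le_trans E3 eta1)) pl; apply: le_trans pl.
have tS (x : R) : 0 <= x -> t ^+ 2 * x <= x.
  by move=> x0; apply: ler_piMl => //; rewrite exprn_ile1.
rewrite ler_expR lerN2; apply: lerD; [apply: lerD => //; apply: lerD|].
- rewrite (_ : \sum_i \sum_j z i j = t * \sum_(p : 'I_N * 'I_N) h (X p.1 w, Y p.2 w)).
    by rewrite mulrCA normrM (@ger0_norm _ t)// ler_piMl.
  by rewrite mulr_sumr -(pair_bigA _ (fun i j => z i j)).
- apply: lerD; apply: ler_sum => i _; rewrite -mulr_sumr mulrCA exprMn; exact: tS (sqr_ge0 _).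
- apply: le_trans eta2; apply: ler_wpM2l => //.
  by rewrite addr_ge0// divr_ge0// ltW.
Qed.

(** The damped denominator is at least [2 * delta] with a [delta] that does not depend on the
    damping, and the undamped one differs from it by less than [delta], both up to small
    probability. *)
Lemma den_lower_tail e : 0 < e -> exists2 delta : R, 0 < delta &
  exists N0, forall N, (N0 <= N)%N -> pbound Pr [set w | T_den xi X Y N w < delta] e.
Proof.
have num (x y : R) : x <= y -> 0 < y -> y + y + (x + y + (x + y)) + (y + y) + (y + y) + (0 + y) <= 16 * y by lra.
have num2 (x y v u v' : R) : 0 <= x -> 0 <= y -> x + y + v <= u + v' -> x + y + 2 * v <= 2 * u + 2 * v' by lra.
have num3 (x y u : R) : - u < x - y -> x < u -> u + u <= y -> False by lra.
move=> e0; pose p := e / 16; have p0 : 0 < p by rewrite divr_gt0.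
have q0 : 0 <= q by exact: (s_ge0 ed).
have [C C0 [dampC _]] := moment_bounds iX iY iXY sxi ed s_le s1.
have [B1 B10 tot1] := total_tight p0.
have [B2 B20 tot2] := tightD (rows_tight iX iY iXY sh (ss_1P ss)) (rows_tight iY iX iYX (ss_sqi ss') (ss_1P ss')) p0.
pose c0 := bound q * (H + H).
have c00 : 0 <= c0.
  rewrite mulr_ge0 ?addr_ge0 ?sqr_ge0// divr_ge0// exprn_ge0// subr_ge0.
  by rewrite exprn_ile1// ltW.
pose c := (c0 + 1) / p; have cp : 0 < c by rewrite divr_gt0// ltr_wpDl.
have cE : c0 / c <= p.
  by rewrite /c invf_div mulrCA ler_piMr ?(ltW p0)// ler_pdivrMr ?ltr_wpDl// mul1r lerDl.
(* The tails are controlled only through the sum of their variables, so the factor 2 of the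
   corrections is put on everything; the last 1 is the share of the scaling error. *)
pose B := 2 * (B1 + B2) + 2 * ((c + 1) + (c + 1)) + 1.
pose delta := expR (- B) / 2.
have d0 : 0 < delta by rewrite divr_gt0 ?expR_gt0.
(* [1 - t]. The second argument makes Chebyshev's inequality at level [delta] cost at most p, by the
   damping bound of [moment_bounds]. *)
pose kap := Num.min (2^-1) (Num.sqrt (p * delta ^+ 2 / (C + 1))).
have C1 : 0 < C + 1 by rewrite ltr_wpDl.
have r0 : 0 < p * delta ^+ 2 / (C + 1) by rewrite divr_gt0// mulr_gt0// exprn_gt0.
have kap0 : 0 < kap by rewrite lt_min invr_gt0 ltr0n sqrtr_gt0.
have kap1 : kap <= 2^-1 by rewrite ge_min lexx.
have kap2 : kap ^+ 2 * C <= p * delta ^+ 2.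
  apply: (@le_trans _ _ (p * delta ^+ 2 / (C + 1) * C)).
    apply: ler_wpM2r => //; rewrite -(sqr_sqrtr (ltW r0)) lerXn2r ?nnegrE ?sqrtr_ge0 ?(ltW kap0)//.
    by rewrite ge_min lexx orbT.
  rewrite mulrAC -[X in X <= _]mulrA; apply: ler_piMr; first exact: mulr_ge0 (ltW p0) (sqr_ge0 _).
  by rewrite ler_pdivrMr// mul1r lerDl.
pose t := 1 - kap; have t01 : 0 <= t <= 1 by rewrite /t; apply/andP; split; lra.
(* The two requirements of [permanent_lower] for [c = kap]: positivity of the corrected matrix, and
   an error term of at most 1 in the exponent. *)
pose eta := Num.min ((kap / 8) ^+ 2) (1 + 2 / kap)^-1.
have k2 : 0 < 1 + 2 / kap by rewrite ltr_wpDl// divr_gt0.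
have eta0 : 0 < eta by rewrite lt_min exprn_gt0 ?divr_gt0// invr_gt0.
have eta60 : 0 < eta / 6 by rewrite divr_gt0.
have [K1 HK1] := row_error_tail iX iY iXY ss t01 eta60 p0.
have [K2 HK2] := row_error_tail iY iX iYX ss' t01 eta60 p0.
pose K := maxn K1 K2.
have errX := HK1 K (leq_maxl _ _); have errY := HK2 K (leq_maxr _ _).
have sumX := corrA_sum_tail iX iY ss t01 K cp p0.
have sumY := corrA_sum_tail iY iX ss' t01 K cp p0.
have i160 : 0 < 16^-1 :> R by rewrite invr_gt0.
have [N3 H3] := corrA_sup iX iY ss t01 K i160 p0.
have [N4 H4] := corrA_sup iY iX ss' t01 K i160 p0.
exists delta => //.
have [N1 H1] := tail_leD (tail_leD tot1 tot2) (tail_leD sumX sumY).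
have [N2 H2] := tail_leD errX errY.
exists (maxn 1 (maxn (maxn N1 N2) (maxn N3 N4))) => N.
rewrite !geq_max => /andP[N0 /andP[/andP[/H1 {}H1 /H2 {}H2] /andP[/H3 {}H3 /H4 {}H4]]].
have H5 := negative_null N.
have H6 : pbound Pr [set w | delta <= `|T_den xi X Y N w - T_den (damp xi t) X Y N w|] p.
  have sD : sqi Pr (fun w => T_den xi X Y N w - T_den (damp xi t) X Y N w).
    by apply: sqiB; apply: den_sqi => //; exact: damp_sqi.
  exists [set w | delta <= `|T_den xi X Y N w - T_den (damp xi t) X Y N w|]; split => //.
    rewrite -[X in measurable X]setTI; apply: measurable_fun_le => //.
    by apply: measurableT_comp => //; case: sD.
  apply: le_trans (chebyshev sD d0) _; rewrite lee_fin expr_div_n ler_pdivrMr ?exprn_gt0//.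
  apply: le_trans (dampC N t t01) _.
  by rewrite (_ : 1 - t = kap) ?kap2// /t; ring.
apply: pboundW (pboundU (pboundU (pboundU H1 H2) (pboundU H3 H4)) (pboundU H5 H6)); last first.
  rewrite (_ : e = 16 * p); last by rewrite /p; field.
  exact: num cE p0.
move=> w /= Dw; apply: contrapT.
move=> /not_orP[/not_orP[/not_orP[/negP n1 /negP n2] /not_orP[/negP n3 /negP n4]] /not_orP[n5 /negP n6]].
rewrite -leNgt in n1; rewrite -leNgt in n2; rewrite -leNgt in n3; rewrite -leNgt in n4; rewrite -ltNge in n6.
have xiw i j : 0 <= xi (X (nat_of_ord (i : 'I_N)) w, Y (nat_of_ord (j : 'I_N)) w).
  by rewrite leNgt; apply/negP => xw; apply: n5; exists (i, j).
have quarter x : x ^+ 2 <= 16^-1 -> `|x| <= 4^-1 :> R.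
  move=> x16; rewrite -(@ler_pXn2r _ 2)// ?nnegrE// ?invr_ge0// real_normK ?num_real//.
  by rewrite exprVn -natrX.
have low : expR (- B) <= T_den (damp xi t) X Y N w.
  have kt : 1 - t = kap by rewrite /t; ring.
  apply: le_trans (damp_den_lower N0 (t := t) (K := K) (eta := eta) t01 _ _ _ xiw _ _ n2).
  - rewrite ler_expR lerN2 /B lerD2r.
    apply: num2 n1; first exact: normr_ge0.
    by rewrite addr_ge0// sumr_ge0// => i _; exact: sqr_ge0.
  - by rewrite kt.
  - by rewrite kt ge_min lexx.
  - by rewrite kt -ler_pdivlMl// mulr1 ge_min lexx orbT.
  - by move=> i; apply: quarter; apply: le_trans (corrA_le X Y sg a b t K i w) n3.
  - by move=> j; apply: quarter; apply: le_trans (corrA_le Y X sg b a t K j w) n4.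
move: n6 Dw low; rewrite (_ : expR (- B) = delta *+ 2); last by rewrite -mulr_natr /delta divfK.
rewrite mulr2n ltr_norml => /andP[D1 _] D2 D3.
exact: num3 D1 D2 D3.
Qed.

End lower_tail.

(** * The functions in the first order term *)

Section density.
Context d d' (S : measurableType d) (T : measurableType d') (R : realType).
Context (P : probability S R) (Q : probability T R) (mu : probability (S * T)%type R).
Variable xi : S * T -> R.
Hypothesis dxi : has_density P Q mu xi.
Hypothesis ixi : (P \x Q)%E.-integrable setT (EFin \o xi).

Local Notation PQ := ((P \x Q)%E : probability _ R).
Local Notation rn := (Radon_Nikodym_SigmaFinite.f mu PQ).

(** [xi] has the same integrals over measurable sets as the Radon-Nikodym derivative, hence agrees
    with it almost everywhere. *)
Lemma density_ge0 : {ae (P \x Q)%E, forall z, 0 <= xi z}.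
Proof.
have [dom mxi xiE] := dxi.
have : ae_eq PQ setT (EFin \o xi) rn.
  apply: integral_ae_eq => //.
    by have /integrableP[] := Radon_Nikodym_SigmaFinite.f_integrable (nu := mu) (mu := PQ) dom.
  move=> E _ mE; rewrite -Radon_Nikodym_SigmaFinite.f_integral//.
  exact/esym/xiE.
apply: filterS => z /(_ Logic.I) /= e.
by rewrite -lee_fin e Radon_Nikodym_SigmaFinite.f_ge0.
Qed.

Lemma Rintegral_density (f : S * T -> R) : mu.-integrable setT (EFin \o f) ->
  \int[mu]_z f z = \int[(P \x Q)%E]_z (f z * xi z).
Proof.
move=> intf; have [dom mxi xiE] := dxi.
have mf : measurable_fun setT f by apply/measurable_EFinP; case/integrableP : intf.
congr fine; rewrite -(Radon_Nikodym_change_of_variables (mu := PQ) dom measurableT intf).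
apply: ae_eq_integral => //.
- apply: emeasurable_funM; first exact/measurable_EFinP.
  by case/integrableP : (Radon_Nikodym_integrable (nu := charge_of_finite_measure mu) (mu := PQ) dom).
- by apply/measurable_EFinP; exact: measurable_funM.
- have : ae_eq PQ setT (EFin \o xi) (Radon_Nikodym (charge_of_finite_measure mu) PQ).
    apply: integral_ae_eq => //.
    move=> E _ mE; rewrite -Radon_Nikodym_integral//.
    exact/esym/xiE.
  apply: filterS => z /(_ Logic.I) /= e _.
  by rewrite -e.
Qed.

End density.

Section inverse.
Context d (U : measurableType d) (R : realType) (P Q : probability U R).
Variables (xi : U * U -> R) (s : nat -> R) (alpha beta : nat -> U -> R).
Hypothesis sxi : sqi (P \x Q)%E xi.
Hypothesis ed : eigen_decomposition P Q xi s alpha beta.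

Let ca : complete_orthonormal P alpha. Proof. exact: (ed_co ed).1. Qed.
Let cb : complete_orthonormal Q beta. Proof. exact: (ed_co ed).2. Qed.

Lemma innerBl (M : probability U R) f g h : sqi M f -> sqi M g -> sqi M h ->
  inner M (fun x => f x - g x) h = inner M f h - inner M g h.
Proof.
move=> sf sg sh; rewrite /inner -RintegralB//; [|exact: sqiM..].
by apply: eq_Rintegral => x _; rewrite mulrBl.
Qed.

Lemma innerDl (M : probability U R) f g h : sqi M f -> sqi M g -> sqi M h ->
  inner M (fun x => f x + g x) h = inner M f h + inner M g h.
Proof.
move=> sf sg sh; rewrite /inner -RintegralD//; [|exact: sqiM..].
by apply: eq_Rintegral => x _; rewrite mulrDl.
Qed.

Lemma inner_ae (M : probability U R) f g h : sqi M f -> sqi M g -> sqi M h ->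
  f = g %[ae M] -> inner M f h = inner M g h.
Proof.
move=> [mf _] [mg _] [mh _] fg; apply: ae_eq_Rint; [exact: measurable_funM..|].
by apply: filterS fg => x + _ => /(_ Logic.I) ->.
Qed.

Lemma inner_opA f g : sqi P f -> sqi Q g ->
  inner Q (opA P xi f) g = inner P (opAs Q xi g) f.
Proof.
move=> sf sg; have sx := sqi_swap sxi.
apply: etrans (inner_opAs (h := fun z => xi (z.2, z.1)) sx sg sf) _.
rewrite (inner_opAs sxi sf sg) /inner.
apply: etrans (_ : _ = \int[(Q \x P)%E]_z ((fun z => xi z * (f z.1 * g z.2)) (z.2, z.1))) _.
  by apply: eq_Rintegral => z _ /=; rewrite [f _ * _]mulrC.
apply: Rintegral_swap.
by apply: measurable_funM; [case: sxi|case: (sqi_tensor sf sg)].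
Qed.

Lemma inner_opAs_eigen g k : sqi Q g ->
  inner P (opAs Q xi g) (alpha k) = s k * inner Q g (beta k).
Proof.
move=> sg; rewrite -inner_opA//; last exact: co_sqi ca k.
have [_ _ _ _ /(_ k)[e _]] := ed.
rewrite innerC -RintegralZl//; last by apply: sqiM => //; exact: co_sqi cb k.
have sA : sqi Q (opA P xi (alpha k)) := sqi_opAs (sqi_swap sxi) (co_sqi ca k).
rewrite innerC (inner_ae sA _ sg e); last exact: sqiZ (co_sqi cb k).
by apply: eq_Rintegral => x _; rewrite -mulrA [beta k x * _]mulrC.
Qed.

End inverse.

Section inverse_spec.
Context d (U : measurableType d) (R : realType) (P Q : probability U R).
Variables (xi : U * U -> R) (s : nat -> R) (alpha beta : nat -> U -> R).
Hypothesis sxi : sqi (P \x Q)%E xi.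
Hypothesis ed : eigen_decomposition P Q xi s alpha beta.
Hypotheses (s_le : forall k, (1 <= k)%N -> s k <= s 1%N) (s1 : s 1%N < 1).

Let ca : complete_orthonormal P alpha. Proof. exact: (ed_co ed).1. Qed.
Let sxi' := sqi_swap sxi.

Let sA f : sqi P f -> sqi Q (opA P xi f). Proof. exact: sqi_opAs sxi'. Qed.

Lemma inner_AsA f k : sqi P f ->
  inner P (opAs Q xi (opA P xi f)) (alpha k) = s k ^+ 2 * inner P f (alpha k).
Proof.
move=> sf; rewrite (inner_opAs_eigen sxi ed k (sA sf)) expr2 -mulrA; congr (_ * _).
exact: (inner_opAs_eigen (xi := fun z => xi (z.2, z.1)) sxi' (eigen_swap ed) k sf).
Qed.

Lemma inner0 (f : U -> R) : inner P f (alpha 0) = \int[P]_x f x.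
Proof. by rewrite (ed_alpha0 ed); apply: eq_Rintegral => x _; rewrite mulr1. Qed.

Lemma spectral_gap k : (0 < k)%N -> 1 - s 1%N ^+ 2 <= 1 - s k ^+ 2.
Proof.
by move=> k0; rewrite lerD2l lerN2 lerXn2r ?nnegrE ?(s_ge0 ed)// s_le.
Qed.

Lemma gap_gt0 : 0 < 1 - s 1%N ^+ 2.
Proof. by rewrite subr_gt0 expr_lt1 ?(s_ge0 ed). Qed.

(** In the eigenbasis the operator divides each coefficient by [1 - s k ^ 2]. On mean-zero functions
    the divisors are bounded below by the spectral gap, so the series converges. *)
Lemma inverse_exists g : sqi P g -> \int[P]_x g x = 0 ->
  exists f, L20 P f /\ I_sub_AsA P Q xi f = g %[ae P].
Proof.
(* For k = 0 the divisor vanishes because [s 0 = 1]; the numerator is the mean of g, so [c 0 = 0] is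
   the right value. *)
move=> sg g0; pose c k := inner P g (alpha k) / (1 - s k ^+ 2).
have c0 : c 0%N = 0 by rewrite /c inner0 g0 mul0r.
have bnd n : \sum_(k < n) c k ^+ 2 <= nrm P g ^+ 2 / (1 - s 1%N ^+ 2) ^+ 2.
  apply: (@le_trans _ _ (\sum_(k < n) inner P g (alpha k) ^+ 2 / (1 - s 1%N ^+ 2) ^+ 2)).
    apply: ler_sum => -[[|k] kn] _ /=; first by rewrite c0 expr0n mulr_ge0 ?sqr_ge0// invr_ge0 sqr_ge0.
    rewrite expr_div_n; apply: (ler_wpM2l (sqr_ge0 _)).
    have gk := spectral_gap (ltn0Sn k).
    rewrite lef_pV2 ?posrE ?exprn_gt0 ?gap_gt0 ?(lt_le_trans gap_gt0 gk)//.
    by rewrite lerXn2r ?nnegrE ?(ltW gap_gt0) ?(ltW (lt_le_trans gap_gt0 gk)).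
  rewrite -mulr_suml ler_pM2r ?invr_gt0 ?exprn_gt0 ?gap_gt0//.
  by apply: (bessel _ (F := fun k : 'I_n => alpha k)) => // [k|i j ij|k];
    [exact: (co_sqi ca)|exact: (co_orth ca)|exact: (co_le1 ca)].
have [f sf cf] := orthogonal_series (co_sqi ca) (co_orth ca) (co_le1 ca) bnd.
have fk k : inner P f (alpha k) = c k.
  have sS n : sqi P (fun x => \sum_(k < n) c k * alpha k x).
    by apply: sqi_sum => i _; apply: sqiZ; exact: (co_sqi ca).
  apply: (inner_cvg sS sf (co_sqi ca k) cf); exists k.+1 => n kn.
  rewrite innerC (inner_sumr predT (F := fun i : 'I_n => alpha i) (fun i : 'I_n => c i)); last first.
  - exact: (co_sqi ca).
  - by move=> i; exact: (co_sqi ca).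
  rewrite (bigD1 (Ordinal kn))//= big1 ?addr0; last first.
    move=> i ik; rewrite (co_orth ca) ?mulr0//; move: ik; apply: contra => /eqP ik.
    exact/eqP/val_inj.
  have [->|h] := co_norm ca k; first by rewrite mulr1.
  by rewrite /c h// mul0r mul0r.
have f0 : \int[P]_x f x = 0 by rewrite -inner0 fk.
exists f; split; first by split => //; exact/Lfun2P.
have sI : sqi P (I_sub_AsA P Q xi f).
  exact: sqiB sf (sqi_opAs sxi (sA sf)).
have E k : inner P (fun x => I_sub_AsA P Q xi f x - g x) (alpha k) = 0.
  rewrite innerBl// ?(co_sqi ca)//; last exact: co_sqi ca k.
  rewrite innerBl//; [|exact: sqi_opAs sxi (sA sf)|exact: co_sqi ca k].
  rewrite (inner_AsA k sf) fk; case: k => [|k]; first by rewrite c0 inner0 g0 mulr0 !subr0.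
  have gk := spectral_gap (ltn0Sn k).
  by rewrite /c; field; rewrite gt_eqF// (lt_le_trans gap_gt0 gk).
case: ca => _ _ _ /(_ _ ((Lfun2P P _).2 (sqiB sI sg)) E).
by apply: filterS => x /(_ Logic.I) /= /subr0_eq.
Qed.

Lemma inverse_spec g : sqi P g -> \int[P]_x g x = 0 ->
  let f := inverse_on P (L20 P) (I_sub_AsA P Q xi) g in
  [/\ sqi P f, \int[P]_x f x = 0 &
      forall k, (1 - s k ^+ 2) * inner P f (alpha k) = inner P g (alpha k)].
Proof.
move=> sg g0 /=; set f := inverse_on _ _ _ _.
have [[/Lfun2P sf f0] fE] : L20 P f /\ I_sub_AsA P Q xi f = g %[ae P].
  by have [f1 h1] := inverse_exists sg g0; rewrite /f /inverse_on; case: xgetP => [? _ //|/(_ f1)]; case.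
split => // k.
have sI : sqi P (I_sub_AsA P Q xi f) by exact: sqiB sf (sqi_opAs sxi (sA sf)).
rewrite -(inner_ae sI sg (co_sqi ca k) fE) innerBl//.
- by rewrite (inner_AsA k sf) mulrBl mul1r.
- exact: sqi_opAs sxi (sA sf).
- exact: co_sqi ca k.
Qed.

Lemma Rint_opAs g : sqi Q g -> \int[P]_x opAs Q xi g x = \int[Q]_y g y.
Proof.
move=> sg; have [[s0 a0 b0] _ _ _ _] := ed.
rewrite -inner0 (inner_opAs_eigen sxi ed 0 sg) s0 mul1r b0.
by apply: eq_Rintegral => y _; rewrite mulr1.
Qed.

End inverse_spec.

Section first_order.
Context d (U : measurableType d) (R : realType) (P Q : probability U R).
Variables (xi : U * U -> R) (s : nat -> R) (alpha beta : nat -> U -> R).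
Hypothesis sxi : sqi (P \x Q)%E xi.
Hypothesis ed : eigen_decomposition P Q xi s alpha beta.
Hypotheses (s_le : forall k, (1 <= k)%N -> s k <= s 1%N) (s1 : s 1%N < 1).

Let ca : complete_orthonormal P alpha. Proof. exact: (ed_co ed).1. Qed.
Let cb : complete_orthonormal Q beta. Proof. exact: (ed_co ed).2. Qed.
Let sxi' := sqi_swap sxi.

(* Against [alpha k] both sides become the 2x2 linear system with matrix [[1, s k], [s k, 1]]. *)
Lemma first_order_system p q : sqi P p -> sqi Q q ->
  \int[P]_x p x = 0 -> \int[Q]_y q y = 0 ->
  let a := inverse_on P (L20 P) (I_sub_AsA P Q xi) (p \- opAs Q xi q) in
  let b := inverse_on Q (L20 Q) (I_sub_AAs P Q xi) (q \- opA P xi p) in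
  [/\ sqi P a, sqi Q b, \int[P]_x a x = 0, \int[Q]_y b y = 0 &
      (fun x => a x + opAs Q xi b x) = p %[ae P]].
Proof.
move=> sp sq p0 q0 a b.
have sAq := sqi_opAs sxi sq.
have sAp : sqi Q (opA P xi p) := sqi_opAs sxi' sp.
have Ap0 : \int[Q]_y opA P xi p y = 0.
  by have := Rint_opAs sxi' (eigen_swap ed) sp; rewrite p0.
have Aq0 : \int[P]_x opAs Q xi q x = 0 by rewrite (Rint_opAs sxi ed sq).
have [sa a0 aE] : [/\ sqi P a, \int[P]_x a x = 0 & forall k,
    (1 - s k ^+ 2) * inner P a (alpha k) = inner P (p \- opAs Q xi q) (alpha k)].
  apply: (inverse_spec sxi ed s_le s1); first exact: sqiB.
  by rewrite RintegralB// ?p0 ?Aq0 ?subrr//; exact: sqi_int.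
have [sb b0 bE] : [/\ sqi Q b, \int[Q]_y b y = 0 & forall k,
    (1 - s k ^+ 2) * inner Q b (beta k) = inner Q (q \- opA P xi p) (beta k)].
  apply: (inverse_spec sxi' (eigen_swap ed) s_le s1); first exact: sqiB.
  by rewrite RintegralB// ?q0 ?Ap0 ?subrr//; exact: sqi_int.
have sAb := sqi_opAs sxi sb.
have sS : sqi P (fun x => a x + opAs Q xi b x) by exact: sqiD.
split => //.
have E k : inner P (fun x => (a x + opAs Q xi b x) - p x) (alpha k) = 0.
  rewrite innerBl//; last exact: co_sqi ca k.
  rewrite innerDl//; last exact: co_sqi ca k.
  rewrite (inner_opAs_eigen sxi ed k sb).
  move: (aE k) (bE k).
  rewrite innerBl//; last exact: co_sqi ca k.
  rewrite innerBl//; last exact: co_sqi cb k.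
  rewrite (inner_opAs_eigen sxi ed k sq) (inner_opAs_eigen (xi := fun z => xi (z.2, z.1)) sxi' (eigen_swap ed) k sp).
  case: k => [|k].
    by move=> _ _; rewrite (inner0 ed) (inner0 (eigen_swap ed)) (inner0 ed) a0 b0 p0 mulr0 addr0 subr0.
  have gk := lt_le_trans (gap_gt0 ed s1) (spectral_gap ed s_le (ltn0Sn k)).
  move: (inner _ _ _) (inner _ _ _) (inner _ _ _) (inner _ _ _) => x y z w h1 h2.
  apply: (mulfI (lt0r_neq0 gk)).
  by rewrite mulr0 mulrBr mulrDr h1 [_ * (_ * x)]mulrCA h2; ring.
case: ca => _ _ _ /(_ _ ((Lfun2P P _).2 (sqiB sS sp)) E).
by apply: filterS => x /(_ Logic.I) /= /subr0_eq.
Qed.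

End first_order.

(** * The expansion *)

(** Truncation shifts the mean by at most the norm of the removed part; restoring it at most doubles
    the error. *)
Lemma centered_approx d (U : measurableType d) (R : realType) (P : probability U R) (f : U -> R) (e : R) :
  sqi P f -> \int[P]_x f x = 0 -> 0 < e ->
  exists (f' : U -> R) (M : R), [/\ measurable_fun setT f', forall x, `|f' x| <= M, \int[P]_x f' x = 0 &
    nrm P (fun x => f x - f' x) <= e].
Proof.
move=> sf f0 e0; have e20 : 0 < e / 2 by rewrite divr_gt0.
have [M M0 /(_ M (lexx _)) HM] := overflow_small sf e20.
have so := overflow_sqi M sf; have [mf _] := sf.
pose c := \int[P]_x overflow f M x.
have cE : `|c| <= e / 2 := le_trans (normr_int_le_nrm so) HM.
have st := sqiB sf so.
have tM x : `|f x - overflow f M x| <= M.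
  rewrite /overflow; case: ifP; first by rewrite subr0.
  by move=> _; rewrite subrr normr0 (ltW M0).
exists (fun x => f x - overflow f M x + c), (M + `|c|); split.
- by apply: measurable_funD => //; case: st.
- by move=> x; apply: le_trans (ler_normD _ _) _; rewrite lerD2r.
- rewrite RintegralD//; [|exact: sqi_int|exact: sqi_int (sqi_cst P c)].
  by rewrite RintegralB// ?f0 ?Rint_cst; [rewrite sub0r addNr|exact: sqi_int..].
- rewrite (@eq_nrm _ _ _ _ _ (fun x => overflow f M x - c)); last by move=> x; ring.
  apply: le_trans (nrmB so (sqi_cst P c)) _; rewrite nrm_cst.
  by rewrite (splitr e) lerD.
Qed.

Lemma chebyshev_root d (Omega : measurableType d) (R : realType) (Pr : probability Omega R)
  f N (e m : R) : sqi Pr f -> (0 < N)%N -> 0 < e -> N%:R * nrm Pr f ^+ 2 <= m ->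
  pbound Pr [set w | e / Num.sqrt N%:R <= `|f w|] (m / e ^+ 2).
Proof.
move=> sf N0 e0 fm; have NR : 0 < N%:R :> R by rewrite ltr0n.
have eN : 0 < e / Num.sqrt N%:R by rewrite divr_gt0 ?sqrtr_gt0.
exists [set w | e / Num.sqrt N%:R <= `|f w|]; split => //.
  rewrite -[X in measurable X]setTI; apply: measurable_fun_le => //.
  by apply: measurableT_comp => //; case: sf.
apply: le_trans (chebyshev sf eN) _; rewrite lee_fin expr_div_n.
rewrite (_ : (e / _) ^+ 2 = e ^+ 2 / N%:R); last by rewrite expr_div_n (sqr_sqrtr (ltW NR)).
by rewrite invf_div mulrA ler_pM2r ?invr_gt0 ?exprn_gt0// mulrC.
Qed.

Section residual.
Context d (U : measurableType d) (R : realType) (P Q : probability U R).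
Variables (xi g0 : U * U -> R) (s : nat -> R) (alpha beta : nat -> U -> R).
Hypotheses (sxi : sqi (P \x Q)%E xi) (sg0 : sqi (P \x Q)%E g0).
Hypothesis ed : eigen_decomposition P Q xi s alpha beta.
Variables (a b a' b' : U -> R).
Hypotheses (sa : sqi P a) (sb : sqi Q b) (sa' : sqi P a') (sb' : sqi Q b').
Hypothesis ab : (fun x => a x + opAs Q xi b x) = opAs Q g0 (cst 1) %[ae P].

(** Since [opAs Q xi] maps 1 to 1, the part subtracted projects to [a' + A^* b']. The system solved
    by [a], [b] then leaves only the approximation errors. *)
Lemma residual_row g : (forall z, g z = g0 z - (a' z.1 + b' z.2) * xi z) ->
  opAs Q g (cst 1) = (fun x => (a x - a' x) + opAs Q xi (fun y => b y - b' y) x) %[ae P].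
Proof.
move=> gE; have [[s0 al0 be0] _ _ _ /(_ 0%N)[_ e0]] := ed.
apply: filterS3 (filterI (sqi_section sxi) (sqi_section sg0)) ab e0 => x [sx sgx] + + _ => /(_ Logic.I) abx /(_ Logic.I).
rewrite be0 al0 s0 mul1r => e1.
have i1 : Q.-integrable setT (EFin \o fun y => 1 * g0 (x, y)).
  by apply: (sqiM (sqi_cst Q 1) sgx).
have i2 : Q.-integrable setT (EFin \o fun y => 1 * xi (x, y)).
  by apply: (sqiM (sqi_cst Q 1) sx).
have i3 : Q.-integrable setT (EFin \o fun y => b' y * xi (x, y)) by exact: sqiM.
have i4 : Q.-integrable setT (EFin \o fun y => b y * xi (x, y)) by exact: sqiM.
have -> : opAs Q xi (fun y => b y - b' y) x = opAs Q xi b x - opAs Q xi b' x.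
  by rewrite /opAs -RintegralB//; apply: eq_Rintegral => y _; rewrite mulrBl.
have -> : opAs Q g (cst 1) x = opAs Q g0 (cst 1) x - (a' x * opAs Q xi (cst 1) x + opAs Q xi b' x).
  rewrite /opAs -RintegralZl// -RintegralD//; last exact: integrable_RZl.
  rewrite -RintegralB//; last by apply: integrable_RD => //; exact: integrable_RZl.
  by apply: eq_Rintegral => y _; rewrite gE /=; ring.
by rewrite -abx e1 /=; ring.
Qed.

Lemma residual_nrm g : sqi (P \x Q)%E g -> (forall z, g z = g0 z - (a' z.1 + b' z.2) * xi z) ->
  nrm P (opAs Q g (cst 1)) <=
  nrm P (fun x => a x - a' x) + nrm (P \x Q)%E xi * nrm Q (fun y => b y - b' y).
Proof.
move=> sg gE; have sB := sqiB sb sb'; have sA := sqiB sa sa'; have sO := sqi_opAs sxi sB.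
rewrite (eq_ae_nrm _ _ (residual_row gE)).
- by apply: le_trans (nrmD sA sO) _; rewrite lerD2l nrm_opAs.
- by have [] := sqi_opAs sg (sqi_cst Q 1).
- by have [] := sqiD sA sO.
Qed.

Lemma residual_mean g : sqi (P \x Q)%E g -> (forall z, g z = g0 z - (a' z.1 + b' z.2) * xi z) ->
  \int[P]_x a x = 0 -> \int[Q]_x b x = 0 -> \int[P]_x a' x = 0 -> \int[Q]_x b' x = 0 ->
  \int[(P \x Q)%E]_z g z = 0.
Proof.
move=> sg gE a0 b0 a'0 b'0.
have sB := sqiB sb sb'; have sA := sqiB sa sa'; have sO := sqi_opAs sxi sB.
rewrite (Rfubini (sqi_int sg)).2.
apply: etrans (_ : _ = \int[P]_x opAs Q g (cst 1) x) _.
  by apply: eq_Rintegral => x _; apply: eq_Rintegral => y _; rewrite mul1r.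
rewrite (ae_eq_Rint _ _ (residual_row gE)).
- rewrite RintegralD//; [|exact: sqi_int sA|exact: sqi_int sO].
  rewrite (Rint_opAs sxi ed sB) RintegralB// ?a0 ?a'0; [|exact: sqi_int..].
  by rewrite RintegralB// ?b0 ?b'0 ?subr0 ?addr0//; exact: sqi_int.
- by have [] := sqi_opAs sg (sqi_cst Q 1).
- by have [] := sqiD sA sO.
Qed.

End residual.

Section score_identity.
Context d d' (Omega : measurableType d) (U : measurableType d') (R : realType).
Context (Pr : probability Omega R) (X Y : nat -> {RV Pr >-> U}).
Variables (xi : U * U -> R).

(** The sum of [a (X i) + b (Y (sigma i))] over i is the same for every permutation, so additive
    functions factor out of the average exactly. *)
Lemma score_shift (g0 : U * U -> R) (a b : U -> R) N w :
  score X Y (fun z => g0 z - (a z.1 + b z.2) * xi z) xi N w =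
  score X Y g0 xi N w - (avg X a N w + avg Y b N w) * T_den xi X Y N w.
Proof.
rewrite /score /T_den /avg mulrCA -mulrBr; congr (_ * _).
rewrite mulr_sumr -sumrB; apply: eq_bigr => sigma _.
rewrite -mulrDr -mulrA -mulrBr (reindex_inj (@perm_inj _ sigma) (P := predT) (F := fun i : 'I_N => b (Y i w)))/=.
rewrite -big_split/= mulr_suml -sumrB; congr (_ * _); apply: eq_bigr => i _.
by rewrite /xi_tensor [X in _ = _ - _ * X](bigD1 i)//=; ring.
Qed.

Lemma T_num_score eta (th : R) N w : (0 < N)%N ->
  T_num xi eta X Y N w = score X Y (fun z => (eta z - th) * xi z) xi N w + th * T_den xi X Y N w.
Proof.
move=> N0; rewrite /T_num /score /T_den mulrCA -mulrDr; congr (_ * _).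
rewrite mulr_sumr -big_split/=; apply: eq_bigr => sigma _.
have E p : th * p = N%:R^-1 * \sum_(i < N) th * p.
  by rewrite sumr_const card_ord -[(th * p) *+ N]mulr_natl mulKf// pnatr_eq0 -lt0n.
rewrite [th * _]E -mulrA -mulrDr; congr (_ * _); rewrite mulr_suml -big_split/=; apply: eq_bigr => i _.
by rewrite /xi_tensor (bigD1 i)//=; ring.
Qed.

End score_identity.

Section first_order_tail.
Context d d' (Omega : measurableType d) (U : measurableType d') (R : realType).
Context (Pr : probability Omega R) (P Q : probability U R).
Variables (X Y : nat -> {RV Pr >-> U}).
Hypotheses (iX : iid P X) (iY : iid Q Y) (iXY : independent_seqs X Y).
Variables (xi g0 : U * U -> R) (s : nat -> R) (alpha beta : nat -> U -> R).
Hypotheses (sxi : sqi (P \x Q)%E xi) (sg0 : sqi (P \x Q)%E g0).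
Hypothesis ed : eigen_decomposition P Q xi s alpha beta.
Hypotheses (s_le : forall k, (1 <= k)%N -> s k <= s 1%N) (s1 : s 1%N < 1).
Hypothesis xi0 : {ae (P \x Q)%E, forall z, 0 <= xi z}.
Variables (a b : U -> R).
Hypotheses (sa : sqi P a) (sb : sqi Q b) (a0 : \int[P]_x a x = 0) (b0 : \int[Q]_y b y = 0).
Hypothesis aE : (fun x => a x + opAs Q xi b x) = opAs Q g0 (cst 1) %[ae P].
Hypothesis bE : (fun y => b y + opA P xi a y) = opA P g0 (cst 1) %[ae Q].

Lemma avgB (Z : nat -> {RV Pr >-> U}) (f g : U -> R) N w :
  avg Z (fun x => f x - g x) N w = avg Z f N w - avg Z g N w.
Proof. by rewrite /avg sumrB mulrBr. Qed.

Lemma score_sqi N g : sqi (P \x Q)%E g -> sqi Pr (score X Y g xi N).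
Proof.
move=> sg; have c f : cvgL2 (P \x Q)%E (fun _ : nat => f) f.
  by move=> e e0; exists 0%N => n _; rewrite (@eq_nrm _ _ _ _ _ (cst 0)) ?nrm_cst ?normr0 ?ltW// => x; rewrite subrr.
by have [] := score_cvg iX iY iXY N (fun _ : nat => sg) sg (c g) (fun _ : nat => sxi) sxi (c xi).
Qed.

(** Four events of probability at most [e / 4] are excluded: a small denominator, a large residual
    score, and large averages of [a - a'] and of [b - b']. *)
Lemma first_order_tail e eps : 0 < e -> 0 < eps -> exists N0, forall N, (N0 <= N)%N ->
  pbound Pr [set w | T_den xi X Y N w = 0 \/ eps / Num.sqrt N%:R <=
    `|score X Y g0 xi N w / T_den xi X Y N w - (avg X a N w + avg Y b N w)|] e.
Proof.
move=> e0 eps0.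
have e4 : 0 < e / 4 by rewrite divr_gt0.
have [delta d0 [N0 HN0]] := den_lower_tail iX iY iXY sxi ed s_le s1 xi0 e4.
have [C C0 [_ mb]] := moment_bounds iX iY iXY sxi ed s_le s1.
pose n := nrm (P \x Q)%E xi; have n0 : 0 <= n by exact: nrm_ge0.
(* Where the denominator is at least [delta], a residual score below [e1 / sqrt N] contributes less
   than half of the allowed error; the two averages get a quarter each. *)
pose e1 := eps * delta / 2; have e10 : 0 < e1 by rewrite divr_gt0 ?mulr_gt0.
pose D := 2 * (C + 1) * (1 + n) ^+ 2.
have n10 : 0 < 1 + n by rewrite ltr_wpDr.
have D0 : 0 < D by rewrite mulr_gt0 ?exprn_gt0// mulr_gt0// ltr_wpDl.
(* The square of the accuracy of [a'] and [b']. The first argument serves the score, where both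
   projections have norm at most [(1 + n) * k], the second the two averages. *)
pose k2 := Num.min (e / 8 * e1 ^+ 2 / D) (e / 4 * (eps / 4) ^+ 2).
have t0 : 0 < e / 8 * e1 ^+ 2.
  by apply: (mulr_gt0 _ (exprn_gt0 2 e10)); rewrite divr_gt0.
have eps4 : 0 < eps / 4 by rewrite divr_gt0.
have k20 : 0 < k2.
  by rewrite lt_min (divr_gt0 t0 D0) (mulr_gt0 e4 (exprn_gt0 2 eps4)).
pose k := Num.sqrt k2; have k0 : 0 < k by rewrite sqrtr_gt0.
have kE : k ^+ 2 = k2 := sqr_sqrtr (ltW k20).
have [a' [Ma [ma' Ma' a'0 aa']]] := centered_approx sa a0 k0.
have [b' [Mb [mb' Mb' b'0 bb']]] := centered_approx sb b0 k0.
have sa' := bounded_sqi P ma' Ma'; have sb' := bounded_sqi Q mb' Mb'.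
pose g z := g0 z - (a' z.1 + b' z.2) * xi z.
have sg : sqi (P \x Q)%E g.
  apply: sqiB => //; apply: (@sqi_bM _ _ _ _ _ _ (Ma + Mb)) => //.
    by apply: measurable_funD; [exact: (measurableT_comp ma')|exact: (measurableT_comp mb')].
  by move=> z; apply: le_trans (ler_normD _ _) _; rewrite lerD.
have gP : nrm P (opAs Q g (cst 1)) <= (1 + n) * k.
  apply: le_trans (residual_nrm sxi sg0 ed sa sb sa' sb' aE sg (fun=> erefl)) _.
  by rewrite mulrDl mul1r lerD// ler_wpM2l.
have gQ : nrm Q (opA P g (cst 1)) <= (1 + n) * k.
  apply: le_trans (residual_nrm (xi := fun z => xi (z.2, z.1)) (g0 := fun z => g0 (z.2, z.1))
    (g := fun z => g (z.2, z.1)) (sqi_swap sxi) (sqi_swap sg0) (eigen_swap ed) sb sa sb' sa' bE (sqi_swap sg) _) _.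
    by move=> z; rewrite /g /= [a' _ + _]addrC.
  rewrite (nrm_swap P Q); last by case: sxi.
  by rewrite mulrDl mul1r lerD// ler_wpM2l.
have g00 : coef P Q alpha beta g 0 0 = 0.
  rewrite /coef /inner /tensor (ed_alpha0 ed) (ed_beta0 ed).
  under eq_Rintegral do rewrite /= !mulr1.
  exact: (residual_mean sxi sg0 ed sa sb sa' sb' aE sg (fun=> erefl) a0 b0 a'0 b'0).
(* The norm of g itself may be large, as it depends on the bounds of [a'] and [b']; being fixed
   before N, it is beaten by the factor [1 / N]. *)
have [N1 HN1] : exists N1, forall N, (N1 <= N)%N -> (0 < N)%N -> C * (N%:R^-1 * nrm (P \x Q)%E g ^+ 2) <= e / 8 * e1 ^+ 2.
  pose v := C * nrm (P \x Q)%E g ^+ 2 / (e / 8 * e1 ^+ 2).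
  exists (Num.bound v) => N vN N00; rewrite mulrCA ler_pdivrMl ?ltr0n//.
  rewrite -ler_pdivrMr//; apply: ltW; apply: lt_le_trans (archi_boundP _) _; last by rewrite ler_nat; exact: vN.
  by rewrite divr_ge0 ?(ltW t0)// mulr_ge0// sqr_ge0.
exists (maxn 1 (maxn N0 N1)) => N; rewrite !geq_max => /andP[N00 /andP[/HN0 pD /HN1 /(_ N00) gN]].
have pS : pbound Pr [set w | e1 / Num.sqrt N%:R <= `|score X Y g xi N w|] (e / 4).
  apply: pboundW (chebyshev_root (score_sqi N sg) N00 e10 (mb N g N00 sg g00)) => //.
  rewrite ler_pdivrMr ?exprn_gt0// mulrDr.
  rewrite (_ : e / 4 * e1 ^+ 2 = e / 8 * e1 ^+ 2 + e / 8 * e1 ^+ 2); last by field.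
  apply: lerD gN.
  apply: (@le_trans _ _ (D * k2)).
    pose m := ((1 + n) * k) ^+ 2.
    have sqm x : 0 <= x -> x <= (1 + n) * k -> x ^+ 2 <= m.
      by move=> x0 xk; rewrite lerXn2r ?nnegrE// mulr_ge0 ?(ltW n10) ?(ltW k0).
    apply: (@le_trans _ _ (C * (m + m))).
      by apply: (ler_wpM2l C0); apply: lerD; apply: sqm; rewrite ?nrm_ge0.
    rewrite -kE (_ : D * k ^+ 2 = (C + 1) * (m + m)); last by rewrite /D /m; ring.
    by apply: ler_wpM2r; rewrite ?lerDl// addr_ge0 ?sqr_ge0.
  by rewrite -ler_pdivlMl// mulrC ge_min lexx.
have pA (M : probability U R) (Z : nat -> {RV Pr >-> U}) (f : U -> R) : iid M Z -> sqi M f ->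
    \int[M]_x f x = 0 -> nrm M f <= k ->
    pbound Pr [set w | eps / 4 / Num.sqrt N%:R <= `|avg Z f N w|] (e / 4).
  move=> iZ sf f0 fk; apply: pboundW (chebyshev_root (m := k2) (avg_sqi iZ N sf) N00 eps4 _) => //.
    by rewrite ler_pdivrMr ?exprn_gt0// ge_min lexx orbT.
  rewrite (avg_nrm iZ N00 sf f0) mulrC divfK ?pnatr_eq0 -?lt0n// -kE.
  by rewrite lerXn2r ?nnegrE ?nrm_ge0 ?(ltW k0).
have pX := pA P X _ iX (sqiB sa sa') _ aa'; have pY := pA Q Y _ iY (sqiB sb sb') _ bb'.
have {}pX : pbound Pr [set w | eps / 4 / Num.sqrt N%:R <= `|avg X (fun x => a x - a' x) N w|] (e / 4).
  by apply: pX; rewrite RintegralB ?a0 ?a'0 ?subrr//; exact: sqi_int.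
have {}pY : pbound Pr [set w | eps / 4 / Num.sqrt N%:R <= `|avg Y (fun y => b y - b' y) N w|] (e / 4).
  by apply: pY; rewrite RintegralB ?b0 ?b'0 ?subrr//; exact: sqi_int.
apply: pboundW (pboundU (pboundU pD pS) (pboundU pX pY)); last first.
  by rewrite le_eqVlt; apply/orP; left; apply/eqP; field.
move=> w /= Dw; apply: contrapT.
move=> /not_orP[/not_orP[/negP n1 /negP n2] /not_orP[/negP n3 /negP n4]].
rewrite -leNgt in n1; rewrite -ltNge in n2; rewrite -ltNge in n3; rewrite -ltNge in n4.
have T0 : 0 < T_den xi X Y N w by exact: lt_le_trans n1.
case: Dw => [T00|]; first by rewrite T00 ltxx in T0.
apply/negP; rewrite -ltNge.
have -> : score X Y g0 xi N w / T_den xi X Y N w - (avg X a N w + avg Y b N w) =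
  score X Y g xi N w / T_den xi X Y N w - (avg X (fun x => a x - a' x) N w + avg Y (fun y => b y - b' y) N w).
  rewrite /g score_shift !avgB; field.
  by rewrite gt_eqF.
have r0 : 0 < Num.sqrt (N%:R : R) by rewrite sqrtr_gt0 ltr0n.
have nS : `|score X Y g xi N w / T_den xi X Y N w| < eps / 2 / Num.sqrt N%:R.
  rewrite normrM (@gtr0_norm _ (_^-1)) ?invr_gt0// ltr_pdivrMr//.
  apply: lt_le_trans n2 _; rewrite /e1 -!mulrA ler_pM2l// mulrCA ler_pM2l ?invr_gt0//.
  by rewrite mulrC ler_pM2l ?invr_gt0.
apply: le_lt_trans (ler_normB _ _) _.
rewrite (_ : eps / Num.sqrt N%:R = eps / 2 / Num.sqrt N%:R + (eps / 4 / Num.sqrt N%:R + eps / 4 / Num.sqrt N%:R)).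
  by apply: ltrD nS _; apply: le_lt_trans (ler_normD _ _) _; exact: ltrD.
by field; rewrite gt_eqF.
Qed.

End first_order_tail.

Section statistic_expansion.
Context d d' (Omega : measurableType d) (U : measurableType d') (R : realType).
Context (Pr : probability Omega R) (P Q : probability U R) (mu : probability (U * U)%type R).
Variables (X Y : nat -> {RV Pr >-> U}) (c : nat -> {RV Pr >-> R}).
Hypotheses (iX : iid P X) (iY : iid Q Y) (iXY : independent_seqs X Y).
Variables (xi eta : U * U -> R) (s : nat -> R) (alpha beta : nat -> U -> R).
Hypothesis dxi : has_density P Q mu xi.
Hypothesis sxi : sqi (P \x Q)%E xi.
Hypothesis ed : eigen_decomposition P Q xi s alpha beta.
Hypotheses (s_le : forall k, (1 <= k)%N -> s k <= s 1%N) (s1 : s 1%N < 1).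
Hypothesis ieta : mu.-integrable setT (EFin \o eta).
Hypothesis sex : sqi (P \x Q)%E (fun z => eta z * xi z).

Local Notation th := (theta mu eta).
Local Notation a := (L1_P P Q mu xi eta).
Local Notation b := (L1_Q P Q mu xi eta).
Let g0 z := (eta z - th) * xi z.

Let sg0 : sqi (P \x Q)%E g0.
Proof.
rewrite (_ : g0 = fun z => eta z * xi z - th * xi z); first exact: sqiB (sqiZ th sxi).
by apply/funext => z; rewrite /g0 mulrBl.
Qed.

Let g0_mean : \int[(P \x Q)%E]_z g0 z = 0.
Proof.
have xi1 : \int[(P \x Q)%E]_z xi z = 1.
  have i1 : mu.-integrable setT (EFin \o cst (1 : R)) by exact: (sqi_int (sqi_cst mu 1)).
  have := Rintegral_density dxi (sqi_int sxi) i1; rewrite Rint_cst => ->.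
  by apply: eq_Rintegral => z _; rewrite mul1r.
apply: etrans (_ : _ = \int[(P \x Q)%E]_z (eta z * xi z - th * xi z)) _.
  by apply: eq_Rintegral => z _; rewrite /g0 mulrBl.
rewrite RintegralB//; [|exact: sqi_int sex|exact: sqi_int (sqiZ th sxi)].
rewrite RintegralZl//; last exact: sqi_int sxi.
by rewrite xi1 mulr1 -(Rintegral_density dxi (sqi_int sxi) ieta) subrr.
Qed.

Lemma eta10E : eta10 Q xi mu eta = opAs Q g0 (cst 1).
Proof. by apply/funext => x; apply: eq_Rintegral => y _; rewrite mul1r. Qed.

Lemma eta01E : eta01 P xi mu eta = opA P g0 (cst 1).
Proof. by apply/funext => y; apply: eq_Rintegral => x _; rewrite mul1r. Qed.

Let first_order : [/\ sqi P a, sqi Q b, \int[P]_x a x = 0, \int[Q]_y b y = 0 &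
  (fun x => a x + opAs Q xi b x) = opAs Q g0 (cst 1) %[ae P] /\
  (fun y => b y + opA P xi a y) = opA P g0 (cst 1) %[ae Q]].
Proof.
have sp : sqi P (eta10 Q xi mu eta) by rewrite eta10E; exact: sqi_opAs sg0 (sqi_cst Q 1).
have sq : sqi Q (eta01 P xi mu eta).
  by rewrite eta01E; exact: (sqi_opAs (sqi_swap sg0) (sqi_cst P 1)).
have p0 : \int[P]_x eta10 Q xi mu eta x = 0.
  by rewrite -g0_mean (Rfubini (sqi_int sg0)).2.
have q0 : \int[Q]_y eta01 P xi mu eta y = 0.
  rewrite -g0_mean -(Rintegral_swap P Q); last by case: sg0.
  by rewrite (Rfubini (sqi_int (sqi_swap sg0))).2.
have [sa sb a0 b0 aE] := first_order_system sxi ed s_le s1 sp sq p0 q0.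
have [_ _ _ _ bE] := first_order_system (sqi_swap sxi) (eigen_swap ed) s_le s1 sq sp q0 p0.
split => //; split; first by rewrite -eta10E.
by rewrite -eta01E.
Qed.

Lemma statistic_expansion : little_op Pr
  (fun N w => T_stat xi eta X Y c N w - th - L1 P Q mu xi eta X Y N w)
  (fun N => 1 / Num.sqrt N%:R).
Proof.
have [sa sb a0 b0 [aE bE]] := first_order.
have xi0 := density_ge0 dxi (sqi_int sxi).
have tail := first_order_tail iX iY iXY sxi sg0 ed s_le s1 xi0 sa sb a0 b0 aE bE.
move=> eps eps0.
pose A N := [set w | eps <= `|(T_stat xi eta X Y c N w - th - L1 P Q mu xi eta X Y N w) / (1 / Num.sqrt N%:R) - 0|].
pose S N w := score X Y g0 xi N w.
pose L N w := avg X a N w + avg Y b N w.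
pose D N w := T_den xi X Y N w.
(* Multiplying out the denominator gives a description without division, from which measurability of
   the event follows; it is needed to compare its probability with that of the covering event. *)
have AE N : (0 < N)%N -> A N = [set w | if D N w == 0 then eps / Num.sqrt N%:R <= `|c N w - th - L N w|
    else eps / Num.sqrt N%:R * `|D N w| <= `|S N w - L N w * D N w|].
  move=> N0; have r0 : 0 < Num.sqrt (N%:R : R) by rewrite sqrtr_gt0 ltr0n.
  have LE w : L1 P Q mu xi eta X Y N w = L N w.
    by rewrite /L1 /L /avg -mulrDr -big_split.
  have scale (x : R) : (eps <= `|x / (1 / Num.sqrt N%:R) - 0|) = (eps / Num.sqrt N%:R <= `|x|).
    by rewrite subr0 div1r invrK normrM (gtr0_norm r0) ler_pdivrMr.
  suff E w : (eps / Num.sqrt N%:R <= `|T_stat xi eta X Y c N w - th - L N w|) =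
      (if D N w == 0 then eps / Num.sqrt N%:R <= `|c N w - th - L N w|
       else eps / Num.sqrt N%:R * `|D N w| <= `|S N w - L N w * D N w|).
    by apply/seteqP; split => w; rewrite /A /mkset LE scale E.
  rewrite /T_stat -/(D N w); case: eqP => // /eqP D0.
  rewrite (T_num_score X Y xi eta th w N0) -/(S N w) -/(D N w).
  rewrite (_ : _ - th - L N w = (S N w - L N w * D N w) / D N w); last by field.
  by rewrite normrM normfV ler_pdivlMr// normr_gt0.
have mA N : (0 < N)%N -> measurable (A N).
  move=> N0; rewrite AE//.
  have mD : measurable_fun setT (D N) by case: (den_sqi iX iY iXY N sxi).
  have mS : measurable_fun setT (S N) by case: (score_sqi iX iY iXY sxi N sg0).
  have mL : measurable_fun setT (L N).
    by apply: measurable_funD; [case: (avg_sqi iX N sa)|case: (avg_sqi iY N sb)].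
  have mb : measurable_fun setT (fun w => if D N w == 0 then eps / Num.sqrt N%:R <= `|c N w - th - L N w|
    else eps / Num.sqrt N%:R * `|D N w| <= `|S N w - L N w * D N w|).
    apply: measurable_fun_ifT.
    - exact: measurable_fun_eqr.
    - apply: measurable_fun_ler => //; apply: measurableT_comp => //.
      by apply: measurable_funB => //; exact: measurable_funB.
    - apply: measurable_fun_ler; first by apply: measurable_funM => //; exact: measurableT_comp.
      by apply: measurableT_comp => //; apply: measurable_funB => //; exact: measurable_funM.
  by rewrite -[X in measurable X]setTI; exact: mb measurableT [set true] _.
apply/fine_cvgP; split.
  by exists 1%N => // N /= N1; apply: fin_num_measure; exact: mA.
apply/cvgr0Pnorm_le => e e0.
have [N0 HN0] := tail e eps e0 eps0.
exists (maxn 1 N0) => // N; rewrite /= geq_max => /andP[N1 /HN0[B [mB AB Be]]].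
rewrite ger0_norm ?fine_ge0 ?measure_ge0// -lee_fin fineK; last by apply: fin_num_measure; exact: mA.
apply: le_trans Be; apply: le_measure; rewrite ?inE//; first exact: mA.
apply: subset_trans AB; rewrite -/(A N) AE// => w /=; case: eqP => [D0 _|/eqP D0 h]; first by left.
right; rewrite -/(D N w) -/(S N w) -/(L N w).
rewrite (_ : _ - L N w = (S N w - L N w * D N w) / D N w); last by field.
by rewrite normrM normfV ler_pdivlMr// normr_gt0.
Qed.

End statistic_expansion.

Theorem theorem4 (R : realType) (dim : nat)
    (P Q : probability (Rd R dim) R)
    (mu : probability (Rd R dim * Rd R dim)%type R)
    (xi eta : Rd R dim * Rd R dim -> R)
    (s : nat -> R) (alpha beta : nat -> Rd R dim -> R)
    (d0 : measure_display) (Omega : measurableType d0)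
    (Pr : probability Omega R)
    (X Y : nat -> {RV Pr >-> Rd R dim})
    (c : nat -> {RV Pr >-> R}) :
  has_marginals P Q mu ->
  has_density P Q mu xi ->
  xi \in Lfun (P \x Q)%E 2%:E ->
  eigen_decomposition P Q xi s alpha beta ->
  (forall k, (1 <= k)%N -> s k <= s 1%N) -> s 1%N < 1 ->
  mu.-integrable setT (EFin \o eta) ->
  (fun z => eta z ^+ 2 * xi z) \in Lfun (P \x Q)%E 1%:E ->
  (fun z => eta z * xi z) \in Lfun (P \x Q)%E 2%:E ->
  iid P X -> iid Q Y -> independent_seqs X Y ->
  little_op Pr
    (fun N w => T_stat xi eta X Y c N w - theta mu eta
                - L1 P Q mu xi eta X Y N w)
    (fun N => 1 / Num.sqrt N%:R).
Proof.
move=> _ dxi /Lfun2P sxi ed s_le s1 ieta _ /Lfun2P sex iX iY iXY.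
exact: (statistic_expansion c iX iY iXY dxi sxi ed s_le s1 ieta sex).
Qed.
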